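(* Consider the quantum Ising chain in a transverse field, $H=-J\sum_{i\in\mathbb{Z}}\sigma^x_i\sigma^x_{i+1}-h\sum_{i\in\mathbb{Z}}\sigma^z_i$ with $h>0$, let $X=\sigma^z$ and $\beta=\infty$ (i.e. take the unique ground state $\omega$). If $|J/h|>0$ is small enough, then the classical restriction $\mu^z$ of $\omega$ to $\sigma^z$ is non-null, i.e. $\mu^z(x_\Lambda)>0$ for every finite $\Lambda\subset\mathbb{Z}$ and every $x_\Lambda\in\{-1,+1\}^\Lambda$, but $\mu^z$ is not quasi-local: the configuration $x\in\{-1,+1\}^{\mathbb{Z}}$ with $x_i=-1$ for all $i$ is a bad configuration for $\mu^z$.
   Context: $\sigma^x,\sigma^y,\sigma^z$ are the Pauli matrices, with copies at each site of $\mathbb{Z}$ acting on $\mathcal{H}_i=\mathbb{C}^2$. The classical restriction $\mu^z$ of a state $\omega$ is the probability measure on $\Omega=\{-1,+1\}^{\mathbb{Z}}$ with $\mu^z(x_\Lambda)=\omega(\prod_{i\in\Lambda}Q_i(x_i))$, where $Q(\pm1)$ are the spectral projections of $\sigma^z$ onto eigenvalues $\pm1$. A configuration $x\in\Omega$ is bad for a probability measure $\mu$ on $\Omega$ if there are $\varepsilon>0$ and a site $i$ such that for every finite $\Lambda\ni i$ there exist a finite $\Gamma\supset\Lambda$ and configurations $y,y'\in\Omega$ with $\mu(x_{\Lambda\setminus i}y_{\Gamma\setminus\Lambda})>0$, $\mu(x_{\Lambda\setminus i}y'_{\Gamma\setminus\Lambda})>0$ and $|\mu(x_i\mid x_{\Lambda\setminus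 i}y_{\Gamma\setminus\Lambda})-\mu(x_i\mid x_{\Lambda\setminus i}y'_{\Gamma\setminus\Lambda})|>\varepsilon$. *)

(* Defs.v *)
From Stdlib Require Import Reals Lra List Bool ZArith.
Import ListNotations.
Open Scope R_scope.

Definition C : Type := (R * R)%type.
Definition RtoC (r : R) : C := (r, 0).
Definition C0 : C := (0, 0).
Definition C1 : C := (1, 0).
Definition Cre (z : C) : R := fst z.
Definition Cim (z : C) : R := snd z.
Definition Cadd (z w : C) : C := (fst z + fst w, snd z + snd w).
Definition Copp (z : C) : C := (- fst z, - snd z).
Definition Csub (z w : C) : C := Cadd z (Copp w).
Definition Cmul (z w : C) : C :=
  (fst z * fst w - snd z * snd w, fst z * snd w + snd z * fst w).
Definition Cconj (z : C) : C := (fst z, - snd z).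

(** * Spin configurations of a block of n consecutive sites.
    A configuration of the block [a, a+n) is a list of n booleans, the k-th
    entry being the sigma^z eigenvalue at site a+k: true = +1, false = -1. *)
Fixpoint all_cfg (n : nat) : list (list bool) :=
  match n with
  | O => [ [] ]
  | S m => map (cons true) (all_cfg m) ++ map (cons false) (all_cfg m)
  end.

Definition Csum_list {A : Type} (f : A -> C) (l : list A) : C :=
  fold_right (fun x acc => Cadd (f x) acc) C0 l.

Definition Csum (n : nat) (f : list bool -> C) : C := Csum_list f (all_cfg n).

(** * Operators on (C^2)^{tensor n}, given by their matrix kernels in the
    sigma^z product basis: A s t = <s| A |t>. *)
Definition Op : Type := list bool -> list bool -> C.

Definition mulOp (n : nat) (A B : Op) : Op :=
  fun s t => Csum n (fun u => Cmul (A s u) (B u t)).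
Definition subOp (A B : Op) : Op := fun s t => Csub (A s t) (B s t).
Definition adjOp (A : Op) : Op := fun s t => Cconj (A t s).
Definition commOp (n : nat) (A B : Op) : Op := subOp (mulOp n A B) (mulOp n B A).

Definition leq_dec (s t : list bool) : bool :=
  if list_eq_dec bool_dec s t then true else false.

Definition sz (k : nat) : Op :=
  fun s t => if leq_dec s t then (if nth k s false then C1 else Copp C1) else C0.

Fixpoint flip_at (k : nat) (s : list bool) : list bool :=
  match s, k with
  | [], _ => []
  | b :: s', O => negb b :: s'
  | b :: s', S k' => b :: flip_at k' s'
  end.

Definition sxx (k : nat) : Op :=
  fun s t => if leq_dec (flip_at (S k) (flip_at k s)) t then C1 else C0.

Definition Ham (J h : R) (n : nat) : Op :=
  fun s t =>
    Csub (Cmul (RtoC (- J)) (Csum_list (fun k => sxx k s t) (seq 0 (n - 1))))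
         (Cmul (RtoC h) (Csum_list (fun k => sz k s t) (seq 0 n))).

(** Embedding of an operator A on [a, a+n) as A tensor identities on the block
    [a-1, a+n+1) (one extra site on each side). *)
Definition mid (s : list bool) : list bool := removelast (tl s).
Definition embOp (A : Op) : Op :=
  fun s t =>
    if Bool.eqb (hd false s) (hd false t) && Bool.eqb (last s false) (last t false)
    then A (mid s) (mid t) else C0.

(** * States of the quasi-local algebra of the chain, given (equivalently) by
    a consistent family of density matrices rho a n on the blocks [a, a+n). *)
Definition is_state (rho : Z -> nat -> Op) : Prop :=
  (forall a n (v : list bool -> C),
     let q := Csum n (fun s => Csum n (fun t =>
                Cmul (Cmul (Cconj (v s)) (rho a n s t)) (v t))) in
     0 <= Cre q /\ Cim q = 0) /\
  (forall a n, Csum n (fun s => rho a n s s) = C1) /\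
  (forall a n s t, length s = n -> length t = n ->
     rho a n s t = Csum_list (fun b => rho a (S n) (s ++ [b]) (t ++ [b])) [true; false]) /\
  (forall a n s t, length s = n -> length t = n ->
     rho (a + 1)%Z n s t = Csum_list (fun b => rho a (S n) (b :: s) (b :: t)) [true; false]).

Definition omega (rho : Z -> nat -> Op) (a : Z) (n : nat) (A : Op) : C :=
  Csum n (fun s => Csum n (fun t => Cmul (rho a n s t) (A t s))).

(** Ground state condition (beta = infinity):
    -i omega(A^* delta(A)) >= 0 for every local A, where delta(A) = i[H,A];
    for A localised in [a, a+n), [H, A] = [H_{[a-1, a+n]}, A]. *)
Definition is_ground_state (J h : R) (rho : Z -> nat -> Op) : Prop :=
  is_state rho /\
  forall (a : Z) (n : nat) (A : Op),
    let B := embOp A in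
    let w := omega rho (a - 1)%Z (n + 2)
               (mulOp (n + 2) (adjOp B) (commOp (n + 2) (Ham J h (n + 2)) B)) in
    0 <= Cre w /\ Cim w = 0.

(** * Classical restriction mu^z.
    Finite sets Lambda of Z are lists of integers; configurations in
    Omega = {-1,+1}^Z are maps Z -> bool (true = +1, false = -1). *)
Definition zlo (L : list Z) : Z := fold_right Z.min (hd 0%Z L) L.
Definition zhi (L : list Z) : Z := fold_right Z.max (hd 0%Z L) L.
Definition zlen (L : list Z) : nat := Z.to_nat (zhi L - zlo L + 1).

Definition Qprod (L : list Z) (x : Z -> bool) (a : Z) : Op :=
  fun s t =>
    if leq_dec s t &&
       forallb (fun k => Bool.eqb (nth (Z.to_nat (k - a)) s false) (x k)) L
    then C1 else C0.

Definition muz (rho : Z -> nat -> Op) (L : list Z) (x : Z -> bool) : R :=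
  Cre (omega rho (zlo L) (zlen L) (Qprod L x (zlo L))).

(** * Non-nullness and bad configurations for a measure on Omega given by its
    cylinder probabilities mu L x = mu(x_L). *)
Definition non_null (mu : list Z -> (Z -> bool) -> R) : Prop :=
  forall (L : list Z) (x : Z -> bool), 0 < mu L x.

Definition glue (L : list Z) (x y : Z -> bool) : Z -> bool :=
  fun k => if in_dec Z.eq_dec k L then x k else y k.

(** mu(x_i | x_{Lambda\i} y_{Gamma\Lambda}) with z = glue Lambda x y *)
Definition cond (mu : list Z -> (Z -> bool) -> R) (i : Z) (G : list Z) (z : Z -> bool) : R :=
  mu G z / mu (remove Z.eq_dec i G) z.

Definition bad_config (mu : list Z -> (Z -> bool) -> R) (x : Z -> bool) : Prop :=
  exists eps : R, 0 < eps /\ exists i : Z,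
    forall L : list Z, In i L ->
      exists (G : list Z) (y y' : Z -> bool),
        incl L G /\
        0 < mu (remove Z.eq_dec i G) (glue L x y) /\
        0 < mu (remove Z.eq_dec i G) (glue L x y') /\
        Rabs (cond mu i G (glue L x y) - cond mu i G (glue L x y')) > eps.

(* Main.v *)
(** In terms of the Majorana operators a_j, b_j of a long finite chain, commutation with H acts as a
    lattice operator -2h D. Stationarity makes the two-point function commute with D, and the ground
    state inequality then shows that a_j + sum_x M_xj b_x annihilates the state in the limit of long
    chains, where M is the a-b block of sign D, obtained by a Newton iteration of polynomials in D.
    (Limits along a free ultrafilter respect sums and products.) M is an exponentially localised
    isometry close to the identity, and maps no nonzero vector of finite support to one of finite
    support.

    Conditioning on plus spins on a finite set T replaces M by a matrix O on the other sites. If T is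
    far away then O is close to M, and a pattern of vanishing conditional probability would force all
    its flips to vanish too; so conditional probabilities of patterns are bounded below, and T = [] gives
    non-nullness. If T is an annulus around a window, O tends to an orthogonal matrix as the annulus
    grows, and the conditional state on the window becomes a pure quasi-free state. It is determined by
    its annihilators, which gives E(P)^2 = E(P P) = 1 for the parity P of the window. Hence
    plus spins far away decide the parity of the window, and thereby the spin at 0 given the other
    spins of the window, even when those near 0 are all minus.

    A ground state is obtained as the limit of minimisers on finite chains. *)

Require Import Defs.
From Stdlib Require Import Reals List ZArith.
From Stdlib Require Import Bool Lra Lia Psatz Permutation Classical FunctionalExtensionality ClassicalEpsilon.
From mathcomp Require ssreflect ssrbool eqtype ssrnat boolp classical_sets filter.
From mathcomp Require all_boot all_order all_algebra Rstruct ring.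
Import ListNotations Defs.
Open Scope R_scope.

(** A single Majorana operator carries a string reaching to minus infinity and is no observable of
    the infinite chain. The strings are cut at the left end of a finite block, only even products
    are local, and odd operators are reached by multiplying them with an auxiliary odd wave. That
    wave costs the minimal value 1-|lam| of |D|, so positivity only places the spectral measure of
    the two-point function at or below 1-|lam|. As D has a spectral gap, all that could remain in
    the positive half is an atom at the edge; it is excluded because the edge wave is not square
    summable. Positive functionals on polynomials in D and repeated Cauchy-Schwarz replace the
    spectral theorem.

    Where the spin is plus, the two Majorana operators of a site coincide up to sign. Eliminating
    the sites of T turns M into the Schur complement O = M_LL - M_LT (1 + M_TT)^(-1) M_TL. It is
    orthogonal if M is: M maps (v, y) to (O v, -y) when (1 + M_TT) y = - M_TL v. The bound 1/100 on
    |J/h| keeps M within 1/4 of the identity in a norm with weight 2^|x|, so 1 + M_TT is invertible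
    uniformly in T. *)

Definition Rsum {A : Type} (f : A -> R) (l : list A) : R :=
  fold_right (fun x acc => f x + acc) 0 l.

Lemma Rsum_cons {A} (f : A -> R) x l : Rsum f (x :: l) = f x + Rsum f l.
Proof. reflexivity. Qed.

Lemma Rsum_ext {A} (f g : A -> R) l :
  (forall x, In x l -> f x = g x) -> Rsum f l = Rsum g l.
Proof.
  induction l as [|x l IH]; intros H; [reflexivity|].
  rewrite !Rsum_cons, IH, (H x); auto with datatypes.
Qed.

Lemma Rsum_plus {A} (f g : A -> R) l :
  Rsum (fun x => f x + g x) l = Rsum f l + Rsum g l.
Proof. induction l as [|x l IH]; [simpl; ring|]. rewrite !Rsum_cons, IH; ring. Qed.

Lemma Rsum_minus {A} (f g : A -> R) l :
  Rsum (fun x => f x - g x) l = Rsum f l - Rsum g l.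
Proof. induction l as [|x l IH]; [simpl; ring|]. rewrite !Rsum_cons, IH; ring. Qed.

Lemma Rsum_scal {A} (c : R) (f : A -> R) l :
  Rsum (fun x => c * f x) l = c * Rsum f l.
Proof. induction l as [|x l IH]; [simpl; ring|]. rewrite !Rsum_cons, IH; ring. Qed.

Lemma Rsum_scal_r {A} (c : R) (f : A -> R) l :
  Rsum (fun x => f x * c) l = Rsum f l * c.
Proof. induction l as [|x l IH]; [simpl; ring|]. rewrite !Rsum_cons, IH; ring. Qed.

Lemma Rsum_opp {A} (f : A -> R) l : Rsum (fun x => - f x) l = - Rsum f l.
Proof. induction l as [|x l IH]; [simpl; ring|]. rewrite !Rsum_cons, IH; ring. Qed.

Lemma Rsum_zero {A} (f : A -> R) l : (forall x, In x l -> f x = 0) -> Rsum f l = 0.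
Proof.
  induction l as [|x l IH]; intros H; [reflexivity|].
  rewrite Rsum_cons, IH, (H x); auto with datatypes; lra.
Qed.

Lemma Rsum_const {A} (c : R) (l : list A) : Rsum (fun _ => c) l = INR (length l) * c.
Proof.
  induction l as [|x l IH]; [simpl; ring|].
  rewrite Rsum_cons, IH. change (length (x :: l)) with (S (length l)).
  rewrite S_INR; ring.
Qed.

Lemma Rsum_app {A} (f : A -> R) l l' : Rsum f (l ++ l') = Rsum f l + Rsum f l'.
Proof. induction l as [|x l IH]; simpl; [ring|]. fold (Rsum f (l++l')) (Rsum f l). rewrite IH; ring. Qed.

Lemma Rsum_map {A B} (h : A -> B) (f : B -> R) l : Rsum f (map h l) = Rsum (fun x => f (h x)) l.
Proof. induction l as [|x l IH]; [reflexivity|]. simpl map. rewrite !Rsum_cons, IH; reflexivity. Qed.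

Lemma Rsum_le {A} (f g : A -> R) l :
  (forall x, In x l -> f x <= g x) -> Rsum f l <= Rsum g l.
Proof.
  induction l as [|x l IH]; intros H; [simpl; lra|].
  rewrite !Rsum_cons. apply Rplus_le_compat; auto with datatypes.
Qed.

Lemma Rsum_nonneg {A} (f : A -> R) l : (forall x, In x l -> 0 <= f x) -> 0 <= Rsum f l.
Proof. intros H. rewrite <- (Rsum_zero (fun _ => 0) l) by reflexivity. now apply Rsum_le. Qed.

Lemma Rsum_abs {A} (f : A -> R) l : Rabs (Rsum f l) <= Rsum (fun x => Rabs (f x)) l.
Proof.
  induction l as [|x l IH]; [simpl; rewrite Rabs_R0; lra|].
  rewrite !Rsum_cons. eapply Rle_trans; [apply Rabs_triang|]. lra.
Qed.

Lemma Rsum_swap {A B} (f : A -> B -> R) l l' :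
  Rsum (fun x => Rsum (f x) l') l = Rsum (fun y => Rsum (fun x => f x y) l) l'.
Proof.
  induction l as [|x l IH].
  - symmetry; apply Rsum_zero; reflexivity.
  - rewrite Rsum_cons, IH, <- Rsum_plus. reflexivity.
Qed.

Lemma Rsum_perm {A} (f : A -> R) l l' : Permutation l l' -> Rsum f l = Rsum f l'.
Proof. induction 1; rewrite ?Rsum_cons in *; try lra; simpl; auto. Qed.

Lemma Rsum_mem_le {A} (f : A -> R) l x :
  (forall y, In y l -> 0 <= f y) -> In x l -> f x <= Rsum f l.
Proof.
  induction l as [|y l IH]; intros H [].
  - subst; rewrite Rsum_cons. assert (0 <= Rsum f l) by (apply Rsum_nonneg; auto with datatypes). lra.
  - rewrite Rsum_cons. assert (0 <= f y) by auto with datatypes.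
    assert (f x <= Rsum f l) by auto with datatypes. lra.
Qed.

Lemma Rsum_delta {A} (dec : forall x y : A, {x = y} + {x <> y}) (f : A -> R) l a :
  NoDup l -> In a l -> Rsum (fun x => if dec x a then f x else 0) l = f a.
Proof.
  induction l as [|x l IH]; intros ND []; inversion ND; subst; rewrite Rsum_cons.
  - destruct (dec a a); [|congruence]. rewrite Rsum_zero; [ring|].
    intros y Hy; destruct (dec y a); [congruence|reflexivity].
  - destruct (dec x a); [subst; contradiction|]. rewrite IH; auto; ring.
Qed.

Lemma Rsum_filter {A} (P : A -> bool) (f : A -> R) l :
  Rsum (fun x => if P x then f x else 0) l = Rsum f (filter P l).
Proof.
  induction l as [|x l IH]; [reflexivity|].
  simpl filter; rewrite Rsum_cons, IH; destruct (P x); [reflexivity|ring].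
Qed.

(** * Configurations *)

Lemma all_cfg_In n l : In l (all_cfg n) <-> length l = n.
Proof.
  revert l; induction n as [|n IH]; intros l; simpl.
  - destruct l; simpl; intuition congruence.
  - rewrite in_app_iff, !in_map_iff. split.
    + intros [[m [<- H]]|[m [<- H]]]; simpl; apply IH in H; congruence.
    + destruct l as [|b l]; simpl; intros H; [congruence|].
      injection H as H; apply IH in H. destruct b; [left|right]; exists l; auto.
Qed.

Lemma all_cfg_NoDup n : NoDup (all_cfg n).
Proof.
  induction n as [|n IH]; simpl; [repeat constructor; simpl; tauto|].
  apply NoDup_app.
  - apply FinFun.Injective_map_NoDup; auto. intros x y H; congruence.
  - apply FinFun.Injective_map_NoDup; auto. intros x y H; congruence.
  - intros l. rewrite !in_map_iff. intros [x [<- _]] [y [H _]]. congruence.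
Qed.

Lemma all_cfg_sum_S n (f : list bool -> R) :
  Rsum f (all_cfg (S n)) =
  Rsum (fun l => f (true :: l)) (all_cfg n) + Rsum (fun l => f (false :: l)) (all_cfg n).
Proof. simpl all_cfg. rewrite Rsum_app, !Rsum_map. reflexivity. Qed.

Lemma all_cfg_sum_flip n k (f : list bool -> R) :
  Rsum (fun l => f (flip_at k l)) (all_cfg n) = Rsum f (all_cfg n).
Proof.
  revert k f; induction n as [|n IH]; intros k f; [destruct k; reflexivity|].
  rewrite !all_cfg_sum_S. destruct k as [|k]; simpl flip_at.
  - simpl; ring.
  - rewrite (IH k (fun l => f (true :: l))), (IH k (fun l => f (false :: l))). reflexivity.
Qed.

Lemma all_cfg_sum_app n m (f : list bool -> R) :
  Rsum f (all_cfg (n + m)) =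
  Rsum (fun l => Rsum (fun l' => f (l ++ l')) (all_cfg m)) (all_cfg n).
Proof.
  revert f; induction n as [|n IH]; intros f.
  - change (Rsum f (all_cfg m) = Rsum f (all_cfg m) + 0). ring.
  - change (S n + m)%nat with (S (n + m)). rewrite !all_cfg_sum_S, !IH. reflexivity.
Qed.

Lemma all_cfg_sum_snoc n (f : list bool -> R) :
  Rsum f (all_cfg (S n)) =
  Rsum (fun l => f (l ++ [true]) + f (l ++ [false])) (all_cfg n).
Proof.
  replace (S n) with (n + 1)%nat by lia. rewrite all_cfg_sum_app.
  apply Rsum_ext; intros l _. simpl. ring.
Qed.

Lemma flip_at_length k l : length (flip_at k l) = length l.
Proof. revert k; induction l as [|b l IH]; intros [|k]; simpl; auto. Qed.

Lemma flip_at_nth k l i : (k < length l)%nat ->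
  nth i (flip_at k l) false = if Nat.eqb i k then negb (nth i l false) else nth i l false.
Proof.
  revert k i; induction l as [|b l IH]; intros [|k] [|i] H; simpl in *; try lia; try reflexivity.
  apply IH; lia.
Qed.

(** Wave functions live on configurations of all of [Z], so that one and the same operator can be
    read on every block; [emb] completes a block word by [false] outside. *)
Definition conf := Z -> bool.
Definition emb (a : Z) (l : list bool) : conf :=
  fun k => if (a <=? k)%Z then nth (Z.to_nat (k - a)) l false else false.
Definition res (a : Z) (n : nat) (s : conf) : list bool :=
  map (fun i => s (a + Z.of_nat i)%Z) (seq 0 n).
Definition flip (j : Z) (s : conf) : conf := fun k => if (k =? j)%Z then negb (s k) else s k.
Definition inb (a : Z) (n : nat) (j : Z) : Prop := (a <= j < a + Z.of_nat n)%Z.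

Lemma res_length a n s : length (res a n s) = n.
Proof. unfold res; now rewrite length_map, length_seq. Qed.

Lemma res_nth a n s i : (i < n)%nat -> nth i (res a n s) false = s (a + Z.of_nat i)%Z.
Proof.
  intros H. unfold res.
  rewrite (nth_indep _ false (s (a + Z.of_nat 0)%Z)) by (now rewrite length_map, length_seq).
  rewrite (map_nth (fun i => s (a + Z.of_nat i)%Z)). rewrite seq_nth; auto.
Qed.

Lemma res_emb a n l : length l = n -> res a n (emb a l) = l.
Proof.
  intros H. apply nth_ext with false false; rewrite res_length; auto.
  intros i Hi. rewrite res_nth by auto. unfold emb.
  destruct (Z.leb_spec a (a + Z.of_nat i)); [|lia].
  f_equal; lia.
Qed.

Lemma emb_res a n s j : inb a n j -> emb a (res a n s) j = s j.
Proof.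
  unfold inb, emb; intros H. destruct (Z.leb_spec a j); [|lia].
  rewrite res_nth by lia. f_equal; lia.
Qed.

Lemma res_ext a n s s' : (forall j, inb a n j -> s j = s' j) -> res a n s = res a n s'.
Proof.
  intros H. unfold res. apply map_ext_in. intros i Hi. apply in_seq in Hi. apply H; unfold inb; lia.
Qed.

Lemma emb_out a l j : ~ inb a (length l) j -> emb a l j = false.
Proof.
  unfold inb, emb; intros H. destruct (Z.leb_spec a j); auto.
  apply nth_overflow; lia.
Qed.

Lemma flip_emb a l j : inb a (length l) j ->
  flip j (emb a l) = emb a (flip_at (Z.to_nat (j - a)) l).
Proof.
  intros H. extensionality k. unfold flip, emb. unfold inb in H.
  destruct (Z.leb_spec a k).
  - rewrite flip_at_nth by lia.
    destruct (Z.eqb_spec k j), (Nat.eqb_spec (Z.to_nat (k - a)) (Z.to_nat (j - a))); try lia; auto.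
  - destruct (Z.eqb_spec k j); [lia|auto].
Qed.

Lemma flip_flip j s : flip j (flip j s) = s.
Proof. extensionality k. unfold flip. destruct (Z.eqb_spec k j); auto using negb_involutive. Qed.

Lemma flip_comm i j s : flip i (flip j s) = flip j (flip i s).
Proof. extensionality k. unfold flip. destruct (Z.eqb_spec k j), (Z.eqb_spec k i); auto. Qed.

Lemma flip_same j s : flip j s j = negb (s j).
Proof. unfold flip; now rewrite Z.eqb_refl. Qed.

Lemma flip_other j k s : k <> j -> flip j s k = s k.
Proof. intros H; unfold flip. destruct (Z.eqb_spec k j); congruence. Qed.

Definition wf := conf -> R.
Definition Bsum (a : Z) (n : nat) (psi : wf) : R := Rsum (fun l => psi (emb a l)) (all_cfg n).

Lemma Bsum_flip a n j psi : inb a n j -> Bsum a n (fun s => psi (flip j s)) = Bsum a n psi.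
Proof.
  intros H. unfold Bsum.
  rewrite <- (all_cfg_sum_flip n (Z.to_nat (j - a)) (fun l => psi (emb a l))).
  apply Rsum_ext. intros l Hl. apply all_cfg_In in Hl. rewrite flip_emb; [reflexivity|].
  now rewrite Hl.
Qed.

(** * Majorana operators *)

Definition sg (b : bool) : R := if b then 1 else -1.

Lemma sg_sq b : sg b * sg b = 1.
Proof. destruct b; simpl; ring. Qed.

Lemma sg_negb b : sg (negb b) = - sg b.
Proof. destruct b; simpl; ring. Qed.

Fixpoint pr (a : Z) (n : nat) (s : conf) : R :=
  match n with O => 1 | S m => pr a m s * sg (s (a + Z.of_nat m)%Z) end.

Definition par (a e : Z) (s : conf) : R := pr a (Z.to_nat (e - a)) s.

Lemma par_S a e s : (a <= e)%Z -> par a (e + 1) s = par a e s * sg (s e).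
Proof.
  intros H. unfold par. replace (Z.to_nat (e + 1 - a)) with (S (Z.to_nat (e - a))) by lia.
  simpl. do 3 f_equal. lia.
Qed.

Lemma par_sq a e s : par a e s * par a e s = 1.
Proof.
  unfold par. induction (Z.to_nat (e - a)) as [|n IH]; simpl; [ring|].
  transitivity (pr a n s * pr a n s * (sg (s (a + Z.of_nat n)%Z) * sg (s (a + Z.of_nat n)%Z))); [ring|].
  rewrite IH, sg_sq; ring.
Qed.

Lemma par_flip_in a e k s : (a <= k < e)%Z -> par a e (flip k s) = - par a e s.
Proof.
  intros H. unfold par. assert (Hn : (a <= k < a + Z.of_nat (Z.to_nat (e - a)))%Z) by lia.
  revert Hn. generalize (Z.to_nat (e - a)); intros n. induction n as [|n IH]; simpl; intros Hn; [lia|].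
  destruct (Z.eq_dec k (a + Z.of_nat n)) as [->|Hk].
  - rewrite flip_same, sg_negb.
    assert (E : pr a n (flip (a + Z.of_nat n) s) = pr a n s).
    { clear. assert (G : forall m, (m <= n)%nat -> pr a m (flip (a + Z.of_nat n) s) = pr a m s).
      { induction m as [|m IHm]; simpl; intros; auto. rewrite IHm by lia.
        rewrite flip_other by lia; auto. }
      now apply G. }
    rewrite E; ring.
  - rewrite flip_other by lia. rewrite IH by lia. ring.
Qed.

Lemma par_flip_out a e k s : ~ (a <= k < e)%Z -> par a e (flip k s) = par a e s.
Proof.
  intros H. unfold par. assert (Hn : ~ (a <= k < a + Z.of_nat (Z.to_nat (e - a)))%Z) by lia.
  revert Hn. generalize (Z.to_nat (e - a)); intros n. induction n as [|n IH]; simpl; intros Hn; [auto|].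
  rewrite IH by lia. rewrite flip_other by lia. reflexivity.
Qed.

Definition op := wf -> wf.

(** The generator [(true, j)] is the Majorana operator a_j = (prod_{k<j} sigma^z_k) sigma^x_j and
    [(false, j)] is i b_j, which is real and antisymmetric; strings start at the left end [a]. *)
Definition gen := (bool * Z)%type.
Definition send (g : gen) : Z := if fst g then snd g else (snd g + 1)%Z.
Definition gam (a : Z) (g : gen) : op := fun psi s => par a (send g) s * psi (flip (snd g) s).
(** The square of the generator, which is also the sign relating it to its adjoint. *)
Definition eta (g : gen) : R := if fst g then 1 else -1.

Lemma eta_sq g : eta g * eta g = 1.
Proof. destruct g as [[] ?]; unfold eta; simpl; ring. Qed.

Lemma gam_sq a g psi s : (a <= snd g)%Z -> gam a g (gam a g psi) s = eta g * psi s.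
Proof.
  intros H. unfold gam. rewrite flip_flip.
  destruct g as [[] j]; unfold send, eta; simpl in *.
  - rewrite par_flip_out by lia. rewrite <- Rmult_assoc, par_sq; ring.
  - rewrite par_flip_in by lia.
    transitivity (- (par a (j + 1) s * par a (j + 1) s) * psi s); [ring|rewrite par_sq; ring].
Qed.

Lemma gen_eq_dec (g g' : gen) : {g = g'} + {g <> g'}.
Proof. decide equality; [apply Z.eq_dec|apply bool_dec]. Defined.

(** For distinct generators exactly one of the two flips lies inside the string of the other, and it
    produces the sign. *)
Lemma gam_anti a g g' psi s : (a <= snd g)%Z -> (a <= snd g')%Z -> g <> g' ->
  gam a g (gam a g' psi) s = - gam a g' (gam a g psi) s.
Proof.
  intros H H' N. unfold gam. rewrite (flip_comm (snd g')).
  destruct g as [b j], g' as [b' j']; unfold send; simpl in *.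
  destruct b, b';
  repeat match goal with |- context [par a ?e (flip ?k s)] =>
    first [rewrite (par_flip_in a e k s) by lia | rewrite (par_flip_out a e k s) by lia |
     destruct (Z_lt_le_dec k e)] end; try ring; try (exfalso; assert (j = j') by lia; congruence); try lia.
  all: destruct (Z.eq_dec j j'); [|exfalso; lia]; subst; try congruence; try ring.
Qed.

Lemma gam_lin a g (f f' : wf) (c : R) s :
  gam a g (fun u => f u + c * f' u) s = gam a g f s + c * gam a g f' s.
Proof. unfold gam; ring. Qed.

Definition ip (a : Z) (n : nat) (psi phi : wf) : R := Bsum a n (fun s => psi s * phi s).
(** An [op] is an arbitrary map without linearity; possession of an adjoint on the block takes the
    place of that assumption. *)
Definition adj (a : Z) (n : nat) (F F' : op) : Prop :=
  forall psi phi, ip a n (F psi) phi = ip a n psi (F' phi).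

Lemma ip_sym a n psi phi : ip a n psi phi = ip a n phi psi.
Proof. unfold ip, Bsum. apply Rsum_ext; intros; ring. Qed.

Lemma adj_sym a n F F' : adj a n F F' -> adj a n F' F.
Proof. intros H psi phi. rewrite ip_sym, <- H, ip_sym. reflexivity. Qed.

Lemma adj_comp a n F F' G G' : adj a n F F' -> adj a n G G' ->
  adj a n (fun psi => F (G psi)) (fun psi => G' (F' psi)).
Proof. intros H H' psi phi. rewrite H, H'. reflexivity. Qed.

Lemma adj_lin a n F F' G G' c : adj a n F F' -> adj a n G G' ->
  adj a n (fun psi s => F psi s + c * G psi s) (fun psi s => F' psi s + c * G' psi s).
Proof.
  intros H H' psi phi. specialize (H psi phi); specialize (H' psi phi).
  unfold ip, Bsum in *.
  transitivity (Rsum (fun l => F psi (emb a l) * phi (emb a l)) (all_cfg n) +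
                c * Rsum (fun l => G psi (emb a l) * phi (emb a l)) (all_cfg n)).
  - rewrite <- Rsum_scal, <- Rsum_plus. apply Rsum_ext; intros; ring.
  - rewrite H, H'. rewrite <- Rsum_scal, <- Rsum_plus. apply Rsum_ext; intros; ring.
Qed.

Lemma adj_diag a n (k : wf) : adj a n (fun psi s => k s * psi s) (fun psi s => k s * psi s).
Proof. intros psi phi. unfold ip, Bsum. apply Rsum_ext; intros; ring. Qed.

Lemma adj_flip a n j : inb a n j -> adj a n (fun psi s => psi (flip j s)) (fun psi s => psi (flip j s)).
Proof.
  intros H psi phi. unfold ip.
  rewrite <- (Bsum_flip a n j (fun s => psi (flip j s) * phi s)) by auto.
  unfold Bsum; apply Rsum_ext; intros. now rewrite flip_flip.
Qed.

Lemma adj_gam a n g : inb a n (snd g) -> adj a n (gam a g) (fun psi s => eta g * gam a g psi s).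
Proof.
  intros H psi phi. unfold ip.
  rewrite <- (Bsum_flip a n (snd g)) by auto.
  unfold Bsum; apply Rsum_ext; intros l _. unfold gam. rewrite flip_flip.
  destruct g as [[] j]; unfold send, eta, inb in *; simpl in *.
  - rewrite par_flip_out by lia. ring.
  - rewrite par_flip_in by lia. ring.
Qed.

(** * Matrix kernels and states on a block *)

Definition dl (a : Z) (n : nat) (l : list bool) : wf :=
  fun s => if list_eq_dec bool_dec (res a n s) l then 1 else 0.
Definition ker (a : Z) (n : nat) (F : op) (l l' : list bool) : R := F (dl a n l') (emb a l).
(** The trace of [F] times [sig]: [F] acts on the columns of [sig], read as wave functions. *)
Definition om (a : Z) (n : nat) (sig : list bool -> list bool -> R) (F : op) : R :=
  Rsum (fun l => F (fun s => sig (res a n s) l) (emb a l)) (all_cfg n).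

Lemma ip_dl a n psi l : length l = n -> ip a n psi (dl a n l) = psi (emb a l).
Proof.
  intros H. unfold ip, Bsum.
  rewrite <- (Rsum_delta (list_eq_dec bool_dec) (fun l => psi (emb a l)) (all_cfg n) l);
    auto using all_cfg_NoDup; [|now apply all_cfg_In].
  apply Rsum_ext; intros x Hx. apply all_cfg_In in Hx. unfold dl. rewrite res_emb by auto.
  destruct (list_eq_dec bool_dec x l); ring.
Qed.

Lemma ker_adj a n F F' l l' : adj a n F F' -> length l = n -> length l' = n ->
  ker a n F' l l' = ker a n F l' l.
Proof.
  intros H Hl Hl'. unfold ker. rewrite <- !ip_dl with (n := n) by auto.
  rewrite H. apply ip_sym.
Qed.

(** Pairing with the delta function at [u] and moving [F] to the other side shows that an operator
    with an adjoint is linear on the block and sees only the values of [psi] there. *)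
Lemma ker_expand a n F F' psi u : adj a n F F' -> length u = n ->
  F psi (emb a u) = Rsum (fun l => ker a n F u l * psi (emb a l)) (all_cfg n).
Proof.
  intros H Hu. rewrite <- ip_dl with (n := n) by auto. rewrite H. unfold ip, Bsum.
  apply Rsum_ext; intros l Hl. apply all_cfg_In in Hl.
  rewrite <- (ker_adj a n F F') by auto. unfold ker. ring.
Qed.

Lemma ker_comp a n F F' G u v : adj a n F F' -> length u = n ->
  ker a n (fun psi => F (G psi)) u v = Rsum (fun w => ker a n F u w * ker a n G w v) (all_cfg n).
Proof. intros H Hu. unfold ker at 1. rewrite (ker_expand a n F F') by auto. reflexivity. Qed.

Lemma om_kernel a n sig F F' : adj a n F F' ->
  om a n sig F = Rsum (fun l => Rsum (fun l' => ker a n F l l' * sig l' l) (all_cfg n)) (all_cfg n).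
Proof.
  intros H. apply Rsum_ext; intros l Hl. apply all_cfg_In in Hl.
  rewrite (ker_expand a n F F') by auto.
  apply Rsum_ext; intros l' Hl'. apply all_cfg_In in Hl'. now rewrite res_emb.
Qed.

Lemma om_ext a n sig F G :
  (forall psi l, length l = n -> F psi (emb a l) = G psi (emb a l)) -> om a n sig F = om a n sig G.
Proof. intros H. apply Rsum_ext; intros l Hl. apply all_cfg_In in Hl. now apply H. Qed.

Lemma om_lin a n sig F G c :
  om a n sig (fun psi s => F psi s + c * G psi s) = om a n sig F + c * om a n sig G.
Proof. unfold om. rewrite <- Rsum_scal, <- Rsum_plus. reflexivity. Qed.

Record density (n : nat) (sig : list bool -> list bool -> R) : Prop := {
  den_sym : forall l l', length l = n -> length l' = n -> sig l l' = sig l' l;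
  den_psd : forall v : list bool -> R,
    0 <= Rsum (fun l => Rsum (fun l' => v l * sig l l' * v l') (all_cfg n)) (all_cfg n);
  den_tr : Rsum (fun l => sig l l) (all_cfg n) = 1 }.

Section Functional.
Variables (a : Z) (n : nat) (sig : list bool -> list bool -> R).
Hypothesis D : density n sig.
Notation w := (om a n sig).

Lemma om_one : w (fun psi => psi) = 1.
Proof.
  rewrite <- (den_tr n sig D). apply Rsum_ext; intros l Hl. apply all_cfg_In in Hl.
  now rewrite res_emb.
Qed.

Lemma om_adj F F' : adj a n F F' -> w F' = w F.
Proof.
  intros H. rewrite (om_kernel a n sig F' F) by now apply adj_sym. rewrite (om_kernel a n sig F F') by auto.
  rewrite Rsum_swap. apply Rsum_ext; intros l Hl; apply Rsum_ext; intros l' Hl'.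
  apply all_cfg_In in Hl, Hl'. rewrite (ker_adj a n F F') by auto.
  rewrite (den_sym n sig D) by auto. reflexivity.
Qed.

Lemma om_pos F F' : adj a n F F' -> 0 <= w (fun psi => F' (F psi)).
Proof.
  intros H. assert (H' := adj_sym _ _ _ _ H).
  rewrite (om_kernel a n sig _ (fun psi => F' (F psi))) by (apply adj_comp; auto).
  apply Rle_trans with
    (Rsum (fun u => Rsum (fun l => Rsum (fun l' => ker a n F u l * sig l l' * ker a n F u l')
       (all_cfg n)) (all_cfg n)) (all_cfg n)).
  - apply Rsum_nonneg; intros u _. apply (den_psd n sig D).
  - right. rewrite Rsum_swap.
    transitivity (Rsum (fun l => Rsum (fun l' => Rsum (fun u => ker a n F u l * sig l l' * ker a n F u l')
       (all_cfg n)) (all_cfg n)) (all_cfg n)).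
    { apply Rsum_ext; intros l _. apply Rsum_swap. }
    apply Rsum_ext; intros l Hl; apply Rsum_ext; intros l' Hl'.
    apply all_cfg_In in Hl, Hl'.
    rewrite (ker_comp a n F' F) by auto. rewrite <- Rsum_scal_r.
    apply Rsum_ext; intros u Hu. apply all_cfg_In in Hu.
    rewrite (ker_adj a n F F') by auto. rewrite (den_sym n sig D l l') by auto. ring.
Qed.

Lemma om_CS F F' G G' : adj a n F F' -> adj a n G G' ->
  Rsqr (w (fun psi => F' (G psi))) <= w (fun psi => F' (F psi)) * w (fun psi => G' (G psi)).
Proof.
  intros HF HG.
  assert (Q : forall x, 0 <= w (fun psi => F' (F psi)) + 2 * x * w (fun psi => F' (G psi))
                           + x * x * w (fun psi => G' (G psi))).
  { intros x.
    assert (HH : adj a n (fun psi s => F psi s + x * G psi s) (fun psi s => F' psi s + x * G' psi s))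
      by (apply adj_lin; auto).
    apply om_pos in HH.
    assert (L1 : forall f f' c l, length l = n -> F' (fun s => f s + c * f' s) (emb a l) = F' f (emb a l) + c * F' f' (emb a l)).
    { intros. rewrite !(ker_expand a n F' F) by auto using adj_sym.
      rewrite <- Rsum_scal, <- Rsum_plus. apply Rsum_ext; intros; ring. }
    assert (L2 : forall f f' c l, length l = n -> G' (fun s => f s + c * f' s) (emb a l) = G' f (emb a l) + c * G' f' (emb a l)).
    { intros. rewrite !(ker_expand a n G' G) by auto using adj_sym.
      rewrite <- Rsum_scal, <- Rsum_plus. apply Rsum_ext; intros; ring. }
    assert (E2 : w (fun psi => G' (F psi)) = w (fun psi => F' (G psi))).
    { apply (om_adj (fun psi => F' (G psi))). apply adj_comp; auto using adj_sym. }
    match type of HH with 0 <= ?X => replace X with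
      (w (fun psi => F' (F psi)) + x * w (fun psi => F' (G psi)) +
        x * (w (fun psi => G' (F psi)) + x * w (fun psi => G' (G psi)))) in HH end.
    - rewrite E2 in HH. lra.
    - rewrite <- !om_lin. apply om_ext. intros psi l Hl. rewrite L1, L2 by auto. reflexivity. }
  assert (P1 := Q 0). assert (PG := om_pos _ _ HG). unfold Rsqr.
  set (A := w (fun psi => F' (F psi))) in *. set (B := w (fun psi => F' (G psi))) in *.
  set (E := w (fun psi => G' (G psi))) in *.
  destruct (Req_dec E 0) as [Z|N].
  - destruct (Req_dec B 0) as [->|NB]; [rewrite Z; lra|].
    (* If [E = 0] the quadratic is affine in [x], and this [x] would give it the value -1. *)
    specialize (Q (- (A + 1) / (2 * B))). rewrite Z in Q.
    replace (A + 2 * (- (A + 1) / (2 * B)) * B + - (A + 1) / (2 * B) * (- (A + 1) / (2 * B)) * 0) with (-1) in Q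
      by (field; auto). lra.
  - specialize (Q (- B / E)). replace (A + 2 * (- B / E) * B + - B / E * (- B / E) * E) with (A - B * B / E) in Q by (field; auto).
    assert (0 < E) by lra. apply Rmult_le_reg_r with (/ E); [now apply Rinv_0_lt_compat|].
    replace (A * E * / E) with A by (field; lra). unfold Rdiv in Q. lra.
Qed.
End Functional.

(** * The Hamiltonian of a block *)

Definition Hop (J h : R) (a : Z) (m : nat) : op := fun psi s =>
  - J * Rsum (fun k => psi (flip (a + Z.of_nat (S k)) (flip (a + Z.of_nat k) s))) (seq 0 (m - 1))
  - h * Rsum (fun k => sg (s (a + Z.of_nat k)%Z) * psi s) (seq 0 m).

Lemma adj_Rsum {A} a n (l : list A) (F F' : A -> op) :
  (forall x, In x l -> adj a n (F x) (F' x)) ->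
  adj a n (fun psi s => Rsum (fun x => F x psi s) l) (fun psi s => Rsum (fun x => F' x psi s) l).
Proof.
  intros H psi phi. unfold ip, Bsum in *.
  transitivity (Rsum (fun x => ip a n (F x psi) phi) l).
  - unfold ip, Bsum. rewrite Rsum_swap. apply Rsum_ext; intros. now rewrite Rsum_scal_r.
  - rewrite (Rsum_ext _ (fun x => ip a n psi (F' x phi))) by (intros; now apply H).
    unfold ip, Bsum. rewrite Rsum_swap. apply Rsum_ext; intros. now rewrite Rsum_scal.
Qed.

Lemma adj_scal a n F F' c : adj a n F F' ->
  adj a n (fun psi s => c * F psi s) (fun psi s => c * F' psi s).
Proof.
  intros H psi phi. specialize (H psi phi). unfold ip, Bsum in *.
  transitivity (c * Rsum (fun l => F psi (emb a l) * phi (emb a l)) (all_cfg n)).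
  - rewrite <- Rsum_scal; apply Rsum_ext; intros; ring.
  - rewrite H, <- Rsum_scal; apply Rsum_ext; intros; ring.
Qed.

Lemma adj_ext a n F F' G G' : adj a n F F' ->
  (forall psi s, F psi s = G psi s) -> (forall psi s, F' psi s = G' psi s) -> adj a n G G'.
Proof.
  intros H E E' psi phi. specialize (H psi phi). unfold ip, Bsum in *.
  rewrite (Rsum_ext _ (fun l => F psi (emb a l) * phi (emb a l))) by (intros; now rewrite E).
  rewrite H. apply Rsum_ext; intros; now rewrite E'.
Qed.

Lemma adj_Hop J h a m : adj a m (Hop J h a m) (Hop J h a m).
Proof.
  unfold Hop.
  assert (A1 : adj a m (fun psi s => Rsum (fun k => psi (flip (a + Z.of_nat (S k)) (flip (a + Z.of_nat k) s))) (seq 0 (m - 1)))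
     (fun psi s => Rsum (fun k => psi (flip (a + Z.of_nat (S k)) (flip (a + Z.of_nat k) s))) (seq 0 (m - 1)))).
  { apply (adj_Rsum a m (seq 0 (m - 1)) (fun k psi s => psi (flip (a + Z.of_nat (S k)) (flip (a + Z.of_nat k) s)))
      (fun k psi s => psi (flip (a + Z.of_nat (S k)) (flip (a + Z.of_nat k) s)))).
    intros k Hk. apply in_seq in Hk.
    eapply adj_ext; [apply (adj_comp a m (fun psi s => psi (flip (a + Z.of_nat k) s)) (fun psi s => psi (flip (a + Z.of_nat k) s))
      (fun psi s => psi (flip (a + Z.of_nat (S k)) s)) (fun psi s => psi (flip (a + Z.of_nat (S k)) s)));
      apply adj_flip; unfold inb; lia| |]; simpl; intros; [reflexivity|now rewrite flip_comm]. }
  assert (A2 : adj a m (fun psi s => Rsum (fun k => sg (s (a + Z.of_nat k)%Z) * psi s) (seq 0 m))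
      (fun psi s => Rsum (fun k => sg (s (a + Z.of_nat k)%Z) * psi s) (seq 0 m))).
  { apply (adj_Rsum a m (seq 0 m) (fun k psi s => sg (s (a + Z.of_nat k)%Z) * psi s) (fun k psi s => sg (s (a + Z.of_nat k)%Z) * psi s)).
    intros k _. apply (adj_diag a m (fun s => sg (s (a + Z.of_nat k)%Z))). }
  eapply adj_ext; [apply (adj_lin a m _ _ _ _ (- h) (adj_scal a m _ _ (- J) A1) A2)| |]; simpl; intros; ring.
Qed.

Lemma Cre_sum {A} (f : A -> Defs.C) l : fst (Csum_list f l) = Rsum (fun x => fst (f x)) l.
Proof. induction l as [|x l IH]; [reflexivity|]. rewrite Rsum_cons, <- IH. reflexivity. Qed.
Lemma Cim_sum {A} (f : A -> Defs.C) l : snd (Csum_list f l) = Rsum (fun x => snd (f x)) l.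
Proof. induction l as [|x l IH]; [reflexivity|]. rewrite Rsum_cons, <- IH. reflexivity. Qed.

Lemma ker_Ham J h a m u v : length u = m -> length v = m ->
  fst (Ham J h m u v) = ker a m (Hop J h a m) u v /\ snd (Ham J h m u v) = 0.
Proof.
  intros Hu Hv. unfold Ham, Csub, Cadd, Copp, Cmul, RtoC. simpl.
  rewrite !Cre_sum, !Cim_sum.
  assert (Z1 : Rsum (fun k => snd (sxx k u v)) (seq 0 (m - 1)) = 0).
  { apply Rsum_zero; intros k _. unfold sxx; destruct leq_dec; reflexivity. }
  assert (Z2 : Rsum (fun k => snd (sz k u v)) (seq 0 m) = 0).
  { apply Rsum_zero; intros k _. unfold sz; destruct leq_dec; [destruct (nth k u false)|]; simpl; ring. }
  rewrite Z1, Z2. split; [|ring].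
  unfold ker, Hop.
  assert (Z3 : Rsum (fun k => fst (sxx k u v)) (seq 0 (m - 1)) =
     Rsum (fun k => dl a m v (flip (a + Z.of_nat (S k)) (flip (a + Z.of_nat k) (emb a u)))) (seq 0 (m - 1))).
  { apply Rsum_ext; intros k Hk. apply in_seq in Hk.
    rewrite flip_emb by (unfold inb; lia). rewrite flip_emb by (rewrite ?flip_at_length; unfold inb; lia).
    unfold dl. rewrite res_emb by (now rewrite !flip_at_length).
    replace (Z.to_nat (a + Z.of_nat k - a)) with k by lia.
    replace (Z.to_nat (a + Z.of_nat (S k) - a)) with (S k) by lia.
    unfold sxx, leq_dec. destruct list_eq_dec; reflexivity. }
  assert (Z4 : Rsum (fun k => fst (sz k u v)) (seq 0 m) =
     Rsum (fun k => sg (emb a u (a + Z.of_nat k)%Z) * dl a m v (emb a u)) (seq 0 m)).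
  { apply Rsum_ext; intros k Hk. apply in_seq in Hk.
    unfold dl. rewrite res_emb by auto. unfold emb. destruct (Z.leb_spec a (a + Z.of_nat k)); [|lia].
    replace (Z.to_nat (a + Z.of_nat k - a)) with k by lia.
    unfold sz, leq_dec. destruct list_eq_dec; [destruct (nth k u false)|]; simpl; ring. }
  rewrite Z3, Z4. ring.
Qed.

(** * Operators acting on an inner block *)

(** The two fields describe operators of the form A tensor 1: they commute with multiplication by
    functions of the outer spins and preserve functions of the inner ones. *)
Record loc (a : Z) (n : nat) (F : op) : Prop := {
  loc_out : forall (chi psi : wf) s, (forall j u, inb a n j -> chi (flip j u) = chi u) ->
     F (fun u => chi u * psi u) s = chi s * F psi s;
  loc_in : forall (psi : wf), (forall u u', (forall j, inb a n j -> u j = u' j) -> psi u = psi u') ->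
     forall s s', (forall j, inb a n j -> s j = s' j) -> F psi s = F psi s' }.

Lemma list_outer (n : nat) (t : list bool) : length t = (n + 2)%nat ->
  exists x m y, t = x :: m ++ [y] /\ length m = n /\ mid t = m /\ hd false t = x /\ last t false = y.
Proof.
  destruct t as [|x t]; simpl; intros H; [lia|].
  destruct (exists_last (l := t)) as [m [y ->]]; [destruct t; simpl in *; [exfalso; lia|congruence]|].
  exists x, m, y. rewrite length_app in H; simpl in H.
  split; [reflexivity|]. split; [lia|]. split; [|split; [reflexivity|]].
  - unfold mid; simpl. now rewrite removelast_last.
  - exact (last_last (x :: m) y false).
Qed.

Lemma emb_outer a n x m y : length m = n ->
  emb (a - 1) (x :: m ++ [y]) (a - 1)%Z = x /\ emb (a - 1) (x :: m ++ [y]) (a + Z.of_nat n)%Z = y /\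
  forall j, inb a n j -> emb (a - 1) (x :: m ++ [y]) j = emb a m j.
Proof.
  intros H. unfold emb. repeat split.
  - destruct (Z.leb_spec (a - 1) (a - 1)); [|lia]. now rewrite Z.sub_diag.
  - destruct (Z.leb_spec (a - 1) (a + Z.of_nat n)); [|lia].
    replace (Z.to_nat (a + Z.of_nat n - (a - 1))) with (S n) by lia. simpl.
    rewrite app_nth2, H, Nat.sub_diag by lia. reflexivity.
  - intros j Hj. unfold inb in Hj. destruct (Z.leb_spec (a - 1) j), (Z.leb_spec a j); try lia.
    replace (Z.to_nat (j - (a - 1))) with (S (Z.to_nat (j - a))) by lia. simpl.
    rewrite app_nth1 by lia. reflexivity.
Qed.

(** The delta function of the enlarged block is a function of the two outer spins times a delta
    function of the inner ones; the two fields of [loc] handle one factor each. *)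
Lemma ker_outer a n F s t : loc a n F -> length s = (n + 2)%nat -> length t = (n + 2)%nat ->
  ker (a - 1) (n + 2) F s t =
  if Bool.eqb (hd false s) (hd false t) && Bool.eqb (last s false) (last t false)
  then ker a n F (mid s) (mid t) else 0.
Proof.
  intros L Hs Ht.
  destruct (list_outer n s Hs) as (x & m & y & Es & Hm & E1 & E2 & E3).
  destruct (list_outer n t Ht) as (x' & m' & y' & Et & Hm' & E1' & E2' & E3').
  rewrite E1, E2, E3, E1', E2', E3'. unfold ker.
  set (chi := fun u : conf => if Bool.eqb (u (a - 1)%Z) x' && Bool.eqb (u (a + Z.of_nat n)%Z) y' then 1 else 0 : R).
  assert (Ed : dl (a - 1) (n + 2) t = fun u => chi u * dl a n m' u).
  { extensionality u. unfold dl, chi.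
    destruct (list_eq_dec bool_dec (res (a - 1) (n + 2) u) t) as [e|ne].
    - assert (N : forall i, (i < n + 2)%nat -> u (a - 1 + Z.of_nat i)%Z = nth i t false).
      { intros i Hi. rewrite <- e. now rewrite res_nth. }
      assert (N0 := N 0%nat ltac:(lia)). assert (Nn := N (S n) ltac:(lia)).
      replace (a - 1 + Z.of_nat 0)%Z with (a - 1)%Z in N0 by lia.
      replace (a - 1 + Z.of_nat (S n))%Z with (a + Z.of_nat n)%Z in Nn by lia.
      rewrite Et in N0, Nn. simpl nth in N0, Nn. rewrite app_nth2, Hm', Nat.sub_diag in Nn by lia. simpl in Nn.
      rewrite N0, Nn, !eqb_reflx. simpl.
      destruct (list_eq_dec bool_dec (res a n u) m') as [|ne]; [ring|].
      exfalso; apply ne. apply nth_ext with false false; rewrite res_length; auto.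
      intros i Hi. rewrite res_nth by auto. specialize (N (S i) ltac:(lia)).
      rewrite Et in N. simpl nth in N. rewrite app_nth1 in N by lia. rewrite <- N. f_equal; lia.
    - destruct (Bool.eqb_spec (u (a - 1)%Z) x') as [ex|], (Bool.eqb_spec (u (a + Z.of_nat n)%Z) y') as [ey|]; simpl; try ring.
      destruct (list_eq_dec bool_dec (res a n u) m') as [e|]; [|ring].
      exfalso; apply ne. rewrite Et. apply nth_ext with false false; rewrite res_length.
      { simpl. rewrite length_app; simpl; lia. }
      intros i Hi. rewrite res_nth by auto. destruct i as [|i]; simpl nth.
      + replace (a - 1 + Z.of_nat 0)%Z with (a - 1)%Z by lia. auto.
      + destruct (Nat.eq_dec i n) as [->|].
        * rewrite app_nth2, Hm', Nat.sub_diag by lia.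
          replace (a - 1 + Z.of_nat (S n))%Z with (a + Z.of_nat n)%Z by lia. exact ey.
        * rewrite app_nth1 by lia. rewrite <- e, res_nth by lia. f_equal; lia. }
  rewrite Ed, (loc_out a n F L).
  2:{ intros j u Hj. unfold chi, inb in *. rewrite !flip_other by lia. reflexivity. }
  destruct (emb_outer a n x m y Hm) as (O1 & O2 & O3). rewrite Es.
  unfold chi. rewrite O1, O2.
  rewrite (loc_in a n F L (dl a n m')) with (s' := emb a m) by
    (auto; intros u u' Hu; unfold dl; now rewrite (res_ext a n u u')).
  destruct (Bool.eqb x x' && Bool.eqb y y'); ring.
Qed.

(** * The ground state condition in real form *)

Definition cm (H F : op) : op := fun psi s => H (F psi) s - F (H psi) s.

Section Ground.
Variables (J h : R) (rho : Z -> nat -> Op).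
Hypothesis G : is_ground_state J h rho.
Definition sr (a : Z) (n : nat) (l l' : list bool) : R := fst (rho a n l l').
Definition si (a : Z) (n : nat) (l l' : list bool) : R := snd (rho a n l l').

(** The quadratic form is real on the vectors [l + i l'] and [l - i l']; the imaginary parts contain
    [sr l l' - sr l' l] with opposite signs, which gives the symmetry. *)
Lemma sr_density a n : density n (sr a n).
Proof.
  destruct G as [(P & T & _ & _) _]. split.
  - intros l l' Hl Hl'.
    set (v := fun c : Defs.C => fun x : list bool => if list_eq_dec bool_dec x l then C1 else
       if list_eq_dec bool_dec x l' then c else C0).
    destruct (list_eq_dec bool_dec l l') as [->|N]; auto.
    assert (E : forall c, snd (Csum n (fun s => Csum n (fun t => Cmul (Cmul (Cconj (v c s)) (rho a n s t)) (v c t))))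
      = snd (rho a n l l) + snd (Cmul (rho a n l l') c) + snd (Cmul (Cconj c) (rho a n l' l))
        + snd (Cmul (Cmul (Cconj c) (rho a n l' l')) c)).
    { intros c. unfold Csum. rewrite Cim_sum.
      rewrite (Rsum_ext _ (fun s =>
         (if list_eq_dec bool_dec s l then snd (Csum n (fun t => Cmul (rho a n l t) (v c t))) else 0) +
         (if list_eq_dec bool_dec s l' then snd (Csum n (fun t => Cmul (Cmul (Cconj c) (rho a n l' t)) (v c t))) else 0))).
      2:{ intros s _. unfold v at 1. destruct (list_eq_dec bool_dec s l) as [->|].
          - destruct (list_eq_dec bool_dec l l'); [congruence|]. unfold Csum; rewrite !Cim_sum, Rplus_0_r.
            apply Rsum_ext; intros t _. unfold Cmul, Cconj, C1; simpl; ring.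
          - destruct (list_eq_dec bool_dec s l') as [->|].
            + unfold Csum; rewrite !Cim_sum. ring.
            + rewrite Cim_sum. rewrite Rsum_zero; [ring|]. intros; unfold Cmul, Cconj, C0; simpl; ring. }
      rewrite Rsum_plus.
      rewrite (Rsum_delta (list_eq_dec bool_dec) (fun s => snd (Csum n (fun t => Cmul (rho a n l t) (v c t)))) _ l);
        auto using all_cfg_NoDup; [|now apply all_cfg_In].
      rewrite (Rsum_delta (list_eq_dec bool_dec) (fun s => snd (Csum n (fun t => Cmul (Cmul (Cconj c) (rho a n l' t)) (v c t)))) _ l');
        auto using all_cfg_NoDup; [|now apply all_cfg_In].
      assert (E2 : forall f : list bool -> C, snd (Csum n (fun t => Cmul (f t) (v c t))) = snd (f l) + snd (Cmul (f l') c)).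
      { intros f. unfold Csum; rewrite Cim_sum.
        rewrite (Rsum_ext _ (fun s => (if list_eq_dec bool_dec s l then snd (f l) else 0) +
          (if list_eq_dec bool_dec s l' then snd (Cmul (f l') c) else 0))).
        2:{ intros s _. unfold v. destruct (list_eq_dec bool_dec s l) as [->|].
          - destruct (list_eq_dec bool_dec l l'); [congruence|]. unfold Cmul, C1; simpl; ring.
          - destruct (list_eq_dec bool_dec s l') as [->|]; [ring|]. unfold Cmul, C0; simpl; ring. }
        rewrite Rsum_plus.
        rewrite (Rsum_delta (list_eq_dec bool_dec) (fun s => snd (f l)) _ l);
          auto using all_cfg_NoDup; [|now apply all_cfg_In].
        rewrite (Rsum_delta (list_eq_dec bool_dec) (fun s => snd (Cmul (f l') c)) _ l');
          auto using all_cfg_NoDup; now apply all_cfg_In. }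
      rewrite (E2 (fun t => rho a n l t)), (E2 (fun t => Cmul (Cconj c) (rho a n l' t))). ring. }
    assert (E0 := fun c => proj2 (P a n (v c))). unfold Cim in E0.
    assert (Ea := E0 C1). assert (Eb := E0 (0, 1)). assert (Ec := E0 (0, -1)). rewrite E in Ea, Eb, Ec.
    unfold sr. unfold Cmul, Cconj, C1 in *; simpl in *. lra.
  - intros v. destruct (P a n (fun l => RtoC (v l))) as [P1 _]. unfold Csum, Cre in P1. rewrite Cre_sum in P1.
    erewrite Rsum_ext in P1; [exact P1|]. intros l _. simpl. rewrite Cre_sum. apply Rsum_ext; intros l' _.
    unfold sr, Cmul, Cconj, RtoC; simpl; ring.
  - specialize (T a n). unfold Csum in T. apply (f_equal fst) in T. rewrite Cre_sum in T. exact T.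
Qed.

(** With B = F1 + i F2 and real F1, F2, the two components are the real and the imaginary part of
    the adjoint of B times [H, B]. *)
Lemma comm_kernel a n (F1 F2 F1' F2' : op) :
  loc a n F1 -> loc a n F2 ->
  adj (a - 1) (n + 2) F1 F1' -> adj (a - 1) (n + 2) F2 F2' ->
  let H := Hop J h (a - 1) (n + 2) in
  let B := embOp (fun s t => (ker a n F1 s t, ker a n F2 s t)) in
  forall s t, length s = (n + 2)%nat -> length t = (n + 2)%nat ->
  mulOp (n + 2) (adjOp B) (commOp (n + 2) (Ham J h (n + 2)) B) s t =
  (ker (a - 1) (n + 2) (fun psi u => F1' (cm H F1 psi) u + 1 * F2' (cm H F2 psi) u) s t,
   ker (a - 1) (n + 2) (fun psi u => F1' (cm H F2 psi) u + (- 1) * F2' (cm H F1 psi) u) s t).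
Proof.
  intros L1 L2 A1 A2 H B.
  assert (HH := adj_Hop J h (a - 1) (n + 2)). fold H in HH.
  assert (KB : forall u v, length u = (n + 2)%nat -> length v = (n + 2)%nat ->
    B u v = (ker (a - 1) (n + 2) F1 u v, ker (a - 1) (n + 2) F2 u v)).
  { intros u v Hu Hv. rewrite !ker_outer by auto. unfold B, embOp. destruct (_ && _); reflexivity. }
  assert (KC : forall u v, length u = (n + 2)%nat -> length v = (n + 2)%nat ->
    commOp (n + 2) (Ham J h (n + 2)) B u v = (ker (a - 1) (n + 2) (cm H F1) u v, ker (a - 1) (n + 2) (cm H F2) u v)).
  { intros u v Hu Hv. unfold commOp, subOp, mulOp, Csub, Cadd, Copp, Csum; simpl. rewrite !Cre_sum, !Cim_sum.
    assert (K : forall F F', adj (a - 1) (n + 2) F F' ->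
       ker (a - 1) (n + 2) (cm H F) u v =
       Rsum (fun w => ker (a-1) (n+2) H u w * ker (a-1) (n+2) F w v) (all_cfg (n+2)) -
       Rsum (fun w => ker (a-1) (n+2) F u w * ker (a-1) (n+2) H w v) (all_cfg (n+2))).
    { intros F F' AF. rewrite <- (ker_comp _ _ H H) by auto. rewrite <- (ker_comp _ _ F F') by auto. reflexivity. }
    rewrite (K _ _ A1), (K _ _ A2). unfold Rminus.
    f_equal; f_equal; try (apply Rsum_ext); try (f_equal; apply Rsum_ext); intros w Hw; apply all_cfg_In in Hw;
    rewrite KB by auto; (destruct (ker_Ham J h (a - 1) (n + 2) u w Hu Hw) as [Q1 Q2]);
    (destruct (ker_Ham J h (a - 1) (n + 2) w v Hw Hv) as [Q3 Q4]); unfold Cmul; cbn [fst snd];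
    rewrite ?Q1, ?Q2, ?Q3, ?Q4; fold H; ring. }
  intros s t Hs Ht. unfold mulOp at 1, Csum.
  rewrite (surjective_pairing (Csum_list _ _)), Cre_sum, Cim_sum.
  assert (KK : forall F F' E, adj (a - 1) (n + 2) F F' -> 
     ker (a - 1) (n + 2) (fun psi => F' (E psi)) s t =
     Rsum (fun w => ker (a-1) (n+2) F w s * ker (a-1) (n+2) E w t) (all_cfg (n+2))).
  { intros F F' E AF. rewrite (ker_comp _ _ F' F) by auto using adj_sym.
    apply Rsum_ext; intros w Hw; apply all_cfg_In in Hw. rewrite (ker_adj _ _ F F') by auto. reflexivity. }
  f_equal.
  - transitivity (ker (a - 1) (n + 2) (fun psi => F1' (cm H F1 psi)) s t + 1 * ker (a - 1) (n + 2) (fun psi => F2' (cm H F2 psi)) s t);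
      [|reflexivity].
    rewrite (KK F1 F1'), (KK F2 F2') by auto. rewrite <- Rsum_scal, <- Rsum_plus.
    apply Rsum_ext; intros w Hw; apply all_cfg_In in Hw. unfold adjOp. rewrite KB, KC by auto.
    unfold Cmul, Cconj; simpl; ring.
  - transitivity (ker (a - 1) (n + 2) (fun psi => F1' (cm H F2 psi)) s t + (-1) * ker (a - 1) (n + 2) (fun psi => F2' (cm H F1 psi)) s t);
      [|reflexivity].
    rewrite (KK F1 F1'), (KK F2 F2') by auto. rewrite <- Rsum_scal, <- Rsum_plus.
    apply Rsum_ext; intros w Hw; apply all_cfg_In in Hw. unfold adjOp. rewrite KB, KC by auto.
    unfold Cmul, Cconj; simpl; ring.
Qed.

Lemma adj_cm a n F F' H : adj a n F F' -> adj a n H H -> 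
  adj a n (cm H F) (fun psi s => F' (H psi) s - H (F' psi) s).
Proof.
  intros A1 A2. eapply adj_ext; [apply (adj_lin a n _ _ _ _ (-1) (adj_comp _ _ _ _ _ _ A2 A1) (adj_comp _ _ _ _ _ _ A1 A2))| |];
  unfold cm; simpl; intros; ring.
Qed.

Lemma ground_ineq a n (F1 F2 F1' F2' : op) :
  loc a n F1 -> loc a n F2 ->
  adj (a - 1) (n + 2) F1 F1' -> adj (a - 1) (n + 2) F2 F2' ->
  let H := Hop J h (a - 1) (n + 2) in
  let X := fun psi u => F1' (cm H F1 psi) u + 1 * F2' (cm H F2 psi) u in
  let Y := fun psi u => F1' (cm H F2 psi) u + (-1) * F2' (cm H F1 psi) u in
  let wr := om (a - 1) (n + 2) (sr (a - 1) (n + 2)) in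
  let wi := om (a - 1) (n + 2) (si (a - 1) (n + 2)) in
  0 <= wr X - wi Y /\ wr Y + wi X = 0.
Proof.
  intros L1 L2 A1 A2 H X Y wr wi.
  destruct G as [_ GG]. specialize (GG a n (fun s t => (ker a n F1 s t, ker a n F2 s t))). cbv zeta in GG.
  set (B := embOp (fun s t => (ker a n F1 s t, ker a n F2 s t))) in *.
  assert (HH := adj_Hop J h (a - 1) (n + 2)). fold H in HH.
  assert (AX : adj (a-1) (n+2) X _) by (exact (adj_lin _ _ _ _ _ _ 1 (adj_comp _ _ _ _ _ _ (adj_sym _ _ _ _ A1) (adj_cm _ _ _ _ _ A1 HH)) (adj_comp _ _ _ _ _ _ (adj_sym _ _ _ _ A2) (adj_cm _ _ _ _ _ A2 HH)))).
  assert (AY : adj (a-1) (n+2) Y _) by (exact (adj_lin _ _ _ _ _ _ (-1) (adj_comp _ _ _ _ _ _ (adj_sym _ _ _ _ A1) (adj_cm _ _ _ _ _ A2 HH)) (adj_comp _ _ _ _ _ _ (adj_sym _ _ _ _ A2) (adj_cm _ _ _ _ _ A1 HH)))).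
  assert (E : omega rho (a - 1) (n + 2) (mulOp (n + 2) (adjOp B) (commOp (n + 2) (Ham J h (n + 2)) B)) =
    (wr X - wi Y, wr Y + wi X)).
  { unfold omega, Csum. rewrite (surjective_pairing (Csum_list _ _)), Cre_sum, Cim_sum. unfold wr, wi.
    rewrite !(om_kernel _ _ _ X _ AX), !(om_kernel _ _ _ Y _ AY).
    rewrite <- Rsum_minus, <- Rsum_plus. 
    rewrite (Rsum_ext (fun x => fst _) (fun x => Rsum (fun t => fst (Cmul (rho (a - 1)%Z (n + 2)%nat x t) (mulOp (n + 2) (adjOp B) (commOp (n + 2) (Ham J h (n + 2)) B) t x))) (all_cfg (n+2)))) by (intros; now rewrite Cre_sum).
    rewrite (Rsum_ext (fun x => snd _) (fun x => Rsum (fun t => snd (Cmul (rho (a - 1)%Z (n + 2)%nat x t) (mulOp (n + 2) (adjOp B) (commOp (n + 2) (Ham J h (n + 2)) B) t x))) (all_cfg (n+2)))) by (intros; now rewrite Cim_sum).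
    f_equal.
    - rewrite Rsum_swap. apply Rsum_ext; intros s Hs. rewrite <- Rsum_minus. apply Rsum_ext; intros t Ht.
      apply all_cfg_In in Hs, Ht. unfold B; rewrite (comm_kernel a n F1 F2 F1' F2') by auto.
      fold H; fold X; fold Y. unfold sr, si, Cmul; simpl; ring.
    - rewrite Rsum_swap. apply Rsum_ext; intros s Hs. rewrite <- Rsum_plus. apply Rsum_ext; intros t Ht.
      apply all_cfg_In in Hs, Ht. unfold B; rewrite (comm_kernel a n F1 F2 F1' F2') by auto.
      fold H; fold X; fold Y. unfold sr, si, Cmul; simpl; ring. }
  rewrite E in GG. exact GG.
Qed.

Lemma loc_zero a n : loc a n (fun _ _ => 0).
Proof. split; intros; ring. Qed.

Lemma loc_id a n : loc a n (fun psi => psi).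
Proof. split; intros; auto. Qed.

Lemma om_zero a n sg0 (F : op) : (forall psi s, F psi s = 0) -> om a n sg0 F = 0.
Proof. intros E. apply Rsum_zero; intros; apply E. Qed.

Lemma ground_pos a n F F' : loc a n F -> adj (a - 1) (n + 2) F F' ->
  0 <= om (a - 1) (n + 2) (sr (a - 1) (n + 2)) (fun psi => F' (cm (Hop J h (a - 1) (n + 2)) F psi)) /\
  om (a - 1) (n + 2) (si (a - 1) (n + 2)) (fun psi => F' (cm (Hop J h (a - 1) (n + 2)) F psi)) = 0.
Proof.
  intros L A.
  assert (A0 : adj (a - 1) (n + 2) (fun _ _ => 0) (fun _ _ => 0)).
  { intros psi phi. unfold ip, Bsum. apply Rsum_ext; intros; ring. }
  assert (Hz : forall psi s, Hop J h (a - 1) (n + 2) (fun _ => 0) s = 0 /\ cm (Hop J h (a - 1) (n + 2)) (fun _ _ => 0) psi s = 0).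
  { intros psi s. assert (Hop J h (a - 1) (n + 2) (fun _ => 0) s = 0).
    { unfold Hop. rewrite (Rsum_zero (fun _ => 0)), (Rsum_zero (fun k => _ * 0)) by (intros; ring). ring. }
    split; auto. unfold cm. rewrite H; ring. }
  destruct (ground_ineq a n F (fun _ _ => 0) F' (fun _ _ => 0) L (loc_zero a n) A A0) as [P1 P2].
  assert (Z0 : forall psi l, length l = (n + 2)%nat -> F' (cm (Hop J h (a - 1) (n + 2)) (fun _ _ => 0) psi) (emb (a - 1) l) = 0).
  { intros psi l Hl. rewrite (ker_expand (a - 1) (n + 2) F' F) by auto using adj_sym. apply Rsum_zero; intros.
    destruct (Hz psi (emb (a - 1) x)) as [_ ->]. ring. }
  assert (Ez : forall sg0, om (a - 1) (n + 2) sg0 (fun psi u => F' (cm (Hop J h (a - 1) (n + 2)) (fun _ _ => 0) psi) u + -1 * 0) = 0).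
  { intros sg0. apply Rsum_zero; intros l Hl; apply all_cfg_In in Hl. rewrite Z0 by auto. ring. }
  rewrite !Ez in P1, P2.
  assert (Ex : forall sg0, om (a - 1) (n + 2) sg0 (fun psi u => F' (cm (Hop J h (a - 1) (n + 2)) F psi) u + 1 * 0) =
    om (a - 1) (n + 2) sg0 (fun psi => F' (cm (Hop J h (a - 1) (n + 2)) F psi))).
  { intros sg0. apply om_ext; intros; ring. }
  rewrite Ex in P1, P2. lra.
Qed.

(** The imaginary part of the condition for 1 + i F is the expectation of [H, F] plus a term which
    vanishes by the condition for F itself. *)
Lemma ground_stat a n F F' : loc a n F -> adj (a - 1) (n + 2) F F' ->
  om (a - 1) (n + 2) (sr (a - 1) (n + 2)) (cm (Hop J h (a - 1) (n + 2)) F) = 0.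
Proof.
  intros L A.
  assert (A0 : adj (a - 1) (n + 2) (fun psi => psi) (fun psi => psi)).
  { intros psi phi; reflexivity. }
  destruct (ground_ineq a n (fun psi => psi) F (fun psi => psi) F' (loc_id a n) L A0 A) as [_ P].
  destruct (ground_pos a n F F' L A) as [_ Q].
  rewrite !om_lin in P.
  assert (Z : om (a - 1) (n + 2) (si (a - 1) (n + 2)) (cm (Hop J h (a - 1) (n + 2)) (fun psi => psi)) = 0).
  { apply om_zero; intros; unfold cm; ring. }
  assert (Z' : om (a - 1) (n + 2) (sr (a - 1) (n + 2))
     (fun psi => F' (cm (Hop J h (a - 1) (n + 2)) (fun psi => psi) psi)) = 0).
  { apply Rsum_zero; intros l Hl; apply all_cfg_In in Hl.
    rewrite (ker_expand (a - 1) (n + 2) F' F) by auto using adj_sym. apply Rsum_zero; intros. unfold cm; ring. }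
  change (om (a - 1) (n + 2) (sr (a - 1) (n + 2)) (cm (Hop J h (a - 1) (n + 2)) F) +
    -1 * om (a - 1) (n + 2) (sr (a - 1) (n + 2)) (fun psi => F' (cm (Hop J h (a - 1) (n + 2)) (fun psi => psi) psi)) +
    (om (a - 1) (n + 2) (si (a - 1) (n + 2)) (cm (Hop J h (a - 1) (n + 2)) (fun psi => psi)) +
    1 * om (a - 1) (n + 2) (si (a - 1) (n + 2)) (fun psi => F' (cm (Hop J h (a - 1) (n + 2)) F psi))) = 0) in P.
  rewrite Z, Z', Q in P. lra.
Qed.
End Ground.

(** * Limits along a free ultrafilter *)

Module Ultra.
Import ssreflect ssrbool eqtype ssrnat boolp classical_sets filter.
Local Open Scope classical_set_scope.

Lemma free_ultrafilter : exists U : (nat -> Prop) -> Prop,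
  (forall P Q : nat -> Prop, (forall n, P n -> Q n) -> U P -> U Q) /\
  (forall P Q : nat -> Prop, U P -> U Q -> U (fun n => P n /\ Q n)) /\
  (forall P : nat -> Prop, U P \/ U (fun n => ~ P n)) /\
  (forall N : nat, U (fun n => Peano.le N n)) /\
  (forall P : nat -> Prop, U P -> exists n, P n).
Proof.
have [G [GU sFG]] := @ultraFilterLemma nat eventually _.
exists G; split; [|split; [|split; [|split]]].
- by move=> P Q PQ; apply: filterS.
- by move=> P Q GP GQ; apply: filterI.
- move=> P; have [|] := in_ultra_setVsetC (F:=G) P GU; [by left|by right].
- move=> N; apply: sFG. exists N => // n /=. by move/leP.
- by move=> P GP; apply: (@filter_ex _ G _ P GP).
Qed.
End Ultra.

Definition ultra : (nat -> Prop) -> Prop :=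
  proj1_sig (constructive_indefinite_description _ Ultra.free_ultrafilter).

Lemma ultra_mono (P Q : nat -> Prop) : (forall n, P n -> Q n) -> ultra P -> ultra Q.
Proof. unfold ultra; destruct constructive_indefinite_description as [U H]; simpl. apply H. Qed.
Lemma ultra_and P Q : ultra P -> ultra Q -> ultra (fun n => P n /\ Q n).
Proof. unfold ultra; destruct constructive_indefinite_description as [U H]; simpl. apply H. Qed.
Lemma ultra_em P : ultra P \/ ultra (fun n => ~ P n).
Proof. unfold ultra; destruct constructive_indefinite_description as [U H]; simpl. apply H. Qed.
Lemma ultra_ge N : ultra (fun n => (N <= n)%nat).
Proof. unfold ultra; destruct constructive_indefinite_description as [U H]; simpl. apply H. Qed.
Lemma ultra_ex P : ultra P -> exists n, P n.
Proof. unfold ultra; destruct constructive_indefinite_description as [U H]; simpl. apply H. Qed.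
Lemma ultra_all (P : nat -> Prop) : (forall n, P n) -> ultra P.
Proof. intros H. apply ultra_mono with (2 := ultra_ge 0); auto. Qed.
Definition ulim (x : nat -> R) (l : R) : Prop :=
  forall eps, 0 < eps -> ultra (fun n => Rabs (x n - l) < eps).
Definition ubd (x : nat -> R) : Prop := exists K, ultra (fun n => Rabs (x n) <= K).
(** Total by choice, with an arbitrary value when no limit exists; limiting kernels can thus be
    defined before their bounds are known. *)
Definition LIM (x : nat -> R) : R := epsilon (inhabits 0) (ulim x).

Lemma ulim_exists x : ubd x -> exists l, ulim x l.
Proof.
  intros [K HK].
  set (E := fun r => ultra (fun n => r <= x n)).
  destruct (completeness E) as [l [Hub Hlub]].
  - exists K. intros r Hr. destruct (ultra_ex _ (ultra_and _ _ Hr HK)) as [n [H1 H2]].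
    assert (x n <= Rabs (x n)) by apply Rle_abs. lra.
  - exists (- K). eapply ultra_mono; [|exact HK]. intros n Hn; simpl in *.
    assert (- x n <= Rabs (x n)) by (rewrite <- Rabs_Ropp; apply Rle_abs). lra.
  - exists l. intros eps He.
    assert (H1 : ultra (fun n => l - eps < x n)).
    { destruct (classic (exists r, E r /\ l - eps < r)) as [[r [Er Hr]]|N].
      - eapply ultra_mono; [|exact Er]. simpl; intros; lra.
      - assert (l <= l - eps); [|lra]. apply Hlub. intros r Er.
        destruct (Rle_dec r (l - eps)); auto. exfalso; apply N; exists r; split; auto; lra. }
    assert (H2 : ultra (fun n => x n < l + eps)).
    { destruct (ultra_em (fun n => x n < l + eps)) as [|H]; auto.
      assert (E (l + eps)). { eapply ultra_mono; [|exact H]. simpl; intros; lra. }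
      apply Hub in H0. lra. }
    eapply ultra_mono; [|exact (ultra_and _ _ H1 H2)]. simpl; intros n [? ?].
    apply Rabs_def1; lra.
Qed.

Lemma ulim_LIM x : ubd x -> ulim x (LIM x).
Proof. intros H. unfold LIM. apply epsilon_spec, ulim_exists, H. Qed.

Lemma ulim_unique x l l' : ulim x l -> ulim x l' -> l = l'.
Proof.
  intros H H'. destruct (Req_dec l l') as [|N]; auto. exfalso.
  assert (P : 0 < Rabs (l - l') / 2) by (assert (0 < Rabs (l - l')) by (apply Rabs_pos_lt; lra); lra).
  destruct (ultra_ex _ (ultra_and _ _ (H _ P) (H' _ P))) as [n [H1 H2]].
  assert (Rabs (l - l') <= Rabs (x n - l) + Rabs (x n - l')).
  { replace (l - l') with (- (x n - l) + (x n - l')) by ring.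
    eapply Rle_trans; [apply Rabs_triang|]. rewrite Rabs_Ropp; lra. }
  lra.
Qed.

Lemma LIM_eq x l : ulim x l -> LIM x = l.
Proof. intros H. apply (ulim_unique x); auto. unfold LIM. apply epsilon_spec. eauto. Qed.

Lemma ulim_ext x y l : ultra (fun n => x n = y n) -> ulim x l -> ulim y l.
Proof.
  intros H Hx eps He. eapply ultra_mono; [|exact (ultra_and _ _ H (Hx eps He))].
  simpl; intros n [-> ?]; auto.
Qed.

Lemma ulim_const c : ulim (fun _ => c) c.
Proof. intros eps He. apply ultra_all; intros. rewrite Rminus_diag, Rabs_R0; auto. Qed.

Lemma ulim_plus x y l m : ulim x l -> ulim y m -> ulim (fun n => x n + y n) (l + m).
Proof.
  intros H H' eps He. assert (P : 0 < eps / 2) by lra.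
  eapply ultra_mono; [|exact (ultra_and _ _ (H _ P) (H' _ P))]. simpl; intros n [H1 H2].
  replace (x n + y n - (l + m)) with ((x n - l) + (y n - m)) by ring.
  eapply Rle_lt_trans; [apply Rabs_triang|]; lra.
Qed.

Lemma ulim_scal c x l : ulim x l -> ulim (fun n => c * x n) (c * l).
Proof.
  intros H eps He. assert (P : 0 < eps / (Rabs c + 1)).
  { apply Rdiv_lt_0_compat; auto. assert (0 <= Rabs c) by apply Rabs_pos; lra. }
  eapply ultra_mono; [|exact (H _ P)]. simpl; intros n H1.
  replace (c * x n - c * l) with (c * (x n - l)) by ring. rewrite Rabs_mult.
  assert (0 <= Rabs c) by apply Rabs_pos. assert (0 <= Rabs (x n - l)) by apply Rabs_pos.
  apply Rle_lt_trans with ((Rabs c) * (eps / (Rabs c + 1))); [apply Rmult_le_compat_l; lra|].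
  apply Rmult_lt_reg_r with (Rabs c + 1); [lra|].
  replace (Rabs c * (eps / (Rabs c + 1)) * (Rabs c + 1)) with (Rabs c * eps) by (field; lra). nra.
Qed.

Lemma ulim_opp x l : ulim x l -> ulim (fun n => - x n) (- l).
Proof.
  intros H. apply ulim_scal with (c := -1) in H. replace (- l) with (-1 * l) by ring.
  eapply ulim_ext; [|exact H]. apply ultra_all; intros; ring.
Qed.

Lemma ulim_minus x y l m : ulim x l -> ulim y m -> ulim (fun n => x n - y n) (l - m).
Proof. intros H H'. apply ulim_plus; auto using ulim_opp. Qed.

Lemma ulim_bd x l : ulim x l -> ubd x.
Proof.
  intros H. exists (Rabs l + 1). eapply ultra_mono; [|exact (H 1 Rlt_0_1)]. simpl; intros n Hn.
  replace (x n) with ((x n - l) + l) by ring. eapply Rle_trans; [apply Rabs_triang|]; lra.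
Qed.

Lemma ulim_mult x y l m : ulim x l -> ulim y m -> ulim (fun n => x n * y n) (l * m).
Proof.
  intros H H'. destruct (ulim_bd _ _ H') as [K HK].
  assert (A : ulim (fun n => (x n - l) * y n) 0).
  { intros eps He. assert (P : 0 < eps / (Rabs K + 1)).
    { apply Rdiv_lt_0_compat; auto. assert (0 <= Rabs K) by apply Rabs_pos; lra. }
    eapply ultra_mono; [|exact (ultra_and _ _ (H _ P) HK)]. simpl; intros n [H1 H2].
    rewrite Rminus_0_r, Rabs_mult. assert (K <= Rabs K) by apply Rle_abs.
    assert (0 <= Rabs (x n - l)) by apply Rabs_pos. assert (0 <= Rabs (y n)) by apply Rabs_pos.
    apply Rle_lt_trans with (Rabs (x n - l) * (Rabs K + 1)); [apply Rmult_le_compat_l; lra|].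
    apply Rlt_le_trans with (eps / (Rabs K + 1) * (Rabs K + 1)); [apply Rmult_lt_compat_r; lra|].
    right; field; lra. }
  assert (B := ulim_plus _ _ _ _ A (ulim_scal l _ _ H')). rewrite Rplus_0_l in B.
  eapply ulim_ext; [|exact B]. apply ultra_all; intros; ring.
Qed.

Lemma ulim_le x y l m : ulim x l -> ulim y m -> ultra (fun n => x n <= y n) -> l <= m.
Proof.
  intros H H' Hle. destruct (Rle_dec l m) as [|N]; auto. exfalso.
  assert (P : 0 < (l - m) / 2) by lra.
  destruct (ultra_ex _ (ultra_and _ _ Hle (ultra_and _ _ (H _ P) (H' _ P)))) as [n [H1 [H2 H3]]].
  apply Rabs_def2 in H2, H3. lra.
Qed.

Lemma ulim_Rsum {A} (f : nat -> A -> R) (g : A -> R) l :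
  (forall x, In x l -> ulim (fun n => f n x) (g x)) ->
  ulim (fun n => fold_right (fun x acc => f n x + acc) 0 l) (fold_right (fun x acc => g x + acc) 0 l).
Proof.
  induction l as [|x l IH]; intros H; simpl; [apply ulim_const|].
  apply ulim_plus; auto with datatypes.
Qed.

Lemma ulim_squeeze0 x y : ulim y 0 -> ultra (fun n => Rabs (x n) <= y n) -> ulim x 0.
Proof.
  intros H Hle eps He. eapply ultra_mono; [|exact (ultra_and _ _ Hle (H eps He))].
  simpl; intros n [H1 H2]. rewrite Rminus_0_r in *. assert (y n <= Rabs (y n)) by apply Rle_abs. lra.
Qed.

Lemma ulim_Un_cv x l : Un_cv x l -> ulim x l.
Proof.
  intros H eps He. destruct (H eps He) as [N HN].
  eapply ultra_mono; [|exact (ultra_ge N)]. intros n Hn; apply HN; auto.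
Qed.

(** * Polynomials and the Newton iteration for the sign function *)

(** Names for the standard tactics on [R], since [ring] gets another meaning inside the next
    module. *)
Ltac rring := ring.
Ltac rfield := field.

Module Pol.
Import all_boot all_order all_algebra Rstruct ring.
Import GRing.Theory.
Local Delimit Scope ring_scope with GR.
Local Open Scope R_scope.

(** The operations get names of their own: identities between polynomials are proved inside this
    module by its [ring] and are used outside only in this form. *)
Definition pol : Type := {poly R}.
Definition pC (c : R) : pol := (c%:P)%GR.
Definition pX : pol := ('X)%GR.
Definition padd (p q : pol) : pol := (p + q)%GR.
Definition pmul (p q : pol) : pol := (p * q)%GR.

Section Act.
Variables (T : Type) (D : (T -> R) -> T -> R).
Hypothesis Dlin : forall (c : R) (f g : T -> R) x, D (fun y => f y + c * g y) x = D f x + c * D g x.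

Fixpoint act_seq (s : seq R) (F : T -> R) : T -> R :=
  match s with
  | [::] => fun _ => 0
  | c :: s' => fun x => c * F x + D (act_seq s' F) x
  end.
Definition act (q : pol) : (T -> R) -> T -> R := act_seq (polyseq q).

Lemma D0 x : D (fun _ => 0) x = 0.
Proof.
have := Dlin (-1) (fun _ => 0) (fun _ => 0) x.
have -> : (fun _ : T => 0 + (-1) * 0) = (fun _ => 0) by apply: functional_extensionality => y; rring.
lra.
Qed.

Lemma act_0 F x : act 0%GR F x = 0.
Proof. by rewrite /act polyseq0. Qed.

Lemma act_cons c (q : {poly R}) F x : act (cons_poly c q) F x = c * F x + D (act q F) x.
Proof.
rewrite /act polyseq_cons; case: ifP => // /negbFE.
rewrite nil_poly => /eqP ->. rewrite polyseq0 /= D0. have [->|nz] := eqVneq c 0%GR.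
  rewrite polyseqC eqxx /=; change (0 = 0 * F x + 0); rring.
by rewrite polyseqC nz /= D0.
Qed.

Lemma act_C c F x : act (pC c) F x = c * F x.
Proof.
have -> : pC c = cons_poly c 0%GR by rewrite cons_poly_def mul0r add0r.
rewrite act_cons. have -> : act 0%GR F = fun _ => 0 by rewrite /act polyseq0.
rewrite D0; rring.
Qed.

Lemma act_add p q F x : act (padd p q) F x = act p F x + act q F x.
Proof.
rewrite /padd; move: p q x; elim/poly_ind => [|p a IH] q x.
  rewrite add0r act_0; rring.
move: q; elim/poly_ind => [|q b _].
  rewrite addr0 act_0; rring.
have -> : (p * 'X + a%:P + (q * 'X + b%:P) = cons_poly (a + b) (p + q))%GR.
  by rewrite cons_poly_def polyCD mulrDl; ring.
rewrite -!cons_poly_def !act_cons.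
have -> : act (p + q)%GR F = fun y => act p F y + 1 * act q F y.
  apply: functional_extensionality => y; rewrite IH; rring.
rewrite Dlin.
change ((a + b) * F x + (D (act p F) x + 1 * D (act q F) x) = a * F x + D (act p F) x + (b * F x + D (act q F) x)).
rring.
Qed.

Lemma act_mulX p F x : act (pmul p pX) F x = D (act p F) x.
Proof.
have -> : pmul p pX = cons_poly 0%GR p by rewrite cons_poly_def addr0.
rewrite act_cons; change (0 * F x + D (act p F) x = D (act p F) x); rring.
Qed.

Lemma act_mulC c q F x : act (pmul (pC c) q) F x = c * act q F x.
Proof.
rewrite /pmul /pC; move: q x; elim/poly_ind => [|q b IH] x.
  rewrite mulr0 act_0; rring.
have -> : (c%:P * (q * 'X + b%:P) = cons_poly (c * b) (c%:P * q))%GR.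
  by rewrite cons_poly_def polyCM; ring.
rewrite -cons_poly_def !act_cons.
have -> : act (c%:P * q)%GR F = fun y => 0 + c * act q F y.
  by apply: functional_extensionality => y; rewrite IH; rring.
rewrite Dlin D0. change (c * b * F x + (0 + c * D (act q F) x) = c * (b * F x + D (act q F) x)). rring.
Qed.

Lemma act_mul p q F x : act (pmul p q) F x = act p (act q F) x.
Proof.
rewrite /pmul; move: p x; elim/poly_ind => [|p c IH] x.
  by rewrite mul0r !act_0.
have -> : ((p * 'X + c%:P) * q = padd (pmul (p * q) pX) (pmul (pC c) q))%GR.
  by rewrite /padd /pmul /pX /pC; ring.
rewrite act_add act_mulX act_mulC.
have -> : act (p * q)%GR F = act p (act q F) by apply: functional_extensionality => y; exact: IH.
have -> : (p * 'X + c%:P = padd (pmul p pX) (pC c))%GR by [].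
by rewrite act_add act_mulX act_C.
Qed.

Lemma act_lin q c f g x :
  act q (fun y => f y + c * g y) x = act q f x + c * act q g x.
Proof.
move: q x; elim/poly_ind => [|q b IH] x.
  rewrite !act_0; rring.
rewrite -cons_poly_def !act_cons.
have -> : act q (fun y => f y + c * g y) = fun y => act q f y + c * act q g y.
  by apply: functional_extensionality => y; exact: IH.
rewrite Dlin; rring.
Qed.
End Act.

(** Write e = 1 - Y r^2. Replacing Y r^2 by 1 - e leaves an identity in e alone: 1 - (1 - e)(1 +
    e/2)^2 = e^2 (3 + e) / 4. *)
Lemma newton_step (A : comNzRingType) (Y r hf : A) : (hf + hf = 1)%GR ->
  (1 + -1 * (Y * (r * (1 + hf * (1 + -1 * (Y * (r * r)))) * (r * (1 + hf * (1 + -1 * (Y * (r * r))))))) =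
   hf * hf * ((1 + -1 * (Y * (r * r))) * (1 + -1 * (Y * (r * r))) * (1 + 1 + 1 + (1 + -1 * (Y * (r * r))))))%GR.
Proof.
move=> H2.
have E2 : (2%:R * hf = 1)%GR by rewrite -[RHS]H2; ring.
have E4 : (4%:R * (hf * hf) = 1)%GR.
  have -> : (4%:R * (hf * hf) = 2%:R * hf * (2%:R * hf))%GR by ring.
  by rewrite E2 mulr1.
set e := (1 + -1 * (Y * (r * r)))%GR.
have -> : (Y * (r * (1 + hf * e) * (r * (1 + hf * e))) = (1 - e) * ((1 + hf * e) * (1 + hf * e)))%GR by rewrite /e; ring.
have -> : (1 + -1 * ((1 - e) * ((1 + hf * e) * (1 + hf * e))) = 1 - (1 - e) * (1 + 2%:R * hf * e + hf * hf * e * e))%GR by ring.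
rewrite E2.
have -> : (1 - (1 - e) * (1 + 1 * e + hf * hf * e * e) = 1 * (e * e) - hf * hf * e * e + hf * hf * e * e * e)%GR by ring.
have -> : (1 * (e * e) = 4%:R * (hf * hf) * (e * e))%GR by rewrite E4.
ring.
Qed.

(** Newton iteration for (1 - t)^(-1/2), where 1 - t = (kappa X)^2. *)
Section Newton.
Variable kap : R.
Definition pY : pol := pmul (pC (kap * kap)) (pmul pX pX).
Definition pt : pol := padd (pC 1) (pmul (pC (-1)) pY).
Definition perr (r : pol) : pol := padd (pC 1) (pmul (pC (-1)) (pmul pY (pmul r r))).
Fixpoint newt (k : nat) : pol :=
  match k with
  | O => pC 1
  | S k' => pmul (newt k') (padd (pC 1) (pmul (pC (/ 2)) (perr (newt k'))))
  end.
(** Tends to 1 + sign X, twice the spectral projection onto the positive half. *)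
Definition pproj (k : nat) : pol := padd (pC 1) (pmul (pC kap) (pmul pX (newt k))).

Lemma pC1 : pC 1 = 1%GR. Proof. by []. Qed.
Lemma pCD a b : pC (a + b) = (pC a + pC b)%GR. Proof. exact: polyCD. Qed.
Lemma pCM a b : pC (a * b) = (pC a * pC b)%GR. Proof. exact: polyCM. Qed.
Lemma pCN a : pC (- a) = (- pC a)%GR. Proof. exact: polyCN. Qed.
Lemma pCN1 : pC (-1) = (-1)%GR.
Proof. have -> : -1 = - (1) by rring. by rewrite pCN pC1. Qed.

Lemma perr_S k : perr (newt (S k)) =
  pmul (pC (/ 4)) (pmul (pmul (perr (newt k)) (perr (newt k))) (padd (pC 3) (perr (newt k)))).
Proof.
rewrite [newt (S k)]/=; move: (newt k) => r. rewrite /perr; move: pY => Y; rewrite /pmul /padd.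
have -> : / 4 = / 2 * / 2 by rfield.
have -> : 3 = 1 + 1 + 1 by rring.
have H2 : (pC (/2) + pC (/2) = 1)%GR by rewrite -pCD -pC1; congr (pC _); rfield.
rewrite pCN1.
rewrite !pCD pCM pC1; apply: newton_step H2.
Qed.

Lemma perr_0 : perr (newt 0) = pt.
Proof. rewrite /perr /pt /= /pmul /padd pC1; ring. Qed.

(** The polynomial [kap X^2 newt] approximates |X|; on the range of the projection it agrees with X
    up to the Newton error. *)
Lemma pproj_X k : pmul pX (pproj k) =
  padd (pmul (pmul (pC kap) (pmul pX (pmul pX (newt k)))) (pproj k)) (pmul pX (perr (newt k))).
Proof.
rewrite /pproj /perr /pY; move: (newt k) => r; rewrite /pmul /padd !pCM.
rewrite ?pCN1.
rewrite pC1; ring.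
Qed.

Lemma pproj_sq k : pmul (pproj k) (pproj k) =
  padd (pC 2) (padd (pmul (pC (-1)) (perr (newt k))) (pmul (pC (2 * kap)) (pmul pX (newt k)))).
Proof.
rewrite /pproj /perr /pY; move: (newt k) => r; rewrite /pmul /padd !pCM.
rewrite ?pCN1.
have -> : 2 = 1 + 1 by rring. rewrite pCD.
rewrite pC1; ring.
Qed.

Lemma pX_newt_sq k : pmul (pmul (pC kap) (pmul pX (newt k))) (pmul (pC kap) (pmul pX (newt k))) =
  padd (pC 1) (pmul (pC (-1)) (perr (newt k))).
Proof.
rewrite /perr /pY; move: (newt k) => r; rewrite /pmul /padd !pCM.
rewrite ?pCN1.
rewrite pC1; ring.
Qed.

(** Here [w] is kap^2 (X^2 - e0^2), so the left side is - w (X + e0) p^2, and [pproj_X] replaces X p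
    by |X| p. A functional that is non-negative on (e0 - X) q^2 is thereby forced to be small on w
    p^2. *)
Lemma pproj_gap e0 nu k : kap * kap * (e0 * e0) = 1 - nu ->
  let q := pmul (padd pX (pC e0)) (pproj k) in
  let pp := pmul (pproj k) (pproj k) in
  let w := padd (pC nu) (pmul (pC (-1)) pt) in
  pmul (pC (kap * kap)) (pmul (padd (pC e0) (pmul (pC (-1)) pX)) (pmul q q)) =
  pmul (pC (-1)) (pmul w (padd (pmul (pmul (pC kap) (pmul pX (pmul pX (newt k)))) pp)
       (padd (pmul (pC e0) pp) (pmul (pmul pX (perr (newt k))) (pproj k))))).
Proof.
move=> He q pp w.
have Ew : w = (pC (kap * kap) * (pX * pX - pC e0 * pC e0))%GR.
  rewrite /w /pt /pmul /padd.
  have -> : nu = 1 + - (kap * kap * (e0 * e0)) by lra.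
  rewrite ?pCN1.
  rewrite pCD pCN /pY /pmul !pCM pC1. ring.
have EX := pproj_X k. move: EX. rewrite Ew /q /pp /pmul /padd => EX.
rewrite ?pCN1.
move: EX; move: (perr (newt k)) (pC kap * (pX * (pX * newt k)))%GR (pproj k) => E S P EX.
have -> : (S * (P * P) + (pC e0 * (P * P) + pX * E * P) = (S * P + pX * E) * P + pC e0 * P * P)%GR by ring.
rewrite -EX. ring.
Qed.

Lemma newt_S k : newt (S k) = pmul (newt k) (padd (pC 1) (pmul (pC (/ 2)) (perr (newt k)))).
Proof. by []. Qed.

(** [(kap X)^2 newt] is kap times the approximant of |X|. It is written as 1 minus a small
    polynomial in order to show that it is positive. *)
Lemma newt_tau k : pmul pY (newt k) =
  padd (pC 1) (pmul (pC (-1)) (padd (pmul (pC (-1)) (padd (newt k) (pC (-1)))) (pmul pt (newt k)))).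
Proof.
move: (newt k) => r; rewrite /pt; move: pY => Y; rewrite /pmul /padd.
rewrite ?pCN1.
rewrite pC1; ring.
Qed.
End Newton.

Lemma pol_rect_alg (P : pol -> Prop) : (forall c, P (pC c)) -> P pX ->
  (forall p q, P p -> P q -> P (padd p q)) -> (forall p q, P p -> P q -> P (pmul p q)) -> forall q, P q.
Proof.
move=> HC HX HD HM; elim/poly_ind => [|q c IH]; first exact: HC 0.
by apply: HD; [apply: HM|].
Qed.
Lemma newt_sub_S kap k : padd (newt kap (S k)) (pC (-1)) =
  padd (padd (newt kap k) (pC (-1))) (pmul (newt kap k) (pmul (pC (/ 2)) (perr kap (newt kap k)))).
Proof. rewrite newt_S; move: (perr kap (newt kap k)) (newt kap k) => E r; rewrite /pmul /padd pC1; ring. Qed.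
Lemma padd_sub q : q = padd (padd q (pC (-1))) (pC 1).
Proof. rewrite /padd pCN1 pC1; ring. Qed.
Lemma pC_cancel : padd (pC 1) (pC (-1)) = pC 0.
Proof. by rewrite /padd -pCD; congr (pC _); rring. Qed.
Lemma pmulA a b c : pmul a (pmul b c) = pmul (pmul a b) c. Proof. exact: mulrA. Qed.
Lemma pmulC a b : pmul a b = pmul b a. Proof. exact: mulrC. Qed.
Lemma pmul_addr a b c : pmul a (padd b c) = padd (pmul a b) (pmul a c). Proof. exact: mulrDr. Qed.
Lemma pmul_addl a b c : pmul (padd a b) c = padd (pmul a c) (pmul b c). Proof. exact: mulrDl. Qed.
Lemma pmul1 a : pmul (pC 1) a = a. Proof. exact: mul1r. Qed.
Lemma pC_mul a b : pC (a * b) = pmul (pC a) (pC b). Proof. exact: polyCM. Qed.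
Lemma psq_mul a b : pmul (pmul a b) (pmul a b) = pmul (pmul a a) (pmul b b).
Proof. rewrite /pmul; ring. Qed.
End Pol.

Import Pol.

(** * Positive functionals on polynomials *)

Lemma Rabs_le_bounds x a : Rabs x <= a -> - a <= x <= a.
Proof. intros H. assert (x <= Rabs x) by apply Rle_abs. assert (- x <= Rabs x) by (rewrite <- Rabs_Ropp; apply Rle_abs). lra. Qed.

(** Iterating the hypothesis along powers of two gives th^(2^k) m_0 <= |m_(2^k)| with th = |m_1| /
    m_0, and growth faster than rho is impossible whatever the size of [K]. *)
Lemma doubling (m : nat -> R) (K rho : R) :
  0 <= m 0%nat -> 0 <= rho ->
  (forall n, m n * m n <= m 0%nat * m (2 * n)%nat) ->
  (forall n, Rabs (m n) <= K * rho ^ n) ->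
  Rabs (m 1%nat) <= rho * m 0%nat.
Proof.
  intros H0 Hr HC HK.
  destruct (Req_dec (m 0%nat) 0) as [Z|NZ].
  { assert (H := HC 1%nat). rewrite Z, Rmult_0_l in H.
    assert (m 1%nat = 0) by nra. rewrite H1, Z, Rabs_R0; lra. }
  destruct (Rle_dec (Rabs (m 1%nat)) (rho * m 0%nat)) as [|N]; auto. exfalso.
  apply Rnot_le_lt in N.
  assert (P0 : 0 < m 0%nat) by lra.
  set (th := Rabs (m 1%nat) / m 0%nat).
  assert (Hth : rho < th). { unfold th. apply Rmult_lt_reg_r with (m 0%nat); auto. unfold Rdiv. rewrite Rmult_assoc, Rinv_l; lra. }
  assert (G : forall k, th ^ (2 ^ k) * m 0%nat <= Rabs (m (2 ^ k)%nat)).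
  { induction k as [|k IH].
    - simpl. unfold th. right; field; lra.
    - assert (H := HC (2 ^ k)%nat). replace (2 * 2 ^ k)%nat with (2 ^ S k)%nat in H by (simpl; lia).
      assert (E : th ^ (2 ^ S k) = th ^ (2 ^ k) * th ^ (2 ^ k)) by (rewrite <- pow_add; f_equal; simpl; lia).
      rewrite E.
      assert (T : 0 <= th ^ (2 ^ k)) by (apply pow_le; lra).
      assert (A : (th ^ (2 ^ k) * m 0%nat) * (th ^ (2 ^ k) * m 0%nat) <= Rabs (m (2 ^ k)%nat) * Rabs (m (2 ^ k)%nat)).
      { apply Rmult_le_compat; auto; apply Rmult_le_pos; lra. }
      rewrite <- Rabs_mult, (Rabs_right (m (2 ^ k)%nat * _)) in A by (apply Rle_ge; nra).
      assert (B : m (2 ^ S k)%nat <= Rabs (m (2 ^ S k)%nat)) by apply Rle_abs.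
      apply Rmult_le_reg_l with (m 0%nat); auto. nra. }
  assert (Kp : 0 < K).
  { assert (H := HK 0%nat). simpl in H. rewrite Rabs_right in H by lra. lra. }
  destruct (Req_dec rho 0) as [Zr|Nr].
  { assert (H := HK 1%nat). rewrite Zr in H. simpl in H. rewrite Zr in N. lra. }
  assert (Hq : 1 < th / rho). { apply Rmult_lt_reg_r with rho; [lra|]. unfold Rdiv; rewrite Rmult_assoc, Rinv_l; lra. }
  destruct (Pow_x_infinity (th / rho) ltac:(rewrite Rabs_right; lra) (K / m 0%nat + 1)) as [N0 HN0].
  specialize (HN0 (2 ^ N0)%nat).
  assert (L : (N0 <= 2 ^ N0)%nat) by (apply Nat.lt_le_incl, Nat.pow_gt_lin_r; lia).
  specialize (HN0 L). rewrite Rabs_right in HN0 by (apply Rle_ge, pow_le; lra).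
  assert (H1 := G N0). assert (H2 := HK (2 ^ N0)%nat).
  assert (rp : 0 < rho ^ (2 ^ N0)) by (apply pow_lt; lra).
  unfold Rdiv in HN0. rewrite Rpow_mult_distr, pow_inv in HN0.
  assert (th ^ (2 ^ N0) * m 0%nat <= K * rho ^ (2 ^ N0)) by lra.
  assert (th ^ (2 ^ N0) * / rho ^ (2 ^ N0) * m 0%nat <= K).
  { apply Rmult_le_reg_r with (rho ^ (2 ^ N0)); auto.
    replace (th ^ 2 ^ N0 * / rho ^ 2 ^ N0 * m 0%nat * rho ^ 2 ^ N0) with (th ^ 2 ^ N0 * m 0%nat) by (field; lra). auto. }
  assert (K * / m 0%nat * m 0%nat = K) by (field; lra). nra.
Qed.

Fixpoint ppow (q : pol) (n : nat) : pol := match n with O => pC 1 | S m => pmul q (ppow q m) end.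

Lemma ppow_add q n m : ppow q (n + m) = pmul (ppow q n) (ppow q m).
Proof. induction n as [|n IH]; simpl; [now rewrite pmul1|]. now rewrite IH, pmulA. Qed.

Section Positive.
Variables (L : pol -> R) (K : R) (bnd : pol -> R -> Prop).
Hypothesis L_add : forall p q, L (padd p q) = L p + L q.
Hypothesis L_C : forall c q, L (pmul (pC c) q) = c * L q.
Hypothesis Lpos : forall q, 0 <= L (pmul q q).
Hypothesis b_C : forall c, bnd (pC c) (Rabs c).
Hypothesis b_mul : forall p q A B, bnd p A -> bnd q B -> bnd (pmul p q) (A * B).
Hypothesis LB : forall q B, bnd q B -> Rabs (L q) <= K * B.

Lemma L_CS p q : L (pmul p q) * L (pmul p q) <= L (pmul p p) * L (pmul q q).
Proof.
  assert (Q : forall x, 0 <= L (pmul p p) + 2 * x * L (pmul p q) + x * x * L (pmul q q)).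
  { intros x. assert (H := Lpos (padd p (pmul (pC x) q))).
    rewrite pmul_addl, !pmul_addr, !L_add in H.
    rewrite (pmulC p (pmul (pC x) q)), <- pmulA, !L_C, (pmulC q p) in H.
    rewrite <- pmulA, L_C, (pmulC q (pmul (pC x) q)), <- pmulA, L_C in H. lra. }
  assert (P := Lpos p). assert (P' := Lpos q).
  set (A := L (pmul p p)) in *. set (B := L (pmul p q)) in *. set (E := L (pmul q q)) in *.
  destruct (Req_dec E 0) as [Z|N].
  - destruct (Req_dec B 0) as [->|NB]; [rewrite Z; lra|].
    specialize (Q (- (A + 1) / (2 * B))). rewrite Z in Q.
    replace (A + 2 * (- (A + 1) / (2 * B)) * B + - (A + 1) / (2 * B) * (- (A + 1) / (2 * B)) * 0) with (-1) in Q
      by (field; auto). lra.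
  - specialize (Q (- B / E)). replace (A + 2 * (- B / E) * B + - B / E * (- B / E) * E) with (A - B * B / E) in Q by (field; auto).
    assert (0 < E) by lra. apply Rmult_le_reg_r with (/ E); [now apply Rinv_0_lt_compat|].
    replace (A * E * / E) with A by (field; lra). unfold Rdiv in Q. lra.
Qed.

Lemma b_pow q B n : bnd q B -> bnd (ppow q n) (B ^ n).
Proof.
  intros H. induction n as [|n IH]; simpl; [|now apply b_mul].
  rewrite <- Rabs_R1 at 2. apply b_C.
Qed.

(** [LB] bounds [L] with a crude constant [K]; applied to all powers of [q], [doubling] improves [K]
    to [L 1]. This plays the role of the spectral theorem. *)
Lemma L_contract q B : 0 <= B -> bnd q B -> Rabs (L q) <= B * L (pC 1).
Proof.
  intros HB Hq.
  assert (H := doubling (fun n => L (ppow q n)) K B).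
  simpl in H. rewrite (pmulC q), pmul1 in H. apply H; auto.
  - rewrite <- (pmul1 (pC 1)). apply Lpos.
  - intros n. assert (C := L_CS (pC 1) (ppow q n)). rewrite !pmul1 in C.
    rewrite <- ppow_add in C. replace (n + (n + 0))%nat with (n + n)%nat by lia. exact C.
  - intros n. apply LB. now apply b_pow.
Qed.
End Positive.

(** * Functionals concentrated below the upper edge of the gap *)

Section Moments.
Variables (L : pol -> R) (K : R) (bnd : pol -> R -> Prop) (kap nu e0 Kx : R).
Hypothesis L_add : forall p q, L (padd p q) = L p + L q.
Hypothesis L_C : forall c q, L (pmul (pC c) q) = c * L q.
Hypothesis Lpos : forall q, 0 <= L (pmul q q).
Hypothesis Lneg : forall q, 0 <= L (pmul (padd (pC e0) (pmul (pC (-1)) pX)) (pmul q q)).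
Hypothesis b_C : forall c, bnd (pC c) (Rabs c).
Hypothesis b_X : bnd pX Kx.
Hypothesis b_t : bnd (pt kap) nu.
Hypothesis b_add : forall p q A B, bnd p A -> bnd q B -> bnd (padd p q) (A + B).
Hypothesis b_mul : forall p q A B, bnd p A -> bnd q B -> bnd (pmul p q) (A * B).
Hypothesis b_mono : forall q A B, bnd q A -> A <= B -> bnd q B.
Hypothesis LB : forall q B, bnd q B -> Rabs (L q) <= K * B.
Hypothesis b_exists : forall q, exists B, 0 <= B /\ bnd q B.
Hypothesis Hnu : 0 <= nu <= 1 / 8.
Hypothesis Hkap : 0 < kap.
Hypothesis He0 : 0 < e0.
Hypothesis Hgap : kap * kap * (e0 * e0) = 1 - nu.
Hypothesis HK : 0 <= K.
Hypothesis HKx : 0 <= Kx.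

(** The Newton step sends e to e^2 (3 + e) / 4, which is at most nu e as e <= nu; this geometric
    rate is enough. *)
Lemma bnd_perr k : bnd (perr kap (newt kap k)) (nu ^ (k + 1)).
Proof.
  induction k as [|k IH].
  - rewrite perr_0. simpl. now rewrite Rmult_1_r.
  - rewrite perr_S. assert (P := pow_le nu (k + 1) (proj1 Hnu)).
    assert (Q : nu ^ (k + 1) <= 1).
    { rewrite <- (pow1 (k + 1)). apply pow_incr; lra. }
    eapply b_mono. { eapply b_mul; [apply b_C|]. apply b_mul; [apply b_mul; apply IH|]. apply b_add; [apply b_C|apply IH]. }
    rewrite !Rabs_right by lra.
    assert (E : nu ^ (k + 1) <= nu). { replace (k + 1)%nat with (S k) by lia. simpl. assert (nu ^ k <= 1) by (rewrite <- (pow1 k); apply pow_incr; lra). assert (0 <= nu ^ k) by (apply pow_le; lra). nra. }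
    replace (nu ^ (S k + 1)) with (nu * nu ^ (k + 1)) by reflexivity.
    set (e := nu ^ (k + 1)) in *. assert (e * e <= nu * e) by nra. nra.
Qed.

Lemma bnd_newt_sub k : bnd (padd (newt kap k) (pC (-1))) (2 * nu * (1 - nu ^ k)) /\ bnd (newt kap k) 2.
Proof.
  induction k as [|k [IH1 IH2]].
  - split.
    + simpl newt. rewrite pC_cancel. eapply b_mono; [apply b_C|]. rewrite Rabs_R0; simpl; lra.
    + simpl. eapply b_mono; [apply b_C|]. rewrite Rabs_R1; lra.
  - assert (B1 : bnd (padd (newt kap (S k)) (pC (-1))) (2 * nu * (1 - nu ^ S k))).
    { rewrite newt_sub_S. eapply b_mono.
      { apply b_add; [exact IH1|]. apply b_mul; [exact IH2|]. apply b_mul; [apply b_C|apply bnd_perr]. }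
      rewrite Rabs_right by lra. replace (k + 1)%nat with (S k) by lia. simpl.
      assert (0 <= nu ^ k) by (apply pow_le; lra).
      assert (0 <= (nu * nu ^ k) * (1 - 2 * nu)) by (apply Rmult_le_pos; [apply Rmult_le_pos|]; lra). lra. }
    split; auto.
    rewrite (padd_sub (newt kap (S k))).
    eapply b_mono; [apply b_add; [exact B1|apply b_C]|]. rewrite Rabs_R1.
    assert (0 <= nu ^ S k) by (apply pow_le; lra). nra.
Qed.

(** By [Hgap] this is kap^2 (X^2 - e0^2), vanishing at the two edges of the gap. *)
Let w := padd (pC nu) (pmul (pC (-1)) (pt kap)).

(** The positive functional r |-> L (q^2 r) contracts [pt] by [nu]; this is the statement X^2 >=
    e0^2. *)
Lemma L_gap q : 0 <= L (pmul w (pmul q q)).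
Proof.
  set (L' := fun r => L (pmul (pmul q q) r)).
  assert (H : Rabs (L' (pt kap)) <= nu * L' (pC 1)).
  { destruct (b_exists (pmul q q)) as [B [HB HqB]].
    apply (L_contract L' (K * B) bnd); auto; try lra.
    - intros; unfold L'. now rewrite pmul_addr, L_add.
    - intros c r; unfold L'. now rewrite pmulA, (pmulC _ (pC c)), <- pmulA, L_C.
    - intros r; unfold L'. rewrite <- psq_mul. apply Lpos.
    - intros r B' Hr. unfold L'. rewrite Rmult_assoc. apply LB. now apply b_mul. }
  unfold w. rewrite pmul_addl, L_add, L_C, <- pmulA, L_C.
  unfold L' in H. rewrite (pmulC _ (pC 1)), pmul1, pmulC in H.
  apply Rabs_le_bounds in H. lra.
Qed.

Lemma bnd_tau k : bnd (padd (pmul (pC (-1)) (padd (newt kap k) (pC (-1)))) (pmul (pt kap) (newt kap k))) (4 * nu).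
Proof.
  destruct (bnd_newt_sub k) as [B1 B2]. eapply b_mono.
  { apply b_add; [apply b_mul; [apply b_C|exact B1]|apply b_mul; [exact b_t|exact B2]]. }
  rewrite Rabs_left by lra. assert (0 <= nu ^ k) by (apply pow_le; lra). nra.
Qed.

(** [Lneg] for (X + e0) p says, through [pproj_gap], that L (w |X| p^2) + e0 L (w p^2) is at most
    the Newton error. Both summands are non-negative, so the second tends to zero: the positive half
    carries no mass off the edge. *)
Lemma gap_decay : exists K2, forall k, 
  0 <= L (pmul w (pmul (pproj kap k) (pproj kap k))) <= K2 * nu ^ (k + 1).
Proof.
  exists (K * (2 * nu * (Kx * (1 + kap * (Kx * 2)))) / e0). intros k. split; [apply L_gap|].
  set (p := pproj kap k). set (M := fun r => L (pmul (pmul w (pmul p p)) r)).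
  assert (Bw : bnd w (2 * nu)).
  { eapply b_mono; [apply b_add; [apply b_C|apply b_mul; [apply b_C|apply b_t]]|].
    rewrite Rabs_right, Rabs_left by lra. lra. }
  destruct (bnd_newt_sub k) as [_ Bn].
  assert (Bp : bnd p (1 + kap * (Kx * 2))).
  { eapply b_mono; [apply b_add; [apply b_C|apply b_mul; [apply b_C|apply b_mul; [apply b_X|exact Bn]]]|].
    rewrite !Rabs_right by lra. lra. }
  assert (HM : Rabs (M (padd (pmul (pC (-1)) (padd (newt kap k) (pC (-1)))) (pmul (pt kap) (newt kap k)))) <= 4 * nu * M (pC 1)).
  { apply (L_contract M (K * (2 * nu * ((1 + kap * (Kx * 2)) * (1 + kap * (Kx * 2))))) bnd); auto; try lra.
    - intros; unfold M. now rewrite pmul_addr, L_add.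
    - intros c r; unfold M. now rewrite pmulA, (pmulC _ (pC c)), <- pmulA, L_C.
    - intros r; unfold M. rewrite <- pmulA, <- psq_mul. apply L_gap.
    - intros r B' Hr. unfold M. rewrite Rmult_assoc. apply LB. apply b_mul; auto.
    - apply bnd_tau. }
  assert (M1 : M (pC 1) = L (pmul w (pmul p p))).
  { unfold M. now rewrite pmulC, pmul1. }
  (* Up to the factor [kap] the argument is 1 minus a polynomial that M contracts by 4 nu <= 1/2;
     the hypothesis nu <= 1/8 is chosen for this. *)
  assert (Ms : 0 <= M (pmul (pC kap) (pmul pX (pmul pX (newt kap k))))).
  { assert (E : pmul (pC kap) (pmul (pC kap) (pmul pX (pmul pX (newt kap k)))) = 
       padd (pC 1) (pmul (pC (-1)) (padd (pmul (pC (-1)) (padd (newt kap k) (pC (-1)))) (pmul (pt kap) (newt kap k))))).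
    { rewrite <- newt_tau. unfold pY. now rewrite pC_mul, !pmulA. }
    assert (E' : kap * M (pmul (pC kap) (pmul pX (pmul pX (newt kap k)))) =
      M (pC 1) - M (padd (pmul (pC (-1)) (padd (newt kap k) (pC (-1)))) (pmul (pt kap) (newt kap k)))).
    { unfold M. rewrite <- L_C, pmulA, (pmulC (pC kap)), <- pmulA, E, pmul_addr, L_add.
      rewrite (pmulA (pmul w (pmul p p)) (pC (-1))), (pmulC (pmul w (pmul p p)) (pC (-1))), <- (pmulA (pC (-1))), L_C. ring. }
    assert (0 <= M (pC 1)) by (rewrite M1; apply L_gap).
    apply Rabs_le_bounds in HM. nra. }
  assert (N := Lneg (pmul (padd pX (pC e0)) p)).
  assert (N2 : 0 <= L (pmul (pC (kap * kap)) (pmul (padd (pC e0) (pmul (pC (-1)) pX))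
     (pmul (pmul (padd pX (pC e0)) p) (pmul (padd pX (pC e0)) p))))).
  { rewrite L_C. apply Rmult_le_pos; [nra|exact N]. }
  unfold p in N2. rewrite (pproj_gap kap e0 nu k Hgap) in N2. fold p w in N2. rewrite L_C in N2.
  rewrite !pmul_addr, !L_add in N2.
  assert (Y1 : L (pmul w (pmul (pmul (pC kap) (pmul pX (pmul pX (newt kap k)))) (pmul p p))) =
     M (pmul (pC kap) (pmul pX (pmul pX (newt kap k))))).
  { unfold M. rewrite <- (pmulA w (pmul p p)). do 2 f_equal. apply pmulC. }
  assert (Y2 : L (pmul w (pmul (pC e0) (pmul p p))) = e0 * L (pmul w (pmul p p))).
  { rewrite <- L_C. f_equal. rewrite (pmulA w), (pmulA (pC e0)). f_equal. apply pmulC. }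
  rewrite Y1, Y2 in N2.
  assert (Y3 : Rabs (L (pmul w (pmul (pmul pX (perr kap (newt kap k))) p))) <= K * ((2 * nu) * (Kx * nu ^ (k + 1) * (1 + kap * (Kx * 2))))).
  { apply LB. apply b_mul; auto. apply b_mul; auto. apply b_mul; auto using bnd_perr. }
  apply Rabs_le_bounds in Y3.
  apply Rmult_le_reg_l with e0; auto.
  replace (e0 * (K * (2 * nu * (Kx * (1 + kap * (Kx * 2)))) / e0 * nu ^ (k + 1))) with
    (K * (2 * nu * (Kx * nu ^ (k + 1) * (1 + kap * (Kx * 2))))) by (field; lra).
  lra.
Qed.

(** With s for the approximate sign, p^2 = 2 - err + 2 s, and positivity of L ((1 - s)^2) bounds 2 L
    s by L 1 + L (s^2). *)
Lemma pproj_bound k : 0 <= L (pmul (pproj kap k) (pproj kap k)) <= 6 * L (pC 1).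
Proof.
  split; [apply Lpos|].
  assert (P1 : 0 <= L (pC 1)) by (rewrite <- (pmul1 (pC 1)); apply Lpos).
  assert (HE : Rabs (L (perr kap (newt kap k))) <= 1 * L (pC 1)).
  { eapply Rle_trans; [apply (L_contract L K bnd L_add L_C Lpos b_C b_mul LB _ (nu ^ (k + 1)))|].
    - apply pow_le; lra.
    - apply bnd_perr.
    - apply Rmult_le_compat_r; auto. rewrite <- (pow1 (k + 1)). apply pow_incr; lra. }
  apply Rabs_le_bounds in HE.
  set (q := pmul (pC kap) (pmul pX (newt kap k))).
  assert (Q := Lpos (padd (pC 1) (pmul (pC (-1)) q))).
  assert (Eq : L (pmul q q) = L (pC 1) - L (perr kap (newt kap k))).
  { unfold q. rewrite pX_newt_sq, L_add, L_C. ring. }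
  rewrite pmul_addl, !pmul_addr, pmul1, !L_add in Q. rewrite pmul1, L_C in Q.
  rewrite (pmulC _ (pC 1)), pmul1, L_C in Q. rewrite <- pmulA, L_C, (pmulC q (pmul (pC (-1)) q)), <- pmulA, L_C in Q.
  rewrite pproj_sq, !L_add, L_C.
  assert (E2 : L (pC 2) = 2 * L (pC 1)). { rewrite <- L_C, pmulC, pmul1. reflexivity. }
  assert (E3 : L (pmul (pC (2 * kap)) (pmul pX (newt kap k))) = 2 * L q).
  { unfold q. rewrite pC_mul, <- pmulA, L_C. reflexivity. }
  rewrite E2, E3. lra.
Qed.
End Moments.

(** * The lattice operator on functions of the generators *)

Definition vec := list (R * gen).
Definition ev (F : gen -> R) (l : vec) : R := Rsum (fun x => fst x * F (snd x)) l.
Definition e1 (g : gen) : vec := [(1, g)].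
Definition vscal (c : R) (l : vec) : vec := map (fun x => (c * fst x, snd x)) l.

Lemma ev_app F l m : ev F (l ++ m) = ev F l + ev F m.
Proof. apply Rsum_app. Qed.
Lemma ev_scal F c l : ev F (vscal c l) = c * ev F l.
Proof. unfold ev, vscal. rewrite Rsum_map, <- Rsum_scal. apply Rsum_ext; intros; simpl; ring. Qed.
Lemma ev_ext F G l : (forall g, F g = G g) -> ev F l = ev G l.
Proof. intros H. apply Rsum_ext; intros; now rewrite H. Qed.
Lemma ev_lin F G c l : ev (fun g => F g + c * G g) l = ev F l + c * ev G l.
Proof. unfold ev. rewrite <- Rsum_scal, <- Rsum_plus. apply Rsum_ext; intros; ring. Qed.
Lemma ev_e1 F g : ev F (e1 g) = F g.
Proof. unfold ev, e1. simpl; ring. Qed.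
Lemma ev_swap (k : gen -> gen -> R) l m :
  ev (fun g => ev (fun g' => k g g') m) l = ev (fun g' => ev (fun g => k g g') l) m.
Proof.
  unfold ev. rewrite (Rsum_ext _ (fun x => Rsum (fun y => fst x * (fst y * k (snd x) (snd y))) m)).
  - rewrite Rsum_swap. apply Rsum_ext; intros y _. rewrite <- Rsum_scal. apply Rsum_ext; intros; ring.
  - intros x _. now rewrite Rsum_scal.
Qed.
Lemma ev_bound F l A : (forall g, Rabs (F g) <= A) -> Rabs (ev F l) <= Rsum (fun x => Rabs (fst x)) l * A.
Proof.
  intros H. unfold ev. eapply Rle_trans; [apply Rsum_abs|]. rewrite <- Rsum_scal_r.
  apply Rsum_le; intros x _. rewrite Rabs_mult. apply Rmult_le_compat_l; auto using Rabs_pos.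
Qed.

(** [-2 h Dg] is the commutator with the Hamiltonian on the span of the generators. *)
Definition Dg (lam : R) (F : gen -> R) : gen -> R := fun g =>
  if fst g then F (false, snd g) - lam * F (false, (snd g - 1)%Z)
  else F (true, snd g) - lam * F (true, (snd g + 1)%Z).

Definition wt (th : R) (z : Z) : R := th ^ (Z.abs_nat z).

Lemma wt_pos th z : 0 < th -> 0 < wt th z.
Proof. intros; unfold wt; now apply pow_lt. Qed.

Lemma wt_step th z z' : 1 <= th -> (Z.abs (z - z') <= 1)%Z -> wt th z <= th * wt th z'.
Proof.
  intros H Hz. unfold wt.
  destruct (Z_lt_le_dec (Z.abs z') (Z.abs z)).
  - replace (Z.abs_nat z) with (S (Z.abs_nat z')) by lia. simpl; lra.
  - assert (P : th ^ Z.abs_nat z <= th ^ Z.abs_nat z') by (apply Rle_pow; auto; lia).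
    assert (0 < th ^ Z.abs_nat z') by (apply pow_lt; lra). nra.
Qed.

Section Fields.
Variable lam : R.
Notation D := (Dg lam).
Notation ac := (act gen D).

Lemma Dg_lin (c : R) (f g : gen -> R) x : D (fun y => f y + c * g y) x = D f x + c * D g x.
Proof. unfold Dg. destruct (fst x); ring. Qed.

Lemma ac_C c F x : ac (pC c) F x = c * F x. Proof. apply act_C, Dg_lin. Qed.
Lemma ac_add p q F x : ac (padd p q) F x = ac p F x + ac q F x. Proof. apply act_add, Dg_lin. Qed.
Lemma ac_mul p q F x : ac (pmul p q) F x = ac p (ac q F) x. Proof. apply act_mul, Dg_lin. Qed.
Lemma ac_X F x : ac pX F x = D F x.
Proof.
  rewrite <- (pmul1 pX), act_mulX by apply Dg_lin.
  f_equal. extensionality y. rewrite ac_C; ring.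
Qed.
Lemma ac_linear q c f g x : ac q (fun y => f y + c * g y) x = ac q f x + c * ac q g x.
Proof. apply act_lin, Dg_lin. Qed.

Lemma ac_t F x : ac (pt (/ sqrt (1 + lam * lam))) F x =
  lam / (1 + lam * lam) * (F (fst x, (snd x - 1)%Z) + F (fst x, (snd x + 1)%Z)).
Proof.
  assert (P : 0 < 1 + lam * lam) by nra.
  assert (E : / sqrt (1 + lam * lam) * / sqrt (1 + lam * lam) = / (1 + lam * lam)).
  { rewrite <- Rinv_mult, sqrt_sqrt by lra. reflexivity. }
  unfold pt, pY. repeat rewrite ?ac_add, ?ac_mul, ?ac_C, ?ac_X.
  replace (ac pX F) with (D F) by (extensionality y; now rewrite ac_X).
  rewrite E. destruct x as [[] j]; unfold Dg; cbn [fst snd];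
  rewrite ?Z.sub_add, ?Z.add_simpl_r; field; lra.
Qed.

(** A polynomial in D reads only finitely many values of a function, so its action can be exchanged
    with other finite sums without any question of convergence. *)
Lemma ac_rep q x : exists l, forall F, ac q F x = ev F l.
Proof.
  revert x. apply (pol_rect_alg (fun q => forall x, exists l, forall F, ac q F x = ev F l)).
  - intros c x. exists (vscal c (e1 x)). intros F. rewrite ev_scal, ev_e1, ac_C. reflexivity.
  - intros [[] j].
    + exists (e1 (false, j) ++ vscal (- lam) (e1 (false, (j - 1)%Z))). intros F.
      rewrite ev_app, ev_scal, !ev_e1, ac_X. unfold Dg; simpl; ring.
    + exists (e1 (true, j) ++ vscal (- lam) (e1 (true, (j + 1)%Z))). intros F.
      rewrite ev_app, ev_scal, !ev_e1, ac_X. unfold Dg; simpl; ring.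
  - intros p r Hp Hr x. destruct (Hp x) as [l Hl], (Hr x) as [m Hm].
    exists (l ++ m). intros F. now rewrite ac_add, ev_app, Hl, Hm.
  - intros p r Hp Hr x. destruct (Hp x) as [l Hl].
    assert (H : exists m, forall F, ev (ac r F) l = ev F m).
    { clear Hl. induction l as [|[c g] l [m Hm]].
      - exists []; reflexivity.
      - destruct (Hr g) as [m' Hm']. exists (vscal c m' ++ m). intros F.
        rewrite ev_app, ev_scal, <- Hm, <- Hm'. reflexivity. }
    destruct H as [m Hm]. exists m. intros F. now rewrite ac_mul, Hl.
Qed.

Lemma qv_ex q l : exists m, forall F, ev F m = ev (ac q F) l.
Proof.
  induction l as [|[c g] l [m Hm]].
  - exists []; reflexivity.
  - destruct (ac_rep q g) as [m' Hm']. exists (vscal c m' ++ m). intros F.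
    rewrite ev_app, ev_scal, Hm, <- Hm'. reflexivity.
Qed.

Lemma ac_exchange p q (k : gen -> gen -> R) x y :
  ac p (fun u => ac q (k u) y) x = ac q (fun v => ac p (fun u => k u v) x) y.
Proof.
  destruct (ac_rep p x) as [l Hl], (ac_rep q y) as [m Hm].
  rewrite Hl, Hm. rewrite (ev_ext _ (fun u => ev (k u) m)) by (intros; apply Hm).
  rewrite (ev_ext (fun v => ac p _ x) (fun v => ev (fun u => k u v) l)) by (intros; apply Hl).
  apply ev_swap.
Qed.

Lemma ac_commute p q F x : ac p (ac q F) x = ac q (ac p F) x.
Proof. rewrite <- !ac_mul, pmulC. reflexivity. Qed.

(** An operator norm on functions growing at most like th^|x - x0|, uniform in the centre: th = 1 is
    the supremum norm, th = 2 yields exponential localisation of kernels. *)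
Definition bnd (th : R) (q : pol) (B : R) : Prop := 0 <= B /\
  forall x0 F A, (forall g, Rabs (F g) <= A * wt th (snd g - x0)) ->
  forall g, Rabs (ac q F g) <= B * (A * wt th (snd g - x0)).

Section Bounds.
Variable th : R.
Hypothesis Hth : 1 <= th.

Lemma bnd_nonneg F A x0 : (forall g : gen, Rabs (F g) <= A * wt th (snd g - x0)) -> 0 <= A.
Proof.
  intros H. assert (P := wt_pos th (0 - x0) ltac:(lra)).
  specialize (H (true, 0%Z)). simpl snd in H. assert (Q := Rabs_pos (F (true, 0%Z))). nra.
Qed.

Lemma bnd_C c : bnd th (pC c) (Rabs c).
Proof.
  split; [apply Rabs_pos|]. intros x0 F A H g. rewrite ac_C, Rabs_mult.
  apply Rmult_le_compat_l; auto using Rabs_pos.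
Qed.
Lemma bnd_add p q A B : bnd th p A -> bnd th q B -> bnd th (padd p q) (A + B).
Proof.
  intros [HA Hp] [HB Hq]. split; [lra|]. intros x0 F K H g. rewrite ac_add.
  eapply Rle_trans; [apply Rabs_triang|]. specialize (Hp x0 F K H g); specialize (Hq x0 F K H g). lra.
Qed.
Lemma bnd_mul p q A B : bnd th p A -> bnd th q B -> bnd th (pmul p q) (A * B).
Proof.
  intros [HA Hp] [HB Hq]. split; [nra|]. intros x0 F K H g. rewrite ac_mul.
  rewrite Rmult_assoc, <- (Rmult_assoc B). apply Hp. intros u. rewrite Rmult_assoc. now apply Hq.
Qed.
Lemma bnd_mono q A B : bnd th q A -> A <= B -> bnd th q B.
Proof.
  intros [HA Hq] HB. split; [lra|]. intros x0 F K H g. eapply Rle_trans; [now apply (Hq x0 F K)|].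
  apply Rmult_le_compat_r; auto.
  apply Rmult_le_pos; [now apply (bnd_nonneg F K x0)|]. left; apply wt_pos; lra.
Qed.
Lemma bnd_X : bnd th pX (1 + Rabs lam * th).
Proof.
  split; [assert (0 <= Rabs lam) by apply Rabs_pos; nra|]. intros x0 F A H g. rewrite ac_X.
  assert (PA := bnd_nonneg F A x0 H).
  assert (L := Rabs_pos lam).
  assert (G : forall b j j', (Z.abs (j - j') <= 1)%Z -> Rabs (F (b, j')) <= A * (th * wt th (j - x0))).
  { intros b j j' Hj. eapply Rle_trans; [apply H|]. simpl snd. apply Rmult_le_compat_l; auto.
    apply wt_step; auto; lia. }
  unfold Dg. destruct g as [[] j]; cbn [fst snd].
  - assert (H1 := H (false, j)). assert (H2 := G false j (j - 1)%Z ltac:(lia)). cbn [snd] in H1.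
    unfold Rminus; eapply Rle_trans; [apply Rabs_triang|]. rewrite Rabs_Ropp, Rabs_mult.
    assert (Rabs lam * Rabs (F (false, (j - 1)%Z)) <= Rabs lam * (A * (th * wt th (j - x0)))) by (now apply Rmult_le_compat_l).
    unfold Rminus in *. lra.
  - assert (H1 := H (true, j)). assert (H2 := G true j (j + 1)%Z ltac:(lia)). cbn [snd] in H1.
    unfold Rminus; eapply Rle_trans; [apply Rabs_triang|]. rewrite Rabs_Ropp, Rabs_mult.
    assert (Rabs lam * Rabs (F (true, (j + 1)%Z)) <= Rabs lam * (A * (th * wt th (j - x0)))) by (now apply Rmult_le_compat_l).
    lra.
Qed.
Lemma bnd_t : bnd th (pt (/ sqrt (1 + lam * lam))) (th * (2 * Rabs lam / (1 + lam * lam))).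
Proof.
  assert (P : 0 < 1 + lam * lam) by nra.
  assert (Q : 0 < / (1 + lam * lam)) by (now apply Rinv_0_lt_compat).
  assert (L := Rabs_pos lam).
  split; [unfold Rdiv; apply Rmult_le_pos; [lra|apply Rmult_le_pos; lra]|].
  intros x0 F A H g. rewrite ac_t.
  assert (PA := bnd_nonneg F A x0 H).
  assert (G : forall b j j', (Z.abs (j - j') <= 1)%Z -> Rabs (F (b, j')) <= A * (th * wt th (j - x0))).
  { intros b j j' Hj. eapply Rle_trans; [apply H|]. simpl snd. apply Rmult_le_compat_l; auto.
    apply wt_step; auto; lia. }
  destruct g as [b j]; cbn [fst snd].
  assert (H1 := G b j (j - 1)%Z ltac:(lia)). assert (H2 := G b j (j + 1)%Z ltac:(lia)).
  rewrite Rabs_mult. unfold Rdiv. rewrite Rabs_mult, (Rabs_right (/ _)) by lra.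
  assert (T := Rabs_triang (F (b, (j - 1)%Z)) (F (b, (j + 1)%Z))).
  assert (0 <= Rabs lam * / (1 + lam * lam)) by (apply Rmult_le_pos; lra).
  apply Rle_trans with (Rabs lam * / (1 + lam * lam) * (A * (th * wt th (j - x0)) + A * (th * wt th (j - x0)))).
  - apply Rmult_le_compat_l; auto. lra.
  - right; ring.
Qed.
Lemma bnd_ex q : exists B, 0 <= B /\ bnd th q B.
Proof.
  apply (pol_rect_alg (fun q => exists B, 0 <= B /\ bnd th q B)).
  - intros c. exists (Rabs c). split; [apply Rabs_pos|apply bnd_C].
  - eexists. split; [|apply bnd_X]. assert (0 <= Rabs lam) by apply Rabs_pos; nra.
  - intros p r [A [HA Hp]] [B [HB Hr]]. exists (A + B). split; [lra|now apply bnd_add].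
  - intros p r [A [HA Hp]] [B [HB Hr]]. exists (A * B). split; [nra|now apply bnd_mul].
Qed.
End Bounds.

Lemma wt1 z : wt 1 z = 1.
Proof. unfold wt. apply pow1. Qed.

Section Form.
Variable c : gen -> gen -> R.
Hypothesis c_comm : forall g g', D (fun u => c u g') g = D (c g) g'.
Hypothesis c_bd : forall g g', Rabs (c g g') <= 1.

Definition Cf (l m : vec) : R := ev (fun g => ev (c g) m) l.
Definition Lf (l m : vec) (q : pol) : R := ev (fun g => ev (ac q (c g)) m) l.

Lemma ac_comm q g g' : ac q (fun u => c u g') g = ac q (c g) g'.
Proof.
  revert g g'. apply (pol_rect_alg (fun q => forall g g', ac q (fun u => c u g') g = ac q (c g) g')).
  - intros; now rewrite !ac_C.
  - intros; rewrite !ac_X. apply c_comm.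
  - intros p r Hp Hr g g'. now rewrite !ac_add, Hp, Hr.
  - intros p r Hp Hr g g'. rewrite !ac_mul.
    replace (ac r (fun u => c u g')) with (fun u => ac r (c u) g') by (extensionality u; symmetry; apply Hr).
    rewrite ac_exchange.
    replace (fun v => ac p (fun u => c u v) g) with (ac p (c g)) by (extensionality v; symmetry; apply Hp).
    apply ac_commute.
Qed.

(** As the form commutes with D, one factor can be moved to the other argument. Hence [Lf l l (q q)]
    is a value of the quadratic form of [c], which is where positivity comes from. *)
Lemma Lf_mul p q l m l' m' : (forall F, ev F l' = ev (ac p F) l) -> (forall F, ev F m' = ev (ac q F) m) ->
  Lf l m (pmul p q) = Cf l' m'.
Proof.
  intros Hl Hm. unfold Cf, Lf. rewrite Hl.
  symmetry. transitivity (ev (fun g => ac p (fun u => ev (ac q (c u)) m) g) l).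
  - apply ev_ext; intros g. f_equal. extensionality u. apply Hm.
  - apply ev_ext; intros g.
    destruct (ac_rep p g) as [k Hk]. rewrite Hk, ev_swap.
    apply ev_ext; intros v. rewrite <- Hk, ac_mul.
    rewrite (ac_exchange p q c g v). 
    replace (fun v0 => ac p (fun u => c u v0) g) with (ac p (c g)) by (extensionality w; symmetry; apply ac_comm).
    apply ac_commute.
Qed.

Lemma Lf_add l m p q : Lf l m (padd p q) = Lf l m p + Lf l m q.
Proof.
  unfold Lf. rewrite <- (Rmult_1_l (ev (fun g => ev (ac q (c g)) m) l)), <- ev_lin.
  apply ev_ext; intros g. rewrite <- ev_lin. apply ev_ext; intros u. rewrite ac_add; ring.
Qed.
Lemma Lf_C l m r q : Lf l m (pmul (pC r) q) = r * Lf l m q.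
Proof.
  unfold Lf. transitivity (0 + r * ev (fun g => ev (ac q (c g)) m) l); [|ring].
  replace 0 with (ev (fun _ => 0) l) at 1 by (unfold ev; apply Rsum_zero; intros; ring).
  rewrite <- ev_lin. apply ev_ext; intros g. 
  transitivity (ev (fun u => 0 + r * ac q (c g) u) m).
  - apply ev_ext; intros u. rewrite ac_mul, ac_C; ring.
  - rewrite ev_lin. f_equal. unfold ev; apply Rsum_zero; intros; ring.
Qed.
Lemma Lf_bound l m q B : bnd 1 q B ->
  Rabs (Lf l m q) <= Rsum (fun x => Rabs (fst x)) l * Rsum (fun x => Rabs (fst x)) m * B.
Proof.
  intros [HB H]. unfold Lf. rewrite Rmult_assoc. apply ev_bound. intros g. apply ev_bound. intros u.
  replace B with (B * (1 * wt 1 (snd u - 0))) by (rewrite wt1; ring).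
  apply (H 0%Z (c g) 1). intros v; rewrite wt1, Rmult_1_r. apply c_bd.
Qed.
End Form.
End Fields.

Definition kapf (lam : R) : R := / sqrt (1 + lam * lam).
Definition nuf (lam : R) : R := 2 * Rabs lam / (1 + lam * lam).

Lemma kapf_pos lam : 0 < kapf lam.
Proof. unfold kapf. apply Rinv_0_lt_compat, sqrt_lt_R0. nra. Qed.
Lemma kapf_sq lam : kapf lam * kapf lam = / (1 + lam * lam).
Proof. unfold kapf. rewrite <- Rinv_mult, sqrt_sqrt by nra. reflexivity. Qed.
Lemma nuf_bound lam : Rabs lam < 1 / 100 -> 0 <= nuf lam <= 2 * Rabs lam.
Proof.
  intros H. assert (L := Rabs_pos lam). assert (P : 0 < 1 + lam * lam) by nra. unfold nuf, Rdiv.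
  assert (0 < / (1 + lam * lam)) by (now apply Rinv_0_lt_compat).
  assert (/ (1 + lam * lam) <= 1) by (rewrite <- Rinv_1; apply Rinv_le_contravar; nra).
  split; [apply Rmult_le_pos; lra|]. nra.
Qed.
Lemma Rabs_sq x : Rabs x * Rabs x = x * x.
Proof. rewrite <- Rabs_mult, Rabs_right; auto. apply Rle_ge; nra. Qed.
(** The smallest value of |D| is 1 - |lam|, because D^2 is 1 + lam^2 minus lam times the sum of the
    two shifts. *)
Lemma gapf lam : kapf lam * kapf lam * ((1 - Rabs lam) * (1 - Rabs lam)) = 1 - nuf lam.
Proof.
  rewrite kapf_sq. unfold nuf.
  replace ((1 - Rabs lam) * (1 - Rabs lam)) with (1 - 2 * Rabs lam + Rabs lam * Rabs lam) by ring.
  rewrite Rabs_sq. field. nra.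
Qed.

Lemma ulim_pow nu : 0 <= nu < 1 -> ulim (fun k => nu ^ (k + 1)) 0.
Proof.
  intros H. apply ulim_Un_cv. intros eps He.
  destruct (pow_lt_1_zero nu ltac:(rewrite Rabs_right; lra) eps He) as [N HN].
  exists N. intros n Hn. unfold R_dist. rewrite Rminus_0_r. apply HN. lia.
Qed.

(** Vanishing second differences make [f] affine, and a bounded affine function is constant. *)
Lemma harmonic_const (f : Z -> R) B : (forall j, Rabs (f j) <= B) ->
  (forall j, 2 * f j = f (j - 1)%Z + f (j + 1)%Z) -> forall j, f j = f 0%Z.
Proof.
  intros HB H.
  assert (St : forall j, f (j + 1)%Z - f j = f (j - 1 + 1)%Z - f (j - 1)%Z).
  { intros j. rewrite Z.sub_add. assert (E := H j). lra. }
  assert (Sp : forall n : nat, f (Z.of_nat n + 1)%Z - f (Z.of_nat n) = f 1%Z - f 0%Z).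
  { induction n as [|n IH]; [reflexivity|]. rewrite St. replace (Z.of_nat (S n) - 1)%Z with (Z.of_nat n) by lia. auto. }
  assert (Sm : forall n : nat, f (- Z.of_nat n + 1)%Z - f (- Z.of_nat n)%Z = f 1%Z - f 0%Z).
  { induction n as [|n IH]; [reflexivity|]. rewrite <- IH, (St (- Z.of_nat n)%Z).
    replace (- Z.of_nat n - 1)%Z with (- Z.of_nat (S n))%Z by lia. reflexivity. }
  assert (Ap : forall n : nat, f (Z.of_nat n) = f 0%Z + INR n * (f 1%Z - f 0%Z)).
  { induction n as [|n IH]; [simpl; ring|]. specialize (Sp n). rewrite S_INR.
    replace (Z.of_nat (S n)) with (Z.of_nat n + 1)%Z by lia. lra. }
  assert (Am : forall n : nat, f (- Z.of_nat n)%Z = f 0%Z - INR n * (f 1%Z - f 0%Z)).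
  { induction n as [|n IH]; [simpl; ring|]. specialize (Sm (S n)). rewrite S_INR.
    replace (- Z.of_nat (S n) + 1)%Z with (- Z.of_nat n)%Z in Sm by lia. lra. }
  assert (D0 : f 1%Z - f 0%Z = 0).
  { destruct (Req_dec (f 1%Z - f 0%Z) 0) as [|N]; auto. exfalso.
    assert (P : 0 < Rabs (f 1%Z - f 0%Z)) by (now apply Rabs_pos_lt).
    destruct (archimed_cor1 (Rabs (f 1%Z - f 0%Z) / (2 * Rabs B + 1))) as [n [Hn Hn0]].
    { apply Rdiv_lt_0_compat; auto. assert (0 <= Rabs B) by apply Rabs_pos; lra. }
    assert (In : 0 < INR n) by (apply lt_0_INR; lia).
    assert (Q : INR n * Rabs (f 1%Z - f 0%Z) <= 2 * Rabs B).
    { replace (INR n * Rabs (f 1%Z - f 0%Z)) with (Rabs (f (Z.of_nat n) - f 0%Z)).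
      - unfold Rminus. eapply Rle_trans; [apply Rabs_triang|]. rewrite Rabs_Ropp.
        assert (B <= Rabs B) by apply Rle_abs. assert (H1 := HB (Z.of_nat n)). assert (H2 := HB 0%Z). lra.
      - rewrite Ap. replace (f 0%Z + INR n * (f 1%Z - f 0%Z) - f 0%Z) with (INR n * (f 1%Z - f 0%Z)) by ring.
        rewrite Rabs_mult, (Rabs_right (INR n)) by lra. reflexivity. }
    assert (0 <= Rabs B) by apply Rabs_pos.
    assert (Hm : 1 < INR n * (Rabs (f 1%Z - f 0%Z) / (2 * Rabs B + 1))).
    { apply Rmult_lt_compat_l with (r := INR n) in Hn; auto. rewrite Rinv_r in Hn by lra. lra. }
    assert (INR n * (Rabs (f 1%Z - f 0%Z) / (2 * Rabs B + 1)) * (2 * Rabs B + 1) = INR n * Rabs (f 1%Z - f 0%Z)) by (field; lra).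
    nra. }
  intros j. destruct (Z_le_gt_dec 0 j).
  - rewrite <- (Z2Nat.id j) by auto. rewrite Ap, D0; ring.
  - replace j with (- Z.of_nat (Z.to_nat (- j)))%Z by lia. rewrite Am, D0; ring.
Qed.

(** * The positive half of the spectrum carries no mass *)

Section Annihilation.
Variables (lam : R) (c : gen -> gen -> R).
Hypothesis Hlam : 0 < Rabs lam < 1 / 100.
Notation D := (Dg lam).
Notation ac := (act gen D).
Hypothesis c_comm : forall g g', D (fun u => c u g') g = D (c g) g'.
Hypothesis c_bd : forall g g', Rabs (c g g') <= 1.
Hypothesis c_sym : forall g g', c g g' = c g' g.
Hypothesis c_aa : forall i j, c (true, i) (true, j) = if Z.eq_dec i j then 1 else 0.
Hypothesis c_pos : forall l, 0 <= Cf c l l.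
Hypothesis c_neg : forall l, 0 <= (1 - Rabs lam) * Cf c l l - ev (fun g => ev (D (c g)) l) l.

Notation L l := (Lf lam c l l).
Notation p := (pproj (kapf lam)).
Let w := padd (pC (nuf lam)) (pmul (pC (-1)) (pt (kapf lam))).

Lemma L_pos l q : 0 <= L l (pmul q q).
Proof.
  destruct (qv_ex lam q l) as [m Hm].
  rewrite (Lf_mul lam c c_comm q q l l m m Hm Hm). apply c_pos.
Qed.

Lemma L_neg l q : 0 <= L l (pmul (padd (pC (1 - Rabs lam)) (pmul (pC (-1)) pX)) (pmul q q)).
Proof.
  destruct (qv_ex lam q l) as [m Hm]. destruct (qv_ex lam (pmul pX q) l) as [m' Hm'].
  rewrite pmul_addl, Lf_add, Lf_C, <- pmulA, Lf_C.
  rewrite (Lf_mul lam c c_comm q q l l m m Hm Hm).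
  rewrite pmulA, (pmulC pX q), <- pmulA.
  rewrite (Lf_mul lam c c_comm q (pmul pX q) l l m m' Hm Hm').
  assert (E : Cf c m m' = ev (fun g => ev (D (c g)) m) m).
  { unfold Cf. apply ev_ext; intros g. rewrite Hm', Hm. apply ev_ext; intros u.
    rewrite pmulC, ac_mul. f_equal. extensionality v. apply ac_X. }
  rewrite E. assert (H := c_neg m). lra.
Qed.

Lemma bnd1_t : bnd lam 1 (pt (kapf lam)) (nuf lam).
Proof. rewrite <- (Rmult_1_l (nuf lam)). apply bnd_t; lra. Qed.

Lemma nu_small : 0 <= nuf lam <= 1 / 8.
Proof. destruct (nuf_bound lam); lra. Qed.

Definition vn (l : vec) : R := Rsum (fun x => Rabs (fst x)) l.

Lemma L_gap_decay l : exists K2, forall k, 0 <= L l (pmul w (pmul (p k) (p k))) <= K2 * nuf lam ^ (k + 1).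
Proof.
  apply (gap_decay (L l) (vn l * vn l) (bnd lam 1) (kapf lam) (nuf lam) (1 - Rabs lam) (1 + Rabs lam * 1)).
  - apply Lf_add.
  - intros; apply Lf_C.
  - apply L_pos.
  - apply L_neg.
  - intros; apply bnd_C.
  - apply bnd_X; lra.
  - apply bnd1_t.
  - intros; now apply bnd_add.
  - intros; now apply bnd_mul.
  - intros q A B H1 H2. apply (bnd_mono lam 1 ltac:(lra) q A B); auto.
  - intros; now apply Lf_bound.
  - intros; apply bnd_ex; lra.
  - apply nu_small.
  - apply kapf_pos.
  - lra.
  - apply gapf.
Qed.

Lemma L_proj_bound l k : 0 <= L l (pmul (p k) (p k)) <= 6 * L l (pC 1).
Proof.
  apply (pproj_bound (L l) (vn l * vn l) (bnd lam 1) (kapf lam) (nuf lam)).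
  - apply Lf_add.
  - intros; apply Lf_C.
  - apply L_pos.
  - intros; apply bnd_C.
  - apply bnd1_t.
  - intros; now apply bnd_add.
  - intros; now apply bnd_mul.
  - intros q A B H1 H2. apply (bnd_mono lam 1 ltac:(lra) q A B); auto.
  - intros; now apply Lf_bound.
  - apply nu_small.
Qed.

Let F k i j : R := ac (pmul (p k) (p k)) (c (true, i)) (true, j).

Lemma F_L k i j : Lf lam c (e1 (true, i)) (e1 (true, j)) (pmul (p k) (p k)) = F k i j.
Proof. unfold Lf. now rewrite !ev_e1. Qed.

Lemma L_app l m q : L (l ++ m) q = L l q + Lf lam c l m q + Lf lam c m l q + L m q.
Proof.
  unfold Lf. rewrite ev_app.
  rewrite !(ev_ext (fun g => ev (ac q (c g)) (l ++ m)) (fun g => ev (ac q (c g)) l + 1 * ev (ac q (c g)) m)) by (intros; rewrite ev_app; ring).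
  rewrite !ev_lin. ring.
Qed.

Lemma Lf_sym l m q : Lf lam c l m q = Lf lam c m l q.
Proof.
  unfold Lf. rewrite ev_swap. apply ev_ext; intros g'. apply ev_ext; intros g.
  rewrite <- (ac_comm lam c c_comm q g g'). f_equal. extensionality u. apply c_sym.
Qed.

Lemma L_scal r l m q : Lf lam c (vscal r l) m q = r * Lf lam c l m q.
Proof. unfold Lf. apply ev_scal. Qed.

Lemma F_diag k i : 0 <= F k i i <= 6.
Proof.
  rewrite <- F_L. assert (H := L_proj_bound (e1 (true, i)) k).
  assert (E : L (e1 (true, i)) (pC 1) = 1).
  { unfold Lf. rewrite !ev_e1, ac_C, c_aa. destruct (Z.eq_dec i i); [ring|congruence]. }
  lra.
Qed.

Lemma F_bound k i j : Rabs (F k i j) <= 6.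
Proof.
  assert (H1 := L_pos (e1 (true, i) ++ e1 (true, j)) (p k)).
  assert (H2 := L_pos (e1 (true, i) ++ vscal (-1) (e1 (true, j))) (p k)).
  rewrite L_app in H1, H2. rewrite (Lf_sym (e1 (true, j))) in H1.
  rewrite (Lf_sym (vscal _ _) (e1 _)) in H2.
  rewrite !(Lf_sym (e1 (true, i)) (vscal _ _)), (L_scal (-1) _ (vscal _ _)), (Lf_sym _ (vscal _ (e1 (true, j)))), !L_scal in H2.
  rewrite (Lf_sym (e1 (true, j)) (e1 (true, i))) in H2.
  rewrite !F_L in H1, H2. assert (Hi := F_diag k i). assert (Hj := F_diag k j).
  apply Rabs_le; lra.
Qed.

Lemma gap_expand k i j : ac (pmul w (pmul (p k) (p k))) (c (true, i)) (true, j) =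
  nuf lam * F k i j - lam / (1 + lam * lam) * (F k i (j - 1)%Z + F k i (j + 1)%Z).
Proof.
  rewrite ac_mul. unfold w at 1. rewrite ac_add, ac_C, (ac_mul lam (pC (-1))), ac_C. change (pt (kapf lam)) with (pt (/ sqrt (1 + lam * lam))). rewrite ac_t.
  cbn [fst snd]. fold (F k i j) (F k i (j - 1)%Z) (F k i (j + 1)%Z). ring.
Qed.

(** Polarisation of [L_gap_decay], rewritten by [gap_expand] as a recursion in the second site. *)
Lemma gap_lim i j : ulim (fun k => nuf lam * F k i j - lam / (1 + lam * lam) * (F k i (j - 1)%Z + F k i (j + 1)%Z)) 0.
Proof.
  assert (Z : forall l, ulim (fun k => L l (pmul w (pmul (p k) (p k)))) 0).
  { intros l. destruct (L_gap_decay l) as [K2 HK].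
    apply ulim_squeeze0 with (y := fun k => K2 * nuf lam ^ (k + 1)).
    - replace 0 with (K2 * 0) by ring. apply ulim_scal, ulim_pow. assert (H := nu_small); lra.
    - apply ultra_all; intros k. rewrite Rabs_right; [apply HK|apply Rle_ge, HK]. }
  assert (H : ulim (fun k => / 2 * (L (e1 (true, i) ++ e1 (true, j)) (pmul w (pmul (p k) (p k)))
     - L (e1 (true, i)) (pmul w (pmul (p k) (p k))) - L (e1 (true, j)) (pmul w (pmul (p k) (p k))))) 0).
  { replace 0 with (/ 2 * (0 - 0 - 0)) by ring. apply ulim_scal. apply ulim_minus; auto. apply ulim_minus; auto. }
  eapply ulim_ext; [|exact H]. apply ultra_all; intros k. cbn beta.
  rewrite L_app, (Lf_sym (e1 (true, j))).
  rewrite <- gap_expand. unfold Lf. rewrite !ev_e1. field.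
Qed.

(** The edge wave of |D| is constant for positive [lam] and alternates for negative [lam];
    multiplication by [sz] reduces the second case to harmonic functions. *)
Let sig : R := if Rle_dec 0 lam then 1 else -1.
Let sz (j : Z) : R := if Z.even j then 1 else sig.

Lemma sig_sq : sig * sig = 1.
Proof. unfold sig; destruct Rle_dec; ring. Qed.
Lemma sig_lam : lam = sig * Rabs lam.
Proof. unfold sig; destruct Rle_dec; [rewrite Rabs_right; lra|rewrite Rabs_left; lra]. Qed.
Lemma sz_succ j : sz (j + 1) = sig * sz j.
Proof.
  unfold sz. rewrite Z.add_1_r, Z.even_succ, <- Z.negb_even. destruct (Z.even j); simpl; [ring|].
  now rewrite sig_sq.
Qed.
Lemma sz_pred j : sz (j - 1) = sig * sz j.
Proof. rewrite <- (Z.sub_add 1 j) at 2. rewrite sz_succ, <- Rmult_assoc, sig_sq; ring. Qed.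
Lemma sz_sq j : sz j * sz j = 1.
Proof. unfold sz; destruct Z.even; [ring|apply sig_sq]. Qed.
Lemma sz_abs j : Rabs (sz j) = 1.
Proof. unfold sz, sig. destruct Z.even; [apply Rabs_R1|]. destruct Rle_dec; [apply Rabs_R1|]. rewrite Rabs_left; lra. Qed.

Let Fi i j : R := LIM (fun k => F k i j).

Lemma Fi_lim i j : ulim (fun k => F k i j) (Fi i j).
Proof. apply ulim_LIM. exists 6. apply ultra_all; intros; apply F_bound. Qed.

Lemma Fi_sym i j : Fi i j = Fi j i.
Proof. unfold Fi. f_equal. extensionality k. rewrite <- !F_L. apply Lf_sym. Qed.

Lemma Fi_row i j : Fi i j = sz j * (sz 0 * Fi i 0).
Proof.
  assert (H : sz j * Fi i j = sz 0 * Fi i 0).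
  { apply (harmonic_const (fun j => sz j * Fi i j) 6).
    - intros j'. rewrite Rabs_mult, sz_abs, Rmult_1_l.
      assert (U := Fi_lim i j'). 
      assert (ulim (fun k => F k i j') (Fi i j')) by auto.
      apply Rabs_le. split.
      + apply (ulim_le (fun _ => - (6)) (fun k => F k i j')); auto using ulim_const.
        apply ultra_all; intros k. assert (B := F_bound k i j'). apply Rabs_le_bounds in B; lra.
      + apply (ulim_le (fun k => F k i j') (fun _ => 6)); auto using ulim_const.
        apply ultra_all; intros k. assert (B := F_bound k i j'). apply Rabs_le_bounds in B; lra.
    - intros j'. 
      assert (G := gap_lim i j').
      assert (G' := ulim_minus _ _ _ _ (ulim_scal (nuf lam) _ _ (Fi_lim i j'))
        (ulim_scal (lam / (1 + lam * lam)) _ _ (ulim_plus _ _ _ _ (Fi_lim i (j' - 1)%Z) (Fi_lim i (j' + 1)%Z)))).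
      assert (E := ulim_unique _ _ _ G G').
      assert (P : 0 < Rabs lam / (1 + lam * lam)) by (apply Rdiv_lt_0_compat; [lra|nra]).
      assert (E2 : 2 * Fi i j' = sig * (Fi i (j' - 1)%Z + Fi i (j' + 1)%Z)).
      { apply Rmult_eq_reg_l with (Rabs lam / (1 + lam * lam)); [|lra].
        rewrite sig_lam in E at 2. unfold nuf in E.
        unfold Rdiv in *. nra. }
      rewrite sz_pred, sz_succ.
      replace (2 * (sz j' * Fi i j')) with (sz j' * (2 * Fi i j')) by ring. rewrite E2. ring. }
  rewrite <- H, <- Rmult_assoc, sz_sq; ring.
Qed.

Lemma Fi_eq i j : Fi i j = sz i * sz j * Fi 0 0.
Proof.
  rewrite Fi_row, Fi_sym, Fi_row. replace (sz j * (sz 0 * (sz i * (sz 0 * Fi 0 0)))) with (sz j * sz i * (sz 0 * sz 0) * Fi 0 0) by ring.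
  rewrite sz_sq; ring.
Qed.

(** Tested on the edge wave of length n, whose norm squared is n, the limiting form has the value
    n^2 Fi 0 0; by [L_proj_bound] this is at most 6 n for every n. *)
Lemma Fi_zero : Fi 0 0 = 0.
Proof.
  set (g := fun n : nat => map (fun i => (sz (Z.of_nat i), (true, Z.of_nat i))) (seq 0 n) : vec).
  assert (B : forall n k, L (g n) (pmul (p k) (p k)) <= 6 * INR n).
  { intros n k. destruct (L_proj_bound (g n) k) as [_ H].
    replace (INR n) with (L (g n) (pC 1)); [lra|].
    unfold Lf, g, ev. rewrite Rsum_map. simpl.
    transitivity (Rsum (fun _ : nat => 1) (seq 0 n)); [|rewrite Rsum_const, length_seq; ring].
    apply Rsum_ext; intros i Hi. rewrite Rsum_map. simpl.
    rewrite (Rsum_ext _ (fun j => if Nat.eq_dec j i then sz (Z.of_nat j) else 0)).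
    - rewrite Rsum_delta; auto using seq_NoDup. apply sz_sq.
    - intros j _. rewrite ac_C, c_aa. destruct (Z.eq_dec (Z.of_nat i) (Z.of_nat j)), (Nat.eq_dec j i); try lia; ring. }
  assert (E : forall n, INR n * INR n * Fi 0 0 <= 6 * INR n).
  { intros n.
    apply (ulim_le (fun k => L (g n) (pmul (p k) (p k))) (fun _ => 6 * INR n)); auto using ulim_const, ultra_all.
    eapply ulim_ext with (x := fun k => Rsum (fun i => Rsum (fun j => sz (Z.of_nat i) * sz (Z.of_nat j) * F k (Z.of_nat i) (Z.of_nat j)) (seq 0 n)) (seq 0 n)).
    - apply ultra_all; intros k. unfold Lf, g, ev. rewrite Rsum_map. apply Rsum_ext; intros i _. simpl.
      rewrite Rsum_map, <- Rsum_scal. apply Rsum_ext; intros j _. simpl. unfold F; ring.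
    - replace (INR n * INR n * Fi 0 0) with (Rsum (fun _ : nat => Rsum (fun _ : nat => Fi 0 0) (seq 0 n)) (seq 0 n))
        by (rewrite !Rsum_const, length_seq; ring).
      apply (ulim_Rsum (fun k i => Rsum (fun j => sz (Z.of_nat i) * sz (Z.of_nat j) * F k (Z.of_nat i) (Z.of_nat j)) (seq 0 n)) (fun _ => Rsum (fun _ : nat => Fi 0 0) (seq 0 n))).
      intros i _.
      apply (ulim_Rsum (fun k j => sz (Z.of_nat i) * sz (Z.of_nat j) * F k (Z.of_nat i) (Z.of_nat j)) (fun _ => Fi 0 0)).
      intros j _. 
      replace (Fi 0 0) with (sz (Z.of_nat i) * sz (Z.of_nat j) * Fi (Z.of_nat i) (Z.of_nat j)).
      + apply ulim_scal, Fi_lim.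
      + rewrite Fi_eq. 
        replace (sz (Z.of_nat i) * sz (Z.of_nat j) * (sz (Z.of_nat i) * sz (Z.of_nat j) * Fi 0 0)) with
          ((sz (Z.of_nat i) * sz (Z.of_nat i)) * (sz (Z.of_nat j) * sz (Z.of_nat j)) * Fi 0 0) by ring.
        rewrite !sz_sq; ring. }
  assert (P : 0 <= Fi 0 0).
  { apply (ulim_le (fun _ => 0) (fun k => F k 0%Z 0%Z)); auto using ulim_const, Fi_lim.
    apply ultra_all; intros; apply F_diag. }
  destruct (Req_dec (Fi 0 0) 0) as [|N]; auto. exfalso.
  destruct (archimed_cor1 (Fi 0 0 / 7)) as [n [Hn Hn0]]; [lra|].
  specialize (E n). assert (In : 0 < INR n) by (apply lt_0_INR; lia).
  assert (INR n * Fi 0 0 <= 6) by nra.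
  apply Rmult_lt_compat_l with (r := INR n) in Hn; auto. rewrite Rinv_r in Hn by lra. lra.
Qed.

Theorem annihilated j : ulim (fun k => ac (pmul (p k) (p k)) (c (true, j)) (true, j)) 0.
Proof.
  assert (H := Fi_lim j j). rewrite Fi_eq, Fi_zero, Rmult_0_r in H. exact H.
Qed.
End Annihilation.

(** * The sign of the lattice operator *)

Definition del (g g' : gen) : R := if gen_eq_dec g g' then 1 else 0.
Definition sw (g : gen) : gen := (negb (fst g), snd g).

Lemma wt_0 th : wt th 0 = 1.
Proof. reflexivity. Qed.
Lemma wt_neg th z : wt th (- z) = wt th z.
Proof. unfold wt. f_equal. lia. Qed.
Lemma wt_ge1 th z : 1 <= th -> 1 <= wt th z.
Proof. intros; unfold wt. now apply pow_R1_Rle. Qed.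
Lemma wt_tri th x y : 1 <= th -> wt th (x + y) <= wt th x * wt th y.
Proof. intros. unfold wt. rewrite <- pow_add. apply Rle_pow; auto. lia. Qed.

Section Kernel.
Variable lam : R.
Hypothesis Hlam : 0 < Rabs lam < 1 / 100.
Notation D := (Dg lam).
Notation ac := (act gen D).
Notation kap := (kapf lam).

Definition spol (k : nat) : pol := pmul (pC kap) (pmul pX (newt kap k)).
Definition sker (k : nat) (g g' : gen) : R := ac (spol k) (fun u => del u g') g.
Definition Sm (g g' : gen) : R := LIM (fun k => sker k g g').

Lemma ac_sk k F g : ac (spol k) F g = kap * D (ac (newt kap k) F) g.
Proof. unfold spol. rewrite ac_mul, ac_C, ac_mul, ac_X. reflexivity. Qed.

Lemma ac_sum {A} q (f : A -> R) (h : A -> gen -> R) l g :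
  ac q (fun v => Rsum (fun x => f x * h x v) l) g = Rsum (fun x => f x * ac q (h x) g) l.
Proof.
  induction l as [|x l IH].
  - change (ac q (fun _ => 0) g = 0).
    assert (H := ac_linear lam q (-1) (fun _ => 0) (fun _ => 0) g). 
    assert (E : ac q (fun _ => 0 + -1 * 0) g = ac q (fun _ => 0) g) by (f_equal; extensionality y; ring).
    cbn beta in H. rewrite E in H. lra.
  - rewrite Rsum_cons, <- IH.
    replace (fun v => Rsum (fun x => f x * h x v) (x :: l)) with (fun v => Rsum (fun x => f x * h x v) l + f x * h x v)
      by (extensionality v; rewrite Rsum_cons; ring).
    rewrite ac_linear. ring.
Qed.

Lemma del_sum F gl v : NoDup gl -> (forall u, ~ In u gl -> F u = 0) -> Rsum (fun u => F u * del v u) gl = F v.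
Proof.
  intros ND H. destruct (in_dec gen_eq_dec v gl) as [Hi|Hn].
  - rewrite <- (Rsum_delta gen_eq_dec F gl v ND Hi). apply Rsum_ext; intros u _. unfold del.
    destruct (gen_eq_dec v u), (gen_eq_dec u v); try congruence; ring.
  - rewrite H by auto. apply Rsum_zero; intros u Hu. unfold del.
    destruct (gen_eq_dec v u); [subst; contradiction|ring].
Qed.

Lemma ac_fin q gl F g : NoDup gl -> (forall u, ~ In u gl -> F u = 0) ->
  ac q F g = Rsum (fun u => F u * ac q (fun v => del v u) g) gl.
Proof.
  intros ND H. rewrite <- ac_sum. f_equal. extensionality v. symmetry. now apply del_sum.
Qed.

Lemma del_eq b j b' j' : del (b, j) (b', j') = if Bool.eqb b b' && Z.eqb j j' then 1 else 0.
Proof.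
  unfold del. destruct (gen_eq_dec (b, j) (b', j')) as [E|E];
  destruct (Bool.eqb_spec b b'), (Z.eqb_spec j j'); simpl; congruence.
Qed.

Lemma del_comm g g' : D (fun u => del u g') g = D (del g) g'.
Proof.
  unfold Dg. destruct g as [[] j], g' as [[] j']; cbn [fst snd]; rewrite !del_eq; simpl;
  repeat match goal with |- context [Z.eqb ?x ?y] => destruct (Z.eqb_spec x y) end;
  try ring; exfalso; lia.
Qed.

Lemma Skf_sym k g g' : sker k g g' = sker k g' g.
Proof.
  unfold sker. rewrite (ac_comm lam del del_comm).
  f_equal. extensionality u. unfold del. destruct (gen_eq_dec g u), (gen_eq_dec u g); congruence.
Qed.

Lemma Sm_sym g g' : Sm g g' = Sm g' g.
Proof. unfold Sm. f_equal. extensionality k. apply Skf_sym. Qed.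

Lemma kap_bound : 1 - Rabs lam <= kap <= 1.
Proof.
  assert (P := kapf_pos lam). assert (Q := kapf_sq lam).
  assert (L : lam * lam <= Rabs lam) by (rewrite <- Rabs_sq; nra).
  assert (P1 : 0 < 1 + lam * lam) by nra.
  assert (B : / (1 + lam * lam) <= 1) by (rewrite <- Rinv_1; apply Rinv_le_contravar; nra).
  assert (B' : 1 - lam * lam <= / (1 + lam * lam)).
  { apply Rmult_le_reg_r with (1 + lam * lam); auto. rewrite Rinv_l by lra. nra. }
  split; nra.
Qed.

Lemma bnd2_newt k : bnd lam 2 (padd (newt kap k) (pC (-1))) (8 * Rabs lam).
Proof.
  assert (N := nuf_bound lam ltac:(lra)).
  destruct (bnd_newt_sub (bnd lam 2) kap (2 * nuf lam)) with (k := k) as [B _].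
  - intros; apply bnd_C.
  - apply bnd_t; lra.
  - intros; now apply bnd_add.
  - intros; now apply bnd_mul.
  - intros q A B H1 H2. apply (bnd_mono lam 2 ltac:(lra) q A B); auto.
  - lra.
  - eapply bnd_mono; [lra|exact B|]. assert (0 <= (2 * nuf lam) ^ k) by (apply pow_le; lra).
    assert (L := Rabs_pos lam). nra.
Qed.

(** For small [lam] both D and its sign are close to the exchange of the two generators of a site.
    The three errors are at most |lam|, 8 |lam| and about 2 |lam|, so |lam| < 1/100 leaves room
    below 1/4. *)
Lemma sk_near k x0 F A : (forall g, Rabs (F g) <= A * wt 2 (snd g - x0)) ->
  forall g, Rabs (ac (spol k) F g - F (sw g)) <= / 4 * (A * wt 2 (snd g - x0)).
Proof.
  intros H g.
  assert (PA := bnd_nonneg 2 ltac:(lra) F A x0 H).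
  assert (L := Rabs_pos lam). assert (KB := kap_bound).
  destruct (bnd2_newt k) as [_ B]. specialize (B x0 F A H).
  set (Rn := ac (newt kap k) F).
  assert (B1 : forall u, Rabs (Rn u - F u) <= 8 * Rabs lam * (A * wt 2 (snd u - x0))).
  { intros u. specialize (B u). rewrite ac_add, ac_C in B. unfold Rn.
    replace (ac (newt kap k) F u - F u) with (ac (newt kap k) F u + -1 * F u) by ring. auto. }
  rewrite ac_sk. fold Rn.
  set (W := A * wt 2 (snd g - x0)).
  assert (W0 : 0 <= W) by (apply Rmult_le_pos; auto; left; apply wt_pos; lra).
  assert (G : forall b j', (Z.abs (snd g - j') <= 1)%Z -> Rabs (F (b, j')) <= 2 * W /\ Rabs (Rn (b, j')) <= (2 + 16 * Rabs lam) * W).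
  { intros b j' Hj. assert (S1 := wt_step 2 (j' - x0) (snd g - x0) ltac:(lra) ltac:(lia)).
    assert (S2 := H (b, j')). assert (S3 := B1 (b, j')). cbn [snd] in *.
    assert (A * wt 2 (j' - x0) <= 2 * W).
    { unfold W. assert (A * wt 2 (j' - x0) <= A * (2 * wt 2 (snd g - x0))) by (apply Rmult_le_compat_l; auto). lra. }
    split; [lra|].
    replace (Rn (b, j')) with ((Rn (b, j') - F (b, j')) + F (b, j')) by ring.
    eapply Rle_trans; [apply Rabs_triang|].
    assert (8 * Rabs lam * (A * wt 2 (j' - x0)) <= 8 * Rabs lam * (2 * W)) by (apply Rmult_le_compat_l; lra). lra. }
  assert (E : exists j', (Z.abs (snd g - j') <= 1)%Z /\ D Rn g = Rn (sw g) - lam * Rn (negb (fst g), j')).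
  { unfold Dg, sw. destruct g as [[] j]; cbn [fst snd negb].
    - exists (j - 1)%Z; split; [lia|reflexivity].
    - exists (j + 1)%Z; split; [lia|reflexivity]. }
  destruct E as [j' [Hj E]]. rewrite E.
  destruct (G (negb (fst g)) j' Hj) as [_ G2].
  assert (B2 := B1 (sw g)). assert (H2 := H (sw g)). cbn [snd sw] in B2, H2. fold W in B2, H2.
  replace (kap * (Rn (sw g) - lam * Rn (negb (fst g), j')) - F (sw g)) with
    ((kap - 1) * F (sw g) + kap * (Rn (sw g) - F (sw g)) + - (kap * (lam * Rn (negb (fst g), j')))) by ring.
  eapply Rle_trans; [apply Rabs_triang|]. rewrite Rabs_Ropp.
  assert (T := Rabs_triang ((kap - 1) * F (sw g)) (kap * (Rn (sw g) - F (sw g)))).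
  rewrite !Rabs_mult in *. rewrite (Rabs_right kap) in * by lra.
  assert (K1 : Rabs (kap - 1) <= Rabs lam) by (apply Rabs_le; lra).
  assert (T1 : Rabs (kap - 1) * Rabs (F (sw g)) <= Rabs lam * W).
  { apply Rmult_le_compat; auto using Rabs_pos. }
  assert (T2 : kap * Rabs (Rn (sw g) - F (sw g)) <= 1 * (8 * Rabs lam * W)).
  { apply Rmult_le_compat; auto using Rabs_pos; lra. }
  assert (T3 : kap * (Rabs lam * Rabs (Rn (negb (fst g), j'))) <= 1 * (Rabs lam * ((2 + 16 * Rabs lam) * W))).
  { apply Rmult_le_compat; [lra| |lra|].
    - apply Rmult_le_pos; auto using Rabs_pos.
    - apply Rmult_le_compat_l; auto. }
  assert (Rabs lam * W <= / 100 * W) by (apply Rmult_le_compat_r; lra).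
  assert (Rabs lam * ((2 + 16 * Rabs lam) * W) <= / 100 * (3 * W)).
  { apply Rmult_le_compat; [lra| |lra|].
    - apply Rmult_le_pos; lra.
    - apply Rmult_le_compat_r; lra. }
  lra.
Qed.

(** Duality: a bound of the action on all functions of size wt 2 is a weighted l1 bound on the rows
    of the kernel. *)
Lemma Skf_sum k g xl : NoDup xl ->
  Rsum (fun x => Rabs (sker k g (negb (fst g), x) - (if Z.eq_dec x (snd g) then 1 else 0)) * wt 2 (x - snd g)) xl <= / 4.
Proof.
  intros ND.
  set (e := fun x => sker k g (negb (fst g), x) - (if Z.eq_dec x (snd g) then 1 else 0)).
  set (sgn := fun r : R => if Rle_dec 0 r then 1 else -1).
  assert (sgn_abs : forall r, sgn r * r = Rabs r).
  { intros r; unfold sgn. destruct (Rle_dec 0 r); [rewrite Rabs_right; lra|rewrite Rabs_left; lra]. }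
  assert (sgn_b : forall r, Rabs (sgn r) = 1).
  { intros r; unfold sgn. destruct (Rle_dec 0 r); [rewrite Rabs_right; lra|rewrite Rabs_left; lra]. }
  (* The extremal test function: the weight with the signs of the kernel entries. *)
  set (F := fun u : gen => if in_dec gen_eq_dec u (map (fun x => (negb (fst g), x)) xl)
      then sgn (e (snd u)) * wt 2 (snd u - snd g) else 0).
  assert (HF : forall u, Rabs (F u) <= 1 * wt 2 (snd u - snd g)).
  { intros u. unfold F. assert (P := wt_pos 2 (snd u - snd g) ltac:(lra)).
    destruct in_dec; [|rewrite Rabs_R0; lra]. rewrite Rabs_mult, sgn_b, (Rabs_right (wt _ _)) by lra. lra. }
  assert (N := sk_near k (snd g) F 1 HF g). rewrite Z.sub_diag, wt_0 in N.
  assert (ND' : NoDup (map (fun x => (negb (fst g), x)) xl)).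
  { apply FinFun.Injective_map_NoDup; auto. intros x y E; congruence. }
  rewrite (ac_fin (spol k) _ F g ND') in N.
  2:{ intros u Hu. unfold F. destruct in_dec; [contradiction|reflexivity]. }
  rewrite Rsum_map in N.
  assert (E1 : F (sw g) = Rsum (fun x => F (negb (fst g), x) * (if Z.eq_dec x (snd g) then 1 else 0)) xl).
  { change (F (sw g)) with (F (negb (fst g), snd g)). destruct (in_dec Z.eq_dec (snd g) xl) as [Hi|Hn].
    - rewrite <- (Rsum_delta Z.eq_dec (fun x => F (negb (fst g), x)) xl (snd g) ND Hi).
      apply Rsum_ext; intros x _. destruct Z.eq_dec; ring.
    - rewrite Rsum_zero.
      + unfold F, sw. destruct in_dec as [Hi|]; auto. apply in_map_iff in Hi.
        destruct Hi as [x [Ex Hx]]. injection Ex as ->. contradiction.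
      + intros x Hx. destruct Z.eq_dec; [subst; contradiction|ring]. }
  rewrite E1, <- Rsum_minus in N.
  replace (Rsum (fun x => F (negb (fst g), x) * ac (spol k) (fun v => del v (negb (fst g), x)) g - F (negb (fst g), x) * (if Z.eq_dec x (snd g) then 1 else 0)) xl)
    with (Rsum (fun x => Rabs (e x) * wt 2 (x - snd g)) xl) in N.
  - fold (e). assert (Q : 0 <= Rsum (fun x => Rabs (e x) * wt 2 (x - snd g)) xl).
    { apply Rsum_nonneg; intros; apply Rmult_le_pos; [apply Rabs_pos|left; apply wt_pos; lra]. }
    rewrite (Rabs_right _ (Rle_ge _ _ Q)) in N. unfold e in *. lra.
  - apply Rsum_ext; intros x Hx. fold (sker k g (negb (fst g), x)). unfold F.
    destruct in_dec as [|Hn]; [|exfalso; apply Hn, in_map_iff; eauto].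
    cbn [snd]. rewrite <- sgn_abs. unfold e. ring.
Qed.

Lemma Skf_bound k g x : Rabs (sker k g (negb (fst g), x)) <= 5 / 4.
Proof.
  assert (H := Skf_sum k g [x] ltac:(repeat constructor; simpl; tauto)). unfold Rsum in H; simpl in H.
  assert (W := wt_ge1 2 (x - snd g) ltac:(lra)).
  set (d := if Z.eq_dec x (snd g) then 1 else 0) in *.
  assert (Hd : Rabs d <= 1) by (unfold d; destruct Z.eq_dec; [rewrite Rabs_R1|rewrite Rabs_R0]; lra).
  assert (P := Rabs_pos (sker k g (negb (fst g), x) - d)).
  replace (sker k g (negb (fst g), x)) with ((sker k g (negb (fst g), x) - d) + d) by ring.
  eapply Rle_trans; [apply Rabs_triang|]. nra.
Qed.

Lemma Sm_lim g x : ulim (fun k => sker k g (negb (fst g), x)) (Sm g (negb (fst g), x)).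
Proof. apply ulim_LIM. exists (5 / 4). apply ultra_all; intros; apply Skf_bound. Qed.

Lemma ulim_abs x l : ulim x l -> ulim (fun n => Rabs (x n)) (Rabs l).
Proof.
  intros H eps He. eapply ultra_mono; [|exact (H eps He)]. simpl; intros n Hn.
  eapply Rle_lt_trans; [apply Rabs_triang_inv2|exact Hn].
Qed.

Lemma Sm_sum g xl : NoDup xl ->
  Rsum (fun x => Rabs (Sm g (negb (fst g), x) - (if Z.eq_dec x (snd g) then 1 else 0)) * wt 2 (x - snd g)) xl <= / 4.
Proof.
  intros ND.
  apply (ulim_le (fun k => Rsum (fun x => Rabs (sker k g (negb (fst g), x) - (if Z.eq_dec x (snd g) then 1 else 0)) * wt 2 (x - snd g)) xl) (fun _ => / 4)).
  - apply (ulim_Rsum (fun k x => Rabs (sker k g (negb (fst g), x) - (if Z.eq_dec x (snd g) then 1 else 0)) * wt 2 (x - snd g))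
      (fun x => Rabs (Sm g (negb (fst g), x) - (if Z.eq_dec x (snd g) then 1 else 0)) * wt 2 (x - snd g))).
    intros x _. apply ulim_mult; [|apply ulim_const]. apply ulim_abs, ulim_minus; [apply Sm_lim|apply ulim_const].
  - apply ulim_const.
  - apply ultra_all; intros k. now apply Skf_sum.
Qed.

(** [Mk b x j] is the coefficient of the generator [(negb b, x)] in the image of [(b, j)] under the
    sign of [D]. *)
Definition Mk (b : bool) (x j : Z) : R := Sm (b, j) (negb b, x).

Lemma Mk_sym b x j : Mk b x j = Mk (negb b) j x.
Proof. unfold Mk. rewrite Sm_sym, negb_involutive. reflexivity. Qed.

Lemma Mk_sum b j xl : NoDup xl ->
  Rsum (fun x => Rabs (Mk b x j - (if Z.eq_dec x j then 1 else 0)) * wt 2 (x - j)) xl <= / 4.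
Proof. intros ND. exact (Sm_sum (b, j) xl ND). Qed.

Lemma Mk_row b x jl : NoDup jl ->
  Rsum (fun j => Rabs (Mk b x j - (if Z.eq_dec x j then 1 else 0)) * wt 2 (x - j)) jl <= / 4.
Proof.
  intros ND. eapply Rle_trans; [|exact (Mk_sum (negb b) x jl ND)]. right.
  apply Rsum_ext; intros j _. rewrite Mk_sym, <- (wt_neg 2 (x - j)), Z.opp_sub_distr.
  replace (- x + j)%Z with (j - x)%Z by lia. destruct (Z.eq_dec x j), (Z.eq_dec j x); congruence.
Qed.

Lemma Mk_sum_abs b j xl : NoDup xl -> Rsum (fun x => Rabs (Mk b x j) * wt 2 (x - j)) xl <= 5 / 4.
Proof.
  intros ND. assert (H := Mk_sum b j xl ND).
  apply Rle_trans with (Rsum (fun x => Rabs (Mk b x j - (if Z.eq_dec x j then 1 else 0)) * wt 2 (x - j)) xl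
     + Rsum (fun x => if Z.eq_dec x j then 1 else 0) xl).
  - rewrite <- Rsum_plus. apply Rsum_le; intros x _. destruct (Z.eq_dec x j) as [->|].
    + rewrite Z.sub_diag, wt_0. replace (Mk b j j) with ((Mk b j j - 1) + 1) at 1 by ring.
      assert (T := Rabs_triang (Mk b j j - 1) 1). rewrite Rabs_R1 in T. lra.
    + rewrite Rminus_0_r. lra.
  - assert (Rsum (fun x => if Z.eq_dec x j then 1 else 0) xl <= 1); [|lra].
    destruct (in_dec Z.eq_dec j xl) as [Hi|Hn].
    + rewrite (Rsum_delta Z.eq_dec (fun _ => 1) xl j ND Hi). lra.
    + rewrite Rsum_zero; [lra|]. intros x Hx; destruct Z.eq_dec; [subst; contradiction|auto].
Qed.
End Kernel.

(** * Degree parity of polynomials and inversion of finite matrices *)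

Module LinAlg.
Import all_boot all_order all_algebra Rstruct ring.
Import GRing.Theory.
Import Pol.
Local Delimit Scope ring_scope with GR.
Local Open Scope R_scope.

Definition peval (p : pol) (z : R) : R := (p : {poly R}).[z]%GR.
Definition pcoef (p : pol) (i : nat) : R := (((p : {poly R})`_i)%GR).
Fixpoint lpoly (l : list (R * nat)) : pol :=
  match l with nil => pC 0 | cons (c, i) l' => padd (pmul (pC c) (('X^i : {poly R})%GR)) (lpoly l') end.

Lemma peval_lpoly l z : peval (lpoly l) z = Rsum (fun x => fst x * z ^ (snd x)) l.
Proof.
elim: l => [|[c i] l IH]; first by rewrite /peval hornerC.
rewrite Rsum_cons -IH /peval [lpoly (_ :: _)]/= /padd /pmul /pC hornerD hornerM hornerC hornerXn.
by rewrite [snd _]/= RpowE.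
Qed.

Lemma pcoef_lpoly l i : pcoef (lpoly l) i = Rsum (fun x => if Nat.eq_dec (snd x) i then fst x else 0) l.
Proof.
elim: l => [|[c j] l IH]; first by rewrite /pcoef coefC; case: ifP.
rewrite Rsum_cons -IH /pcoef [lpoly (_ :: _)]/= /padd /pmul /pC coefD coefCM coefXn.
rewrite [snd _]/= [fst _]/=; case: Nat.eq_dec => [E|ne] /=.
  by rewrite E eqxx mulr1.
have -> : (i == j) = false by apply/eqP => E; apply: ne.
by rewrite mulr0.
Qed.

Lemma poly_many_roots (d : {poly R}) : (forall z, 1 <= z <= 3 / 2 -> d.[z]%GR = 0) -> d = 0%GR.
Proof.
move=> H; apply/eqP; apply/negPn/negP => nz.
set f := fun i : nat => 1 + / (INR i + 2).
have f_in i : 1 <= f i <= 3 / 2.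
  rewrite /f; have Hi := pos_INR i.
  have P : 0 < / (INR i + 2) by apply: Rinv_0_lt_compat; lra.
  have Q : / (INR i + 2) <= / 2 by apply: Rinv_le_contravar; lra.
  lra.
have f_inj : injective f.
  move=> i j; rewrite /f => E.
  have E' : INR i + 2 = INR j + 2.
    rewrite -(Rinv_inv (INR i + 2)) -(Rinv_inv (INR j + 2)); congr (/ _); lra.
  apply: INR_eq; lra.
have := max_poly_roots nz (rs := [seq f i | i <- iota 0 (size d)]).
rewrite size_map size_iota ltnn => /(_ _ _) F.
suff: false by []. apply: F.
- by apply/allP => x /mapP [i _ ->]; apply/rootP; apply: H.
- by rewrite map_inj_uniq // iota_uniq.
Qed.

(** Infinitely many points turn the hypothesis into an identity of polynomials; unless both vanish,
    the left side has odd degree and the right side even degree. *)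
Lemma poly_parity (p q : pol) (lam : R) : lam <> 0 ->
  (forall z, 1 <= z <= 3 / 2 -> (z - lam) * (peval p z * peval p z) = z * (1 - lam * z) * (peval q z * peval q z)) ->
  forall i, pcoef q i = 0.
Proof.
move=> nl H.
have E : (('X - lam%:P) * (p * p) = ('X * (1 - lam *: 'X)) * (q * q) :> {poly R})%GR.
  apply/eqP; rewrite -subr_eq0; apply/eqP; apply: poly_many_roots => z Hz.
  have := H z Hz; rewrite /peval !hornerE => E.
  by apply/eqP; rewrite subr_eq0; apply/eqP.
have [q0|nq] := eqVneq (q : {poly R}) 0%GR.
  by move=> i; rewrite /pcoef q0 coef0.
have nl' : (lam != 0)%GR by apply/eqP.
have s1 : size (1 - lam *: 'X : {poly R})%GR = 2%N.
  rewrite addrC size_polyDl ?size_polyN ?size_scale ?size_polyX // size_poly1 //.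
have n1 : (1 - lam *: 'X != 0 :> {poly R})%GR by rewrite -size_poly_eq0 s1.
have nR : ('X * (1 - lam *: 'X) * (q * q) != 0 :> {poly R})%GR.
  by rewrite !mulf_neq0 ?polyX_eq0.
have np : (p : {poly R}) != 0%GR.
  apply/eqP => p0; move: nR; by rewrite -E p0 !mulr0 eqxx.
have := congr1 (fun r : {poly R} => size r) E.
have nX : ('X - lam%:P != 0 :> {poly R})%GR by rewrite polyXsubC_eq0.
rewrite !size_mul ?mulf_neq0 ?polyX_eq0 // size_XsubC s1 size_polyX.
have := nq; have := np; rewrite -!size_poly_gt0.
case: (size (p : {poly R})) => // a _; case: (size (q : {poly R})) => // b _.
rewrite !addnS !addSn /= => /(congr1 odd); rewrite /= !oddD /=.
by case: (odd a); case: (odd b).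
Qed.

Lemma Rsum_big {A} (f : A -> R) (l : list A) : Rsum f l = (\sum_(x <- l) f x)%GR.
Proof. by elim: l => [|x l IH]; rewrite ?big_nil ?big_cons // Rsum_cons IH. Qed.

Lemma Rsum_ord (f : Z -> R) (S : list Z) : Rsum f S = (\sum_(i < size S) f (nth Z0 S i))%GR.
Proof. by rewrite Rsum_big (big_nth Z0) big_mkord. Qed.

Lemma In_nth_ord (S : list Z) j : List.In j S -> exists i : 'I_(size S), nth Z0 S i = j.
Proof.
elim: S => //= x S IH [->|/IH [i Hi]]; first by exists ord0.
by exists (lift ord0 i).
Qed.

Lemma nth_In (S : list Z) i : (i < size S)%N -> List.In (nth Z0 S i) S.
Proof. elim: S i => [|x S IH] [|i] //= H; [by left|by right; apply: IH]. Qed.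

Lemma nth_inj (S : list Z) i j : NoDup S -> (i < size S)%N -> (j < size S)%N ->
  nth Z0 S i = nth Z0 S j -> i = j.
Proof.
move=> ND; elim: S ND i j => [|x S IH] //= ND.
have [Hn HN] : ~ List.In x S /\ NoDup S by inversion ND.
move=> [|i] [|j] //= Hi Hj E.
- by exfalso; apply: Hn; rewrite E; apply: nth_In.
- by exfalso; apply: Hn; rewrite -E; apply: nth_In.
- by congr (_.+1); apply: IH.
Qed.

(** Kernels on a list of sites are transported to square matrices, where a trivial null space gives
    a two-sided inverse. *)
Lemma matrix_inverse (S : list Z) (A : Z -> Z -> R) : NoDup S ->
  (forall z, (forall j, List.In j S -> Rsum (fun k => A j k * z k) S = 0) -> forall k, List.In k S -> z k = 0) ->
  exists B : Z -> Z -> R,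
   (forall j k, List.In j S -> List.In k S -> Rsum (fun i => B j i * A i k) S = if Z.eq_dec j k then 1 else 0) /\
   (forall j k, List.In j S -> List.In k S -> Rsum (fun i => A j i * B i k) S = if Z.eq_dec j k then 1 else 0).
Proof.
move=> ND inj.
pose Am : 'M[R]_(size S) := (\matrix_(i, j) A (nth Z0 S i) (nth Z0 S j))%GR.
pose ix x := find (fun y => Z.eqb y x) S.
have ixE (j : 'I_(size S)) : insub (ix (nth Z0 S j)) = Some j.
  have hs : has (fun y => Z.eqb y (nth Z0 S j)) S.
    apply/(has_nthP Z0); exists j => //; exact: Z.eqb_refl.
  have -> : ix (nth Z0 S j) = j :> nat.
    apply: (nth_inj S _ _ ND) => //; first by rewrite -has_find.
    by apply/Z.eqb_eq; exact: (nth_find Z0 hs).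
  exact: valK.
pose ev2 (v : 'I_(size S) -> R) x : R := if insub (ix x) is Some i then v i else 0.
have ev2E v (j : 'I_(size S)) : ev2 v (nth Z0 S j) = v j by rewrite /ev2 ixE.
have U : Am \in unitmx.
  rewrite unitmxE unitfE; apply/negP => /eqP d0.
  have : (\det (Am^T)%GR == 0)%GR by rewrite det_tr d0.
  move=> /det0P [v nv Hv].
  move: nv => /eqP; apply; apply/rowP => i; rewrite mxE.
  rewrite -(ev2E (fun i => v ord0 i)); apply: inj; last by apply: nth_In.
  move=> j /In_nth_ord [i' <-]; rewrite Rsum_ord.
  have := congr1 (fun w : 'rV[R]_(size S) => w ord0 i') Hv.
  rewrite !mxE => H; rewrite -[RHS]H; apply: eq_bigr => k _.
  by rewrite ev2E !mxE mulrC.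
exists (fun x y => ev2 (fun i => ev2 (fun j => invmx Am i j) y) x); split.
- move=> j k /In_nth_ord [j' Hj] /In_nth_ord [k' Hk]; rewrite Rsum_ord -Hj -Hk.
  have := congr1 (fun M : 'M[R]_(size S) => M j' k') (mulVmx U).
  rewrite !mxE => H.
  transitivity ((j' == k')%:R : R)%GR.
    rewrite -H; apply: eq_bigr => i _; by rewrite !ev2E !mxE.
  case: Z.eq_dec => E /=.
    have Ej : j' = k' by apply: val_inj; apply: (nth_inj S _ _ ND _ _ E).
    by rewrite Ej eqxx.
  by have -> : (j' == k') = false by apply/eqP => E'; apply: E; rewrite E'.
- move=> j k /In_nth_ord [j' Hj] /In_nth_ord [k' Hk]; rewrite Rsum_ord -Hj -Hk.
  have := congr1 (fun M : 'M[R]_(size S) => M j' k') (mulmxV U).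
  rewrite !mxE => H.
  transitivity ((j' == k')%:R : R)%GR.
    rewrite -H; apply: eq_bigr => i _; by rewrite !ev2E !mxE.
  case: Z.eq_dec => E /=.
    have Ej : j' = k' by apply: val_inj; apply: (nth_inj S _ _ ND _ _ E).
    by rewrite Ej eqxx.
  by have -> : (j' == k') = false by apply/eqP => E'; apply: E; rewrite E'.
Qed.
End LinAlg.

Definition win (n : nat) : list Z := map (fun i => (Z.of_nat i - Z.of_nat n)%Z) (seq 0 (2 * n + 1)).

Lemma win_In n x : In x (win n) <-> (Z.abs x <= Z.of_nat n)%Z.
Proof.
  unfold win. rewrite in_map_iff. split.
  - intros [i [<- Hi]]. apply in_seq in Hi. lia.
  - intros H. exists (Z.to_nat (x + Z.of_nat n)). rewrite in_seq. lia.
Qed.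
Lemma win_NoDup n : NoDup (win n).
Proof. apply FinFun.Injective_map_NoDup; [|apply seq_NoDup]. intros x y H; lia. Qed.

Lemma win_contains (S : list Z) : exists n, forall x, In x S -> In x (win n).
Proof.
  induction S as [|x S [n Hn]].
  - exists 0%nat. intros x [].
  - exists (Nat.max n (Z.abs_nat x)). intros y [<-|Hy].
    + apply win_In. lia.
    + apply Hn, win_In in Hy. apply win_In. lia.
Qed.

Lemma Rsum_incl (f : Z -> R) S T : NoDup S -> NoDup T -> incl S T ->
  (forall x, In x T -> ~ In x S -> f x = 0) -> Rsum f T = Rsum f S.
Proof.
  intros NS NT I H.
  transitivity (Rsum (fun x => if in_dec Z.eq_dec x S then f x else 0) T).
  { apply Rsum_ext; intros x Hx. destruct in_dec; auto. }
  assert (E := Rsum_filter (fun x => if in_dec Z.eq_dec x S then true else false) f T).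
  rewrite (Rsum_ext _ (fun x => if (if in_dec Z.eq_dec x S then true else false) then f x else 0))
    by (intros; destruct in_dec; reflexivity).
  rewrite E. apply Rsum_perm. apply NoDup_Permutation; auto using NoDup_filter.
  intros x. rewrite filter_In. destruct in_dec; intuition; discriminate.
Qed.

(** * The sign kernel as an isometry, and its symbol *)

Section Kernel2.
Variable lam : R.
Hypothesis Hlam : 0 < Rabs lam < 1 / 100.
Notation D := (Dg lam).
Notation ac := (act gen D).
Notation kap := (kapf lam).
Notation Skf := (sker lam).

Notation Mk := (Mk lam).
Notation sk := (spol lam).

Definition Mv (b : bool) (f : Z -> R) (S : list Z) (x : Z) : R := Rsum (fun j => Mk b x j * f j) S.
Definition Mvk (k : nat) (b : bool) (f : Z -> R) (S : list Z) (x : Z) : R :=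
  Rsum (fun j => Skf k (b, j) (negb b, x) * f j) S.

Lemma Mv_lim b f S x : ulim (fun k => Mvk k b f S x) (Mv b f S x).
Proof.
  apply (ulim_Rsum (fun k j => Skf k (b, j) (negb b, x) * f j) (fun j => Mk b x j * f j)).
  intros j _. apply ulim_mult; [|apply ulim_const]. apply (Sm_lim lam Hlam (b, j)).
Qed.

(** The Newton polynomial is built from X^2 and respects the type of the generator; [spol] has one
    factor X more and exchanges the types. *)
Lemma sk_odd k b F : (forall j, F (negb b, j) = 0) -> forall j, ac (sk k) F (b, j) = 0.
Proof.
  intros H.
  set (even := fun q => forall F, (forall j, F (negb b, j) = 0) -> forall j, ac q F (negb b, j) = 0).
  assert (eC : forall c, even (pC c)).
  { intros c G HG j. rewrite ac_C, HG; ring. }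
  assert (ea : forall p q, even p -> even q -> even (padd p q)).
  { intros p q Hp Hq G HG j. rewrite ac_add, Hp, Hq; auto; ring. }
  assert (em : forall p q, even p -> even q -> even (pmul p q)).
  { intros p q Hp Hq G HG j. rewrite ac_mul. apply Hp. intros; now apply Hq. }
  assert (eX : even (pmul pX pX)).
  { intros G HG j. rewrite ac_mul, ac_X.
    replace (ac pX G) with (D G) by (extensionality y; now rewrite ac_X).
    destruct b; unfold Dg; cbn [fst snd negb] in *; rewrite !HG; ring. }
  assert (en : even (newt kap k)).
  { induction k as [|k IH]; [apply eC|]. rewrite newt_S. unfold perr, pY. auto 20. }
  intros j. rewrite ac_sk. specialize (en F H).
  destruct b; unfold Dg; cbn [fst snd negb] in *; rewrite !en; ring.
Qed.

Lemma Skf_sum_abs k b x jl : NoDup jl -> 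
  Rsum (fun j => Rabs (Skf k (b, j) (negb b, x)) * wt 2 (x - j)) jl <= 5 / 4.
Proof.
  intros ND. assert (H := Skf_sum lam Hlam k (negb b, x) jl ND). cbn [fst snd] in H. rewrite negb_involutive in H.
  apply Rle_trans with (Rsum (fun j => Rabs (Skf k (negb b, x) (b, j) - (if Z.eq_dec j x then 1 else 0)) * wt 2 (j - x)) jl
     + Rsum (fun j => if Z.eq_dec j x then 1 else 0) jl).
  - rewrite <- Rsum_plus. apply Rsum_le; intros j _. rewrite Skf_sym by auto.
    rewrite <- (wt_neg 2 (x - j)). replace (- (x - j))%Z with (j - x)%Z by lia.
    destruct (Z.eq_dec j x) as [->|].
    + rewrite Z.sub_diag, wt_0. 
      assert (T := Rabs_triang (Skf k (negb b, x) (b, x) - 1) 1). rewrite Rabs_R1 in T.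
      replace (Skf k (negb b, x) (b, x) - 1 + 1) with (Skf k (negb b, x) (b, x)) in T by ring. lra.
    + rewrite Rminus_0_r. lra.
  - assert (Rsum (fun j => if Z.eq_dec j x then 1 else 0) jl <= 1); [|lra].
    destruct (in_dec Z.eq_dec x jl) as [Hi|Hn].
    + rewrite (Rsum_delta Z.eq_dec (fun _ => 1) jl x ND Hi). lra.
    + rewrite Rsum_zero; [lra|]. intros j Hj; destruct Z.eq_dec; [subst; contradiction|auto].
Qed.

Lemma decay_out A n x : Rabs A * 1 >= 0 -> (Z.of_nat n < Z.abs x)%Z -> 2 ^ n <= wt 2 x.
Proof. intros _ H. unfold wt. apply Rle_pow; [lra|lia]. Qed.

(** The kernel is an isometry of l2; the weights control what leaves the window. *)
Lemma kernel_isometry b S f g A n : NoDup S -> 0 <= A -> (forall j, In j S -> Rabs (g j) * wt 2 j <= A) ->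
  Rabs (Rsum (fun x => Mv b f S x * Mv b g S x) (win n) - Rsum (fun j => f j * g j) S)
   <= 2 * A * Rsum (fun j => Rabs (f j)) S / 2 ^ n.
Proof.
  intros ND HA Hg.
  assert (P2 : 0 < 2 ^ n) by (apply pow_lt; lra).
  set (phi := fun u => Rsum (fun j => g j * del u (b, j)) S).
  set (G := fun k => ac (sk k) phi).
  assert (G1 : forall k x, G k (negb b, x) = Mvk k b g S x).
  { intros k x. unfold G, phi. rewrite (ac_sum lam (sk k) g (fun j u => del u (b, j))).
    apply Rsum_ext; intros j _. rewrite Skf_sym by auto. unfold sker. ring. }
  assert (G0 : forall k x, G k (b, x) = 0).
  { intros k x. unfold G. apply sk_odd. intros j. unfold phi. apply Rsum_zero; intros i _.
    rewrite del_eq. destruct b; simpl; ring. }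
  set (F1 := fun k u => if in_dec gen_eq_dec u (map (fun x => (negb b, x)) (win n)) then G k u else 0).
  assert (NDm : NoDup (map (fun x => (negb b, x)) (win n))).
  { apply FinFun.Injective_map_NoDup; [|apply win_NoDup]. intros x y E; congruence. }
  assert (EF1 : forall k, Rsum (fun j => f j * ac (sk k) (F1 k) (b, j)) S = Rsum (fun x => Mvk k b f S x * Mvk k b g S x) (win n)).
  { intros k. rewrite (Rsum_ext _ (fun j => Rsum (fun x => f j * (Mvk k b g S x * Skf k (b, j) (negb b, x))) (win n))).
    - rewrite Rsum_swap. apply Rsum_ext; intros x _. unfold Mvk at 2. rewrite <- Rsum_scal_r.
      apply Rsum_ext; intros; ring.
    - intros j _. rewrite (ac_fin lam (sk k) _ (F1 k) (b, j) NDm).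
      2:{ intros u Hu. unfold F1. destruct in_dec; [contradiction|auto]. }
      rewrite Rsum_map, <- Rsum_scal. apply Rsum_ext; intros x Hx. unfold F1.
      destruct in_dec as [|Hn]; [|exfalso; apply Hn, in_map_iff; eauto]. rewrite G1. reflexivity. }
  assert (BG : forall k x, Rabs (Mvk k b g S x) * wt 2 x <= 5 / 4 * A).
  { intros k x. assert (Wx := wt_pos 2 x ltac:(lra)).
    unfold Mvk. apply Rle_trans with (Rsum (fun j => Rabs (Skf k (b, j) (negb b, x)) * wt 2 (x - j) * A) S).
    - eapply Rle_trans; [apply Rmult_le_compat_r; [lra|apply Rsum_abs]|].
      rewrite <- Rsum_scal_r. apply Rsum_le; intros j Hj. rewrite Rabs_mult.
      assert (T := wt_tri 2 (x - j) j ltac:(lra)). replace (x - j + j)%Z with x in T by lia.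
      assert (Q := Rabs_pos (Skf k (b, j) (negb b, x))). assert (Q' := Rabs_pos (g j)).
      assert (W1 := wt_pos 2 (x - j) ltac:(lra)). specialize (Hg j Hj).
      apply Rle_trans with (Rabs (Skf k (b, j) (negb b, x)) * Rabs (g j) * (wt 2 (x - j) * wt 2 j)).
      + apply Rmult_le_compat_l; auto. apply Rmult_le_pos; auto.
      + replace (Rabs (Skf k (b, j) (negb b, x)) * Rabs (g j) * (wt 2 (x - j) * wt 2 j)) with
          (Rabs (Skf k (b, j) (negb b, x)) * wt 2 (x - j) * (Rabs (g j) * wt 2 j)) by ring.
        apply Rmult_le_compat_l; auto. apply Rmult_le_pos; lra.
    - rewrite Rsum_scal_r. apply Rmult_le_compat_r; auto. now apply Skf_sum_abs. }
  assert (EF2 : forall k, Rabs (Rsum (fun j => f j * (ac (sk k) (G k) (b, j) - ac (sk k) (F1 k) (b, j))) S)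
     <= 2 * A * Rsum (fun j => Rabs (f j)) S / 2 ^ n).
  { intros k. set (Bd := 5 / 4 * A / 2 ^ n).
    assert (Bd0 : 0 <= Bd) by (unfold Bd; apply Rmult_le_pos; [lra|left; now apply Rinv_0_lt_compat]).
    assert (F2b : forall u, Rabs (G k u + -1 * F1 k u) <= Bd).
    { intros u. unfold F1. destruct in_dec as [Hi|Hn].
      - replace (G k u + -1 * G k u) with 0 by ring. rewrite Rabs_R0; auto.
      - rewrite Rmult_0_r, Rplus_0_r. destruct u as [b' x]. destruct (bool_dec b' b) as [->|Nb].
        + rewrite G0, Rabs_R0; auto.
        + assert (Eb : b' = negb b) by (destruct b, b'; simpl; congruence). subst b'.
          rewrite G1. assert (Hx : (Z.of_nat n < Z.abs x)%Z).
          { destruct (Z_le_gt_dec (Z.abs x) (Z.of_nat n)); [|lia]. exfalso; apply Hn, in_map_iff.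
            exists x; split; auto. now apply win_In. }
          apply (decay_out A n x) in Hx; [|assert (H := Rabs_pos A); lra].
          specialize (BG k x). assert (Q := Rabs_pos (Mvk k b g S x)).
          unfold Bd. apply Rmult_le_reg_r with (2 ^ n); auto.
          replace (5 / 4 * A / 2 ^ n * 2 ^ n) with (5 / 4 * A) by (field; lra). nra. }
    eapply Rle_trans; [apply Rsum_abs|].
    apply Rle_trans with (Rsum (fun j => Rabs (f j) * (5 / 4 * Bd)) S).
    - apply Rsum_le; intros j _. rewrite Rabs_mult. apply Rmult_le_compat_l; [apply Rabs_pos|].
      replace (ac (sk k) (G k) (b, j) - ac (sk k) (F1 k) (b, j)) with (ac (sk k) (fun u => G k u + -1 * F1 k u) (b, j))
        by (rewrite ac_linear; ring).
      assert (N := sk_near lam Hlam k j (fun u => G k u + -1 * F1 k u) Bd).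
      assert (N' : forall g0 : gen, Rabs (G k g0 + -1 * F1 k g0) <= Bd * wt 2 (snd g0 - j)).
      { intros u. assert (W := wt_ge1 2 (snd u - j) ltac:(lra)). specialize (F2b u). nra. }
      specialize (N N' (b, j)). cbn beta in N. cbn [snd] in N. rewrite Z.sub_diag, wt_0 in N.
      specialize (F2b (sw (b, j))).
      set (X := ac (sk k) (fun u => G k u + -1 * F1 k u) (b, j)) in *.
      replace X with ((X - (G k (sw (b, j)) + -1 * F1 k (sw (b, j)))) + (G k (sw (b, j)) + -1 * F1 k (sw (b, j)))) by ring.
      change (Rabs (X - (G k (sw (b, j)) + -1 * F1 k (sw (b, j)))) <= / 4 * (Bd * 1)) in N.
      eapply Rle_trans; [apply Rabs_triang|]. lra.
    - rewrite Rsum_scal_r. assert (Q : 0 <= Rsum (fun j => Rabs (f j)) S) by (apply Rsum_nonneg; intros; apply Rabs_pos).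
      unfold Bd. replace (2 * A * Rsum (fun j => Rabs (f j)) S / 2 ^ n) with (Rsum (fun j => Rabs (f j)) S * (2 * (A / 2 ^ n))) by (field; lra).
      apply Rmult_le_compat_l; auto. 
      assert (0 <= A / 2 ^ n) by (apply Rmult_le_pos; [lra|left; now apply Rinv_0_lt_compat]).
      replace (5 / 4 * (5 / 4 * A / 2 ^ n)) with (25 / 16 * (A / 2 ^ n)) by (field; lra). lra. }
  assert (EG : forall k, Rsum (fun j => f j * ac (sk k) (G k) (b, j)) S =
      Rsum (fun j => f j * g j) S - Rsum (fun j => f j * ac (perr kap (newt kap k)) phi (b, j)) S).
  { intros k. rewrite <- Rsum_minus. apply Rsum_ext; intros j Hj. unfold G. rewrite <- ac_mul.
    unfold spol. rewrite pX_newt_sq, ac_add, ac_C, ac_mul, ac_C.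
    assert (E : phi (b, j) = g j).
    { unfold phi. rewrite <- (Rsum_delta Z.eq_dec g S j ND Hj). apply Rsum_ext; intros i _. rewrite del_eq, eqb_reflx. simpl.
      destruct (Z.eqb_spec j i), (Z.eq_dec i j); try congruence; ring. }
    rewrite E. ring. }
  assert (nuB := nuf_bound lam ltac:(lra)).
  assert (Err : ulim (fun k => Rsum (fun j => f j * ac (perr kap (newt kap k)) phi (b, j)) S) 0).
  { set (PA := Rsum (fun j => Rabs (g j)) S).
    assert (Hphi : forall u, Rabs (phi u) <= PA).
    { intros u. unfold phi. eapply Rle_trans; [apply Rsum_abs|]. apply Rsum_le; intros j _. rewrite Rabs_mult.
      assert (Rabs (del u (b, j)) <= 1) by (unfold del; destruct gen_eq_dec; [rewrite Rabs_R1|rewrite Rabs_R0]; lra).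
      assert (Q := Rabs_pos (g j)). nra. }
    assert (BE : forall k, bnd lam 1 (perr kap (newt kap k)) (nuf lam ^ (k + 1))).
    { intros k. apply bnd_perr.
      - intros; apply bnd_C.
      - rewrite <- (Rmult_1_l (nuf lam)). apply bnd_t; lra.
      - intros; now apply bnd_add.
      - intros; now apply bnd_mul.
      - intros q A0 B H1 H2. apply (bnd_mono lam 1 ltac:(lra) q A0 B); auto.
      - lra. }
    apply ulim_squeeze0 with (y := fun k => (Rsum (fun j => Rabs (f j)) S * PA) * nuf lam ^ (k + 1)).
    - replace 0 with ((Rsum (fun j => Rabs (f j)) S * PA) * 0) by ring. apply ulim_scal, ulim_pow. lra.
    - apply ultra_all; intros k. eapply Rle_trans; [apply Rsum_abs|].
      rewrite Rmult_assoc, <- Rsum_scal_r. apply Rsum_le; intros j _. rewrite Rabs_mult.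
      apply Rmult_le_compat_l; [apply Rabs_pos|].
      destruct (BE k) as [_ H]. specialize (H 0%Z phi PA).
      assert (H0 : forall g0 : gen, Rabs (phi g0) <= PA * wt 1 (snd g0 - 0)) by (intros; rewrite wt1; specialize (Hphi g0); lra).
      specialize (H H0 (b, j)). rewrite wt1 in H. lra. }
  apply (ulim_le (fun k => Rabs (Rsum (fun x => Mvk k b f S x * Mvk k b g S x) (win n) - (Rsum (fun j => f j * g j) S - Rsum (fun j => f j * ac (perr kap (newt kap k)) phi (b, j)) S)))
     (fun _ => 2 * A * Rsum (fun j => Rabs (f j)) S / 2 ^ n)).
  - apply ulim_abs. apply ulim_minus.
    + apply (ulim_Rsum (fun k x => Mvk k b f S x * Mvk k b g S x) (fun x => Mv b f S x * Mv b g S x)).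
      intros x _. apply ulim_mult; apply Mv_lim.
    + replace (Rsum (fun j => f j * g j) S) with (Rsum (fun j => f j * g j) S - 0) at 1 by ring.
      apply ulim_minus; auto. apply ulim_const.
  - apply ulim_const.
  - apply ultra_all; intros k. rewrite <- EG, <- EF1, <- Rsum_minus.
    specialize (EF2 k). rewrite <- Rabs_Ropp in EF2. rewrite <- Rsum_opp in EF2.
    rewrite (Rsum_ext _ (fun j => - (f j * (ac (sk k) (G k) (b, j) - ac (sk k) (F1 k) (b, j))))); [exact EF2|].
    intros; ring.
Qed.

(** A plane wave at real [z]. With 1 <= z <= 3/2 it stays below the weight 2^|x|, so the localised
    kernels can be summed against it. *)
Definition Fz (z : R) (u : gen) : R := if fst u then powerRZ z (snd u) else 0.

Lemma Fz_D z j : z <> 0 -> D (Fz z) (false, j) = (1 - lam * z) * powerRZ z j.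
Proof.
  intros Hz. unfold Dg, Fz; cbn [fst snd]. rewrite powerRZ_add by auto. simpl. ring.
Qed.

Lemma Fz_Y z : z <> 0 -> forall u, ac (pY kap) (Fz z) u = kap * kap * ((1 - lam * z) * (1 - lam / z)) * Fz z u.
Proof.
  intros Hz u. unfold pY. rewrite ac_mul, ac_C, ac_mul, ac_X.
  replace (ac pX (Fz z)) with (D (Fz z)) by (extensionality y; now rewrite ac_X).
  destruct u as [[] j].
  - unfold Dg at 1; cbn [fst snd]. rewrite !Fz_D by auto. unfold Fz; cbn [fst snd].
    unfold Z.sub. rewrite powerRZ_add by auto. simpl. field; auto.
  - unfold Dg, Fz; cbn [fst snd]. ring.
Qed.

(** The plane wave is an eigenfunction of D^2, hence of every polynomial in D^2, and the Newton
    iteration becomes a scalar one. *)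
Lemma newt_eigen z k : z <> 0 -> exists r, (forall u, ac (newt kap k) (Fz z) u = r * Fz z u) /\
  (forall u, ac (perr kap (newt kap k)) (Fz z) u = (1 - kap * kap * ((1 - lam * z) * (1 - lam / z)) * r * r) * Fz z u).
Proof.
  intros Hz.
  assert (S2 : forall p q a c, (forall u, ac p (Fz z) u = a * Fz z u) -> (forall u, ac q (Fz z) u = c * Fz z u) ->
     forall u, ac (pmul p q) (Fz z) u = a * c * Fz z u).
  { intros p q a c Hp Hq u. rewrite ac_mul. 
    replace (ac q (Fz z)) with (fun y => Fz z y + (c - 1) * Fz z y) by (extensionality y; rewrite Hq; ring).
    rewrite ac_linear, Hp. ring. }
  assert (S1 : forall p q a c, (forall u, ac p (Fz z) u = a * Fz z u) -> (forall u, ac q (Fz z) u = c * Fz z u) ->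
     forall u, ac (padd p q) (Fz z) u = (a + c) * Fz z u).
  { intros p q a c Hp Hq u. rewrite ac_add, Hp, Hq. ring. }
  assert (SE : forall q r, (forall u, ac q (Fz z) u = r * Fz z u) ->
     forall u, ac (perr kap q) (Fz z) u = (1 - kap * kap * ((1 - lam * z) * (1 - lam / z)) * r * r) * Fz z u).
  { intros q r Hq u. unfold perr.
    rewrite (S1 _ _ 1 (-1 * (kap * kap * ((1 - lam * z) * (1 - lam / z)) * (r * r)))); [ring|intros; now rewrite ac_C|].
    apply S2; [intros; now rewrite ac_C|]. apply S2; [now apply Fz_Y|]. now apply S2. }
  induction k as [|k [r [H1 H2]]].
  - exists 1. assert (H : forall u, ac (newt kap 0) (Fz z) u = 1 * Fz z u) by (intros; simpl; now rewrite ac_C).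
    split; auto. 
  - eexists. assert (H : forall u, ac (newt kap (Datatypes.S k)) (Fz z) u = (r * (1 + / 2 * (1 - kap * kap * ((1 - lam * z) * (1 - lam / z)) * r * r))) * Fz z u).
    { rewrite newt_S. apply S2; auto. apply S1; [intros; now rewrite ac_C|]. apply S2; auto. intros; now rewrite ac_C. }
    split; [exact H|]. now apply SE.
Qed.

Lemma powerRZ_wt z j : 1 <= z <= 3 / 2 -> 0 < powerRZ z j <= wt (3 / 2) j.
Proof.
  intros Hz. split; [apply powerRZ_lt; lra|]. unfold wt.
  destruct (Z_le_gt_dec 0 j).
  - replace (powerRZ z j) with (z ^ Z.abs_nat j).
    + apply pow_incr; lra.
    + rewrite pow_powerRZ. f_equal. lia.
  - apply Rle_trans with 1; [|apply pow_R1_Rle; lra].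
    replace j with (- Z.of_nat (Z.abs_nat j))%Z by lia.
    rewrite powerRZ_neg', <- pow_powerRZ. rewrite <- Rinv_1. apply Rinv_le_contravar; [lra|].
    apply pow_R1_Rle; lra.
Qed.

(** On plane waves the kernel acts by (1 - lam z) / sqrt ((1 - lam z) (1 - lam / z)), whose square
    is z (1 - lam z) / (z - lam). As both [v] and its image are supported in [S], the squared
    relation contains only finite sums. *)
Lemma genfun S v z : NoDup S -> (forall x, ~ In x S -> Mv false v S x = 0) -> 1 <= z <= 3 / 2 ->
  (z - lam) * (Rsum (fun x => Mv false v S x * powerRZ z x) S * Rsum (fun x => Mv false v S x * powerRZ z x) S) =
  z * (1 - lam * z) * (Rsum (fun x => v x * powerRZ z x) S * Rsum (fun x => v x * powerRZ z x) S).
Proof.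
  intros ND Hout Hz.
  set (Wk := fun k => Rsum (fun x => v x * ac (sk k) (Fz z) (false, x)) S).
  set (W := Rsum (fun x => Mv false v S x * powerRZ z x) S).
  set (V := Rsum (fun x => v x * powerRZ z x) S).
  assert (Lb := Rabs_le_bounds lam (1 / 100) ltac:(lra)).
  set (Cv := Rsum (fun x => Rabs (v x) * wt 2 x) S).
  assert (Cv0 : 0 <= Cv) by (apply Rsum_nonneg; intros; apply Rmult_le_pos; [apply Rabs_pos|left; apply wt_pos; lra]).
  (* Cutting the wave to the window costs (3/4)^n, the quotient of the growth 3/2 and the weight 2,
     uniformly in [k]; thus the limits in [k] and in the window can be exchanged. *)
  assert (Tail : forall n k, Rabs (Wk k - Rsum (fun j => Mvk k false v S j * powerRZ z j) (win n)) <= 2 * Cv * (3 / 4) ^ n).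
  { intros n k.
    set (F1 := fun u => if in_dec gen_eq_dec u (map (fun x => (true, x)) (win n)) then Fz z u else 0).
    assert (NDm : NoDup (map (fun x => (true, x)) (win n))).
    { apply FinFun.Injective_map_NoDup; [|apply win_NoDup]. intros x y E; congruence. }
    assert (E1 : Rsum (fun j => Mvk k false v S j * powerRZ z j) (win n) = Rsum (fun x => v x * ac (sk k) F1 (false, x)) S).
    { rewrite (Rsum_ext (fun x => v x * _) (fun x => Rsum (fun j => v x * (powerRZ z j * Skf k (false, x) (true, j))) (win n))).
      - rewrite Rsum_swap. apply Rsum_ext; intros j _. unfold Mvk. rewrite <- Rsum_scal_r. apply Rsum_ext; intros; simpl; ring.
      - intros x _. rewrite (ac_fin lam (sk k) _ F1 (false, x) NDm).
        2:{ intros u Hu. unfold F1. destruct in_dec; [contradiction|auto]. }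
        rewrite Rsum_map, <- Rsum_scal. apply Rsum_ext; intros j Hj. unfold F1.
        destruct in_dec as [|Hn]; [|exfalso; apply Hn, in_map_iff; eauto]. reflexivity. }
    rewrite E1. unfold Wk. rewrite <- Rsum_minus.
    assert (Q34 : 0 < (3 / 4) ^ n) by (apply pow_lt; lra).
    assert (F2b : forall u, Rabs (Fz z u + -1 * F1 u) <= (3 / 4) ^ n * wt 2 (snd u - 0)).
    { intros u. rewrite Z.sub_0_r. assert (Wp := wt_pos 2 (snd u) ltac:(lra)). unfold F1. destruct in_dec as [Hi|Hn].
      - replace (Fz z u + -1 * Fz z u) with 0 by ring. rewrite Rabs_R0. apply Rmult_le_pos; lra.
      - rewrite Rmult_0_r, Rplus_0_r. destruct u as [[] x]; unfold Fz; cbn [fst snd] in *.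
        2:{ rewrite Rabs_R0. apply Rmult_le_pos; lra. }
        assert (Hx : (Z.of_nat n < Z.abs x)%Z).
        { destruct (Z_le_gt_dec (Z.abs x) (Z.of_nat n)); [|lia]. exfalso; apply Hn, in_map_iff.
          exists x; split; auto. now apply win_In. }
        destruct (powerRZ_wt z x Hz) as [P1 P2]. rewrite Rabs_right by lra. eapply Rle_trans; [exact P2|].
        unfold wt. replace (3 / 2) with (3 / 4 * 2) by field. rewrite Rpow_mult_distr.
        apply Rmult_le_compat_r; [apply pow_le; lra|].
        replace (Z.abs_nat x) with (n + (Z.abs_nat x - n))%nat by lia. rewrite pow_add.
        assert ((3 / 4) ^ (Z.abs_nat x - n) <= 1) by (rewrite <- (pow1 (Z.abs_nat x - n)); apply pow_incr; lra). nra. }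
    eapply Rle_trans; [apply Rsum_abs|].
    unfold Cv. rewrite <- Rsum_scal, <- Rsum_scal_r. apply Rsum_le; intros x _.
    replace (v x * ac (sk k) (Fz z) (false, x) - v x * ac (sk k) F1 (false, x)) with (v x * ac (sk k) (fun u => Fz z u + -1 * F1 u) (false, x))
        by (rewrite ac_linear; ring).
    rewrite Rabs_mult.
    assert (N := sk_near lam Hlam k 0 (fun u => Fz z u + -1 * F1 u) ((3 / 4) ^ n) F2b (false, x)).
    specialize (F2b (sw (false, x))). cbn beta in F2b, N. unfold sw in F2b, N. cbn [fst snd negb] in F2b, N. rewrite Z.sub_0_r in *.
    set (X := ac (sk k) (fun u => Fz z u + -1 * F1 u) (false, x)) in *.
    assert (HX : Rabs X <= 2 * ((3 / 4) ^ n * wt 2 x)).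
    { replace X with ((X - (Fz z (true, x) + -1 * F1 (true, x))) + (Fz z (true, x) + -1 * F1 (true, x))) by ring.
      change (Rabs (X - (Fz z (true, x) + -1 * F1 (true, x))) <= / 4 * ((3 / 4) ^ n * wt 2 x)) in N.
      eapply Rle_trans; [apply Rabs_triang|]. assert (0 < wt 2 x) by (apply wt_pos; lra). 
      assert (0 <= (3 / 4) ^ n * wt 2 x) by (apply Rmult_le_pos; lra). lra. }
    apply Rle_trans with (Rabs (v x) * (2 * ((3 / 4) ^ n * wt 2 x))); [apply Rmult_le_compat_l; auto using Rabs_pos|right; ring]. }
  assert (zl : 0 < z - lam /\ 0 < 1 - lam * z) by (split; nra).
  assert (Wsq : ulim (fun k => Wk k * Wk k) (z * (1 - lam * z) / (z - lam) * (V * V))).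
  { assert (Ek : exists e, ulim e 0 /\ forall k, Wk k * Wk k = (1 - e k) * (z * (1 - lam * z) / (z - lam) * (V * V))).
    { assert (C : forall k, exists e, Rabs e <= (2 * nuf lam) ^ (k + 1) /\ Wk k * Wk k = (1 - e) * (z * (1 - lam * z) / (z - lam) * (V * V))).
      { intros k. destruct (newt_eigen z k ltac:(lra)) as [r [H1 H2]].
        exists (1 - kap * kap * ((1 - lam * z) * (1 - lam / z)) * r * r). split.
        - assert (nuB := nuf_bound lam ltac:(lra)).
          assert (BE : bnd lam 2 (perr kap (newt kap k)) ((2 * nuf lam) ^ (k + 1))).
          { apply bnd_perr.
            - intros; apply bnd_C.
            - apply bnd_t; lra.
            - intros; now apply bnd_add.
            - intros; now apply bnd_mul.
            - intros q A0 B HH1 HH2. apply (bnd_mono lam 2 ltac:(lra) q A0 B); auto.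
            - lra. }
          destruct BE as [_ BE].
          assert (BF : forall g : gen, Rabs (Fz z g) <= 1 * wt 2 (snd g - 0)).
          { intros [[] x]; unfold Fz; cbn [fst snd]; rewrite Z.sub_0_r.
            - destruct (powerRZ_wt z x Hz) as [P1 P2]. rewrite Rabs_right by lra. rewrite Rmult_1_l.
              eapply Rle_trans; [exact P2|]. unfold wt. apply pow_incr; lra.
            - rewrite Rabs_R0. assert (Wp := wt_pos 2 x ltac:(lra)). lra. }
          specialize (BE 0%Z (Fz z) 1 BF (true, 0%Z)). rewrite H2 in BE. unfold Fz in BE; cbn [fst snd] in BE.
          rewrite Z.sub_diag, wt_0 in BE. simpl powerRZ in BE. rewrite !Rmult_1_r in BE. exact BE.
        - assert (E : Wk k = kap * r * (1 - lam * z) * V).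
          { unfold Wk, V. rewrite <- Rsum_scal. apply Rsum_ext; intros x _. rewrite ac_sk.
            replace (ac (newt kap k) (Fz z)) with (fun y => Fz z y + (r - 1) * Fz z y) by (extensionality y; rewrite H1; ring).
            rewrite Dg_lin, Fz_D by lra. ring. }
          rewrite E. field. lra. }
      destruct (ClassicalEpsilon.choice _ C) as [e He]. exists e. split; [|apply He].
      assert (nuB := nuf_bound lam ltac:(lra)).
      apply ulim_squeeze0 with (y := fun k => (2 * nuf lam) ^ (k + 1)); [apply ulim_pow; lra|].
      apply ultra_all; intros; apply He. }
    destruct Ek as [e [He1 He2]].
    replace (z * (1 - lam * z) / (z - lam) * (V * V)) with ((1 - 0) * (z * (1 - lam * z) / (z - lam) * (V * V))) by ring.
    eapply ulim_ext with (x := fun k => (1 - e k) * (z * (1 - lam * z) / (z - lam) * (V * V))).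
    - apply ultra_all; intros; now rewrite He2.
    - apply ulim_mult; [|apply ulim_const]. apply ulim_minus; auto. apply ulim_const. }
  destruct (win_contains S) as [n0 Hn0].
  assert (Wlim : ulim Wk W).
  { intros eps He.
    destruct (pow_lt_1_zero (3 / 4) ltac:(rewrite Rabs_right; lra) (eps / 2 / (2 * Cv + 1)) ltac:(apply Rdiv_lt_0_compat; lra)) as [n1 Hn1].
    set (n := Nat.max n0 n1). specialize (Hn1 n ltac:(lia)). rewrite Rabs_right in Hn1 by (apply Rle_ge, pow_le; lra).
    assert (Lw : ulim (fun k => Rsum (fun j => Mvk k false v S j * powerRZ z j) (win n)) W).
    { replace W with (Rsum (fun j => Mv false v S j * powerRZ z j) (win n)).
      - apply (ulim_Rsum (fun k j => Mvk k false v S j * powerRZ z j) (fun j => Mv false v S j * powerRZ z j)).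
        intros j _. apply ulim_mult; [apply Mv_lim|apply ulim_const].
      - unfold W. apply Rsum_incl; auto using win_NoDup.
        + intros x Hx. apply Hn0, win_In in Hx. apply win_In. lia.
        + intros x _ Hx. rewrite Hout by auto. ring. }
    assert (e2 : 0 < eps / 2) by lra.
    eapply ultra_mono; [|exact (Lw _ e2)]. simpl; intros k Hk. specialize (Tail n k).
    replace (Wk k - W) with ((Wk k - Rsum (fun j => Mvk k false v S j * powerRZ z j) (win n)) + (Rsum (fun j => Mvk k false v S j * powerRZ z j) (win n) - W)) by ring.
    eapply Rle_lt_trans; [apply Rabs_triang|].
    assert (2 * Cv * (3 / 4) ^ n <= eps / 2).
    { apply Rle_trans with (2 * Cv * (eps / 2 / (2 * Cv + 1))); [apply Rmult_le_compat_l; lra|].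
      apply Rle_trans with ((2 * Cv + 1) * (eps / 2 / (2 * Cv + 1))); [apply Rmult_le_compat_r; [left; apply Rdiv_lt_0_compat; lra|lra]|].
      right; field; lra. }
    lra. }
  assert (E := ulim_unique _ _ _ Wsq (ulim_mult _ _ _ _ Wlim Wlim)).
  rewrite <- E. field. lra.
Qed.

(** The squared generating functions would be polynomials of opposite degree parity. *)
Lemma no_finite_image S v : NoDup S -> (forall x, ~ In x S -> Mv false v S x = 0) ->
  forall x, In x S -> v x = 0.
Proof.
  intros ND Hout x Hx.
  destruct (win_contains S) as [n Hn].
  set (enc := fun (f : Z -> R) => map (fun x => (f x, Z.to_nat (x + Z.of_nat n))) S).
  assert (Ee : forall f z, 1 <= z <= 3 / 2 -> LinAlg.peval (LinAlg.lpoly (enc f)) z = z ^ n * Rsum (fun x => f x * powerRZ z x) S).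
  { intros f z Hz. rewrite LinAlg.peval_lpoly. unfold enc. rewrite Rsum_map, <- Rsum_scal.
    apply Rsum_ext; intros y Hy. cbn [fst snd]. apply Hn, win_In in Hy.
    rewrite !pow_powerRZ, Z2Nat.id by lia. rewrite powerRZ_add by lra. ring. }
  assert (H := LinAlg.poly_parity (LinAlg.lpoly (enc (Mv false v S))) (LinAlg.lpoly (enc v)) lam).
  assert (lam <> 0) by (intros E; rewrite E, Rabs_R0 in Hlam; lra).
  specialize (H H0). assert (H1 : LinAlg.pcoef (LinAlg.lpoly (enc v)) (Z.to_nat (x + Z.of_nat n)) = 0); [apply H|].
  - intros z Hz. rewrite !Ee by auto. assert (G := genfun S v z ND Hout Hz).
    assert (forall a p q, a * p = z * (1 - lam * z) * q -> a * (z ^ n * z ^ n * p) = z * (1 - lam * z) * (z ^ n * z ^ n * q)).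
    { intros a p q E. replace (a * (z ^ n * z ^ n * p)) with (z ^ n * z ^ n * (a * p)) by ring. rewrite E; ring. }
    apply H1 in G. etransitivity; [|etransitivity; [exact G|]]; ring.
  - rewrite LinAlg.pcoef_lpoly in H1. unfold enc in H1. rewrite Rsum_map in H1. cbn [fst snd] in H1.
    rewrite <- (Rsum_delta Z.eq_dec v S x ND Hx). etransitivity; [|exact H1].
    apply Rsum_ext; intros y Hy. apply Hn, win_In in Hy. apply Hn, win_In in Hx.
    destruct Z.eq_dec as [->|], Nat.eq_dec; cbn; try reflexivity; exfalso; lia.
Qed.
End Kernel2.

(** * The two-point function of the ground state *)

Lemma adj_ev a n B B' (f : gen -> wf) d l : adj a n B B' -> length l = n ->
  B (fun s => ev (fun g => f g s) d) (emb a l) = ev (fun g => B (f g) (emb a l)) d.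
Proof.
  intros A Hl. rewrite (ker_expand a n B B') by auto. unfold ev.
  rewrite (Rsum_ext _ (fun u => Rsum (fun x => ker a n B l u * (fst x * f (snd x) (emb a u))) d))
    by (intros; now rewrite Rsum_scal).
  rewrite Rsum_swap. apply Rsum_ext; intros x _.
  rewrite (ker_expand a n B B' (f (snd x))) by auto. rewrite <- Rsum_scal.
  apply Rsum_ext; intros; ring.
Qed.

Lemma om_ev a n sig (F : gen -> op) d :
  om a n sig (fun psi s => ev (fun g => F g psi s) d) = ev (fun g => om a n sig (F g)) d.
Proof.
  unfold om, ev. rewrite Rsum_swap. apply Rsum_ext; intros x _. now rewrite Rsum_scal.
Qed.

Lemma par_head a e s : (a < e)%Z -> par a e s = sg (s a) * par (a + 1) e s.
Proof.
  intros H. unfold par. replace (Z.to_nat (e - a)) with (S (Z.to_nat (e - (a + 1)))) by lia.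
  induction (Z.to_nat (e - (a + 1))) as [|n IH].
  - simpl. replace (a + 0)%Z with a by lia. ring.
  - change (pr a (S (S n)) s) with (pr a (S n) s * sg (s (a + Z.of_nat (S n))%Z)). rewrite IH.
    simpl pr. replace (a + 1 + Z.of_nat n)%Z with (a + Z.of_nat (S n))%Z by lia. ring.
Qed.

Lemma pr_ext a n s s' : (forall j, inb a n j -> s j = s' j) -> pr a n s = pr a n s'.
Proof.
  induction n as [|n IH]; simpl; intros H; auto.
  rewrite IH by (intros j Hj; apply H; unfold inb in *; lia). rewrite (H (a + Z.of_nat n)%Z) by (unfold inb; lia). reflexivity.
Qed.

Section Chain.
Variables (J h : R) (rho : Z -> nat -> Op).
Hypothesis G : is_ground_state J h rho.
Hypothesis Hh : 0 < h.
Let lam := J / h.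
Hypothesis Hlam : 0 < Rabs lam < 1 / 100.

(** The block [-N-1, N+1]. Generators at sites |j| <= N keep one site of margin on each side, as the
    ground state condition demands. *)
Definition bs (N : nat) : Z := (- Z.of_nat N - 1)%Z.
Definition bl (N : nat) : nat := (2 * N + 1 + 2)%nat.
Definition chain_om (N : nat) (F : op) : R := om (bs N) (bl N) (sr rho (bs N) (bl N)) F.
Definition gm (N : nat) (g : gen) : op := gam (bs N) g.
Definition inN (N : nat) (g : gen) : Prop := (Z.abs (snd g) <= Z.of_nat N)%Z.
Definition HN (N : nat) : op := Hop J h (bs N) (bl N).
Notation adjN N := (adj (bs N) (bl N)).

Lemma DN N : density (bl N) (sr rho (bs N) (bl N)).
Proof. apply (sr_density J h rho G). Qed.

Lemma adj_gm N g : inN N g -> adjN N (gm N g) (fun psi s => eta g * gm N g psi s).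
Proof. intros H. apply adj_gam. unfold inN, inb, bs, bl in *. lia. Qed.

Lemma gm_sq N g psi s : inN N g -> gm N g (gm N g psi) s = eta g * psi s.
Proof. intros H. apply gam_sq. unfold inN, bs in *. lia. Qed.

Lemma gm_anti N g g' psi s : inN N g -> inN N g' -> g <> g' -> gm N g (gm N g' psi) s = - gm N g' (gm N g psi) s.
Proof. intros H H' E. apply gam_anti; auto; unfold inN, bs in *; lia. Qed.

Lemma gm_lin N g (f f' : wf) c s : gm N g (fun u => f u + c * f' u) s = gm N g f s + c * gm N g f' s.
Proof. apply gam_lin. Qed.

Lemma gm_scal N g (f : wf) c s : gm N g (fun u => c * f u) s = c * gm N g f s.
Proof. unfold gm, gam. ring. Qed.

Lemma gm_ev N g (f : gen -> wf) d s : gm N g (fun u => ev (fun x => f x u) d) s = ev (fun x => gm N g (f x) s) d.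
Proof. unfold gm, gam, ev. rewrite <- Rsum_scal. apply Rsum_ext; intros; ring. Qed.

(** Only two terms of the Hamiltonian fail to commute with a generator: the bond straddling the end
    of its string and the field at its site. Each of them yields one generator of the other type. *)
Lemma HN_comm N g psi s : inN N g ->
  HN N (gm N g psi) s = gm N g (HN N psi) s + - (2) * h * Dg lam (fun u => gm N u psi s) g.
Proof.
  intros Hin. unfold inN in Hin. destruct g as [b j]; cbn [snd] in Hin.
  set (e := send (b, j)). assert (He : e = if b then j else (j + 1)%Z) by reflexivity.
  assert (EX : Rsum (fun k => gm N (b, j) psi (flip (bs N + Z.of_nat (S k)) (flip (bs N + Z.of_nat k) s))) (seq 0 (bl N - 1))
    = par (bs N) e s * Rsum (fun k => psi (flip (bs N + Z.of_nat (S k)) (flip (bs N + Z.of_nat k) (flip j s)))) (seq 0 (bl N - 1))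
      + (-2) * gm N (negb b, if b then (j - 1)%Z else (j + 1)%Z) psi s).
  { assert (Hp : forall k, In k (seq 0 (bl N - 1)) ->
      gm N (b, j) psi (flip (bs N + Z.of_nat (S k)) (flip (bs N + Z.of_nat k) s)) =
      par (bs N) e s * psi (flip (bs N + Z.of_nat (S k)) (flip (bs N + Z.of_nat k) (flip j s))) +
      (if Nat.eq_dec k (Z.to_nat (e - 1 - bs N)) then (-2) * gm N (negb b, if b then (j - 1)%Z else (j + 1)%Z) psi s else 0)).
    { intros k Hk. apply in_seq in Hk. unfold gm at 1, gam. fold e. cbn [snd].
      rewrite (flip_comm j), (flip_comm j).
      destruct (Nat.eq_dec k (Z.to_nat (e - 1 - bs N))) as [Ek|Nk].
      - assert (E1 : (bs N + Z.of_nat (S k))%Z = e) by (subst; unfold bs, bl in *; destruct b; lia).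
        assert (E2 : (bs N + Z.of_nat k)%Z = (e - 1)%Z) by (subst; unfold bs, bl in *; destruct b; lia).
        rewrite E1, E2.
        rewrite par_flip_out by lia. rewrite par_flip_in by (unfold bs in *; subst; destruct b; lia).
        unfold gm, gam, send; destruct b; cbn [fst snd negb]; rewrite He.
        + replace (j - 1 + 1)%Z with j by lia.
          rewrite (flip_comm j (j - 1)), flip_flip. ring.
        + replace (j + 1 - 1)%Z with j by lia. rewrite flip_flip. ring.
      - rewrite Rplus_0_r. f_equal.
        destruct (Z_lt_le_dec (bs N + Z.of_nat (S k)) e).
        + rewrite !par_flip_in by lia. ring.
        + rewrite !par_flip_out by (unfold bs, bl in *; lia). reflexivity. }
    rewrite (Rsum_ext _ _ _ Hp), Rsum_plus, Rsum_scal. f_equal.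
    rewrite (Rsum_delta Nat.eq_dec (fun _ => (-2) * gm N (negb b, if b then (j - 1)%Z else (j + 1)%Z) psi s)); auto using seq_NoDup.
    apply in_seq. unfold bs, bl in *. subst e. destruct b; unfold send; cbn [fst snd]; lia. }
  assert (EZ : Rsum (fun k => sg (s (bs N + Z.of_nat k)%Z) * gm N (b, j) psi s) (seq 0 (bl N))
    = par (bs N) e s * Rsum (fun k => sg (flip j s (bs N + Z.of_nat k)%Z) * psi (flip j s)) (seq 0 (bl N))
      + 2 * gm N (negb b, j) psi s).
  { assert (Hp : forall k, In k (seq 0 (bl N)) ->
      sg (s (bs N + Z.of_nat k)%Z) * gm N (b, j) psi s =
      par (bs N) e s * (sg (flip j s (bs N + Z.of_nat k)%Z) * psi (flip j s)) +
      (if Nat.eq_dec k (Z.to_nat (j - bs N)) then 2 * gm N (negb b, j) psi s else 0)).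
    { intros k Hk. apply in_seq in Hk. unfold gm at 1, gam. fold e. cbn [snd].
      destruct (Nat.eq_dec k (Z.to_nat (j - bs N))) as [Ek|Nk].
      - assert (E1 : (bs N + Z.of_nat k)%Z = j) by (subst; unfold bs in *; lia).
        rewrite E1, flip_same, sg_negb. unfold gm, gam, send; destruct b; cbn [fst snd negb]; rewrite He.
        + rewrite par_S by (unfold bs in *; lia). ring.
        + rewrite par_S by (unfold bs in *; lia).
          transitivity (par (bs N) j s * psi (flip j s) * (sg (s j) * sg (s j))); [ring|].
          transitivity (par (bs N) j s * psi (flip j s) * (2 - sg (s j) * sg (s j))); [rewrite sg_sq; ring|ring].
      - rewrite flip_other by (unfold bs in *; lia). ring. }
    rewrite (Rsum_ext _ _ _ Hp), Rsum_plus, Rsum_scal. f_equal.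
    rewrite (Rsum_delta Nat.eq_dec (fun _ => 2 * gm N (negb b, j) psi s)); auto using seq_NoDup.
    apply in_seq. unfold bs, bl in *. lia. }
  unfold HN, Hop. rewrite EX, EZ.
  assert (EJ : J = lam * h) by (unfold lam; field; lra).
  unfold gm at 3, gam. fold e. cbn [snd]. unfold Dg. destruct b; cbn [fst snd negb] in *; rewrite EJ; ring.
Qed.

Definition ph N (l : vec) : op := fun psi s => ev (fun g => gm N g psi s) l.
Definition pht N (l : vec) : op := fun psi s => ev (fun g => eta g * gm N g psi s) l.
Definition inv N (l : vec) : Prop := forall x, In x l -> inN N (snd x).

Lemma adj_ph N l : inv N l -> adjN N (ph N l) (pht N l).
Proof.
  intros H. unfold ph, pht, ev.
  apply (adj_Rsum (bs N) (bl N) l (fun x psi s => fst x * gm N (snd x) psi s) (fun x psi s => fst x * (eta (snd x) * gm N (snd x) psi s))).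
  intros x Hx. apply (adj_scal _ _ (gm N (snd x)) (fun psi s => eta (snd x) * gm N (snd x) psi s)).
  now apply adj_gm, H.
Qed.

Definition cN (N : nat) (g g' : gen) : R := chain_om N (fun psi s => eta g * gm N g (gm N g' psi) s).

Lemma cN_ph N l m : chain_om N (fun psi => pht N l (ph N m psi)) = ev (fun g => ev (cN N g) m) l.
Proof.
  unfold pht, chain_om. rewrite om_ev. apply ev_ext; intros g.
  transitivity (om (bs N) (bl N) (sr rho (bs N) (bl N)) (fun psi s => ev (fun g' => eta g * gm N g (gm N g' psi) s) m)).
  - apply om_ext; intros psi l' _. unfold ph. rewrite (gm_ev N g (fun x => gm N x psi)).
    unfold ev. rewrite <- Rsum_scal. apply Rsum_ext; intros; cbn beta; ring.
  - now rewrite om_ev.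
Qed.

Lemma adj_pair N g g' : inN N g -> inN N g' ->
  adjN N (fun psi s => eta g * gm N g (gm N g' psi) s) (fun psi s => eta g' * gm N g' (gm N g psi) s).
Proof.
  intros H H'.
  eapply adj_ext; [apply (adj_comp _ _ _ _ _ _ (adj_sym _ _ _ _ (adj_gm N g H)) (adj_gm N g' H'))| |];
  simpl; intros; [reflexivity|]. reflexivity.
Qed.

Lemma cN_sym N g g' : inN N g -> inN N g' -> cN N g g' = cN N g' g.
Proof. intros H H'. symmetry. unfold cN, chain_om. apply (om_adj _ _ _ (DN N)), adj_pair; auto. Qed.

Lemma om_norm N g : inN N g -> chain_om N (fun psi s => eta g * gm N g (gm N g psi) s) = 1.
Proof.
  intros H. rewrite <- (om_one (bs N) _ _ (DN N)). apply om_ext; intros. rewrite gm_sq by auto.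
  rewrite <- Rmult_assoc, eta_sq; ring.
Qed.

Lemma om_CS_N N F F' E E' : adjN N F F' -> adjN N E E' ->
  chain_om N (fun psi => F' (F psi)) <= 1 -> chain_om N (fun psi => E' (E psi)) <= 1 ->
  Rabs (chain_om N (fun psi => F' (E psi))) <= 1.
Proof.
  intros A1 A2 B1 B2. assert (C := om_CS _ _ _ (DN N) F F' E E' A1 A2).
  assert (P1 := om_pos _ _ _ (DN N) F F' A1). assert (P2 := om_pos _ _ _ (DN N) E E' A2).
  fold (chain_om N (fun psi => F' (E psi))) in C. unfold chain_om in B1, B2. unfold Rsqr in C.
  set (X := chain_om N (fun psi => F' (E psi))) in *.
  assert (X * X <= 1) by nra. apply Rabs_le. nra.
Qed.

Lemma cN_bd N g g' : inN N g -> inN N g' -> Rabs (cN N g g') <= 1.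
Proof.
  intros H H'.
  apply (om_CS_N N (gm N g) (fun psi s => eta g * gm N g psi s) (gm N g') (fun psi s => eta g' * gm N g' psi s));
    auto using adj_gm.
  - right. apply om_norm; auto.
  - right. apply om_norm; auto.
Qed.

(** For distinct sites the value is antisymmetric by anticommutation and symmetric by [cN_sym]. *)
Lemma cN_aa N i j : inN N (true, i) -> inN N (true, j) -> cN N (true, i) (true, j) = if Z.eq_dec i j then 1 else 0.
Proof.
  intros H H'. destruct (Z.eq_dec i j) as [->|NE].
  - apply om_norm; auto.
  - assert (E := cN_sym N _ _ H H'). 
    assert (E2 : cN N (true, j) (true, i) = - cN N (true, i) (true, j)).
    { transitivity (0 + (-1) * cN N (true, i) (true, j)); [|ring].
      unfold cN, chain_om. replace 0 with (om (bs N) (bl N) (sr rho (bs N) (bl N)) (fun _ _ => 0)) by (apply Rsum_zero; auto).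
      rewrite <- om_lin. apply om_ext; intros. unfold eta; cbn [fst].
      rewrite gm_anti by (auto; congruence). ring. }
    lra.
Qed.

Lemma eventually_in g : ultra (fun N => inN N g).
Proof. eapply ultra_mono; [|exact (ultra_ge (Z.abs_nat (snd g)))]. intros n Hn; unfold inN; simpl in *. lia. Qed.

Lemma eventually_inv l : ultra (fun N => inv N l).
Proof.
  induction l as [|x l IH].
  - apply ultra_all. intros n y [].
  - eapply ultra_mono; [|exact (ultra_and _ _ IH (eventually_in (snd x)))].
    intros n [H1 H2] y [<-|Hy]; auto.
Qed.

Definition cc (g g' : gen) : R := LIM (fun N => cN N g g').

Lemma cc_lim g g' : ulim (fun N => cN N g g') (cc g g').
Proof.
  apply ulim_LIM. exists 1. eapply ultra_mono; [|exact (ultra_and _ _ (eventually_in g) (eventually_in g'))].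
  intros n [H H']. now apply cN_bd.
Qed.

Lemma cc_ev_lim l m : ulim (fun N => ev (fun g => ev (cN N g) m) l) (ev (fun g => ev (cc g) m) l).
Proof.
  apply (ulim_Rsum (fun N x => fst x * ev (cN N (snd x)) m) (fun x => fst x * ev (cc (snd x)) m)).
  intros x _. apply ulim_scal.
  apply (ulim_Rsum (fun N y => fst y * cN N (snd x) (snd y)) (fun y => fst y * cc (snd x) (snd y))).
  intros y _. apply ulim_scal, cc_lim.
Qed.

Lemma cc_sym g g' : cc g g' = cc g' g.
Proof.
  apply (ulim_unique (fun N => cN N g' g)); [|apply cc_lim].
  eapply ulim_ext; [|apply cc_lim]. eapply ultra_mono; [|exact (ultra_and _ _ (eventually_in g) (eventually_in g'))].
  intros n [H H']. now apply cN_sym.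
Qed.

Lemma cc_bd g g' : Rabs (cc g g') <= 1.
Proof.
  apply (ulim_le (fun N => Rabs (cN N g g')) (fun _ => 1)).
  - apply ulim_abs, cc_lim.
  - apply ulim_const.
  - eapply ultra_mono; [|exact (ultra_and _ _ (eventually_in g) (eventually_in g'))].
    intros n [H H']. now apply cN_bd.
Qed.

Lemma cc_aa i j : cc (true, i) (true, j) = if Z.eq_dec i j then 1 else 0.
Proof.
  apply (ulim_unique (fun N => cN N (true, i) (true, j))); [apply cc_lim|].
  eapply ulim_ext; [|apply ulim_const].
  eapply ultra_mono; [|exact (ultra_and _ _ (eventually_in (true, i)) (eventually_in (true, j)))].
  intros n [H H']. cbn beta. now rewrite cN_aa.
Qed.

Lemma cc_pos l : 0 <= Cf cc l l.
Proof.
  apply (ulim_le (fun _ => 0) (fun N => ev (fun g => ev (cN N g) l) l)); [apply ulim_const|apply cc_ev_lim|].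
  eapply ultra_mono; [|exact (eventually_inv l)]. intros N H. rewrite <- cN_ph.
  apply (om_pos _ _ _ (DN N)). now apply adj_ph.
Qed.

(** * Local operators *)

Notation locN N := (loc (- Z.of_nat N) (2 * N + 1)).

Lemma bs_inner N : (- Z.of_nat N - 1)%Z = bs N. Proof. reflexivity. Qed.

Lemma loc_pair N g g' : inN N g -> inN N g' -> locN N (fun psi => gm N g (gm N g' psi)).
Proof.
  intros H H'. unfold inN in *. split.
  - intros chi psi s Hc. unfold gm, gam. rewrite !Hc by (unfold inb; lia). ring.
  - intros psi Hpsi s s' Hs. unfold gm, gam.
    assert (Q : forall u u', (forall j, inb (- Z.of_nat N) (2 * N + 1) j -> u j = u' j) ->
       forall e, (- Z.of_nat N <= e <= Z.of_nat N + 1)%Z -> par (bs N + 1) e u = par (bs N + 1) e u').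
    { intros u u' Hu e He. unfold par. apply pr_ext. intros j Hj. apply Hu. unfold inb, bs in *. lia. }
    assert (Hf : forall j, inb (- Z.of_nat N) (2 * N + 1) j -> flip (snd g) s j = flip (snd g) s' j).
    { intros j Hj. unfold flip. rewrite Hs by auto. reflexivity. }
    assert (Ee : forall g0 : gen, (Z.abs (snd g0) <= Z.of_nat N)%Z -> (- Z.of_nat N <= send g0 <= Z.of_nat N + 1)%Z).
    { intros [[] j0] Hj; unfold send; cbn [fst snd] in *; lia. }
    assert (Eg := Ee g H). assert (Eg' := Ee g' H').
    (* Both strings contain the spin at the leftmost site [bs N]; this factor is split off and
       squares to one, so the product does not see that site. *)
    rewrite !(par_head (bs N)) by (unfold bs; lia).
    rewrite (Q s s' Hs), (Q _ _ Hf) by auto.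
    rewrite (Hpsi (flip (snd g') (flip (snd g) s)) (flip (snd g') (flip (snd g) s'))).
    2:{ intros j Hj. unfold flip at 1 3. rewrite Hf by auto. reflexivity. }
    rewrite !flip_other by (unfold bs; lia).
    transitivity (sg (s (bs N)) * sg (s (bs N)) * (par (bs N + 1) (send g) s' * (par (bs N + 1) (send g') (flip (snd g) s') * psi (flip (snd g') (flip (snd g) s'))))); [ring|].
    rewrite sg_sq. 
    transitivity (sg (s' (bs N)) * sg (s' (bs N)) * (par (bs N + 1) (send g) s' * (par (bs N + 1) (send g') (flip (snd g) s') * psi (flip (snd g') (flip (snd g) s'))))); [rewrite sg_sq; ring|ring].
Qed.

Lemma loc_Rsum {A} N (F : A -> op) l : (forall x, In x l -> locN N (F x)) -> locN N (fun psi s => Rsum (fun x => F x psi s) l).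
Proof.
  intros H. split.
  - intros chi psi s Hc. rewrite <- Rsum_scal. apply Rsum_ext; intros x Hx. now apply (loc_out _ _ _ (H x Hx)).
  - intros psi Hp s s' Hs. apply Rsum_ext; intros x Hx. now apply (loc_in _ _ _ (H x Hx)).
Qed.

Lemma loc_scal N F c : locN N F -> locN N (fun psi s => c * F psi s).
Proof.
  intros H. split.
  - intros chi psi s Hc. rewrite (loc_out _ _ _ H) by auto. ring.
  - intros psi Hp s s' Hs. now rewrite (loc_in _ _ _ H psi Hp s s').
Qed.

Lemma loc_ph2 N l m : inv N l -> inv N m -> locN N (fun psi => ph N l (ph N m psi)).
Proof.
  intros Hl Hm.
  assert (E : (fun psi => ph N l (ph N m psi)) = fun psi s => Rsum (fun x => Rsum (fun y => fst x * (fst y * gm N (snd x) (gm N (snd y) psi) s)) m) l).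
  { extensionality psi. extensionality s. unfold ph at 1, ev. apply Rsum_ext; intros x _. unfold ph.
    rewrite gm_ev. unfold ev. now rewrite Rsum_scal. }
  rewrite E. apply (loc_Rsum N (fun x psi s => Rsum (fun y => fst x * (fst y * gm N (snd x) (gm N (snd y) psi) s)) m)).
  intros x Hx. apply (loc_Rsum N (fun y psi s => fst x * (fst y * gm N (snd x) (gm N (snd y) psi) s))).
  intros y Hy. apply (loc_scal N (fun psi s => fst y * gm N (snd x) (gm N (snd y) psi) s)).
  apply (loc_scal N (fun psi s => gm N (snd x) (gm N (snd y) psi) s)). apply loc_pair; auto.
Qed.

Lemma bl_eq N : (2 * N + 1 + 2)%nat = bl N. Proof. reflexivity. Qed.

Lemma Dg_scal (c : R) F g : Dg lam (fun u => c * F u) g = c * Dg lam F g.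
Proof. unfold Dg; destruct (fst g); ring. Qed.

Lemma om_scalN N c F : chain_om N (fun psi s => c * F psi s) = c * chain_om N F.
Proof. unfold chain_om, om. now rewrite Rsum_scal. Qed.
Lemma om_plusN N F E : chain_om N (fun psi s => F psi s + E psi s) = chain_om N F + chain_om N E.
Proof. unfold chain_om, om. now rewrite Rsum_plus. Qed.
Lemma om_extN N F E : (forall psi s, F psi s = E psi s) -> chain_om N F = chain_om N E.
Proof. intros H. apply om_ext; intros; apply H. Qed.

Lemma om_Dg N (K : gen -> op) g : chain_om N (fun psi s => Dg lam (fun u => K u psi s) g) = Dg lam (fun u => chain_om N (K u)) g.
Proof.
  unfold Dg. destruct (fst g).
  - rewrite (om_extN N _ (fun psi s => K (false, snd g) psi s + (- lam) * K (false, (snd g - 1)%Z) psi s)) by (intros; ring).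
    rewrite om_plusN, om_scalN. replace (fun psi s => K (false, snd g) psi s) with (K (false, snd g)) by reflexivity. ring.
  - rewrite (om_extN N _ (fun psi s => K (true, snd g) psi s + (- lam) * K (true, (snd g + 1)%Z) psi s)) by (intros; ring).
    rewrite om_plusN, om_scalN. ring.
Qed.

(** Stationarity for the local product of two generators; the sign [eta], which D reverses, turns
    the commutator with the first factor into D acting on the first argument with a minus sign. *)
Lemma cN_comm N g g' : inN N g -> inN N g' -> 
  Dg lam (fun u => cN N u g') g = Dg lam (cN N g) g'.
Proof.
  intros H H'.
  assert (A := adj_pair N g g' H H').
  assert (L : locN N (fun psi s => eta g * gm N g (gm N g' psi) s)) by (apply (loc_scal N (fun psi s => gm N g (gm N g' psi) s)), loc_pair; auto).
  assert (St := ground_stat J h rho G (- Z.of_nat N) (2 * N + 1) _ _ L A).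
  rewrite bs_inner, bl_eq in St.
  change (chain_om N (cm (HN N) (fun psi s => eta g * gm N g (gm N g' psi) s)) = 0) in St.
  assert (E : chain_om N (cm (HN N) (fun psi s => eta g * gm N g (gm N g' psi) s)) =
    - (2) * h * (Dg lam (cN N g) g' - Dg lam (fun u => cN N u g') g)).
  { transitivity (chain_om N (fun psi s => - (2) * h * Dg lam (fun u => eta g * gm N g (gm N u psi) s) g' +
       (- (2) * h) * Dg lam (fun u => - (eta u * gm N u (gm N g' psi) s)) g)).
    - apply om_extN; intros psi s. unfold cm.
      assert (HS : forall f, HN N (fun u => eta g * f u) s = eta g * HN N f s).
      { intros f. unfold HN, Hop. 
        assert (Z1 : forall (ff : nat -> R) l, Rsum (fun k => eta g * ff k) l = eta g * Rsum ff l) by (intros; apply Rsum_scal).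
        rewrite (Z1 (fun k => f (flip (bs N + Z.of_nat (S k)) (flip (bs N + Z.of_nat k) s)))).
        rewrite (Rsum_ext _ (fun k => eta g * (sg (s (bs N + Z.of_nat k)%Z) * f s)) (seq 0 (bl N))) by (intros; ring).
        rewrite Z1. ring. }
      rewrite HS, HN_comm by auto.
      replace (HN N (gm N g' psi)) with (fun v => gm N g' (HN N psi) v + (- (2) * h) * Dg lam (fun u => gm N u psi v) g')
        by (extensionality v; rewrite HN_comm by auto; ring).
      rewrite gm_lin.
      assert (E1 : gm N g (fun v => Dg lam (fun u => gm N u psi v) g') s = Dg lam (fun u => gm N g (gm N u psi) s) g').
      { unfold gm at 1, gam at 1. unfold Dg. destruct (fst g'); unfold gm, gam; ring. }
      rewrite E1.
      assert (E2 : eta g * Dg lam (fun u => gm N u (gm N g' psi) s) g = Dg lam (fun u => - (eta u * gm N u (gm N g' psi) s)) g).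
      { unfold Dg, eta. destruct g as [[] j]; cbn [fst snd]; ring. }
      rewrite <- E2, (Dg_scal (eta g) (fun u => gm N g (gm N u psi) s)). ring.
    - rewrite om_plusN, !om_scalN, (om_Dg N (fun u psi s => eta g * gm N g (gm N u psi) s) g').
      rewrite (om_Dg N (fun u psi s => - (eta u * gm N u (gm N g' psi) s)) g).
      assert (E3 : Dg lam (fun u => chain_om N (fun psi s => - (eta u * gm N u (gm N g' psi) s))) g = - Dg lam (fun u => cN N u g') g).
      { transitivity (Dg lam (fun u => (-1) * cN N u g') g).
        - f_equal. extensionality u. unfold cN. rewrite <- om_scalN. apply om_extN; intros; ring.
        - rewrite Dg_scal. ring. }
      rewrite E3. unfold cN at 1. 
      change (fun u => chain_om N (fun psi s => eta g * gm N g (gm N u psi) s)) with (cN N g).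
      unfold cN. ring. }
  rewrite E in St. nra.
Qed.

Lemma Dg_lim (K : nat -> gen -> R) (k : gen -> R) g : (forall u, ulim (fun N => K N u) (k u)) ->
  ulim (fun N => Dg lam (K N) g) (Dg lam k g).
Proof. intros H. unfold Dg. destruct (fst g); (apply ulim_minus; [apply H|apply ulim_scal, H]). Qed.

Lemma cc_comm g g' : Dg lam (fun u => cc u g') g = Dg lam (cc g) g'.
Proof.
  apply (ulim_unique (fun N => Dg lam (cN N g) g')).
  - eapply ulim_ext; [|apply (Dg_lim (fun N u => cN N u g')); intros; apply cc_lim].
    eapply ultra_mono; [|exact (ultra_and _ _ (eventually_in g) (eventually_in g'))].
    intros N [H H']. now apply cN_comm.
  - apply Dg_lim. intros; apply cc_lim.
Qed.
End Chain.

Lemma adj_lin_emb a n B B' (f g : wf) c d l : adj a n B B' -> length l = n ->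
  B (fun s => c * f s + d * g s) (emb a l) = c * B f (emb a l) + d * B g (emb a l).
Proof.
  intros A Hl. rewrite !(ker_expand a n B B') by auto. rewrite <- !Rsum_scal, <- Rsum_plus.
  apply Rsum_ext; intros; ring.
Qed.

Lemma Hop_ev J h a m (f : gen -> wf) d s :
  Hop J h a m (fun u => ev (fun g => f g u) d) s = ev (fun g => Hop J h a m (f g) s) d.
Proof.
  unfold Hop, ev.
  assert (E1 : Rsum (fun k => Rsum (fun x => fst x * f (snd x) (flip (a + Z.of_nat (S k)) (flip (a + Z.of_nat k) s))) d) (seq 0 (m - 1))
    = Rsum (fun x => fst x * Rsum (fun k => f (snd x) (flip (a + Z.of_nat (S k)) (flip (a + Z.of_nat k) s))) (seq 0 (m - 1))) d).
  { rewrite Rsum_swap. apply Rsum_ext; intros. now rewrite Rsum_scal. }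
  assert (E2 : Rsum (fun k => sg (s (a + Z.of_nat k)%Z) * Rsum (fun x => fst x * f (snd x) s) d) (seq 0 m)
    = Rsum (fun x => fst x * Rsum (fun k => sg (s (a + Z.of_nat k)%Z) * f (snd x) s) (seq 0 m)) d).
  { rewrite (Rsum_ext _ (fun k => Rsum (fun x => fst x * (sg (s (a + Z.of_nat k)%Z) * f (snd x) s)) d)).
    - rewrite Rsum_swap. apply Rsum_ext; intros. now rewrite Rsum_scal.
    - intros k _. rewrite <- Rsum_scal. apply Rsum_ext; intros; ring. }
  rewrite E1, E2, <- !Rsum_scal, <- Rsum_minus. apply Rsum_ext; intros; ring.
Qed.

(** * From local even operators to odd ones *)

Section Slow.
Variable lam : R.
Definition Dl (u : vec) : vec :=
  map (fun x => (fst x, sw (snd x))) u ++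
  map (fun x => (- lam * fst x, (negb (fst (snd x)), if fst (snd x) then (snd (snd x) - 1)%Z else (snd (snd x) + 1)%Z))) u.

Lemma ev_Dl F u : ev F (Dl u) = ev (Dg lam F) u.
Proof.
  unfold Dl. rewrite ev_app. unfold ev. rewrite !Rsum_map, <- Rsum_plus. apply Rsum_ext; intros [c [[] j]] _;
  unfold Dg, sw; cbn [fst snd negb]; ring.
Qed.

(** A test wave at the bottom of the spectrum of |D|, multiplied with odd operators to turn the
    ground state inequality for even operators into an inequality for odd ones. *)
Fixpoint slow (sig : R) (m : nat) : vec :=
  match m with O => [] | S m' => (sig ^ m', (true, Z.of_nat m')) :: slow sig m' end.

Lemma slow_true sig m x : In x (slow sig m) -> fst (snd x) = true.
Proof. induction m as [|m IH]; simpl; [tauto|]. intros [<-|H]; auto. Qed.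
Lemma Dl_slow_false sig m x : In x (Dl (slow sig m)) -> fst (snd x) = false.
Proof.
  unfold Dl. rewrite in_app_iff, !in_map_iff. intros [[y [<- Hy]]|[y [<- Hy]]]; apply slow_true in Hy; destruct y as [r [b j]]; simpl in *; subst; reflexivity.
Qed.

Lemma slow_norm sig m : sig * sig = 1 -> ev (fun g => ev (del g) (slow sig m)) (slow sig m) = INR m.
Proof.
  intros Hs.
  assert (H0 : forall p m, (m <= p)%nat -> ev (del (true, Z.of_nat p)) (slow sig m) = 0).
  { intros p k. induction k as [|k IH]; intros Hk; [reflexivity|].
    simpl slow. unfold ev in *. rewrite Rsum_cons, IH by lia. cbn [fst snd]. rewrite del_eq. simpl.
    destruct (Z.eqb_spec (Z.of_nat p) (Z.of_nat k)); [lia|ring]. }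
  assert (H1 : forall m, ev (fun g => del g (true, Z.of_nat m)) (slow sig m) = 0).
  { intros k. rewrite <- (H0 k k) by lia. apply ev_ext; intros g. unfold del. destruct gen_eq_dec, gen_eq_dec; congruence. }
  induction m as [|m IH]; [reflexivity|].
  rewrite S_INR, <- IH. simpl slow at 2. unfold ev at 1. rewrite Rsum_cons. cbn [fst snd].
  fold (ev (fun g => ev (del g) (slow sig (S m))) (slow sig m)).
  assert (E : forall g, ev (del g) (slow sig (S m)) = sig ^ m * del g (true, Z.of_nat m) + 1 * ev (del g) (slow sig m)).
  { intros g. simpl slow. unfold ev. rewrite Rsum_cons. cbn [fst snd]. ring. }
  rewrite (ev_ext _ _ (slow sig m) E), ev_lin, E, H0 by lia.
  assert (E2 : ev (fun g => sig ^ m * del g (true, Z.of_nat m)) (slow sig m) = 0).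
  { transitivity (sig ^ m * ev (fun g => del g (true, Z.of_nat m)) (slow sig m)).
    - unfold ev. rewrite <- Rsum_scal. apply Rsum_ext; intros; ring.
    - rewrite H1; ring. }
  rewrite E2, del_eq, Z.eqb_refl. simpl.
  assert (E3 : sig ^ m * sig ^ m = 1) by (rewrite <- Rpow_mult_distr, Hs; apply pow1).
  transitivity (sig ^ m * sig ^ m + ev (fun g => ev (del g) (slow sig m)) (slow sig m)); [ring|]. rewrite E3. ring.
Qed.

(** Matrix elements of D^2 between generators of type [true]. *)
Definition PP (i j : Z) : R := Dg lam (fun g => Dg lam (del g) (true, j)) (true, i).
Lemma PP_eq i j : PP i j = (1 + lam * lam) * (if Z.eqb i j then 1 else 0)
  - lam * (if Z.eqb i (j - 1) then 1 else 0) - lam * (if Z.eqb (i - 1) j then 1 else 0).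
Proof.
  unfold PP, Dg; cbn [fst snd]. rewrite !del_eq; simpl.
  repeat match goal with |- context [Z.eqb ?x ?y] => destruct (Z.eqb_spec x y) end; try ring; exfalso; lia.
Qed.

(** Each of the m + 1 sites contributes 1 + lam^2 and each of the m bonds -2 |lam|, as [sig] has the
    sign of [lam]; the missing bond is the surplus 2 |lam|. *)
Lemma slow_energy sig m : sig * sig = 1 -> sig * lam = Rabs lam ->
  ev (fun g => ev (del g) (Dl (slow sig (S m)))) (Dl (slow sig (S m))) =
  INR (S m) * ((1 - Rabs lam) * (1 - Rabs lam)) + 2 * Rabs lam.
Proof.
  intros Hs Hl.
  set (nb := fun u v => ev (Dg lam (fun g => ev (Dg lam (del g)) v)) u).
  assert (E0 : forall u v, ev (fun g => ev (del g) (Dl v)) (Dl u) = nb u v).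
  { intros u v. rewrite ev_Dl. unfold nb. f_equal. f_equal. extensionality g. apply ev_Dl. }
  rewrite E0.
  assert (Ec : forall c g u v, nb ((c, g) :: u) v = c * nb (e1 g) v + nb u v).
  { intros. unfold nb, ev. rewrite !Rsum_cons. cbn [fst snd]. unfold e1. rewrite Rsum_cons. cbn [fst snd]. change (Rsum _ []) with 0. ring. }
  assert (Esym : forall u v, nb u v = nb v u).
  { intros u v. rewrite <- !E0, ev_swap. apply ev_ext; intros g. apply ev_ext; intros g'.
    unfold del. destruct gen_eq_dec, gen_eq_dec; congruence. }
  assert (Epp : forall i j, nb (e1 (true, i)) (e1 (true, j)) = PP i j).
  { intros. unfold nb, PP. rewrite ev_e1. f_equal. extensionality g. apply ev_e1. }
  assert (T : forall p k, (k <= p)%nat -> nb (e1 (true, Z.of_nat p)) (slow sig k) =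
     if Nat.eqb p k then match k with O => 0 | S k' => - lam * sig ^ k' end else 0).
  { intros p k. induction k as [|k IH]; intros Hk.
    - transitivity 0; [|destruct (Nat.eqb p 0); reflexivity]. rewrite Esym. reflexivity.
    - simpl slow. rewrite Esym, Ec, (Esym (slow sig k)), IH by lia.
      rewrite (Esym (e1 _)), Epp, PP_eq.
      destruct (Nat.eqb_spec p k); [lia|].
      destruct (Z.eqb_spec (Z.of_nat p) (Z.of_nat k)), (Z.eqb_spec (Z.of_nat p) (Z.of_nat k - 1)); try lia.
      destruct (Nat.eqb_spec p (S k)), (Z.eqb_spec (Z.of_nat p - 1) (Z.of_nat k)); try lia; ring. }
  assert (St : forall k, nb (slow sig (S k)) (slow sig (S k)) =
      sig ^ k * sig ^ k * (1 + lam * lam) + 2 * sig ^ k * (match k with O => 0 | S k' => - lam * sig ^ k' end) + nb (slow sig k) (slow sig k)).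
  { intros k. simpl slow. rewrite Ec, (Esym (e1 _)), Ec, Epp, PP_eq, (Esym (slow sig k) (e1 _)), T, Nat.eqb_refl by lia.
    rewrite (Esym (slow sig k) (_ :: _)), Ec, T, Nat.eqb_refl by lia.
    rewrite Z.eqb_refl. destruct (Z.eqb_spec (Z.of_nat k) (Z.of_nat k - 1)), (Z.eqb_spec (Z.of_nat k - 1) (Z.of_nat k)); try lia.
    ring. }
  assert (Hp : forall k, sig ^ k * sig ^ k = 1) by (intros; rewrite <- Rpow_mult_distr, Hs; apply pow1).
  induction m as [|m IH].
  - rewrite St. simpl. change (nb [] []) with 0. rewrite <- (Rabs_sq lam). ring.
  - rewrite St, IH, Hp. rewrite !S_INR.
    replace (2 * sig ^ S m * (- lam * sig ^ m)) with (- (2) * (sig * lam) * (sig ^ m * sig ^ m)) by (simpl; ring).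
    rewrite Hp, Hl, <- (Rabs_sq lam). ring.
Qed.
End Slow.

Section Chain2.
Variables (J h : R) (rho : Z -> nat -> Op).
Hypothesis G : is_ground_state J h rho.
Hypothesis Hh : 0 < h.
Let lam := J / h.
Hypothesis Hlam : 0 < Rabs lam < 1 / 100.
Notation adjN N := (adj (bs N) (bl N)).
Notation omN := (chain_om rho).
Notation cN := (cN rho).
Notation cc := (cc rho).
Notation HN := (HN J h).

Lemma ph_sq N u psi s : inv N u -> ph N u (ph N u psi) s = ev (fun g => ev (fun g' => eta g * del g g') u) u * psi s.
Proof.
  intros Hu.
  assert (E : ph N u (ph N u psi) s = ev (fun g => ev (fun g' => gm N g (gm N g' psi) s) u) u).
  { unfold ph at 1. apply ev_ext; intros g. unfold ph. apply (gm_ev N g (fun x => gm N x psi)). }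
  assert (E2 : 2 * ph N u (ph N u psi) s = 2 * (ev (fun g => ev (fun g' => eta g * del g g') u) u * psi s)).
  { transitivity (ev (fun g => ev (fun g' => gm N g (gm N g' psi) s) u) u + 1 * ev (fun g => ev (fun g' => gm N g' (gm N g psi) s) u) u).
    - rewrite E. rewrite (ev_swap (fun g g' => gm N g' (gm N g psi) s)). ring.
    - unfold ev. rewrite <- Rsum_scal, <- Rsum_plus, <- Rsum_scal_r, <- Rsum_scal. apply Rsum_ext; intros x Hx.
      transitivity (fst x * (Rsum (fun y => fst y * gm N (snd x) (gm N (snd y) psi) s) u + Rsum (fun y => fst y * gm N (snd y) (gm N (snd x) psi) s) u)); [ring|].
      transitivity (fst x * (2 * psi s * Rsum (fun y => fst y * (eta (snd x) * del (snd x) (snd y))) u)); [|ring].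
      f_equal. rewrite <- Rsum_plus, <- Rsum_scal. apply Rsum_ext; intros y Hy.
      unfold del. destruct (gen_eq_dec (snd x) (snd y)) as [Ee|Ne].
      + rewrite <- Ee, !gm_sq by (now apply Hu). ring.
      + rewrite (gm_anti N (snd x) (snd y)) by (auto; now apply Hu). ring. }
  lra.
Qed.

Lemma ph_anti N u w psi s : inv N u -> inv N w -> (forall x, In x u -> fst (snd x) = true) ->
  (forall x, In x w -> fst (snd x) = false) -> ph N u (ph N w psi) s = - ph N w (ph N u psi) s.
Proof.
  intros Hu Hw Tu Tw.
  assert (E : forall u w, ph N u (ph N w psi) s = ev (fun g => ev (fun g' => gm N g (gm N g' psi) s) w) u).
  { intros u' w'. unfold ph at 1. apply ev_ext; intros g. unfold ph. apply (gm_ev N g (fun x => gm N x psi)). }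
  rewrite !E, ev_swap. unfold ev. rewrite <- Rsum_opp. apply Rsum_ext; intros y Hy.
  transitivity (fst y * - Rsum (fun x => fst x * gm N (snd y) (gm N (snd x) psi) s) u); [|ring].
  f_equal. rewrite <- Rsum_opp. apply Rsum_ext; intros x Hx.
  rewrite (gm_anti N (snd x) (snd y)); [ring|now apply Hu|now apply Hw|].
  intros Ee. specialize (Tu x Hx). specialize (Tw y Hy). congruence.
Qed.

Lemma ph_lin N u f g c d s : ph N u (fun v => c * f v + d * g v) s = c * ph N u f s + d * ph N u g s.
Proof.
  unfold ph, ev. rewrite <- !Rsum_scal, <- Rsum_plus. apply Rsum_ext; intros. unfold gm, gam; ring.
Qed.
Lemma ph_scal N u f c s : ph N u (fun v => c * f v) s = c * ph N u f s.
Proof. unfold ph, ev. rewrite <- !Rsum_scal. apply Rsum_ext; intros. unfold gm, gam; ring. Qed.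

Lemma pht_true N u psi s : (forall x, In x u -> fst (snd x) = true) -> pht N u psi s = ph N u psi s.
Proof. intros H. apply Rsum_ext; intros x Hx. unfold eta. rewrite H by auto. ring. Qed.
Lemma pht_false N u psi s : (forall x, In x u -> fst (snd x) = false) -> pht N u psi s = - ph N u psi s.
Proof. intros H. unfold ph, pht, ev. rewrite <- Rsum_opp. apply Rsum_ext; intros x Hx. unfold eta. rewrite H by auto. ring. Qed.

Lemma HN_ph N u psi s : inv N u -> HN N (ph N u psi) s = ph N u (HN N psi) s + - (2) * h * ph N (Dl lam u) psi s.
Proof.
  intros Hu. unfold ph, HN. rewrite (Hop_ev J h _ _ (fun g => gm N g psi)).
  rewrite ev_Dl. unfold ev. rewrite <- Rsum_scal, <- Rsum_plus. apply Rsum_ext; intros x Hx.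
  fold (HN N (gm N (snd x) psi) s) (HN N psi). unfold lam.
  rewrite (HN_comm J h Hh N (snd x) psi s) by (now apply Hu). fold (HN N psi). ring.
Qed.

(** The condition for the even operator u l, with u the slow wave and w = D u, reads |u|^2 <l, D l>
    + <l, u w l> <= 0 in expectation. The product u w is self-adjoint with square |u|^2 |w|^2, so
    the second term is at least -|u| |w| times the norm of l, and |w| is nearly (1 - |lam|) |u|. *)
Lemma neg_chain N l m : inv N l -> inv N (slow (if Rle_dec 0 lam then 1 else -1) (S m)) ->
  inv N (Dl lam (slow (if Rle_dec 0 lam then 1 else -1) (S m))) ->
  INR (S m) * ev (fun g => ev (Dg lam (cN N g)) l) l <=
  (INR (S m) * (1 - Rabs lam) + Rabs lam / (1 - Rabs lam)) * ev (fun g => ev (cN N g) l) l.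
Proof.
  set (sig := if Rle_dec 0 lam then 1 else -1). set (u := slow sig (S m)). set (w := Dl lam u).
  intros Hl Hu Hw.
  assert (Hs : sig * sig = 1) by (unfold sig; destruct Rle_dec; ring).
  assert (Hsl : sig * lam = Rabs lam).
  { unfold sig. destruct (Rle_dec 0 lam); [rewrite Rabs_right; lra|rewrite Rabs_left; lra]. }
  assert (Tu : forall x, In x u -> fst (snd x) = true) by (intros x Hx; eapply slow_true; exact Hx).
  assert (Fw : forall x, In x w -> fst (snd x) = false) by (intros x Hx; eapply Dl_slow_false; exact Hx).
  assert (Hm : 0 < INR (S m)) by (apply lt_0_INR; lia).
  assert (SqU : forall psi s, ph N u (ph N u psi) s = INR (S m) * psi s).
  { intros psi s. rewrite ph_sq by auto. f_equal. rewrite <- (slow_norm sig (S m) Hs).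
    apply Rsum_ext; intros x Hx. f_equal. apply ev_ext; intros g'. unfold eta. rewrite (Tu x Hx). ring. }
  set (b2 := INR (S m) * ((1 - Rabs lam) * (1 - Rabs lam)) + 2 * Rabs lam).
  assert (SqW : forall psi s, ph N w (ph N w psi) s = - b2 * psi s).
  { intros psi s. rewrite ph_sq by auto. f_equal. unfold b2. rewrite <- (slow_energy lam sig m Hs Hsl). fold u w.
    unfold ev. rewrite <- Rsum_opp. apply Rsum_ext; intros x Hx.
    rewrite <- Ropp_mult_distr_r_reverse. f_equal. rewrite <- Rsum_opp. apply Rsum_ext; intros y Hy.
    unfold eta. rewrite (Fw x Hx). ring. }
  assert (AF : adjN N (fun psi => ph N u (ph N l psi)) (fun psi => pht N l (pht N u psi))).
  { apply (adj_comp _ _ (ph N u) (pht N u) (ph N l) (pht N l)); now apply adj_ph. }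
  assert (LF := loc_ph2 N u l Hu Hl).
  destruct (ground_pos J h rho G (- Z.of_nat N) (2 * N + 1) _ _ LF AF) as [GP _].
  rewrite bs_inner, bl_eq in GP. fold (HN N) in GP.
  match type of GP with 0 <= ?X => change X with (omN N (fun psi => pht N l (pht N u (cm (HN N) (fun psi => ph N u (ph N l psi)) psi)))) in GP end.
  set (X1 := omN N (fun psi => pht N l (ph N u (ph N w (ph N l psi))))).
  set (X2 := ev (fun g => ev (Dg lam (cN N g)) l) l).
  set (CC := ev (fun g => ev (cN N g) l) l).
  assert (AF' := adj_sym _ _ _ _ AF).
  assert (Al := adj_sym _ _ _ _ (adj_ph N l Hl)).
  assert (EG : omN N (fun psi => pht N l (pht N u (cm (HN N) (fun psi => ph N u (ph N l psi)) psi))) =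
     - (2) * h * (X1 + INR (S m) * X2)).
  { assert (Ecm : forall psi, cm (HN N) (fun psi => ph N u (ph N l psi)) psi = 
       fun s => - (2) * h * ph N w (ph N l psi) s + - (2) * h * ph N u (ph N (Dl lam l) psi) s).
    { intros psi. extensionality s. unfold cm. rewrite HN_ph by auto.
      replace (HN N (ph N l psi)) with (fun v => 1 * ph N l (HN N psi) v + (- (2) * h) * ph N (Dl lam l) psi v)
        by (extensionality v; rewrite HN_ph by auto; ring).
      rewrite ph_lin. fold w. ring. }
    transitivity (omN N (fun psi s => - (2) * h * pht N l (pht N u (ph N w (ph N l psi))) s + - (2) * h * pht N l (pht N u (ph N u (ph N (Dl lam l) psi))) s)).
    - apply om_ext. intros psi l' Hl'. rewrite Ecm.
      apply (adj_lin_emb (bs N) (bl N) (fun psi => pht N l (pht N u psi)) _ _ _ _ _ _ AF' Hl').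
    - rewrite om_plusN, !om_scalN.
      assert (E1 : omN N (fun psi => pht N l (pht N u (ph N w (ph N l psi)))) = X1).
      { unfold X1. apply om_extN. intros psi s. f_equal. extensionality v. now apply pht_true. }
      assert (E2 : omN N (fun psi => pht N l (pht N u (ph N u (ph N (Dl lam l) psi)))) = INR (S m) * X2).
      { transitivity (omN N (fun psi s => INR (S m) * pht N l (ph N (Dl lam l) psi) s)).
        - apply om_ext. intros psi l' Hl'.
          replace (pht N u (ph N u (ph N (Dl lam l) psi))) with (fun v => INR (S m) * ph N (Dl lam l) psi v + 0 * psi v)
            by (extensionality v; rewrite pht_true by auto; rewrite SqU; ring).
          rewrite (adj_lin_emb (bs N) (bl N) (pht N l) _ _ _ _ _ _ Al Hl'). ring.
        - rewrite om_scalN. f_equal. rewrite cN_ph. unfold X2. apply ev_ext; intros g. apply ev_Dl. }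
      change (- (2) * h * omN N (fun psi => pht N l (pht N u (ph N w (ph N l psi)))) + - (2) * h * omN N (fun psi => pht N l (pht N u (ph N u (ph N (Dl lam l) psi)))) = - (2) * h * (X1 + INR (S m) * X2)).
      rewrite E1, E2. ring. }
  rewrite EG in GP. assert (G1 : INR (S m) * X2 <= - X1) by (apply Rmult_le_reg_l with (2 * h); lra).
  (* An approximation of |u| |w| which avoids square roots; positivity of the square of r + u w,
     applied after l, gives the lower bound of X1. *)
  set (r := INR (S m) * (1 - Rabs lam)). assert (Hr : 0 < r) by (unfold r; apply Rmult_lt_0_compat; lra).
  set (K := fun psi s => r * ph N l psi s + 1 * ph N u (ph N w (ph N l psi)) s).
  assert (AK : adjN N K (fun psi s => r * pht N l psi s + 1 * pht N l (ph N u (ph N w psi)) s)).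
  { assert (A1 := adj_scal _ _ _ _ r (adj_ph N l Hl)).
    assert (A2 : adjN N (fun psi => ph N u (ph N w (ph N l psi))) (fun psi => pht N l (ph N u (ph N w psi)))).
    { assert (A3 : adjN N (fun psi => ph N u (ph N w psi)) (fun psi => ph N u (ph N w psi))).
      { eapply adj_ext; [apply (adj_comp _ _ _ _ _ _ (adj_ph N u Hu) (adj_ph N w Hw))| |]; intros; cbn beta; [reflexivity|].
        rewrite pht_false by auto. rewrite ph_anti by auto. f_equal. f_equal. extensionality v. now apply pht_true. }
      apply (adj_comp _ _ (fun psi => ph N u (ph N w psi)) (fun psi => ph N u (ph N w psi)) (ph N l) (pht N l)); auto using adj_ph. }
    apply (adj_lin _ _ _ _ _ _ 1 A1 A2). }
  assert (PK := om_pos _ _ _ (DN J h rho G N) _ _ AK).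
  assert (PK' : 0 <= r * r * CC + 2 * r * X1 + INR (S m) * b2 * CC).
  { eapply Rle_trans; [exact PK|]. right.
      transitivity (omN N (fun psi s => (r * r + INR (S m) * b2) * pht N l (ph N l psi) s + (2 * r) * pht N l (ph N u (ph N w (ph N l psi))) s)).
      - apply om_ext. intros psi l' Hl'. unfold K.
        rewrite (adj_lin_emb (bs N) (bl N) (pht N l) _ _ _ _ _ _ Al Hl').
        replace (ph N u (ph N w (fun s => r * ph N l psi s + 1 * ph N u (ph N w (ph N l psi)) s))) with
          (fun s => r * ph N u (ph N w (ph N l psi)) s + (INR (S m) * b2) * ph N l psi s).
        + rewrite (adj_lin_emb (bs N) (bl N) (pht N l) _ _ _ _ _ _ Al Hl'). ring.
        + extensionality s.
          replace (ph N w (fun s => r * ph N l psi s + 1 * ph N u (ph N w (ph N l psi)) s)) with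
            (fun s => r * ph N w (ph N l psi) s + 1 * ph N w (ph N u (ph N w (ph N l psi))) s) by (extensionality v; now rewrite ph_lin).
          rewrite ph_lin.
          replace (ph N w (ph N u (ph N w (ph N l psi)))) with (fun v => b2 * ph N u (ph N l psi) v).
          * rewrite ph_scal, SqU. ring.
          * extensionality v.
            assert (AN := ph_anti N u w (ph N w (ph N l psi)) v Hu Hw Tu Fw).
            replace (ph N w (ph N w (ph N l psi))) with (fun z => - b2 * ph N l psi z) in AN by (extensionality z; now rewrite SqW).
            rewrite ph_scal in AN. lra.
      - rewrite om_plusN, !om_scalN.
        change (fun psi s => pht N l (ph N l psi) s) with (fun psi => pht N l (ph N l psi)). rewrite cN_ph. fold CC.
        change (omN N (fun psi s => pht N l (ph N u (ph N w (ph N l psi))) s)) with X1. ring. }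
  assert (CC0 : 0 <= CC).
  { unfold CC. rewrite <- cN_ph. apply (om_pos _ _ _ (DN J h rho G N)). now apply adj_ph. }
  assert (L1 : 0 < 1 - Rabs lam) by lra.
  apply Rmult_le_reg_l with (2 * r); [lra|].
  assert (EF : 2 * r * ((r + Rabs lam / (1 - Rabs lam)) * CC) = r * r * CC + INR (S m) * b2 * CC)
    by (unfold r, b2; field; lra).
  rewrite EF.
  assert (2 * r * (INR (S m) * X2) <= 2 * r * (- X1)) by (apply Rmult_le_compat_l; lra).
  lra.
Qed.

(** Dividing [neg_chain] by the length of the wave, which is free, removes the boundary term |lam| /
    (1 - |lam|). *)
Lemma cc_neg l : 0 <= (1 - Rabs lam) * Cf cc l l - ev (fun g => ev (Dg lam (cc g)) l) l.
Proof.
  assert (P := cc_pos J h rho G Hlam l). unfold Cf in *.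
  set (X2 := ev (fun g => ev (Dg lam (cc g)) l) l) in *. set (CC := ev (fun g => ev (cc g) l) l) in *.
  assert (M : forall m, INR (S m) * X2 <= (INR (S m) * (1 - Rabs lam) + Rabs lam / (1 - Rabs lam)) * CC).
  { intros m.
    apply (ulim_le (fun N => INR (S m) * ev (fun g => ev (Dg lam (cN N g)) l) l)
      (fun N => (INR (S m) * (1 - Rabs lam) + Rabs lam / (1 - Rabs lam)) * ev (fun g => ev (cN N g) l) l)).
    - apply ulim_scal. unfold X2. unfold ev at 1 3.
      apply (ulim_Rsum (fun N x => fst x * ev (Dg lam (cN N (snd x))) l) (fun x => fst x * ev (Dg lam (cc (snd x))) l)).
      intros x _. apply ulim_scal.
      apply (ulim_Rsum (fun N y => fst y * Dg lam (cN N (snd x)) (snd y)) (fun y => fst y * Dg lam (cc (snd x)) (snd y))).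
      intros y _. apply ulim_scal. apply (Dg_lim J h (fun N u => cN N (snd x) u)). intros v. apply (cc_lim J h rho G Hlam).
    - apply ulim_scal. apply (cc_ev_lim J h rho G Hlam).
    - eapply ultra_mono; [|exact (ultra_and _ _ (eventually_inv l) (ultra_and _ _ (eventually_inv (slow (if Rle_dec 0 lam then 1 else -1) (S m))) (eventually_inv (Dl lam (slow (if Rle_dec 0 lam then 1 else -1) (S m))))))].
      intros N [H1 [H2 H3]]. now apply neg_chain. }
  destruct (Rle_dec X2 ((1 - Rabs lam) * CC)) as [|N]; [lra|]. exfalso. apply Rnot_le_lt in N.
  set (dlt := X2 - (1 - Rabs lam) * CC) in *. assert (Hd : 0 < dlt) by (unfold dlt; lra).
  set (B := Rabs lam / (1 - Rabs lam) * CC).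
  assert (B0 : 0 <= B) by (unfold B; apply Rmult_le_pos; auto; apply Rlt_le, Rdiv_lt_0_compat; lra).
  destruct (archimed_cor1 (dlt / (B + 1))) as [n [Hn Hn0]]; [apply Rdiv_lt_0_compat; lra|].
  destruct n as [|n]; [lia|]. specialize (M n).
  assert (In : 0 < INR (S n)) by (apply lt_0_INR; lia).
  assert (INR (S n) * dlt <= B) by (unfold dlt, B; lra).
  apply Rmult_lt_compat_l with (r := INR (S n)) in Hn; auto. rewrite Rinv_r in Hn by lra.
  assert (INR (S n) * (dlt / (B + 1)) * (B + 1) = INR (S n) * dlt) by (field; lra). nra.
Qed.
End Chain2.

(** * Functionals determined by their annihilation relations *)

Section Vacuum.
Variables (S : list Z) (O : Z -> Z -> R) (Psi : list gen -> R).
Definition over (w : list gen) : Prop := forall g, In g w -> In (snd g) S.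
Hypothesis NDS : NoDup S.
Hypothesis HR : forall X j, over X -> In j S ->
  Psi (X ++ [(true, j)]) = - Rsum (fun k => O k j * Psi (X ++ [(false, k)])) S.
Hypothesis HL : forall X j, over X -> In j S ->
  Psi ((true, j) :: X) = Rsum (fun k => O k j * Psi ((false, k) :: X)) S.
Hypothesis HC : forall X g g' Y, over (X ++ g :: g' :: Y) ->
  Psi (X ++ g :: g' :: Y) = (if gen_eq_dec g g' then 2 * eta g * Psi (X ++ Y) else 0) - Psi (X ++ g' :: g :: Y).
Hypothesis HO : forall k l, In k S -> In l S -> Rsum (fun j => O k j * O l j) S = if Z.eq_dec k l then 1 else 0.

Lemma over_app u v : over (u ++ v) <-> over u /\ over v.
Proof. unfold over. split; [intros H; split; intros; apply H, in_app_iff; auto|]. intros [H H'] g Hg. apply in_app_iff in Hg. destruct Hg; auto. Qed.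
Lemma over_cons g u : over (g :: u) <-> In (snd g) S /\ over u.
Proof. unfold over. simpl. split; [intros H; split; auto|]. intros [H H'] g' [<-|]; auto. Qed.

(** Up to shorter words the annihilation relation moves a Majorana operator from the right end of
    a word to its left end with a sign opposite to the one produced by anticommutation. *)
Lemma vacuum_unique : Psi [] = 0 -> forall w, over w -> Psi w = 0.
Proof.
  intros H0. assert (G : forall n w, (length w <= n)%nat -> over w -> Psi w = 0).
  { induction n as [|n IH]; intros w Hl Hw.
    - destruct w; [exact H0|simpl in Hl; lia].
    - assert (Mv : forall X Y g, over (g :: X ++ Y) -> (length (g :: X ++ Y) <= Datatypes.S n)%nat ->
        Psi (g :: X ++ Y) = (-1) ^ length X * Psi (X ++ g :: Y)).
      { intros X. induction X as [|g' X IHX] using rev_ind; intros Y g Hov Hlen; [simpl; ring|].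
        rewrite <- !app_assoc in *. simpl app in *.
        assert (Pm : over (X ++ g' :: g :: Y)).
        { rewrite over_cons, over_app, over_cons in Hov. rewrite over_app, !over_cons. tauto. }
        rewrite IHX by auto. rewrite length_app, pow_add.
        rewrite HC.
        2:{ rewrite over_app, !over_cons in *. tauto. }
        assert (E : Psi (X ++ Y) = 0).
        { apply IH. - simpl in Hlen. rewrite !length_app in *. simpl in Hlen. lia.
          - rewrite over_app, !over_cons in Pm. rewrite over_app; tauto. }
        rewrite E. destruct gen_eq_dec; simpl; ring. }
      assert (A : forall X j, over X -> In j S -> (length X <= n)%nat -> Psi (X ++ [(true, j)]) = 0).
      { intros X j HX Hj HlX.
        assert (Mv' : forall g, In (snd g) S -> Psi (g :: X) = (-1) ^ length X * Psi (X ++ [g])).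
        { intros g Hg. specialize (Mv X [] g). rewrite app_nil_r in Mv. apply Mv; [apply over_cons; auto|simpl; lia]. }
        assert (E1 := HL X j HX Hj). rewrite Mv' in E1 by auto.
        rewrite (Rsum_ext _ (fun k => (-1) ^ length X * (O k j * Psi (X ++ [(false, k)])))) in E1.
        2:{ intros k Hk. rewrite Mv' by auto. ring. }
        rewrite Rsum_scal in E1. assert (E2 := HR X j HX Hj).
        assert (N : (-1) ^ length X <> 0) by (apply pow_nonzero; lra).
        apply Rmult_eq_reg_l in E1; auto. lra. }
      destruct w as [|g w] using rev_ind; [exact H0|]. clear IHw.
      rewrite length_app in Hl. simpl in Hl. rewrite over_app, over_cons in Hw. destruct Hw as [Hw [Hg _]].
      destruct g as [[] k]; cbn [snd] in Hg; [apply A; auto; lia|].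
      transitivity (Rsum (fun l => (if Z.eq_dec k l then 1 else 0) * Psi (w ++ [(false, l)])) S).
      { rewrite (Rsum_ext _ (fun l => if Z.eq_dec l k then Psi (w ++ [(false, l)]) else 0)).
        - now rewrite (Rsum_delta Z.eq_dec (fun l => Psi (w ++ [(false, l)]))).
        - intros l _. destruct (Z.eq_dec k l), (Z.eq_dec l k); try congruence; ring. }
      rewrite (Rsum_ext _ (fun l => Rsum (fun j => O k j * (O l j * Psi (w ++ [(false, l)]))) S)).
      2:{ intros l Hl'. rewrite <- HO by auto. rewrite <- Rsum_scal_r. apply Rsum_ext; intros; ring. }
      rewrite Rsum_swap. apply Rsum_zero. intros j Hj. rewrite Rsum_scal.
      assert (E := HR w j Hw Hj). rewrite A in E by (auto; lia).
      replace (Rsum (fun l => O l j * Psi (w ++ [(false, l)])) S) with 0 by lra. ring. }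
  intros w. apply (G (length w)); auto.
Qed.
End Vacuum.

(** * Expectations of words in the limit of long chains *)

Fixpoint wop (N : nat) (w : list gen) : op :=
  match w with [] => fun psi => psi | g :: w' => fun psi => gm N g (wop N w' psi) end.
Fixpoint wopt (N : nat) (w : list gen) : op :=
  match w with [] => fun psi => psi | g :: w' => fun psi => wopt N w' (fun s => eta g * gm N g psi s) end.
Fixpoint flw (w : list gen) (s : conf) : conf :=
  match w with [] => s | g :: w' => flip (snd g) (flw w' s) end.
Definition inw (N : nat) (w : list gen) : Prop := forall g, In g w -> inN N g.
(** A diagonal operator between two words. The strings in the words begin at the left end of the
    chain, hence the dependence on [N]. *)
Definition tr (N : nat) (u : list gen) (r : wf) (v : list gen) : op := fun psi => wop N u (fun s => r s * wop N v psi s).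
Definition bd1 (r : wf) : Prop := forall s, Rabs (r s) <= 1.

Lemma flw_flip w j s : flw w (flip j s) = flip j (flw w s).
Proof. induction w as [|g w IH]; simpl; [reflexivity|]. rewrite IH. apply flip_comm. Qed.

Lemma adj_wop N w : inw N w -> adj (bs N) (bl N) (wop N w) (wopt N w).
Proof.
  induction w as [|g w IH]; intros H.
  - intros psi phi. reflexivity.
  - assert (Hw : inw N w) by (intros x Hx; apply H; simpl; auto).
    apply (adj_comp _ _ (gm N g) (fun psi s => eta g * gm N g psi s) (wop N w) (wopt N w)); auto.
    apply adj_gm, H; simpl; auto.
Qed.

Lemma gm_mul N g (r phi : wf) s : gm N g (fun u => r u * phi u) s = r (flip (snd g) s) * gm N g phi s.
Proof. unfold gm, gam. ring. Qed.

(** Conjugation by a word only transports a diagonal operator along the flips of the word; the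
    string signs square away. *)
Lemma wopt_mid N w r psi s : inw N w -> wopt N w (fun u => r u * wop N w psi u) s = r (flw w s) * psi s.
Proof.
  revert r. induction w as [|g w IH]; intros r H; [reflexivity|]. simpl.
  assert (Hw : inw N w) by (intros x Hx; apply H; simpl; auto).
  replace (fun u : conf => eta g * gm N g (fun u0 => r u0 * gm N g (wop N w psi) u0) u) with
     (fun u => r (flip (snd g) u) * wop N w psi u).
  - now rewrite (IH (fun u => r (flip (snd g) u))).
  - extensionality u. rewrite gm_mul.
    change (gm N g (gm N g (wop N w psi)) u) with (gm N g (gm N g (wop N w psi)) u).
    rewrite gm_sq by (apply H; simpl; auto).
    transitivity (eta g * eta g * (r (flip (snd g) u) * wop N w psi u)); [rewrite eta_sq; ring|ring].
Qed.

Lemma wop_mid N w r psi s : inw N w -> wop N w (fun u => r u * wopt N w psi u) s = r (flw w s) * psi s.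
Proof.
  revert psi s. induction w as [|g w IH]; intros psi s H; [reflexivity|]. simpl.
  assert (Hw : inw N w) by (intros x Hx; apply H; simpl; auto).
  replace (wop N w (fun u => r u * wopt N w (fun s0 => eta g * gm N g psi s0) u)) with
     (fun u => r (flw w u) * (eta g * gm N g psi u)) by (extensionality u; now rewrite IH).
  rewrite (gm_mul N g (fun u => r (flw w u)) (fun u => eta g * gm N g psi u)), gm_scal, gm_sq, flw_flip by (apply H; simpl; auto).
  transitivity (eta g * eta g * (r (flip (snd g) (flw w s)) * psi s)); [ring|rewrite eta_sq; ring].
Qed.

Lemma wop_app N u v psi : wop N (u ++ v) psi = wop N u (wop N v psi).
Proof. induction u as [|g u IH]; simpl; congruence. Qed.
Lemma wop_scal N w c psi s : wop N w (fun u => c * psi u) s = c * wop N w psi s.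
Proof.
  revert s; induction w as [|g w IH]; intros s; simpl; [reflexivity|].
  replace (wop N w (fun u => c * psi u)) with (fun u => c * wop N w psi u) by (extensionality u; now rewrite IH).
  apply gm_scal.
Qed.
Lemma eventually_inw w : ultra (fun N => inw N w).
Proof.
  induction w as [|g w IH]; [apply ultra_all; intros n x []|].
  eapply ultra_mono; [|exact (ultra_and _ _ IH (eventually_in g))]. intros n [H H'] x [<-|]; auto.
Qed.

Section Om.
Variables (J h : R) (rho : Z -> nat -> Op).
Hypothesis G : is_ground_state J h rho.
Notation omN := (chain_om rho).
Notation adjN N := (adj (bs N) (bl N)).

Definition EN N (r : wf) : R := omN N (fun psi s => r s * psi s).

Lemma EN_le N r r' : (forall s, r s <= r' s) -> EN N r <= EN N r'.
Proof.
  intros H.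
  (* Multiplication by r' - r is the square of multiplication by its root, so positivity of the
     state applies. *)
  assert (P := om_pos _ _ _ (DN J h rho G N) _ _ (adj_diag (bs N) (bl N) (fun s => sqrt (r' s - r s)))).
  apply Rplus_le_reg_l with (- EN N r). rewrite Rplus_opp_l. eapply Rle_trans; [exact P|]. right.
  transitivity (omN N (fun psi s => r' s * psi s + (-1) * (r s * psi s))).
  - apply om_ext. intros psi l _. rewrite <- Rmult_assoc, sqrt_sqrt by (specialize (H (emb (bs N) l)); lra). ring.
  - unfold EN. rewrite om_plusN, om_scalN. ring.
Qed.
Lemma EN_const N c : EN N (fun _ => c) = c.
Proof. unfold EN. rewrite (om_scalN rho N c (fun psi => psi)). unfold chain_om. rewrite (om_one _ _ _ (DN J h rho G N)). ring. Qed.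

(** Splitting the diagonal factor lets the support of an indicator be used on either side of the
    word, as suits the estimate. *)
Lemma tr_CS N u v r1 r2 : inw N u -> inw N v ->
  Rsqr (omN N (tr N u (fun s => r1 s * r2 s) v)) <= EN N (fun s => Rsqr (r1 (flw u s))) * EN N (fun s => Rsqr (r2 (flw v s))).
Proof.
  intros Hu Hv.
  assert (A1 := adj_comp _ _ _ _ _ _ (adj_diag (bs N) (bl N) r1) (adj_sym _ _ _ _ (adj_wop N u Hu))).
  assert (A2 := adj_comp _ _ _ _ _ _ (adj_diag (bs N) (bl N) r2) (adj_wop N v Hv)).
  assert (CS := om_CS _ _ _ (DN J h rho G N) _ _ _ _ A1 A2). cbn beta in CS.
  fold (omN N (tr N u (fun s => r1 s * r2 s) v)).
  assert (E1 : omN N (tr N u (fun s => r1 s * r2 s) v) =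
     om (bs N) (bl N) (sr rho (bs N) (bl N)) (fun psi => wop N u (fun s => r1 s * (r2 s * wop N v psi s)))).
  { apply om_ext; intros psi l _. unfold tr. f_equal. extensionality s. ring. }
  rewrite E1. eapply Rle_trans; [exact CS|]. right. f_equal; apply om_ext; intros psi l _; cbn beta.
  - rewrite <- (wop_mid N u (fun s => Rsqr (r1 s))) by auto. f_equal. extensionality s. unfold Rsqr. ring.
  - rewrite <- (wopt_mid N v (fun s => Rsqr (r2 s))) by auto. f_equal. extensionality s. unfold Rsqr. ring.
Qed.

Lemma bd1_sq r s : bd1 r -> Rsqr (r s) <= 1.
Proof. intros H. rewrite <- Rsqr_1. apply Rsqr_le_abs_1. rewrite (Rabs_right 1) by lra. apply H. Qed.
Lemma bd1_mul r1 r2 : bd1 r1 -> bd1 r2 -> bd1 (fun s => r1 s * r2 s).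
Proof.
  intros H H' s. rewrite Rabs_mult. specialize (H s); specialize (H' s).
  assert (0 <= Rabs (r1 s)) by apply Rabs_pos. assert (0 <= Rabs (r2 s)) by apply Rabs_pos. nra.
Qed.
Lemma bd1_one : bd1 (fun _ => 1). Proof. intros s. rewrite Rabs_R1; lra. Qed.

Lemma tr_bd N u r v : inw N u -> inw N v -> bd1 r -> Rabs (omN N (tr N u r v)) <= 1.
Proof.
  intros Hu Hv Hr. assert (CS := tr_CS N u v r (fun _ => 1) Hu Hv).
  cbn beta in CS. replace (fun s => r s * 1) with r in CS by (extensionality s; ring).
  assert (EN N (fun s => Rsqr (r (flw u s))) <= 1).
  { apply Rle_trans with (EN N (fun _ => 1)); [|rewrite EN_const; lra]. apply EN_le. intros; now apply bd1_sq. }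
  assert (0 <= EN N (fun s => Rsqr (r (flw u s)))).
  { apply Rle_trans with (EN N (fun _ => 0)); [rewrite EN_const; lra|]. apply EN_le. intros; apply Rle_0_sqr. }
  rewrite (EN_const N (Rsqr 1)), Rsqr_1 in CS.
  rewrite <- (Rabs_right 1) by lra. apply Rsqr_le_abs_0. rewrite Rsqr_1. lra.
Qed.

Definition Om (u : list gen) (r : wf) (v : list gen) : R := LIM (fun N => omN N (tr N u r v)).
Definition expect (r : wf) : R := Om [] r [].
Notation E := expect.

Lemma Om_lim u r v : bd1 r -> ulim (fun N => omN N (tr N u r v)) (Om u r v).
Proof.
  intros Hr. apply ulim_LIM. exists 1. eapply ultra_mono; [|exact (ultra_and _ _ (eventually_inw u) (eventually_inw v))].
  intros N [Hu Hv]. now apply tr_bd.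
Qed.
Lemma E_lim r : bd1 r -> ulim (fun N => EN N r) (E r).
Proof. intros H. exact (Om_lim [] r [] H). Qed.

Lemma Om_lin2 u r v u1 r1 v1 u2 r2 v2 c1 c2 : bd1 r -> bd1 r1 -> bd1 r2 ->
  (forall N psi s, inw N (u ++ v) -> tr N u r v psi s = c1 * tr N u1 r1 v1 psi s + c2 * tr N u2 r2 v2 psi s) ->
  Om u r v = c1 * Om u1 r1 v1 + c2 * Om u2 r2 v2.
Proof.
  intros H H1 H2 HE. apply LIM_eq.
  eapply ulim_ext with (x := fun N => c1 * omN N (tr N u1 r1 v1) + c2 * omN N (tr N u2 r2 v2)).
  - eapply ultra_mono; [|exact (eventually_inw (u ++ v))]. intros N HN. cbn beta.
    rewrite <- !om_scalN, <- om_plusN. symmetry. apply om_extN. intros; now apply HE.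
  - apply ulim_plus; apply ulim_scal; now apply Om_lim.
Qed.

Lemma Om_eq u r v u1 r1 v1 c : bd1 r -> bd1 r1 ->
  (forall N psi s, inw N (u ++ v) -> tr N u r v psi s = c * tr N u1 r1 v1 psi s) -> Om u r v = c * Om u1 r1 v1.
Proof.
  intros H H1 HE. rewrite (Om_lin2 u r v u1 r1 v1 u1 r1 v1 c 0); auto; [ring|].
  intros N psi s HN. rewrite HE by auto. ring.
Qed.

Lemma Om_CS u v r1 r2 : bd1 r1 -> bd1 r2 ->
  Rsqr (Om u (fun s => r1 s * r2 s) v) <= E (fun s => Rsqr (r1 (flw u s))) * E (fun s => Rsqr (r2 (flw v s))).
Proof.
  intros H1 H2.
  apply (ulim_le (fun N => Rsqr (omN N (tr N u (fun s => r1 s * r2 s) v)))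
    (fun N => EN N (fun s => Rsqr (r1 (flw u s))) * EN N (fun s => Rsqr (r2 (flw v s))))).
  - apply ulim_mult; apply Om_lim; now apply bd1_mul.
  - apply ulim_mult; apply E_lim; intros s; rewrite Rabs_right by (apply Rle_ge, Rle_0_sqr); now apply bd1_sq.
  - eapply ultra_mono; [|exact (ultra_and _ _ (eventually_inw u) (eventually_inw v))].
    intros N [Hu Hv]. now apply tr_CS.
Qed.

(** Cauchy-Schwarz with a combination of generators on the right; if its norm tends to zero, so does
    its expectation after any word. *)
Lemma Om_CS_lin u d r1 r2 : bd1 r1 -> bd1 r2 ->
  Rsqr (ev (fun g => Om u (fun s => r1 s * r2 s) [g]) d) <=
  E (fun s => Rsqr (r1 (flw u s))) * ev (fun g => ev (fun g' => eta g * Om [g] (fun s => Rsqr (r2 s)) [g']) d) d.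
Proof.
  intros H1 H2.
  assert (H22 : bd1 (fun s => Rsqr (r2 s))) by (intros s; rewrite Rabs_right by (apply Rle_ge, Rle_0_sqr); now apply bd1_sq).
  apply (ulim_le (fun N => Rsqr (ev (fun g => omN N (tr N u (fun s => r1 s * r2 s) [g])) d))
    (fun N => EN N (fun s => Rsqr (r1 (flw u s))) * ev (fun g => ev (fun g' => eta g * omN N (tr N [g] (fun s => Rsqr (r2 s)) [g'])) d) d)).
  - assert (L : ulim (fun N => ev (fun g => omN N (tr N u (fun s => r1 s * r2 s) [g])) d) (ev (fun g => Om u (fun s => r1 s * r2 s) [g]) d)).
    { apply (ulim_Rsum (fun N x => fst x * omN N (tr N u (fun s => r1 s * r2 s) [snd x])) (fun x => fst x * Om u (fun s => r1 s * r2 s) [snd x])).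
      intros x _. apply ulim_scal, Om_lim. now apply bd1_mul. }
    now apply ulim_mult.
  - apply ulim_mult; [apply E_lim; intros s; rewrite Rabs_right by (apply Rle_ge, Rle_0_sqr); now apply bd1_sq|].
    apply (ulim_Rsum (fun N x => fst x * ev (fun g' => eta (snd x) * omN N (tr N [snd x] (fun s => Rsqr (r2 s)) [g'])) d)
       (fun x => fst x * ev (fun g' => eta (snd x) * Om [snd x] (fun s => Rsqr (r2 s)) [g']) d)).
    intros x _. apply ulim_scal.
    apply (ulim_Rsum (fun N y => fst y * (eta (snd x) * omN N (tr N [snd x] (fun s => Rsqr (r2 s)) [snd y])))
       (fun y => fst y * (eta (snd x) * Om [snd x] (fun s => Rsqr (r2 s)) [snd y]))).
    intros y _. do 2 apply ulim_scal. now apply Om_lim.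
  - eapply ultra_mono; [|exact (ultra_and _ _ (eventually_inw u) (eventually_inv d))].
    intros N [Hu Hd].
    assert (A1 := adj_comp _ _ _ _ _ _ (adj_diag (bs N) (bl N) r1) (adj_sym _ _ _ _ (adj_wop N u Hu))).
    assert (A2 := adj_comp _ _ _ _ _ _ (adj_diag (bs N) (bl N) r2) (adj_ph N d Hd)).
    assert (CS := om_CS _ _ _ (DN J h rho G N) _ _ _ _ A1 A2). cbn beta in CS.
    assert (E1 : ev (fun g => omN N (tr N u (fun s => r1 s * r2 s) [g])) d =
       om (bs N) (bl N) (sr rho (bs N) (bl N)) (fun psi => wop N u (fun s => r1 s * (r2 s * ph N d psi s)))).
    { unfold chain_om. rewrite <- (om_ev (bs N) (bl N) (sr rho (bs N) (bl N)) (fun g => tr N u (fun s => r1 s * r2 s) [g])).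
      apply om_ext; intros psi l Hl. unfold tr. rewrite <- (adj_ev _ _ _ _ (fun g s => r1 s * r2 s * wop N [g] psi s) d l (adj_wop N u Hu)) by auto.
      f_equal. extensionality s. unfold ph, ev. rewrite <- !Rsum_scal. apply Rsum_ext; intros; simpl; ring. }
    rewrite E1. eapply Rle_trans; [exact CS|]. right. f_equal.
    + apply om_ext; intros psi l _; cbn beta.
      rewrite <- (wop_mid N u (fun s => Rsqr (r1 s))) by auto. f_equal. extensionality s. unfold Rsqr. ring.
    + unfold pht, chain_om. rewrite om_ev. apply ev_ext; intros g.
      transitivity (om (bs N) (bl N) (sr rho (bs N) (bl N)) (fun psi s => ev (fun g' => eta g * tr N [g] (fun s => Rsqr (r2 s)) [g'] psi s) d)).
      * apply om_ext; intros psi l _. unfold tr, ph; cbn [wop].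
        replace (fun s => r2 s * (r2 s * ev (fun g0 => gm N g0 psi s) d)) with (fun s => ev (fun g0 => Rsqr (r2 s) * gm N g0 psi s) d).
        -- rewrite (gm_ev N g (fun g0 s => Rsqr (r2 s) * gm N g0 psi s)). unfold ev. rewrite <- Rsum_scal. apply Rsum_ext; intros; ring.
        -- extensionality s. unfold ev, Rsqr. rewrite <- !Rsum_scal. apply Rsum_ext; intros; ring.
      * rewrite om_ev. apply ev_ext; intros g'. apply (om_scalN rho N).
Qed.
End Om.

Definition ind (V : list Z) (z : conf) : wf := fun u => if forallb (fun k => Bool.eqb (u k) (z k)) V then 1 else 0.
Definition dep (a : Z) (n : nat) (r : wf) : Prop := forall s s', (forall j, inb a n j -> s j = s' j) -> r s = r s'.

Lemma forallb_ext_in {A} (f g : A -> bool) l : (forall x, In x l -> f x = g x) -> forallb f l = forallb g l.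
Proof. induction l as [|x l IH]; intros H; simpl; [reflexivity|]. rewrite H, IH; simpl; auto. intros y Hy. apply H. simpl; auto. Qed.

Lemma zlo_le L k : In k L -> (zlo L <= k)%Z.
Proof.
  unfold zlo. generalize (hd 0%Z L). induction L as [|x L IH]; intros d; simpl; [tauto|].
  intros [->|H]; [apply Z.le_min_l|]. specialize (IH d H). lia.
Qed.
Lemma zhi_ge L k : In k L -> (k <= zhi L)%Z.
Proof.
  unfold zhi. generalize (hd 0%Z L). induction L as [|x L IH]; intros d; simpl; [tauto|].
  intros [->|H]; [apply Z.le_max_l|]. specialize (IH d H). lia.
Qed.

(** * The classical restriction and the limiting annihilators *)

Section State.
Variables (J h : R) (rho : Z -> nat -> Op).
Hypothesis G : is_ground_state J h rho.
Hypothesis Hh : 0 < h.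
Let lam := J / h.
Hypothesis Hlam : 0 < Rabs lam < 1 / 100.
Notation omN := (chain_om rho).
Notation EN := (EN rho).
Notation Om := (Om rho).
Notation E := (expect rho).
Notation ac := (act gen (Dg lam)).

Definition EB (a : Z) (n : nat) (r : wf) : R := Rsum (fun l => sr rho a n l l * r (emb a l)) (all_cfg n).

Lemma EN_EB N r : EN N r = EB (bs N) (bl N) r.
Proof.
  unfold EN, EB, chain_om, om. apply Rsum_ext; intros l Hl. apply all_cfg_In in Hl.
  rewrite res_emb by auto. ring.
Qed.

Lemma EB_right a n r : dep a n r -> EB a (S n) r = EB a n r.
Proof.
  intros D. unfold EB. rewrite all_cfg_sum_snoc. apply Rsum_ext; intros l Hl. apply all_cfg_In in Hl.
  destruct G as [(_ & _ & P & _) _].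
  assert (E : forall b, r (emb a (l ++ [b])) = r (emb a l)).
  { intros b. apply D. intros j Hj. unfold emb, inb in *. destruct (Z.leb_spec a j); auto. rewrite app_nth1 by lia. reflexivity. }
  rewrite !E. unfold sr. rewrite (P a n l l Hl Hl). simpl. ring.
Qed.
Lemma EB_left a n r : dep (a + 1) n r -> EB a (S n) r = EB (a + 1) n r.
Proof.
  intros D. unfold EB. rewrite all_cfg_sum_S, <- Rsum_plus. apply Rsum_ext; intros l Hl. apply all_cfg_In in Hl.
  destruct G as [(_ & _ & _ & P) _].
  assert (E : forall b, r (emb a (b :: l)) = r (emb (a + 1) l)).
  { intros b. apply D. intros j Hj. unfold emb, inb in *. destruct (Z.leb_spec a j), (Z.leb_spec (a + 1) j); try lia.
    replace (Z.to_nat (j - a)) with (S (Z.to_nat (j - (a + 1)))) by lia. reflexivity. }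
  rewrite !E. unfold sr. rewrite (P a n l l Hl Hl). simpl. ring.
Qed.
Lemma EB_incl a n i k r : dep a n r -> EB (a - Z.of_nat i) (i + (k + n)) r = EB a n r.
Proof.
  intros D. assert (E1 : EB a (k + n) r = EB a n r).
  { induction k as [|k IH]; [reflexivity|]. simpl. rewrite EB_right; auto.
    intros s s' H. apply D. intros j Hj. apply H. unfold inb in *. lia. }
  rewrite <- E1. induction i as [|i IH].
  - simpl. f_equal. lia.
  - rewrite <- IH. simpl Nat.add. replace (a - Z.of_nat i)%Z with (a - Z.of_nat (S i) + 1)%Z by lia.
    apply EB_left. intros s s' H. apply D. intros j Hj. apply H. unfold inb in *. lia.
Qed.

(** Consistency of the density matrices makes the chain expectations of a function of finitely many
    spins constant for large [N], so the limit is their common value. *)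
Lemma E_EB a n r : bd1 r -> dep a n r -> E r = EB a n r.
Proof.
  intros B D. apply LIM_eq. eapply ulim_ext with (x := fun _ => EB a n r); [|apply ulim_const].
  eapply ultra_mono; [|exact (ultra_ge (Z.abs_nat a + n))]. intros N HN. cbn beta.
  change (EB a n r = EN N r). rewrite EN_EB. symmetry.
  replace (bs N) with (a - Z.of_nat (Z.to_nat (a - bs N)))%Z by (unfold bs; lia).
  replace (bl N) with (Z.to_nat (a - bs N) + ((bl N - n - Z.to_nat (a - bs N)) + n))%nat by (unfold bl, bs in *; lia).
  rewrite EB_incl; auto.
Qed.

Lemma ind_bd V z : bd1 (ind V z).
Proof. intros s. unfold ind. destruct forallb; rewrite ?Rabs_R1, ?Rabs_R0; lra. Qed.
Lemma ind_dep a n V z : (forall k, In k V -> inb a n k) -> dep a n (ind V z).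
Proof.
  intros H s s' Hs. unfold ind. replace (forallb (fun k => Bool.eqb (s k) (z k)) V) with (forallb (fun k => Bool.eqb (s' k) (z k)) V); auto.
  symmetry. apply forallb_ext_in. intros k Hk. rewrite Hs by auto. reflexivity.
Qed.

Lemma muz_E L x : muz rho L x = E (ind L x).
Proof.
  assert (HB : forall k, In k L -> inb (zlo L) (zlen L) k).
  { intros k Hk. assert (A := zlo_le L k Hk). assert (B := zhi_ge L k Hk). unfold inb, zlen. lia. }
  rewrite (E_EB (zlo L) (zlen L)) by (auto using ind_bd, ind_dep).
  unfold muz, omega, Csum, Cre. rewrite Cre_sum. unfold EB. apply Rsum_ext; intros l Hl.
  rewrite Cre_sum. 
  rewrite (Rsum_ext _ (fun t => if list_eq_dec bool_dec t l then sr rho (zlo L) (zlen L) l t * ind L x (emb (zlo L) t) else 0)).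
  - rewrite (Rsum_delta (list_eq_dec bool_dec) (fun t => sr rho (zlo L) (zlen L) l t * ind L x (emb (zlo L) t))); auto using all_cfg_NoDup.
  - intros t Ht. apply all_cfg_In in Hl, Ht. unfold Qprod, leq_dec, sr, ind.
    destruct (list_eq_dec bool_dec t l) as [->|N].
    + assert (Ef : forallb (fun k => Bool.eqb (emb (zlo L) l k) (x k)) L =
        forallb (fun k => Bool.eqb (nth (Z.to_nat (k - zlo L)) l false) (x k)) L).
      { apply forallb_ext_in. intros k Hk. unfold emb. assert (A := zlo_le L k Hk). destruct (Z.leb_spec (zlo L) k); [auto|lia]. }
      rewrite Ef. cbn [andb].
      assert (K : forall (c : Defs.C) (b : bool), fst (Cmul c (if b then Defs.C1 else C0)) = fst c * (if b then 1 else 0))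
        by (intros c []; unfold Cmul, Defs.C1, C0; cbn [fst snd]; ring).
      apply K.
    + cbn. unfold Cmul, C0; cbn [fst snd]; ring.
Qed.

Lemma E_le r r' : bd1 r -> bd1 r' -> (forall s, r s <= r' s) -> E r <= E r'.
Proof.
  intros B B' H. eapply ulim_le; [apply (E_lim J h rho G r B)|apply (E_lim J h rho G r' B')|].
  apply ultra_all; intros N. now apply (EN_le J h rho G).
Qed.
Lemma E_one : E (fun _ => 1) = 1.
Proof. apply LIM_eq. eapply ulim_ext with (x := fun _ => 1); [|apply ulim_const]. apply ultra_all; intros N. symmetry. apply (EN_const J h rho G N 1). Qed.
Lemma E_lin r r1 r2 c1 c2 : bd1 r -> bd1 r1 -> bd1 r2 -> (forall s, r s = c1 * r1 s + c2 * r2 s) -> E r = c1 * E r1 + c2 * E r2.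
Proof.
  intros B B1 B2 H. apply (Om_lin2 J h rho G); auto. intros N psi s _. unfold tr; simpl. rewrite H. ring.
Qed.

(** In the limit a_j + sum_x M_xj b_x annihilates the ground state; by anticommutation only the
    sites of [V] contribute when it is paired with an odd operator living on [V]. *)
Lemma W_relation hg r V j : bd1 r -> NoDup V -> (forall x s, ~ In x V -> r (flip x s) = r s) ->
  In (snd hg) V -> 
  Om [hg] r [(true, j)] - Om [(true, j); hg] r [] +
  Rsum (fun x => Mk lam true x j * (Om [hg] r [(false, x)] + Om [(false, x); hg] r [])) V = 0.
Proof.
  intros Br ND Hr Hg.
  set (F := fun g => Om [hg] r [g] - eta g * Om [g; hg] r []).
  set (pk := fun k => pproj (kapf lam) k).
  assert (Fout : forall x, ~ In x V -> F (false, x) = 0).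
  { intros x Hx. unfold F, eta; cbn [fst].
    assert (Q : Om [hg] r [(false, x)] = -1 * Om [(false, x); hg] r []); [|change (Om [hg] r [(false, x)] - -1 * Om [(false, x); hg] r [] = 0); rewrite Q; ring].
    apply (Om_eq J h rho G); auto.
    intros N psi s HN. unfold tr; simpl.
    assert (inN N hg) by (apply HN; simpl; auto). assert (inN N (false, x)) by (apply HN; simpl; auto).
    replace (fun s0 : conf => r s0 * gm N (false, x) psi s0) with (gm N (false, x) (fun u => r u * psi u)).
    - rewrite (gm_anti N hg) by (auto; intros Ee; rewrite Ee in Hg; contradiction). ring.
    - extensionality u. rewrite gm_mul. cbn [snd]. now rewrite Hr. }
  (* The vector d is the approximate projection applied to a_j. Both halves of [F] are bounded by
     its norm through Cauchy-Schwarz, whence the factor 4. *)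
  assert (KL : forall k, exists d, (forall f, ev f d = ac (pk k) f (true, j)) /\ Rsqr (ev F d) <= 4 * ac (pmul (pk k) (pk k)) (cc rho (true, j)) (true, j)).
  { intros k. destruct (qv_ex lam (pk k) (e1 (true, j))) as [d Hd].
    exists d. split; [intros f; now rewrite Hd, ev_e1|].
    assert (EC : ac (pmul (pk k) (pk k)) (cc rho (true, j)) (true, j) = Cf (cc rho) d d).
    { rewrite <- (Lf_mul lam (cc rho) (cc_comm J h rho G Hh Hlam) (pk k) (pk k) (e1 (true, j)) (e1 (true, j)) d d Hd Hd).
      unfold Lf. rewrite ev_e1. rewrite ev_e1. reflexivity. }
    rewrite EC.
    assert (Lf1 : ulim (fun N => ev (fun g => omN N (tr N [hg] r [g]) - eta g * omN N (tr N [g; hg] r [])) d) (ev F d)).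
    { apply (ulim_Rsum (fun N x => fst x * (omN N (tr N [hg] r [snd x]) - eta (snd x) * omN N (tr N [snd x; hg] r []))) (fun x => fst x * F (snd x))).
      intros x _. apply ulim_scal. apply ulim_minus; [|apply ulim_scal]; now apply (Om_lim J h rho G). }
    apply (ulim_le _ _ _ _ (ulim_mult _ _ _ _ Lf1 Lf1) (ulim_scal 4 _ _ (cc_ev_lim J h rho G Hlam d d))).
    eapply ultra_mono; [|exact (ultra_and _ _ (eventually_inv d) (eventually_in hg))].
    intros N [Hd' Hhg]. cbn beta.
    set (X := ev (fun g => omN N (tr N [hg] r [g])) d). set (Y := ev (fun g => eta g * omN N (tr N [g; hg] r [])) d).
    assert (EXY : ev (fun g => omN N (tr N [hg] r [g]) - eta g * omN N (tr N [g; hg] r [])) d = X - Y).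
    { unfold X, Y, ev. rewrite <- Rsum_minus. apply Rsum_ext; intros; ring. }
    rewrite EXY. rewrite <- cN_ph. set (CN := omN N (fun psi => pht N d (ph N d psi))).
    assert (Ihg : inw N [hg]) by (intros g [<-|[]]; auto).
    assert (A0 := adj_ph N d Hd'). assert (A0' := adj_sym _ _ _ _ A0).
    assert (A1 := adj_comp _ _ _ _ _ _ (adj_diag (bs N) (bl N) r) (adj_sym _ _ _ _ (adj_wop N [hg] Ihg))).
    assert (A2 := adj_comp _ _ _ _ _ _ (adj_wop N [hg] Ihg) (adj_diag (bs N) (bl N) r)).
    assert (C1 := om_CS _ _ _ (DN J h rho G N) _ _ _ _ A1 A0). cbn beta in C1.
    assert (C2 := om_CS _ _ _ (DN J h rho G N) _ _ _ _ A0 A2). cbn beta in C2.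
    assert (NX : X = om (bs N) (bl N) (sr rho (bs N) (bl N)) (fun psi => wop N [hg] (fun s => r s * ph N d psi s))).
    { unfold X, chain_om. rewrite <- (om_ev (bs N) (bl N) (sr rho (bs N) (bl N)) (fun g => tr N [hg] r [g])).
      apply om_ext; intros psi l Hl. unfold tr. rewrite <- (adj_ev _ _ _ _ (fun g s => r s * wop N [g] psi s) d l (adj_wop N [hg] Ihg)) by auto.
      f_equal. extensionality s. unfold ph, ev. rewrite <- !Rsum_scal. apply Rsum_ext; intros; simpl; ring. }
    assert (NY : Y = om (bs N) (bl N) (sr rho (bs N) (bl N)) (fun psi => pht N d (wop N [hg] (fun s => r s * psi s)))).
    { unfold Y, pht, chain_om. rewrite om_ev. apply ev_ext; intros g.
      symmetry. exact (om_scalN rho N (eta g) (tr N [g; hg] r [])). }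
    rewrite <- NX in C1. rewrite <- NY in C2.
    assert (B1 : om (bs N) (bl N) (sr rho (bs N) (bl N)) (fun psi => wop N [hg] (fun s => r s * (r s * wopt N [hg] psi s))) <= 1).
    { apply Rle_trans with (EN N (fun s => Rsqr (r (flw [hg] s)))).
      - right. apply om_ext; intros psi l _. rewrite <- (wop_mid N [hg] (fun s => Rsqr (r s))) by auto. f_equal. extensionality s. unfold Rsqr. ring.
      - rewrite <- (EN_const J h rho G N 1). apply (EN_le J h rho G). intros; now apply bd1_sq. }
    assert (B2 : om (bs N) (bl N) (sr rho (bs N) (bl N)) (fun psi s => r s * wopt N [hg] (wop N [hg] (fun s => r s * psi s)) s) <= 1).
    { apply Rle_trans with (EN N (fun s => Rsqr (r s))).
      - right. apply om_ext; intros psi l _. 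
        replace (wop N [hg] (fun s => r s * psi s)) with (fun u => 1 * wop N [hg] (fun s => r s * psi s) u) by (extensionality u; ring).
        rewrite (wopt_mid N [hg] (fun _ => 1)) by auto. unfold Rsqr. ring.
      - rewrite <- (EN_const J h rho G N 1). apply (EN_le J h rho G). intros; now apply bd1_sq. }
    assert (PC := om_pos _ _ _ (DN J h rho G N) _ _ A0). cbn beta in PC.
    change (om (bs N) (bl N) (sr rho (bs N) (bl N)) (fun psi => pht N d (ph N d psi))) with CN in C1, C2, PC.
    unfold Rsqr in C1, C2.
    assert (X * X <= CN) by (eapply Rle_trans; [exact C1|]; rewrite <- (Rmult_1_l CN) at 2; apply Rmult_le_compat_r; auto).
    assert (Y * Y <= CN) by (eapply Rle_trans; [exact C2|]; rewrite <- (Rmult_1_r CN) at 2; apply Rmult_le_compat_l; auto).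
    assert (0 <= (X + Y) * (X + Y)) by apply Rle_0_sqr. lra. }
  assert (FE : forall k f, ac (pk k) f (true, j) = f (true, j) + ac (spol lam k) f (true, j)).
  { intros k f. unfold pk, pproj. rewrite ac_add, ac_C. unfold spol. ring. }
  assert (FV : forall k, ac (spol lam k) F (true, j) = Rsum (fun x => F (false, x) * sker lam k (true, j) (false, x)) V).
  { intros k.
    set (Fb := fun g : gen => if fst g then 0 else F g).
    assert (E1 : ac (spol lam k) F (true, j) = ac (spol lam k) Fb (true, j)).
    { replace F with (fun g => Fb g + 1 * (F g + (-1) * Fb g)) by (extensionality g; ring).
      rewrite ac_linear. rewrite (sk_odd lam k true (fun g => F g + (-1) * Fb g)); [|intros; unfold Fb; cbn [fst negb]; ring].
      ring. }
    rewrite E1, (ac_fin lam (spol lam k) (map (fun x => (false, x)) V) Fb (true, j)).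
    - rewrite Rsum_map. reflexivity.
    - apply FinFun.Injective_map_NoDup; auto. intros x y Ee; congruence.
    - intros [[] x] Hx; unfold Fb; cbn [fst]; auto. apply Fout. intros Hv. apply Hx, in_map_iff. eauto. }
  assert (L0 : ulim (fun k => F (true, j) + Rsum (fun x => F (false, x) * sker lam k (true, j) (false, x)) V) 0).
  { intros eps He.
    assert (A := annihilated lam (cc rho) Hlam (cc_comm J h rho G Hh Hlam) (cc_bd J h rho G Hlam) (cc_sym J h rho G Hlam)
       (cc_aa J h rho G Hlam) (cc_pos J h rho G Hlam) (cc_neg J h rho G Hh Hlam) j).
    eapply ultra_mono; [|exact (A (eps * eps / 4) ltac:(nra))]. intros k Hk. cbn beta in *.
    destruct (KL k) as [d [Hd1 Hd2]]. rewrite Hd1, FE, FV in Hd2. unfold pk in Hd2.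
    rewrite Rminus_0_r in *. set (X := F (true, j) + _) in *.
    match type of Hk with Rabs ?Y < _ => assert (Y < eps * eps / 4) by (eapply Rle_lt_trans; [apply Rle_abs|exact Hk]) end.
    unfold Rsqr in Hd2. apply Rabs_def1; nra. }
  assert (L1 : ulim (fun k => F (true, j) + Rsum (fun x => F (false, x) * sker lam k (true, j) (false, x)) V)
     (F (true, j) + Rsum (fun x => F (false, x) * Mk lam true x j) V)).
  { apply ulim_plus; [apply ulim_const|].
    apply (ulim_Rsum (fun k x => F (false, x) * sker lam k (true, j) (false, x)) (fun x => F (false, x) * Mk lam true x j)).
    intros x _. apply ulim_scal. apply (Sm_lim lam Hlam (true, j) x). }
  assert (EQ := ulim_unique _ _ _ L1 L0).
  change (Om [hg] r [(true, j)] - 1 * Om [(true, j); hg] r [] +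
    Rsum (fun x => (Om [hg] r [(false, x)] - -1 * Om [(false, x); hg] r []) * Mk lam true x j) V = 0) in EQ.
  etransitivity; [|exact EQ]. f_equal; [ring|]. apply Rsum_ext; intros x _; ring.
Qed.
End State.

(** * Conditioning on plus spins *)

Lemma list_max {A} (f : A -> R) l : exists M, 0 <= M /\ (forall x, In x l -> f x <= M) /\ (M = 0 \/ exists x, In x l /\ f x = M).
Proof.
  induction l as [|a l (M & H0 & H1 & H2)].
  - exists 0. split; [lra|]. split; [intros x []|auto].
  - destruct (Rle_dec (f a) M) as [L|L].
    + exists M. split; auto. split; [intros x [<-|]; auto|]. destruct H2 as [|[x [Hx Ex]]]; [auto|right; exists x; simpl; auto].
    + exists (f a). split; [lra|]. split; [|right; exists a; simpl; auto].
      intros x [<-|Hx]; [lra|]. specialize (H1 x Hx); lra.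
Qed.

Section Conditioning.
Variables (J h : R) (rho : Z -> nat -> Op).
Hypothesis G : is_ground_state J h rho.
Hypothesis Hh : 0 < h.
Let lam := J / h.
Hypothesis Hlam : 0 < Rabs lam < 1 / 100.
Notation omN := (chain_om rho).
Notation Om := (Om rho).
Notation E := (expect rho).
Notation M := (Mk lam true).

Lemma gm_false N x psi s : inN N (true, x) -> gm N (false, x) psi s = sg (s x) * gm N (true, x) psi s.
Proof.
  intros H. unfold gm, gam, send, inN in *; cbn [fst snd] in *. rewrite par_S by (unfold bs; lia). ring.
Qed.

Lemma b_right u r x e : bd1 r -> (forall s, r s * sg (s x) = e * r s) -> Om u r [(false, x)] = e * Om u r [(true, x)].
Proof.
  intros Br He. apply (Om_eq J h rho G); auto. intros N psi s HN. unfold tr. simpl.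
  rewrite <- wop_scal. f_equal. extensionality t.
  rewrite gm_false by (apply (HN (false, x)), in_app_iff; simpl; auto).
  rewrite <- !Rmult_assoc, He. ring.
Qed.

(** Here the spin at [x] is flipped between [r] and the sign carried by the generator, whence the
    minus sign compared with [b_right]. *)
Lemma b_left hg r x e : bd1 r -> snd hg <> x -> (forall s, r s * sg (s x) = e * r s) ->
  Om [(false, x); hg] r [] = - e * Om [(true, x); hg] r [].
Proof.
  intros Br Hx He. apply (Om_eq J h rho G); auto. intros N psi s HN. unfold tr. simpl.
  rewrite gm_false by (apply (HN (false, x)); simpl; auto).
  unfold gm, gam. cbn [snd].
  assert (Q := He (flip (snd hg) (flip x s))). rewrite flip_other, flip_same, sg_negb in Q by auto.
  set (c := r (flip (snd hg) (flip x s))) in *.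
  transitivity (- (c * - sg (s x)) * (par (bs N) (send (true, x)) s * (par (bs N) (send hg) (flip x s) * psi (flip (snd hg) (flip x s))))); [ring|].
  rewrite Q. ring.
Qed.

(** 1 + M is within 1/4 of twice the identity; at a site where the weighted modulus of [y] attains
    its maximum mu this gives 2 mu <= c + mu / 4. *)
Lemma dominance T j y c : NoDup T -> 0 <= c ->
  (forall x, In x T -> Rabs (y x + Rsum (fun t => M x t * y t) T) * wt 2 (x - j) <= c) ->
  forall x, In x T -> Rabs (y x) * wt 2 (x - j) <= 4 / 7 * c.
Proof.
  intros ND Hc H.
  destruct (list_max (fun x => Rabs (y x) * wt 2 (x - j)) T) as (mu & M0 & M1 & M2).
  intros x Hx. eapply Rle_trans; [apply M1; auto|].
  destruct M2 as [->|[x0 [Hx0 E0]]]; [lra|].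
  specialize (H x0 Hx0). assert (Wp := wt_pos 2 (x0 - j) ltac:(lra)).
  assert (S2 : 2 * y x0 = (y x0 + Rsum (fun t => M x0 t * y t) T) - Rsum (fun t => (M x0 t - if Z.eq_dec x0 t then 1 else 0) * y t) T).
  { rewrite (Rsum_ext (fun t => (M x0 t - if Z.eq_dec x0 t then 1 else 0) * y t) (fun t => M x0 t * y t - (if Z.eq_dec t x0 then y t else 0))).
    - rewrite Rsum_minus, Rsum_delta by auto. ring.
    - intros t _. destruct (Z.eq_dec x0 t), (Z.eq_dec t x0); subst; try congruence; ring. }
  assert (B : Rabs (Rsum (fun t => (M x0 t - if Z.eq_dec x0 t then 1 else 0) * y t) T) * wt 2 (x0 - j) <= / 4 * mu).
  { apply Rle_trans with (Rsum (fun t => (Rabs (M x0 t - if Z.eq_dec x0 t then 1 else 0) * wt 2 (x0 - t)) * mu) T).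
    - eapply Rle_trans; [apply Rmult_le_compat_r; [lra|apply Rsum_abs]|].
      rewrite <- Rsum_scal_r. apply Rsum_le; intros t Ht. rewrite Rabs_mult.
      assert (Wt := wt_tri 2 (x0 - t) (t - j) ltac:(lra)). replace (x0 - t + (t - j))%Z with (x0 - j)%Z in Wt by lia.
      specialize (M1 t Ht). cbn beta in M1. set (A := Rabs (M x0 t - _)) in *.
      assert (0 <= A) by apply Rabs_pos. assert (0 <= Rabs (y t)) by apply Rabs_pos.
      assert (W1 := wt_pos 2 (x0 - t) ltac:(lra)).
      apply Rle_trans with (A * Rabs (y t) * (wt 2 (x0 - t) * wt 2 (t - j))).
      + apply Rmult_le_compat_l; auto. now apply Rmult_le_pos.
      + replace (A * Rabs (y t) * (wt 2 (x0 - t) * wt 2 (t - j))) with (A * wt 2 (x0 - t) * (Rabs (y t) * wt 2 (t - j))) by ring.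
        apply Rmult_le_compat_l; auto. apply Rmult_le_pos; lra.
    - rewrite Rsum_scal_r. apply Rmult_le_compat_r; auto. apply (Mk_row lam Hlam); auto. }
  assert (2 * mu <= c + / 4 * mu); [|lra].
  rewrite <- E0 at 1.
  replace (2 * (Rabs (y x0) * wt 2 (x0 - j))) with (Rabs (2 * y x0) * wt 2 (x0 - j)) by (rewrite Rabs_mult, (Rabs_right 2) by lra; ring).
  rewrite S2. eapply Rle_trans; [apply Rmult_le_compat_r; [lra|apply Rabs_triang]|].
  rewrite Rabs_Ropp. lra.
Qed.

Lemma M_off x j : x <> j -> Rabs (M x j) * wt 2 (x - j) <= / 4.
Proof.
  intros H. assert (Q := Mk_sum lam Hlam true j [x] ltac:(repeat constructor; simpl; tauto)).
  simpl in Q. destruct (Z.eq_dec x j); [contradiction|]. cbn in Q. rewrite Rminus_0_r, Rplus_0_r in Q. exact Q.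
Qed.

(** 1 + M is invertible on [T] by [dominance]. Off-diagonal weighted entries of M are at most 1/4,
    and 4/7 of that is the bound 1/7. *)
Lemma solution T : NoDup T -> exists Y : Z -> Z -> R, forall j, ~ In j T ->
  (forall x, In x T -> Y j x + Rsum (fun t => M x t * Y j t) T = - M x j) /\
  (forall x, In x T -> Rabs (Y j x) * wt 2 (x - j) <= 1 / 7).
Proof.
  intros ND.
  destruct (LinAlg.matrix_inverse T (fun x t => M x t + if Z.eq_dec t x then 1 else 0) ND) as [B [_ HB]].
  - intros z Hz k Hk. assert (D := dominance T k z 0 ND ltac:(lra)).
    assert (D' : Rabs (z k) * wt 2 (k - k) <= 4 / 7 * 0).
    { apply D; auto. intros x Hx. specialize (Hz x Hx).
      rewrite (Rsum_ext _ (fun t => M x t * z t + (if Z.eq_dec t x then z t else 0))) in Hz.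
      - rewrite Rsum_plus, Rsum_delta in Hz by auto. rewrite Rplus_comm, Hz, Rabs_R0. lra.
      - intros t _. destruct Z.eq_dec; ring. }
    rewrite Z.sub_diag, wt_0 in D'. assert (0 <= Rabs (z k)) by apply Rabs_pos.
    destruct (Req_dec (z k) 0) as [|Nz]; auto. apply Rabs_pos_lt in Nz. lra.
  - exists (fun j x => Rsum (fun i => B x i * - M i j) T). intros j Hj.
    assert (S1 : forall x, In x T -> Rsum (fun i => B x i * - M i j) T + Rsum (fun t => M x t * Rsum (fun i => B t i * - M i j) T) T = - M x j).
    { intros x Hx. transitivity (Rsum (fun t => (M x t + if Z.eq_dec t x then 1 else 0) * Rsum (fun i => B t i * - M i j) T) T).
      - rewrite (Rsum_ext (fun t => (M x t + _) * _) (fun t => M x t * Rsum (fun i => B t i * - M i j) T + (if Z.eq_dec t x then Rsum (fun i => B t i * - M i j) T else 0))).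
        + rewrite Rsum_plus. rewrite (Rsum_delta Z.eq_dec (fun t => Rsum (fun i => B t i * - M i j) T)) by auto. ring.
        + intros t _. destruct Z.eq_dec; ring.
      - rewrite (Rsum_ext _ (fun t => Rsum (fun i => (M x t + if Z.eq_dec t x then 1 else 0) * B t i * - M i j) T))
          by (intros; rewrite <- Rsum_scal; apply Rsum_ext; intros; ring).
        rewrite Rsum_swap.
        rewrite (Rsum_ext _ (fun i => if Z.eq_dec i x then - M i j else 0)).
        + now rewrite (Rsum_delta Z.eq_dec (fun i => - M i j)).
        + intros i Hi. rewrite Rsum_scal_r, HB by auto.
          destruct (Z.eq_dec x i), (Z.eq_dec i x); subst; try congruence; cbn; ring. }
    split; auto. intros x Hx.
    replace (1 / 7) with (4 / 7 * / 4) by field.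
    apply (dominance T j (fun x => Rsum (fun i => B x i * - M i j) T)); auto; [lra|].
    intros x' Hx'. rewrite S1, Rabs_Ropp by auto. apply M_off. intros ->; contradiction.
Qed.

(** With [Y] from [solution] this is the Schur complement M_LL - M_LT (1 + M_TT)^(-1) M_TL. *)
Definition Ocoef (T : list Z) (Y : Z -> Z -> R) (k j : Z) : R := M k j + Rsum (fun t => M k t * Y j t) T.

(** On sites of [T] the sum over the second generator equals the difference over the first, since
    the spin there is plus. Adding the relations of [T] with weights [Y] to that of [j] cancels all
    terms of [T]. *)
Lemma cond_relation L T Y r hg j : NoDup (L ++ T) -> bd1 r ->
  (forall x s, ~ In x (L ++ T) -> r (flip x s) = r s) -> (forall x s, In x T -> r s * sg (s x) = r s) ->
  In (snd hg) L -> In j L ->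
  (forall x, In x T -> Y j x + Rsum (fun t => M x t * Y j t) T = - M x j) ->
  Om [hg] r [(true, j)] - Om [(true, j); hg] r [] =
  - Rsum (fun k => Ocoef T Y k j * (Om [hg] r [(false, k)] + Om [(false, k); hg] r [])) L.
Proof.
  intros ND Br Hr HT Hg Hj HY.
  set (Dd := fun x => Om [hg] r [(true, x)] - Om [(true, x); hg] r []).
  set (Sd := fun x => Om [hg] r [(false, x)] + Om [(false, x); hg] r []).
  assert (HgT : forall x, In x T -> snd hg <> x).
  { intros x Hx Ex. rewrite Ex in Hg. apply (NoDup_app_remove_l L T) in ND as NT. 
    clear - ND Hg Hx. induction L as [|a L IH]; simpl in *; [tauto|]. inversion ND; subst.
    destruct Hg as [->|Hg]; [|auto]. apply H1, in_app_iff; auto. }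
  assert (SD : forall x, In x T -> Sd x = Dd x).
  { intros x Hx. unfold Sd, Dd.
    rewrite (b_right [hg] r x 1), (b_left hg r x 1); auto; [ring| |]; intros s; rewrite HT by auto; ring. }
  assert (W : forall i, Dd i + Rsum (fun k => M k i * Sd k) L + Rsum (fun x => M x i * Dd x) T = 0).
  { intros i. assert (Q := W_relation J h rho G Hh Hlam hg r (L ++ T) i Br ND Hr ltac:(apply in_app_iff; auto)).
    rewrite Rsum_app in Q. rewrite <- Q. unfold Dd at 1. rewrite Rplus_assoc. f_equal. f_equal.
    apply Rsum_ext; intros x Hx. rewrite <- SD by auto. reflexivity. }
  assert (WT : Rsum (fun t => Y j t * (Dd t + Rsum (fun k => M k t * Sd k) L + Rsum (fun x => M x t * Dd x) T)) T = 0).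
  { apply Rsum_zero. intros t _. rewrite W. ring. }
  assert (W0 := W j).
  rewrite (Rsum_ext _ (fun t => Y j t * Dd t + (Rsum (fun k => Y j t * M k t * Sd k) L + Rsum (fun x => Y j t * M x t * Dd x) T))) in WT.
  2:{ intros t _. rewrite (Rsum_ext (fun k => Y j t * M k t * Sd k) (fun k => Y j t * (M k t * Sd k))) by (intros; ring).
      rewrite (Rsum_ext (fun x => Y j t * M x t * Dd x) (fun x => Y j t * (M x t * Dd x))) by (intros; ring).
      rewrite !Rsum_scal. ring. }
  rewrite !Rsum_plus in WT. rewrite Rsum_swap in WT.
  rewrite (Rsum_swap (fun t x => Y j t * M x t * Dd x)) in WT.
  assert (E1 : Rsum (fun y => Rsum (fun x => Y j x * M y x * Dd y) T) T = Rsum (fun x => (- Y j x - M x j) * Dd x) T).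
  { apply Rsum_ext; intros x Hx. rewrite Rsum_scal_r. f_equal.
    rewrite (Rsum_ext _ (fun t => M x t * Y j t)) by (intros; ring). specialize (HY x Hx). lra. }
  rewrite E1 in WT.
  assert (E2 : Rsum (fun x => (- Y j x - M x j) * Dd x) T = - Rsum (fun t => Y j t * Dd t) T - Rsum (fun x => M x j * Dd x) T).
  { rewrite <- Rsum_opp, <- Rsum_minus. apply Rsum_ext; intros; ring. }
  assert (E3 : Rsum (fun k => Ocoef T Y k j * Sd k) L = Rsum (fun k => M k j * Sd k) L + Rsum (fun k => Rsum (fun t => Y j t * M k t * Sd k) T) L).
  { rewrite <- Rsum_plus. apply Rsum_ext; intros k _. unfold Ocoef. rewrite Rsum_scal_r, Rmult_plus_distr_r. f_equal. f_equal.
    apply Rsum_ext; intros; ring. }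
  fold (Dd j). change (Dd j = - Rsum (fun k => Ocoef T Y k j * Sd k) L). rewrite E3. lra.
Qed.
End Conditioning.

(** * Indicators of patterns *)

Lemma ind_flip_out V z x s : ~ In x V -> ind V z (flip x s) = ind V z s.
Proof.
  intros H. unfold ind. rewrite (forallb_ext_in (fun k => Bool.eqb (flip x s k) (z k)) (fun k => Bool.eqb (s k) (z k))); [reflexivity|].
  intros k Hk. rewrite flip_other; auto. congruence.
Qed.
Lemma ind_flip_in V z x s : ind V z (flip x s) = ind V (flip x z) s.
Proof.
  unfold ind. rewrite (forallb_ext_in (fun k => Bool.eqb (flip x s k) (z k)) (fun k => Bool.eqb (s k) (flip x z k))); [reflexivity|].
  intros k Hk. unfold flip. destruct (Z.eqb_spec k x); auto. destruct (s k), (z k); reflexivity.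
Qed.
Lemma ind_sg V z x s : In x V -> ind V z s * sg (s x) = sg (z x) * ind V z s.
Proof.
  intros H. unfold ind. destruct (forallb _ V) eqn:Q; [|ring].
  rewrite forallb_forall in Q. specialize (Q x H). apply eqb_prop in Q. rewrite Q. ring.
Qed.
Lemma ind_sq V z s : Rsqr (ind V z s) = ind V z s.
Proof. unfold ind, Rsqr. destruct forallb; ring. Qed.
Lemma ind_01 V z s : 0 <= ind V z s <= 1.
Proof. unfold ind. destruct forallb; lra. Qed.
Lemma ind_app V W z s : ind (V ++ W) z s = ind V z s * ind W z s.
Proof. unfold ind. rewrite forallb_app. destruct (forallb _ V), (forallb _ W); simpl; ring. Qed.
Lemma ind_ext V z z' : (forall k, In k V -> z k = z' k) -> ind V z = ind V z'.
Proof.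
  intros H. extensionality s. unfold ind. rewrite (forallb_ext_in (fun k => Bool.eqb (s k) (z k)) (fun k => Bool.eqb (s k) (z' k))); [reflexivity|].
  intros k Hk. now rewrite H.
Qed.
Lemma ind_cons x V z s : ind (x :: V) z s = (if Bool.eqb (s x) (z x) then 1 else 0) * ind V z s.
Proof. unfold ind. simpl. destruct (Bool.eqb (s x) (z x)), (forallb _ V); simpl; ring. Qed.
Lemma ind_split x V z s : ~ In x V -> ind V z s = ind (x :: V) z s + ind (x :: V) (flip x z) s.
Proof.
  intros H. rewrite !ind_cons, flip_same. rewrite <- (ind_flip_in V z x s), ind_flip_out by auto.
  destruct (s x), (z x); simpl; ring.
Qed.
Lemma ind_perm V W z : (forall k, In k V <-> In k W) -> ind V z = ind W z.
Proof.
  intros H. extensionality s. unfold ind.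
  assert (E : forallb (fun k => Bool.eqb (s k) (z k)) V = forallb (fun k => Bool.eqb (s k) (z k)) W); [|now rewrite E].
  apply eq_true_iff_eq. rewrite !forallb_forall. split; intros Q k Hk; apply Q, H, Hk.
Qed.
Lemma ind_mono V W z s : incl V W -> ind W z s <= ind V z s.
Proof.
  intros H. unfold ind. destruct (forallb (fun k => Bool.eqb (s k) (z k)) W) eqn:Q; [|destruct (forallb (fun k => Bool.eqb (s k) (z k)) V); lra].
  rewrite forallb_forall in Q. assert (Q' : forallb (fun k => Bool.eqb (s k) (z k)) V = true) by (apply forallb_forall; intros k Hk; apply Q, H, Hk).
  rewrite Q'. lra.
Qed.

Definition plus (T : list Z) : wf := ind T (fun _ => true).
Definition pat (s : conf) (T : list Z) : conf := fun x => if in_dec Z.eq_dec x T then true else s x.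

Lemma plus_flw T u s : (forall g, In g u -> ~ In (snd g) T) -> plus T (flw u s) = plus T s.
Proof.
  induction u as [|g u IH]; intros H; simpl; [reflexivity|].
  unfold plus in *. rewrite ind_flip_out by (apply H; simpl; auto). apply IH. intros; apply H; simpl; auto.
Qed.

Lemma NoDup_disj (L T : list Z) x : NoDup (L ++ T) -> In x L -> ~ In x T.
Proof.
  induction L as [|a L IH]; simpl; [tauto|]. intros ND [->|Hx] HT; inversion ND; subst.
  - apply H1, in_app_iff; auto.
  - apply IH; auto.
Qed.

Lemma pat_flip s T k : ~ In k T -> flip k (pat s T) = pat (flip k s) T.
Proof.
  intros H. extensionality x. unfold flip, pat. destruct (Z.eqb_spec x k); [|reflexivity].
  subst. destruct in_dec; [contradiction|reflexivity].
Qed.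

Lemma Rsum_incl_le (f : Z -> R) S T : NoDup S -> NoDup T -> incl S T -> (forall x, 0 <= f x) -> Rsum f S <= Rsum f T.
Proof.
  intros NS NT H F.
  rewrite (Rsum_ext f (fun y => if in_dec Z.eq_dec y S then f y else 0) S).
  - rewrite <- (Rsum_incl (fun y => if in_dec Z.eq_dec y S then f y else 0) S T); auto.
    + apply Rsum_le; intros y _. destruct in_dec; [lra|auto].
    + intros y _ Hy. destruct in_dec; [contradiction|reflexivity].
  - intros y Hy. destruct in_dec; [reflexivity|contradiction].
Qed.

(** * Lower bounds for patterns conditioned on far plus spins *)

Section Low.
Variables (J h : R) (rho : Z -> nat -> Op).
Hypothesis G : is_ground_state J h rho.
Hypothesis Hh : 0 < h.
Let lam := J / h.
Hypothesis Hlam : 0 < Rabs lam < 1 / 100.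
Notation Om := (Om rho).
Notation E := (expect rho).
Notation M := (Mk lam true).
Definition prob_plus (T : list Z) : R := E (plus T).
Notation pT := prob_plus.

Lemma bd1_flw r u : bd1 r -> bd1 (fun s => Rsqr (r (flw u s))).
Proof. intros H s. rewrite Rabs_right by (apply Rle_ge, Rle_0_sqr). now apply bd1_sq. Qed.

Lemma E_nonneg r : bd1 r -> (forall s, 0 <= r s) -> 0 <= E r.
Proof.
  intros B H. assert (Q : E (fun s => 0) <= E r). { apply (E_le J h rho G); auto. intros s. rewrite Rabs_R0; lra. }
  rewrite (E_lin J h rho G (fun _ => 0) (fun _ => 1) (fun _ => 1) 0 0) in Q; auto using bd1_one; [lra| |intros; ring].
  intros s. rewrite Rabs_R0; lra.
Qed.

Lemma Om_bound_l T u v r : bd1 r -> (forall s, r s * plus T s = r s) -> (forall g, In g v -> ~ In (snd g) T) ->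
  Rsqr (Om u r v) <= E (fun s => Rsqr (r (flw u s))) * pT T.
Proof.
  intros Br Hr Hv. replace r with (fun s => r s * plus T s) at 1 by (extensionality s; apply Hr).
  eapply Rle_trans; [apply (Om_CS J h rho G); auto; apply ind_bd|]. right. f_equal. unfold prob_plus. f_equal.
  extensionality s. rewrite plus_flw by auto. apply ind_sq.
Qed.
Lemma Om_bound_r T u v r : bd1 r -> (forall s, r s * plus T s = r s) -> (forall g, In g u -> ~ In (snd g) T) ->
  Rsqr (Om u r v) <= pT T * E (fun s => Rsqr (r (flw v s))).
Proof.
  intros Br Hr Hv. replace r with (fun s => plus T s * r s) at 1 by (extensionality s; rewrite Rmult_comm; apply Hr).
  eapply Rle_trans; [apply (Om_CS J h rho G); auto; apply ind_bd|]. right. f_equal. unfold prob_plus. f_equal.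
  extensionality s. rewrite plus_flw by auto. apply ind_sq.
Qed.

(** On [L] the image of [v] already has the full norm of [v], so the isometry forces it to vanish
    outside [L]. Then [v] has an image of finite support and is zero. *)
Lemma isometry_kernel L v sgn : NoDup L -> (forall k, In k L -> sgn k * sgn k = 1) ->
  (forall j, In j L -> sgn j * v j + Rsum (fun k => M k j * v k) L = 0) -> forall k, In k L -> v k = 0.
Proof.
  intros ND Hs Hv. apply (no_finite_image lam Hlam L v ND).
  assert (MV : forall j, In j L -> Mv lam false v L j = - (sgn j * v j)).
  { intros j Hj. specialize (Hv j Hj). unfold Mv. rewrite (Rsum_ext _ (fun k => M k j * v k)); [lra|].
    intros k _. now rewrite (Mk_sym lam false). }
  intros x Hx.
  destruct (list_max (fun j => Rabs (v j) * wt 2 j) L) as (A & A0 & A1 & _).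
  assert (Iso := fun n => kernel_isometry lam Hlam false L v v A n ND A0 A1).
  set (K := 2 * A * Rsum (fun j => Rabs (v j)) L) in *.
  destruct (win_contains (x :: L)) as [n0 Hn0].
  assert (B : forall n, (n0 <= n)%nat -> Rsqr (Mv lam false v L x) <= K / 2 ^ n).
  { intros n Hn. eapply Rle_trans; [|apply Iso]. eapply Rle_trans; [|apply Rle_abs].
    assert (Hin : incl (x :: L) (win n)). { intros y Hy. apply Hn0, win_In in Hy. apply win_In. lia. }
    set (g := fun y => Mv lam false v L y * Mv lam false v L y).
    assert (H := Rsum_incl_le g (x :: L) (win n) ltac:(now constructor) (win_NoDup n) Hin ltac:(intros; apply Rle_0_sqr)).
    rewrite Rsum_cons in H.
    assert (E1 : Rsum g L = Rsum (fun j => v j * v j) L).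
    { apply Rsum_ext; intros j Hj. unfold g. rewrite MV by auto. specialize (Hs j Hj).
      transitivity (sgn j * sgn j * (v j * v j)); [ring|rewrite Hs; ring]. }
    unfold g in *. unfold Rsqr. lra. }
  destruct (Req_dec (Mv lam false v L x) 0) as [|N]; auto. exfalso.
  apply Rsqr_pos_lt in N. set (m := Rsqr (Mv lam false v L x)) in *.
  destruct (Pow_x_infinity 2 ltac:(rewrite Rabs_right; lra) (K / m + 1)) as [n1 Hn1].
  specialize (Hn1 (Nat.max n0 n1) ltac:(lia)). specialize (B (Nat.max n0 n1) ltac:(lia)).
  assert (P : 0 < 2 ^ Nat.max n0 n1) by (apply pow_lt; lra). rewrite Rabs_right in Hn1 by lra.
  apply Rmult_le_compat_r with (r := 2 ^ Nat.max n0 n1) in B; [|lra].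
  replace (K / 2 ^ Nat.max n0 n1 * 2 ^ Nat.max n0 n1) with K in B by (field; lra).
  apply Rge_le in Hn1. apply Rmult_le_compat_l with (r := m) in Hn1; [|lra].
  replace (m * (K / m + 1)) with (K + m) in Hn1 by (field; lra). lra.
Qed.
End Low.

Section Low2.
Variables (J h : R) (rho : Z -> nat -> Op).
Hypothesis G : is_ground_state J h rho.
Hypothesis Hh : 0 < h.
Let lam := J / h.
Hypothesis Hlam : 0 < Rabs lam < 1 / 100.
Notation Om := (Om rho).
Notation E := (expect rho).
Notation M := (Mk lam true).
Notation pT := (prob_plus rho).
Notation Oc := (Ocoef J h).

Lemma M_row_abs k T : NoDup T -> Rsum (fun t => Rabs (M k t)) T <= 5 / 4.
Proof.
  intros ND. eapply Rle_trans; [|apply (Mk_sum_abs lam Hlam false k T ND)].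
  apply Rsum_le; intros t _. rewrite (Mk_sym lam false). cbn [negb].
  assert (W := wt_ge1 2 (t - k) ltac:(lra)). assert (0 <= Rabs (M k t)) by apply Rabs_pos.
  rewrite <- (Rmult_1_r (Rabs (M k t))) at 1. apply Rmult_le_compat_l; auto.
Qed.

(** Only the response [Y] has to travel from [j] to [T], and it decays like 2^(-D). *)
Lemma O_near T Y k j D : NoDup T -> (forall x, In x T -> Rabs (Y j x) * wt 2 (x - j) <= 1 / 7) ->
  (forall x, In x T -> (Z.of_nat D <= Z.abs (x - j))%Z) -> Rabs (Oc T Y k j - M k j) <= 1 / 2 ^ D.
Proof.
  intros ND HY HD. unfold Ocoef. fold lam.
  replace (M k j + Rsum (fun t => M k t * Y j t) T - M k j) with (Rsum (fun t => M k t * Y j t) T) by ring.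
  assert (P := pow_lt 2 D ltac:(lra)).
  eapply Rle_trans; [apply Rsum_abs|].
  apply Rle_trans with (Rsum (fun t => Rabs (M k t) * (1 / 7 / 2 ^ D)) T).
  - apply Rsum_le; intros t Ht. rewrite Rabs_mult. apply Rmult_le_compat_l; [apply Rabs_pos|].
    specialize (HY t Ht). specialize (HD t Ht).
    assert (2 ^ D <= wt 2 (t - j)) by (apply Rle_pow; [lra|lia]).
    assert (0 <= Rabs (Y j t)) by apply Rabs_pos.
    apply Rmult_le_reg_r with (2 ^ D); auto. replace (1 / 7 / 2 ^ D * 2 ^ D) with (1 / 7) by (field; lra).
    eapply Rle_trans; [|exact HY]. now apply Rmult_le_compat_l.
  - rewrite Rsum_scal_r. assert (B := M_row_abs k T ND).
    assert (0 < / 2 ^ D) by now apply Rinv_0_lt_compat. unfold Rdiv. nra.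
Qed.

Lemma pow_inv_lim (c : nat) : ulim (fun n => 1 / 2 ^ (n - c)) 0.
Proof.
  intros eps He. destruct (pow_lt_1_zero (/ 2) ltac:(rewrite Rabs_right; lra) eps He) as [n0 Hn0].
  eapply ultra_mono; [|exact (ultra_ge (n0 + c))]. intros n Hn. rewrite Rminus_0_r.
  unfold Rdiv. rewrite Rmult_1_l, <- pow_inv. apply Hn0. lia.
Qed.

Lemma far n c t j : (Z.abs j <= Z.of_nat c)%Z -> ~ In t (win n) -> (Z.of_nat (n - c) <= Z.abs (t - j))%Z.
Proof. intros Hj Ht. rewrite win_In in Ht. lia. Qed.

Lemma Rsqr_le_bound x c : Rsqr x <= c -> Rabs x <= sqrt c.
Proof. intros H. rewrite <- sqrt_Rsqr_abs. now apply sqrt_le_1_alt. Qed.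

Section Sequence.
Variables (L : list Z) (T : nat -> list Z).
Hypothesis NDT : forall n, NoDup (L ++ T n).
Hypothesis Tfar : forall n x, In x (T n) -> ~ In x (win n).
Hypothesis pTpos : forall n, 0 < pT (T n).
Definition rn n s := ind (L ++ T n) (pat s (T n)).
Definition qn s n := E (rn n s) / pT (T n).

Lemma rn_plus n s u : rn n s u * plus (T n) u = rn n s u.
Proof.
  unfold rn, plus. rewrite ind_app.
  rewrite (ind_ext (T n) (pat s (T n)) (fun _ => true)).
  - assert (Q := ind_sq (T n) (fun _ => true) u). unfold Rsqr in Q. rewrite Rmult_assoc, Q. reflexivity.
  - intros k Hk. unfold pat. destruct in_dec; [reflexivity|contradiction].
Qed.

Lemma disj n x : In x L -> ~ In x (T n).
Proof. apply NoDup_disj, NDT. Qed.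

Lemma rn_flip n s k u : In k L -> rn n s (flip k u) = rn n (flip k s) u.
Proof. intros H. unfold rn. rewrite ind_flip_in, pat_flip; auto using disj. Qed.

Lemma qn_01 s n : 0 <= qn s n <= 1.
Proof.
  assert (P := pTpos n). unfold qn. split.
  - apply Rmult_le_pos; [|left; now apply Rinv_0_lt_compat]. apply (E_nonneg J h rho G); [apply ind_bd|]. intros; apply ind_01.
  - apply Rmult_le_reg_r with (pT (T n)); auto. unfold Rdiv. rewrite Rmult_assoc, Rinv_l, Rmult_1_r, Rmult_1_l by lra.
    apply (E_le J h rho G); [apply ind_bd|apply ind_bd|]. intros u. rewrite <- rn_plus.
    assert (A := ind_01 (L ++ T n) (pat s (T n)) u). assert (B := ind_01 (T n) (fun _ => true) u). unfold rn, plus. nra.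
Qed.

(** When the pattern [s] has vanishing limiting probability, Cauchy-Schwarz kills the right-hand side
    of [cond_relation], and [isometry_kernel] applies to what is left. *)
Lemma flip_null s k0 : In k0 L -> ulim (qn s) 0 -> ulim (qn (flip k0 s)) 0.
Proof.
  intros Hk0 Hq. destruct (win_contains L) as [c Hc].
  assert (HcZ : forall j, In j L -> (Z.abs j <= Z.of_nat c)%Z) by (intros; now apply win_In, Hc).
  assert (NDL : NoDup L) by (apply NoDup_app_remove_r with (T 0%nat), NDT).
  assert (NDTn : forall n, NoDup (T n)) by (intros n; apply NoDup_app_remove_l with L, NDT).
  set (a0 := (true, k0) : gen).
  set (z := fun n j => Om [a0] (rn n s) [(true, j)] / pT (T n)).
  set (x1 := fun n j => Om [(true, j); a0] (rn n s) [] / pT (T n)).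
  set (x2 := fun n j => Om [(false, j); a0] (rn n s) [] / pT (T n)).
  assert (Bz : forall n j, In j L -> Rabs (z n j) <= 1).
  { intros n j Hj. assert (P := pTpos n).
    assert (B := Om_bound_l J h rho G (T n) [a0] [(true, j)] (rn n s) (ind_bd _ _) (rn_plus n s)
      ltac:(intros g [<-|[]]; apply disj; auto)).
    assert (B2 : E (fun u => Rsqr (rn n s (flw [a0] u))) <= pT (T n)).
    { apply (E_le J h rho G); [apply bd1_flw, ind_bd|apply ind_bd|]. intros u. simpl. rewrite rn_flip by auto. unfold rn. rewrite ind_sq.
      assert (Q := rn_plus n (flip k0 s) u). unfold rn in Q. rewrite <- Q.
      assert (A1 := ind_01 (L ++ T n) (pat (flip k0 s) (T n)) u). assert (B1 := ind_01 (T n) (fun _ => true) u). unfold plus. nra. }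
    assert (B3 : Rsqr (Om [a0] (rn n s) [(true, j)]) <= Rsqr (pT (T n))).
    { eapply Rle_trans; [exact B|]. change (Rsqr (pT (T n))) with (pT (T n) * pT (T n)). apply Rmult_le_compat_r; lra. }
    apply Rsqr_le_abs_0 in B3. rewrite (Rabs_right (pT (T n))) in B3 by lra.
    unfold z, Rdiv. rewrite Rabs_mult, (Rabs_right (/ pT (T n))) by (apply Rle_ge; left; now apply Rinv_0_lt_compat).
    apply Rmult_le_reg_r with (pT (T n)); auto. rewrite Rmult_assoc, Rinv_l, Rmult_1_r by lra. lra. }
  (* Here the indicator of [s] acts first, so Cauchy-Schwarz leaves the root of its conditional
     probability; in [Bz] the word [[a0]] on the left turns it into the flipped pattern, and only
     boundedness is available. *)
  assert (Bx : forall b n j, In j L -> Rabs (Om [(b, j); a0] (rn n s) [] / pT (T n)) <= sqrt (qn s n)).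
  { intros b n j Hj. assert (P := pTpos n). apply Rsqr_le_bound.
    assert (B := Om_bound_r J h rho G (T n) [(b, j); a0] [] (rn n s) (ind_bd _ _) (rn_plus n s)
      ltac:(intros g [<-|[<-|[]]]; apply disj; auto)).
    simpl flw in B. replace (fun u => Rsqr (rn n s u)) with (rn n s) in B by (extensionality u; symmetry; apply ind_sq).
    unfold Rdiv. rewrite Rsqr_mult. unfold qn.
    apply Rle_trans with (pT (T n) * E (rn n s) * Rsqr (/ pT (T n))).
    - apply Rmult_le_compat_r; [apply Rle_0_sqr|exact B].
    - right. unfold Rsqr. field. lra. }
  assert (Lsq : ulim (fun n => sqrt (qn s n)) 0).
  { intros eps He. eapply ultra_mono; [|exact (Hq (eps * eps) ltac:(nra))]. intros n Hn. cbn beta in *.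
    rewrite Rminus_0_r in *. destruct (qn_01 s n) as [Q0 _]. rewrite Rabs_right in Hn by lra.
    rewrite Rabs_right by (apply Rle_ge, sqrt_pos). rewrite <- (sqrt_square eps) by lra. apply sqrt_lt_1_alt. split; lra. }
  assert (Lx : forall b j, In j L -> ulim (fun n => Om [(b, j); a0] (rn n s) [] / pT (T n)) 0).
  { intros b j Hj. apply ulim_squeeze0 with (y := fun n => sqrt (qn s n)); auto. apply ultra_all; intros n. now apply Bx. }
  set (zl := fun j => LIM (fun n => z n j)).
  assert (Lz : forall j, In j L -> ulim (fun n => z n j) (zl j)).
  { intros j Hj. apply ulim_LIM. exists 1. apply ultra_all; intros; now apply Bz. }
  destruct (ClassicalEpsilon.choice _ (fun n => solution J h Hlam (T n) (NDTn n))) as [Y HY].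
  assert (LO : forall k j, In k L -> In j L -> ulim (fun n => Oc (T n) (Y n) k j) (M k j)).
  { intros k j Hk Hj.
    assert (Q : ulim (fun n => Oc (T n) (Y n) k j - M k j) 0).
    { apply ulim_squeeze0 with (y := fun n => 1 / 2 ^ (n - c)); [apply pow_inv_lim|]. apply ultra_all; intros n.
      destruct (HY n j (disj n j Hj)) as [_ H2].
      apply (O_near (T n) (Y n) k j (n - c)); [apply NDTn|exact H2|]. intros x Hx. apply far; [now apply HcZ|now apply (Tfar n)]. }
    assert (Q2 := ulim_plus _ _ _ _ Q (ulim_const (M k j))). rewrite Rplus_0_l in Q2.
    eapply ulim_ext; [|exact Q2]. apply ultra_all; intros n; cbn beta. lra. }
  (* The limit of [cond_relation] divided by [pT]. The terms with the indicator rightmost vanish,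
     and as [T n] recedes the coefficients tend to M. *)
  assert (Rel : forall j, In j L -> zl j + Rsum (fun k => M k j * (sg (s k) * zl k)) L = 0).
  { intros j Hj.
    apply (ulim_unique (fun n => (z n j - x1 n j) + Rsum (fun k => Oc (T n) (Y n) k j * (sg (s k) * z n k + x2 n k)) L)).
    - apply ulim_plus.
      + replace (zl j) with (zl j - 0) by ring. apply ulim_minus; auto. now apply Lx.
      + apply (ulim_Rsum (fun n k => Oc (T n) (Y n) k j * (sg (s k) * z n k + x2 n k)) (fun k => M k j * (sg (s k) * zl k))).
        intros k Hk. apply ulim_mult; auto. replace (sg (s k) * zl k) with (sg (s k) * zl k + 0) by ring.
        apply ulim_plus; [apply ulim_scal; auto|now apply Lx].
    - eapply ulim_ext with (x := fun _ => 0); [|apply ulim_const]. apply ultra_all; intros n. cbn beta.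
      destruct (HY n j (disj n j Hj)) as [H1 _]. assert (P := pTpos n).
      assert (C := cond_relation J h rho G Hh Hlam L (T n) (Y n) (rn n s) a0 j (NDT n) (ind_bd _ _)
        (fun x u Hx => ind_flip_out _ _ x u Hx)).
      assert (HS : forall x u, In x (T n) -> rn n s u * sg (u x) = rn n s u).
      { intros x u Hx. unfold rn. rewrite ind_sg by (apply in_app_iff; auto). unfold pat at 1. destruct in_dec; [simpl; ring|contradiction]. }
      specialize (C HS Hk0 Hj H1).
      change (Om [a0] (rn n s) [(true, j)] - Om [(true, j); a0] (rn n s) [] =
         - Rsum (fun k => Oc (T n) (Y n) k j * (Om [a0] (rn n s) [(false, k)] + Om [(false, k); a0] (rn n s) [])) L) in C.
      assert (E1 : forall k, In k L -> Om [a0] (rn n s) [(false, k)] = sg (s k) * Om [a0] (rn n s) [(true, k)]).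
      { intros k Hk. apply (b_right J h rho G); [apply ind_bd|]. intros u. unfold rn. rewrite ind_sg by (apply in_app_iff; auto).
        unfold pat at 1. destruct in_dec as [Hi|]; [exfalso; eapply disj; eauto|reflexivity]. }
      transitivity ((Om [a0] (rn n s) [(true, j)] - Om [(true, j); a0] (rn n s) [] +
         Rsum (fun k => Oc (T n) (Y n) k j * (Om [a0] (rn n s) [(false, k)] + Om [(false, k); a0] (rn n s) [])) L) / pT (T n)).
      + rewrite C. unfold Rdiv. ring.
      + unfold Rdiv. rewrite Rmult_plus_distr_r. f_equal; [unfold z, x1; field; lra|].
        rewrite <- Rsum_scal_r. apply Rsum_ext; intros k Hk. rewrite E1 by auto. unfold z, x2. field. lra. }
  assert (V0 : forall k, In k L -> sg (s k) * zl k = 0).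
  { apply (isometry_kernel J h Hlam L (fun k => sg (s k) * zl k) (fun k => sg (s k)) NDL); [intros; apply sg_sq|].
    intros j Hj. rewrite <- (Rel j Hj). f_equal. rewrite <- Rmult_assoc, sg_sq. ring. }
  assert (Z0' : zl k0 = 0).
  { specialize (V0 k0 Hk0). assert (Q := sg_sq (s k0)). 
    rewrite <- (Rmult_1_l (zl k0)), <- Q, Rmult_assoc, V0. ring. }
  assert (Lz0 := Lz k0 Hk0). rewrite Z0' in Lz0.
  (* At [j = k0] the generator on both sides conjugates the indicator of [s] into that of the
     flipped pattern, so [z] is the probability in question. *)
  eapply ulim_ext; [|exact Lz0]. apply ultra_all; intros n. cbn beta. unfold z, qn. f_equal.
  rewrite <- (Rmult_1_l (E (rn n (flip k0 s)))). unfold expect. apply (Om_eq J h rho G); [apply ind_bd|apply ind_bd|].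
  intros N psi u HN. unfold tr, a0; simpl.
  rewrite gm_mul. rewrite gm_sq by (apply (HN (true, k0)); simpl; auto). cbn [snd]. rewrite rn_flip by auto. unfold eta; cbn [fst]; ring.
Qed.

(** Any two patterns on [L] differ by finitely many flips, and the induction runs over the sites
    where they may differ. *)
Lemma all_null s0 : ulim (qn s0) 0 -> forall s, ulim (qn s) 0.
Proof.
  intros H0.
  assert (K : forall K, incl K L -> forall s, (forall x, In x L -> ~ In x K -> s x = s0 x) -> ulim (qn s) 0).
  { induction K as [|x K IH]; intros HK s Hs.
    - eapply ulim_ext; [|exact H0]. apply ultra_all; intros n. unfold qn, rn. do 2 f_equal.
      apply ind_ext. intros k Hk. unfold pat. destruct in_dec; auto. apply in_app_iff in Hk. destruct Hk; [|contradiction].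
      symmetry. apply Hs; auto.
    - assert (HK' : incl K L) by (intros y Hy; apply HK; simpl; auto).
      destruct (bool_dec (s x) (s0 x)) as [e|ne].
      + apply IH; auto. intros y Hy Hn. destruct (Z.eq_dec x y) as [->|]; auto. apply Hs; auto. intros [|]; auto.
      + rewrite <- (flip_flip x s). apply flip_null; [apply HK; simpl; auto|].
        apply IH; auto. intros y Hy Hn. destruct (Z.eq_dec y x) as [->|Ny].
        * rewrite flip_same. destruct (s x), (s0 x); simpl; congruence.
        * rewrite flip_other by auto. apply Hs; auto. intros [|]; auto. }
  intros s. apply (K L); [intros x; auto|]. intros x Hx Hn; contradiction.
Qed.
End Sequence.

(** The conditional probabilities of all patterns add up to one. Summing over the spin at the head
    of [L] removes this site and keeps the limits zero. *)
Lemma no_null_sequence (L : list Z) (T : nat -> list Z) : (forall n, NoDup (L ++ T n)) -> (forall n, 0 < pT (T n)) ->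
  (forall s, ulim (qn L T s) 0) -> False.
Proof.
  induction L as [|x L IH]; intros ND P H.
  - assert (Q : ulim (fun _ : nat => 1) 0).
    { eapply ulim_ext; [|exact (H (fun _ => true))]. apply ultra_all; intros n. unfold qn, rn, prob_plus, plus. simpl app.
      rewrite (ind_ext (T n) (pat (fun _ => true) (T n)) (fun _ => true)).
      - field. specialize (P n). unfold prob_plus, plus in P. lra.
      - intros k _. unfold pat. destruct in_dec; reflexivity. }
    assert (E1 := ulim_unique _ _ _ (ulim_const 1) Q). lra.
  - apply IH; auto.
    + intros n. specialize (ND n). now inversion ND.
    + intros s. assert (A := ulim_plus _ _ _ _ (H s) (H (flip x s))). rewrite Rplus_0_r in A.
      eapply ulim_ext; [|exact A]. apply ultra_all; intros n. cbn beta. unfold qn. specialize (ND n). simpl in ND. inversion ND; subst.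
      unfold Rdiv. rewrite <- Rmult_plus_distr_r. f_equal.
      rewrite (E_lin J h rho G (rn L T n s) (rn (x :: L) T n s) (rn (x :: L) T n (flip x s)) 1 1); [ring|apply ind_bd|apply ind_bd|apply ind_bd|].
      intros u. unfold rn. rewrite (ind_split x (L ++ T n)) by auto. rewrite pat_flip; [simpl; ring|].
      intros Hx. apply H2, in_app_iff; auto.
Qed.

(** A compactness argument: if no constant worked, sets receding to infinity would make the
    conditional probability of [s0], hence of every pattern, tend to zero. *)
Lemma pattern_lower_bound L s0 : NoDup L -> exists c, 0 < c /\ exists D, forall T, NoDup T -> (forall x, In x T -> ~ In x L /\ ~ In x (win D)) ->
  0 < pT T -> c * pT T <= E (ind (L ++ T) (pat s0 T)).
Proof.
  intros NDL. apply NNPP. intros N.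
  assert (S : forall n, exists T, NoDup (L ++ T) /\ (forall x, In x T -> ~ In x (win n)) /\ 0 < pT T /\
     E (ind (L ++ T) (pat s0 T)) < / (INR n + 1) * pT T).
  { intros n. apply NNPP. intros N2. apply N. exists (/ (INR n + 1)). split; [apply Rinv_0_lt_compat; assert (Q := pos_INR n); lra|].
    exists n. intros T NDT HT PT. apply Rnot_lt_le. intros Hl. apply N2. exists T. split; [|split; [|split]]; auto.
    - apply NoDup_app; auto. intros x Hx Hy. destruct (HT x Hy); auto.
    - intros x Hx. destruct (HT x Hx); auto. }
  destruct (ClassicalEpsilon.choice _ S) as [T HT].
  apply (no_null_sequence L T); [intros; apply HT|intros; apply HT|].
  apply (all_null L T (fun n => proj1 (HT n)) (fun n => proj1 (proj2 (HT n))) (fun n => proj1 (proj2 (proj2 (HT n)))) s0).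
  intros eps He. destruct (archimed_cor1 eps He) as [n0 [Hn0 Hp]].
  eapply ultra_mono; [|exact (ultra_ge n0)]. intros n Hn. destruct (HT n) as (A1 & A2 & A3 & A4).
  rewrite Rminus_0_r.
  assert (Q : 0 <= E (ind (L ++ T n) (pat s0 (T n)))) by (apply (E_nonneg J h rho G); [apply ind_bd|intros; apply ind_01]).
  unfold qn, rn. rewrite Rabs_right.
  - apply Rle_lt_trans with (/ (INR n + 1)).
    + apply Rmult_le_reg_r with (pT (T n)); auto. unfold Rdiv. rewrite Rmult_assoc, Rinv_l, Rmult_1_r by lra. lra.
    + apply Rle_lt_trans with (/ INR n0); auto. assert (0 < INR n0) by (apply lt_0_INR; lia). 
      apply Rinv_le_contravar; auto. apply le_INR in Hn. lra.
  - apply Rle_ge, Rmult_le_pos; auto. left; now apply Rinv_0_lt_compat.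
Qed.
End Low2.

(** * Parity of a window *)

(** Each letter contributes [eta] from taking adjoints and [e] from passing the diagonal factor. *)
Definition chi (e : R) (w : list gen) : R := fold_right (fun g acc => e * eta g * acc) 1 w.

Definition parity (V : list Z) (s : conf) : R := fold_right (fun x acc => sg (s x) * acc) 1 V.
Lemma parity_sq V s : parity V s * parity V s = 1.
Proof.
  induction V as [|x V IH]; simpl; [ring|].
  transitivity ((sg (s x) * sg (s x)) * (parity V s * parity V s)); [ring|]. rewrite sg_sq, IH. ring.
Qed.
Lemma parity_out V x s : ~ In x V -> parity V (flip x s) = parity V s.
Proof.
  induction V as [|y V IH]; simpl; intros H; [reflexivity|].
  rewrite IH, flip_other by (intros E; apply H; auto). reflexivity.
Qed.
Lemma parity_in V x s : NoDup V -> In x V -> parity V (flip x s) = - parity V s.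
Proof.
  induction V as [|y V IH]; simpl; intros ND H; [tauto|]. inversion ND; subst. destruct H as [->|H].
  - rewrite flip_same, sg_negb, parity_out by auto. ring.
  - rewrite IH, flip_other by (auto; intros ->; contradiction). ring.
Qed.

Definition annulus (D n : nat) : list Z := filter (fun x => if in_dec Z.eq_dec x (win D) then false else true) (win n).
Lemma annulus_In D n x : In x (annulus D n) <-> In x (win n) /\ ~ In x (win D).
Proof. unfold annulus. rewrite filter_In. destruct in_dec; intuition congruence. Qed.
Lemma annulus_NoDup D n : NoDup (annulus D n).
Proof. apply NoDup_filter, win_NoDup. Qed.
Lemma annulus_NDT D n : NoDup (win D ++ annulus D n).
Proof. apply NoDup_app; auto using win_NoDup, annulus_NoDup. intros x Hx Hy. apply annulus_In in Hy. tauto. Qed.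


Section Par.
Variables (J h : R) (rho : Z -> nat -> Op).
Hypothesis G : is_ground_state J h rho.
Hypothesis Hh : 0 < h.
Let lam := J / h.
Hypothesis Hlam : 0 < Rabs lam < 1 / 100.
Notation omN := (chain_om rho).
Notation Om := (Om rho).
Notation E := (expect rho).
Notation M := (Mk lam true).
Notation pT := (prob_plus rho).
Notation Oc := (Ocoef J h).

Lemma Om_car X g g' Y r v : bd1 r ->
  Om (X ++ g :: g' :: Y) r v = (if gen_eq_dec g g' then 2 * eta g * Om (X ++ Y) r v else 0) - Om (X ++ g' :: g :: Y) r v.
Proof.
  intros Br. rewrite (Om_lin2 J h rho G (X ++ g :: g' :: Y) r v (X ++ Y) r v (X ++ g' :: g :: Y) r v
    (if gen_eq_dec g g' then 2 * eta g else 0) (-1)); auto; [destruct gen_eq_dec; ring|].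
  intros N psi s HN. unfold tr. rewrite !wop_app.
  set (phi := fun s => r s * wop N v psi s).
  assert (Hg : inN N g) by (apply HN; apply in_app_iff; left; apply in_app_iff; right; simpl; auto).
  assert (Hg' : inN N g') by (apply HN; apply in_app_iff; left; apply in_app_iff; right; simpl; auto).
  simpl wop. set (c := if gen_eq_dec g g' then 2 * eta g else 0).
  transitivity (wop N X (fun u => c * wop N Y phi u + (-1) * gm N g' (gm N g (wop N Y phi)) u) s).
  - f_equal. extensionality u. unfold c. destruct (gen_eq_dec g g') as [->|Ne].
    + rewrite gm_sq by auto. ring.
    + rewrite (gm_anti N g g') by auto. ring.
  - clear. revert s. induction X as [|x X IH]; intros s; simpl; [reflexivity|].
    match goal with |- gm N x ?f s = _ => replace f with (fun u => c * wop N X (wop N Y phi) u + (-1) * wop N X (gm N g' (gm N g (wop N Y phi))) u)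
      by (extensionality u; now rewrite IH) end.
    unfold gm, gam. ring.
Qed.

Lemma wopt_rev N w psi s : wopt N w psi s = chi 1 w * wop N (rev w) psi s.
Proof.
  revert psi s. induction w as [|g w IH]; intros psi s; simpl; [ring|].
  rewrite IH, wop_app. simpl. rewrite wop_scal. ring.
Qed.

Lemma wop_commute N w R psi s e : (forall g s, In g w -> R (flip (snd g) s) = e * R s) ->
  wop N w (fun u => R u * psi u) s = e ^ length w * (R s * wop N w psi s).
Proof.
  revert s. induction w as [|g w IH]; intros s H; simpl; [ring|].
  replace (wop N w (fun u => R u * psi u)) with (fun u => R u * (e ^ length w * wop N w psi u)).
  - rewrite (gm_mul N g R (fun u => e ^ length w * wop N w psi u)), gm_scal, H by (simpl; auto). ring.
  - extensionality u. rewrite IH by (intros; apply H; simpl; auto). ring.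
Qed.

Lemma chi_pow e w : chi e w = e ^ length w * chi 1 w.
Proof. induction w as [|g w IH]; simpl; [ring|]. rewrite IH. ring. Qed.

(** The state takes the same value on the adjoint, which is [R] times the reversed word up to signs;
    moving [R] back to the right gives one factor [e] per letter. *)
Lemma Om_rev w R e : bd1 R -> e * e = 1 -> (forall g s, In g w -> R (flip (snd g) s) = e * R s) ->
  Om w R [] = chi e w * Om (rev w) R [].
Proof.
  intros Br He H. apply LIM_eq.
  eapply ulim_ext with (x := fun N => chi e w * omN N (tr N (rev w) R [])); [|apply ulim_scal; now apply (Om_lim J h rho G)].
  eapply ultra_mono; [|exact (eventually_inw w)]. intros N HN. cbn beta.
  rewrite <- om_scalN.
  assert (A := adj_comp _ _ _ _ _ _ (adj_wop N w HN) (adj_diag (bs N) (bl N) R)).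
  assert (Q := om_adj _ _ _ (DN J h rho G N) _ _ A). cbn beta in Q.
  transitivity (om (bs N) (bl N) (sr rho (bs N) (bl N)) (fun psi s => R s * wopt N w psi s)); [|exact Q].
  apply om_ext; intros psi l _. unfold tr. cbn [wop]. rewrite (wop_commute N (rev w) R psi _ e).
  - rewrite wopt_rev, (chi_pow e), length_rev. change (@length (bool * Z) w) with (@length gen w).
    transitivity ((e * e) ^ length w * (R (emb (bs N) l) * (chi 1 w * wop N (rev w) psi (emb (bs N) l)))).
    + rewrite Rpow_mult_distr. change (@length gen w) with (@length (bool * Z) w). ring.
    + rewrite He, pow1, Rmult_1_l. reflexivity.
  - intros g s Hg. apply H, in_rev. exact Hg.
Qed.

Lemma Om_move X g R e : bd1 R -> e * e = 1 -> (forall s, R (flip (snd g) s) = e * R s) -> Om X R [g] = e * Om (X ++ [g]) R [].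
Proof.
  intros Br He H. apply (Om_eq J h rho G); auto. intros N psi s HN. unfold tr. rewrite wop_app. simpl.
  rewrite <- wop_scal. f_equal. extensionality u. rewrite gm_mul, H.
  transitivity (e * e * (R u * gm N g psi u)); [rewrite He|]; ring.
Qed.

(** * The coefficient matrix of a growing annulus *)

Section Block.
Variable D : nat.
Notation T := (annulus D).

Hypothesis pTpos : forall n, 0 < pT (T n).

Lemma Yex : exists Y : nat -> Z -> Z -> R, forall n j, In j (win D) ->
  (forall x, In x (T n) -> Y n j x + Rsum (fun t => M x t * Y n j t) (T n) = - M x j) /\
  (forall x, In x (T n) -> Rabs (Y n j x) * wt 2 (x - j) <= 1 / 7).
Proof.
  destruct (ClassicalEpsilon.choice _ (fun n => solution J h Hlam (T n) (annulus_NoDup D n))) as [Y HY].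
  exists Y. intros n j Hj. apply HY. intros Hn. apply annulus_In in Hn. tauto.
Qed.

Section WithY.
Variable Y : nat -> Z -> Z -> R.
Hypothesis HY : forall n j, In j (win D) ->
  (forall x, In x (T n) -> Y n j x + Rsum (fun t => M x t * Y n j t) (T n) = - M x j) /\
  (forall x, In x (T n) -> Rabs (Y n j x) * wt 2 (x - j) <= 1 / 7).
Definition cond_coef n k j := Oc (T n) (Y n) k j.
Notation On := cond_coef.
Definition lim_coef k j := LIM (fun n => On n k j).
Notation O := lim_coef.

Lemma Y_abs n j x : In j (win D) -> In x (T n) -> Rabs (Y n j x) <= 1 / 7.
Proof.
  intros Hj Hx. destruct (HY n j Hj) as [_ H]. specialize (H x Hx).
  assert (W := wt_ge1 2 (x - j) ltac:(lra)). assert (0 <= Rabs (Y n j x)) by apply Rabs_pos. nra.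
Qed.

Lemma O_lim k j : In j (win D) -> ulim (fun n => On n k j) (O k j).
Proof.
  intros Hj. apply ulim_LIM. exists (Rabs (M k j) + 5 / 4). apply ultra_all; intros n.
  unfold cond_coef, Ocoef. fold lam. eapply Rle_trans; [apply Rabs_triang|]. apply Rplus_le_compat_l.
  eapply Rle_trans; [apply Rsum_abs|]. eapply Rle_trans; [|apply (M_row_abs J h Hlam k (T n) (annulus_NoDup D n))].
  apply Rsum_le; intros t Ht. rewrite Rabs_mult. assert (Q := Y_abs n j t Hj Ht). fold lam.
  assert (0 <= Rabs (M k t)) by apply Rabs_pos. nra.
Qed.

(** Bernoulli's inequality for (1 + 1/2)^n. *)
Lemma growth n : (2 * INR n + 1) / 2 ^ n <= 4 * (3 / 4) ^ n.
Proof.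
  assert (P := poly n (/ 2) ltac:(lra)). assert (P2 : 0 < 2 ^ n) by (apply pow_lt; lra).
  apply Rmult_le_reg_r with (2 ^ n); auto. replace ((2 * INR n + 1) / 2 ^ n * 2 ^ n) with (2 * INR n + 1) by (field; lra).
  rewrite Rmult_assoc, <- Rpow_mult_distr. replace (3 / 4 * 2) with (1 + / 2) by field.
  assert (0 <= INR n) by apply pos_INR. lra.
Qed.

(** Extend the unit vector at [i] by [Y n i] on the annulus. M sends it to [On] on the window and to
    -Y on the annulus, so the annulus contributions cancel in the isometry and only the loss outside
    [win n] remains, which tends to zero. *)
Lemma O_orth i j : In i (win D) -> In j (win D) -> Rsum (fun k => O k i * O k j) (win D) = if Z.eq_dec i j then 1 else 0.
Proof.
  intros Hi Hj.
  apply (ulim_unique (fun n => Rsum (fun k => On n k i * On n k j) (win D))).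
  - apply (ulim_Rsum (fun n k => On n k i * On n k j) (fun k => O k i * O k j)). intros k _. apply ulim_mult; now apply O_lim.
  - set (f := fun n i x => if Z.eq_dec x i then 1 else if in_dec Z.eq_dec x (T n) then Y n i x else 0).
    set (S := fun n => win D ++ T n).
    assert (fD : forall n i x, In i (win D) -> In x (win D) -> f n i x = if Z.eq_dec x i then 1 else 0).
    { intros n i' x Hi' Hx. unfold f. destruct Z.eq_dec; auto. destruct in_dec as [Ht|]; auto. apply annulus_In in Ht. tauto. }
    assert (fT : forall n i x, In i (win D) -> In x (T n) -> f n i x = Y n i x).
    { intros n i' x Hi' Hx. unfold f. destruct (Z.eq_dec x i') as [->|]; [apply annulus_In in Hx; tauto|]. destruct in_dec; tauto. }
    assert (MvO : forall n i x, In i (win D) -> Mv lam true (f n i) (S n) x = On n x i).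
    { intros n i' x Hi'. unfold Mv, S. rewrite Rsum_app. unfold cond_coef, Ocoef. fold lam. f_equal.
      - rewrite (Rsum_ext _ (fun t => if Z.eq_dec t i' then M x t else 0)).
        + now rewrite (Rsum_delta Z.eq_dec (fun t => M x t)) by (auto using win_NoDup).
        + intros t Ht. rewrite fD by auto. destruct Z.eq_dec; ring.
      - apply Rsum_ext; intros t Ht. now rewrite fT. }
    assert (OT : forall n i x, In i (win D) -> In x (T n) -> On n x i = - Y n i x).
    { intros n i' x Hi' Hx. destruct (HY n i' Hi') as [H _]. specialize (H x Hx). unfold cond_coef, Ocoef. fold lam. lra. }
    assert (fb : forall n i x, In i (win D) -> In x (S n) -> Rabs (f n i x) * wt 2 x <= 2 ^ D).
    { intros n i' x Hi' Hx. apply in_app_iff in Hx.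
      assert (Wi : wt 2 i' <= 2 ^ D) by (unfold wt; apply Rle_pow; [lra|apply win_In in Hi'; lia]).
      assert (Wp := wt_pos 2 x ltac:(lra)). assert (P2 : 0 < 2 ^ D) by (apply pow_lt; lra).
      destruct Hx as [Hx|Hx].
      - rewrite fD by auto. destruct (Z.eq_dec x i') as [->|]; [rewrite Rabs_R1; lra|rewrite Rabs_R0; lra].
      - rewrite fT by auto. destruct (HY n i' Hi') as [_ H]. specialize (H x Hx).
        assert (Wt := wt_tri 2 (x - i') i' ltac:(lra)). replace (x - i' + i')%Z with x in Wt by lia.
        assert (Wq := wt_pos 2 (x - i') ltac:(lra)). assert (Wr := wt_pos 2 i' ltac:(lra)).
        assert (0 <= Rabs (Y n i' x)) by apply Rabs_pos.
        apply Rle_trans with (Rabs (Y n i' x) * wt 2 (x - i') * wt 2 i').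
        + rewrite Rmult_assoc. now apply Rmult_le_compat_l.
        + apply Rle_trans with (1 / 7 * wt 2 i'); [apply Rmult_le_compat_r; lra|lra]. }
    assert (f1 : forall n i x, In i (win D) -> In x (S n) -> Rabs (f n i x) <= 1).
    { intros n i' x Hi' Hx. apply in_app_iff in Hx. destruct Hx as [Hx|Hx].
      - rewrite fD by auto. destruct (Z.eq_dec x i'); [rewrite Rabs_R1; lra|rewrite Rabs_R0; lra].
      - rewrite fT by auto. assert (Q := Y_abs n i' x Hi' Hx). lra. }
    assert (PermS : forall n, (D <= n)%nat -> Permutation (win n) (S n)).
    { intros n Hn. apply NoDup_Permutation; [apply win_NoDup|apply (annulus_NDT D)|]. intros x. unfold S. rewrite in_app_iff, annulus_In.
      rewrite !win_In. destruct (Z_le_gt_dec (Z.abs x) (Z.of_nat D)); lia. }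
    assert (Q : ulim (fun n => Rsum (fun k => On n k i * On n k j) (win D) - (if Z.eq_dec i j then 1 else 0)) 0).
    { apply ulim_squeeze0 with (y := fun n => 2 * 2 ^ D * 4 * (3 / 4) ^ n).
      - replace 0 with (2 * 2 ^ D * 4 * 0) by ring. apply ulim_scal.
        intros eps He. destruct (pow_lt_1_zero (3 / 4) ltac:(rewrite Rabs_right; lra) eps He) as [n0 Hn0].
        eapply ultra_mono; [|exact (ultra_ge n0)]. intros n Hn. rewrite Rminus_0_r. now apply Hn0.
      - eapply ultra_mono; [|exact (ultra_ge D)]. intros n Hn. cbn beta.
        assert (I := kernel_isometry lam Hlam true (S n) (f n i) (f n j) (2 ^ D) n (annulus_NDT D n) ltac:(apply pow_le; lra) (fun x Hx => fb n j x Hj Hx)).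
        assert (EL : Rsum (fun x => Mv lam true (f n i) (S n) x * Mv lam true (f n j) (S n) x) (win n) =
           Rsum (fun k => On n k i * On n k j) (win D) + Rsum (fun x => Y n i x * Y n j x) (T n)).
        { rewrite (Rsum_perm _ _ _ (PermS n Hn)). unfold S at 3. rewrite Rsum_app. f_equal; apply Rsum_ext; intros x Hx; rewrite !MvO by auto; auto.
          rewrite !OT by auto. ring. }
        assert (ER : Rsum (fun x => f n i x * f n j x) (S n) = (if Z.eq_dec i j then 1 else 0) + Rsum (fun x => Y n i x * Y n j x) (T n)).
        { unfold S. rewrite Rsum_app. f_equal.
          - rewrite (Rsum_ext _ (fun x => if Z.eq_dec x i then (if Z.eq_dec i j then 1 else 0) else 0)).
            + rewrite (Rsum_delta Z.eq_dec (fun _ => if Z.eq_dec i j then 1 else 0)) by (auto using win_NoDup). reflexivity.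
            + intros x Hx. rewrite !fD by auto. destruct (Z.eq_dec x i), (Z.eq_dec x j), (Z.eq_dec i j); subst; try congruence; ring.
          - apply Rsum_ext; intros x Hx. now rewrite !fT. }
        rewrite EL, ER in I.
        match type of I with Rabs ?X <= _ => replace X with (Rsum (fun k => On n k i * On n k j) (win D) - (if Z.eq_dec i j then 1 else 0)) in I by ring end.
        eapply Rle_trans; [exact I|].
        assert (SF : Rsum (fun x => Rabs (f n i x)) (S n) <= 2 * INR n + 1).
        { apply Rle_trans with (Rsum (fun _ => 1) (S n)); [apply Rsum_le; intros; now apply f1|].
          rewrite Rsum_const, <- (Permutation_length (PermS n Hn)). unfold win. rewrite length_map, length_seq.
          rewrite plus_INR, mult_INR. simpl. lra. }
        assert (Gr := growth n). assert (P2 : 0 < 2 ^ n) by (apply pow_lt; lra). assert (PD : 0 < 2 ^ D) by (apply pow_lt; lra).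
        unfold Rdiv. rewrite Rmult_assoc. rewrite !Rmult_assoc. apply Rmult_le_compat_l; [lra|]. apply Rmult_le_compat_l; [lra|].
        eapply Rle_trans; [|exact Gr]. unfold Rdiv. apply Rmult_le_compat_r; [left; now apply Rinv_0_lt_compat|exact SF]. }
    assert (Q2 := ulim_plus _ _ _ _ Q (ulim_const (if Z.eq_dec i j then 1 else 0))). rewrite Rplus_0_l in Q2.
    eapply ulim_ext; [|exact Q2]. apply ultra_all; intros n; cbn beta. ring.
Qed.

(** A square matrix with orthonormal columns has orthonormal rows; the rows are what [vacuum_unique]
    needs. *)
Lemma O_orth' k l : In k (win D) -> In l (win D) -> Rsum (fun j => O k j * O l j) (win D) = if Z.eq_dec k l then 1 else 0.
Proof.
  destruct (LinAlg.matrix_inverse (win D) O (win_NoDup D)) as [B [HB1 HB2]].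
  - intros z Hz i Hi.
    transitivity (Rsum (fun j => (if Z.eq_dec j i then z j else 0)) (win D)); [rewrite (Rsum_delta Z.eq_dec z); auto using win_NoDup|].
    rewrite (Rsum_ext _ (fun j => Rsum (fun k => O k i * (O k j * z j)) (win D))).
    + rewrite Rsum_swap. apply Rsum_zero. intros k' Hk'. rewrite Rsum_scal, Hz by auto. ring.
    + intros j Hj. rewrite (Rsum_ext _ (fun k => O k i * O k j * z j)) by (intros; ring). rewrite Rsum_scal_r, O_orth by auto.
      destruct (Z.eq_dec j i), (Z.eq_dec i j); subst; try congruence; ring.
  - intros Hk Hl.
    assert (BO : forall j x, In j (win D) -> In x (win D) -> B j x = O x j).
    { intros j x Hj Hx.
      transitivity (Rsum (fun i => (if Z.eq_dec i j then B i x else 0)) (win D)); [rewrite (Rsum_delta Z.eq_dec (fun i => B i x)); auto using win_NoDup|].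
      rewrite (Rsum_ext _ (fun i => Rsum (fun k => O k j * (O k i * B i x)) (win D))).
      - rewrite Rsum_swap. rewrite (Rsum_ext _ (fun k => if Z.eq_dec k x then O k j else 0)).
        + rewrite (Rsum_delta Z.eq_dec (fun k => O k j)); auto using win_NoDup.
        + intros k' Hk'. rewrite Rsum_scal, HB2 by auto. destruct (Z.eq_dec k' x); cbn; ring.
      - intros i Hi. rewrite (Rsum_ext _ (fun k => O k j * O k i * B i x)) by (intros; ring). rewrite Rsum_scal_r, O_orth by auto.
        destruct (Z.eq_dec i j), (Z.eq_dec j i); subst; try congruence; ring. }
    rewrite (Rsum_ext _ (fun i => O k i * B i l)) by (intros; now rewrite BO).
    rewrite HB2 by auto. destruct (Z.eq_dec k l); reflexivity.
Qed.
End WithY.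
End Block.
End Par.

(** * The limiting state on a window *)

Section Par2.
Variables (J h : R) (rho : Z -> nat -> Op).
Hypothesis G : is_ground_state J h rho.
Hypothesis Hh : 0 < h.
Let lam := J / h.
Hypothesis Hlam : 0 < Rabs lam < 1 / 100.
Notation Om := (Om rho).
Notation E := (expect rho).
Notation M := (Mk lam true).
Notation pT := (prob_plus rho).
Variable D : nat.
Notation T := (annulus D).
Hypothesis pTpos : forall n, 0 < pT (T n).
Variable Y : nat -> Z -> Z -> R.
Hypothesis HY : forall n j, In j (win D) ->
  (forall x, In x (T n) -> Y n j x + Rsum (fun t => M x t * Y n j t) (T n) = - M x j) /\
  (forall x, In x (T n) -> Rabs (Y n j x) * wt 2 (x - j) <= 1 / 7).
Notation On := (cond_coef J h D Y).
Notation O := (lim_coef J h D Y).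
Notation overD := (over (win D)).

(** The state conditioned on plus spins on the annulus [T n], multiplied by a sign function [r]
    (constant, or the parity of the window). *)
Definition Phn (r : wf) n w := Om w (fun s => r s * plus (T n) s) [] / pT (T n).
Definition Ph (r : wf) w := LIM (fun n => Phn r n w).
Definition signf (e : R) (r : wf) : Prop := e * e = 1 /\ (forall s, r s * r s = 1) /\ forall x s, In x (win D) -> r (flip x s) = e * r s.

Lemma signf_bd e r : signf e r -> bd1 r.
Proof.
  intros [_ [H _]] s. rewrite <- Rabs_R1. apply Rsqr_le_abs_0. unfold Rsqr. rewrite H. lra.
Qed.
Lemma rp_bd e r n : signf e r -> bd1 (fun s => r s * plus (T n) s).
Proof. intros H. apply bd1_mul; [now apply signf_bd with e|apply ind_bd]. Qed.
Lemma rp_flip e r n x s : signf e r -> In x (win D) -> r (flip x s) * plus (T n) (flip x s) = e * (r s * plus (T n) s).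
Proof.
  intros (_ & _ & H) Hx. rewrite H by auto. unfold plus. rewrite ind_flip_out; [ring|]. intros Ht. apply annulus_In in Ht. tauto.
Qed.
Lemma rp_sq e r n : signf e r -> (fun s => Rsqr (r s * plus (T n) s)) = plus (T n).
Proof.
  intros (_ & H & _). extensionality s. rewrite Rsqr_mult. unfold plus at 1. rewrite ind_sq. unfold Rsqr. rewrite H. fold (plus (T n)). ring.
Qed.
Lemma one_signf : signf 1 (fun _ => 1).
Proof. repeat split; intros; ring. Qed.

Lemma over_notT w n g : overD w -> In g w -> ~ In (snd g) (T n).
Proof. intros H Hg Ht. apply annulus_In in Ht. specialize (H g Hg). tauto. Qed.

Lemma Phn_bd e r n w : signf e r -> overD w -> Rabs (Phn r n w) <= 1.
Proof.
  intros Hr Hw. assert (P := pTpos n).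
  assert (B := Om_bound_r J h rho G (T n) w [] (fun s => r s * plus (T n) s) (rp_bd e r n Hr)).
  assert (PP : forall s, plus (T n) s * plus (T n) s = plus (T n) s) by (intros s; apply (ind_sq (T n) (fun _ => true) s)).
  assert (B1 : Rsqr (Om w (fun s => r s * plus (T n) s) []) <= pT (T n) * pT (T n)).
  { eapply Rle_trans; [apply B|].
    - intros s. rewrite Rmult_assoc, PP. reflexivity.
    - intros g Hg. now apply over_notT with w.
    - simpl. rewrite (rp_sq e) by auto. apply Rle_refl. }
  change (pT (T n) * pT (T n)) with (Rsqr (pT (T n))) in B1.
  apply Rsqr_le_abs_0 in B1. rewrite (Rabs_right (pT (T n))) in B1 by lra.
  unfold Phn, Rdiv. rewrite Rabs_mult, (Rabs_right (/ pT (T n))) by (apply Rle_ge; left; now apply Rinv_0_lt_compat).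
  apply Rmult_le_reg_r with (pT (T n)); auto. rewrite Rmult_assoc, Rinv_l, Rmult_1_r by lra. lra.
Qed.

Lemma Ph_lim e r w : signf e r -> overD w -> ulim (fun n => Phn r n w) (Ph r w).
Proof. intros Hr Hw. apply ulim_LIM. exists 1. apply ultra_all; intros n. now apply (Phn_bd e). Qed.

Lemma Ph_car e r X g g' Yw : signf e r -> overD (X ++ g :: g' :: Yw) ->
  Ph r (X ++ g :: g' :: Yw) = (if gen_eq_dec g g' then 2 * eta g * Ph r (X ++ Yw) else 0) - Ph r (X ++ g' :: g :: Yw).
Proof.
  intros Hr Hw.
  assert (H1 : overD (X ++ Yw)) by (rewrite over_app, !over_cons in Hw; rewrite over_app; tauto).
  assert (H2 : overD (X ++ g' :: g :: Yw)) by (rewrite over_app, !over_cons in *; tauto).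
  apply LIM_eq.
  eapply ulim_ext with (x := fun n => (if gen_eq_dec g g' then 2 * eta g else 0) * Phn r n (X ++ Yw) - Phn r n (X ++ g' :: g :: Yw)).
  - apply ultra_all; intros n. cbn beta. unfold Phn. rewrite (Om_car J h rho G X g g' Yw) by (now apply (rp_bd e)).
    specialize (pTpos n). destruct gen_eq_dec; field; lra.
  - replace (if gen_eq_dec g g' then 2 * eta g * Ph r (X ++ Yw) else 0) with ((if gen_eq_dec g g' then 2 * eta g else 0) * Ph r (X ++ Yw))
      by (destruct gen_eq_dec; ring).
    apply ulim_minus; [apply ulim_scal|]; now apply (Ph_lim e).
Qed.

Lemma Ph_rev e r w : signf e r -> overD w -> Ph r w = chi e w * Ph r (rev w).
Proof.
  intros Hr Hw. assert (Hw' : overD (rev w)) by (intros g Hg; apply Hw; now apply in_rev).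
  apply LIM_eq. eapply ulim_ext with (x := fun n => chi e w * Phn r n (rev w)); [|apply ulim_scal; now apply (Ph_lim e)].
  apply ultra_all; intros n. cbn beta. unfold Phn.
  rewrite (Om_rev J h rho G w (fun s => r s * plus (T n) s) e); [unfold Rdiv; symmetry; apply Rmult_assoc|now apply (rp_bd e)|apply Hr|].
  intros g s Hg. apply (rp_flip e); [exact Hr|now apply Hw].
Qed.

Lemma Ph1_nil : Ph (fun _ => 1) [] = 1.
Proof.
  apply LIM_eq. eapply ulim_ext with (x := fun _ => 1); [|apply ulim_const]. apply ultra_all; intros n.
  unfold Phn. replace (fun s => 1 * plus (T n) s) with (plus (T n)) by (extensionality s; ring).
  specialize (pTpos n). unfold prob_plus, expect in *. field. lra.
Qed.

(** In [cond_relation] with the generator [(false, l)] anticommutation doubles the left side and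
    leaves only k = l on the right. *)
Lemma Ph_ba l j : In l (win D) -> In j (win D) -> Ph (fun _ => 1) [(false, l); (true, j)] = O l j.
Proof.
  intros Hl Hj. apply LIM_eq. eapply ulim_ext; [|exact (O_lim J h Hlam D Y HY l j Hj)].
  apply ultra_all; intros n. cbn beta. assert (P := pTpos n).
  set (q := plus (T n)). assert (Bq : bd1 q) by apply ind_bd.
  assert (qf : forall (g : gen) s, In (snd g) (win D) -> q (flip (snd g) s) = 1 * q s).
  { intros g s Hg. unfold q, plus. rewrite ind_flip_out; [ring|]. intros Ht. apply annulus_In in Ht. tauto. }
  destruct (HY n j Hj) as [H1 _].
  assert (C := cond_relation J h rho G Hh Hlam (win D) (T n) (Y n) q (false, l) j (annulus_NDT D n) Bq).
  assert (C1 : Om [(false, l)] q [(true, j)] - Om [(true, j); (false, l)] q [] =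
     - Rsum (fun k => On n k j * (Om [(false, l)] q [(false, k)] + Om [(false, k); (false, l)] q [])) (win D)).
  { apply C; auto.
    - intros x s Hx. apply ind_flip_out. intros Ht. apply Hx, in_app_iff; auto.
    - intros x s Hx. unfold q, plus. rewrite ind_sg by auto. simpl; ring. }
  clear C.
  assert (Mv : forall g g' : gen, In (snd g) (win D) -> In (snd g') (win D) -> Om [g] q [g'] = Om [g; g'] q []).
  { intros g g' Hg Hg'. assert (Q := Om_move J h rho G [g] g' q 1 Bq (Rmult_1_l 1) (fun s => qf g' s Hg')). rewrite Rmult_1_l in Q. exact Q. }
  assert (E1 : Om [(true, j); (false, l)] q [] = - Om [(false, l); (true, j)] q []).
  { assert (Q := Om_car J h rho G [] (true, j) (false, l) [] q [] Bq). destruct gen_eq_dec; [congruence|].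
    change (Om [(true, j); (false, l)] q [] = 0 - Om [(false, l); (true, j)] q []) in Q. lra. }
  assert (E2 : forall k, In k (win D) -> Om [(false, l)] q [(false, k)] + Om [(false, k); (false, l)] q [] = if Z.eq_dec k l then -2 * pT (T n) else 0).
  { intros k Hk. rewrite Mv by auto.
    assert (Q := Om_car J h rho G [] (false, l) (false, k) [] q [] Bq).
    destruct gen_eq_dec as [e|ne], (Z.eq_dec k l); try congruence.
    - change (Om [(false, l); (false, k)] q [] + Om [(false, k); (false, l)] q [] = -2 * pT (T n)).
      change (Om [(false, l); (false, k)] q [] = 2 * -1 * pT (T n) - Om [(false, k); (false, l)] q []) in Q. lra.
    - change (Om [(false, l); (false, k)] q [] + Om [(false, k); (false, l)] q [] = 0).
      change (Om [(false, l); (false, k)] q [] = 0 - Om [(false, k); (false, l)] q []) in Q. lra. }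
  rewrite Mv, E1 in C1 by auto.
  rewrite (Rsum_ext _ (fun k => if Z.eq_dec k l then On n k j * (-2 * pT (T n)) else 0)) in C1.
  2:{ intros k Hk. rewrite E2 by auto. destruct Z.eq_dec; ring. }
  rewrite (Rsum_delta Z.eq_dec (fun k => On n k j * (-2 * pT (T n)))) in C1 by (auto using win_NoDup).
  unfold Phn. replace (fun s => 1 * plus (T n) s) with q by (extensionality s; unfold q; ring).
  apply Rmult_eq_reg_r with (pT (T n)); [|lra]. unfold Rdiv. rewrite Rmult_assoc, Rinv_l, Rmult_1_r by lra.
  change (Om [(false, l); (true, j)] q [] - - Om [(false, l); (true, j)] q [] = - (On n l j * (-2 * pT (T n)))) in C1.
  change (On n l j * pT (T n) = Om [(false, l); (true, j)] q []). lra.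
Qed.

(** The annihilator of the limiting state attached to the site [j]. *)
Definition dv j : vec := (1, (true, j)) :: map (fun k => (O k j, (false, k))) (win D).

Lemma ev_dv F j : ev F (dv j) = F (true, j) + Rsum (fun k => O k j * F (false, k)) (win D).
Proof. unfold dv, ev. rewrite Rsum_cons, Rsum_map. cbn [fst snd]. ring. Qed.

(** The squared norm of the annihilator is 1 - 2 s + s, where s is the sum of the squares in column
    [j] of [O]; orthogonality gives s = 1. *)
Lemma Ph_quad j : In j (win D) -> ev (fun g => ev (fun g' => eta g * Ph (fun _ => 1) [g; g']) (dv j)) (dv j) = 0.
Proof.
  intros Hj.
  assert (ov : forall g g' : gen, In (snd g) (win D) -> In (snd g') (win D) -> overD [g; g']).
  { intros g g' H H'. rewrite !over_cons. split; auto. split; auto. intros x []. }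
  assert (CAR : forall g g' : gen, In (snd g) (win D) -> In (snd g') (win D) ->
     Ph (fun _ => 1) [g; g'] = (if gen_eq_dec g g' then 2 * eta g else 0) - Ph (fun _ => 1) [g'; g]).
  { intros g g' H H'. assert (Q := Ph_car 1 (fun _ => 1) [] g g' [] one_signf (ov g g' H H')). 
    change (Ph (fun _ => 1) [g; g'] = (if gen_eq_dec g g' then 2 * eta g * Ph (fun _ => 1) [] else 0) - Ph (fun _ => 1) [g'; g]) in Q. rewrite Q, Ph1_nil.
    destruct gen_eq_dec; ring. }
  set (f := fun g g' => Ph (fun _ => 1) [g; g']) in *.
  assert (F1 : f (true, j) (true, j) = 1).
  { assert (Q := CAR (true, j) (true, j) Hj Hj). fold (f (true, j) (true, j)) in Q. destruct gen_eq_dec; [|congruence]. unfold eta in Q; cbn [fst] in Q. lra. }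
  assert (F2 : forall k, In k (win D) -> f (false, k) (true, j) = O k j) by (intros; now apply Ph_ba).
  assert (F3 : forall k, In k (win D) -> f (true, j) (false, k) = - O k j).
  { intros k Hk. rewrite <- F2 by auto. unfold f. rewrite (CAR (true, j) (false, k)) by auto. destruct gen_eq_dec; [congruence|ring]. }
  assert (F4 : Rsum (fun k => O k j * Rsum (fun l => O l j * f (false, k) (false, l)) (win D)) (win D) = - Rsum (fun k => O k j * O k j) (win D)).
  { set (S := Rsum _ _). assert (S2 : S = Rsum (fun k => O k j * Rsum (fun l => O l j * f (false, l) (false, k)) (win D)) (win D)).
    { unfold S. rewrite (Rsum_ext _ (fun k => Rsum (fun l => O k j * (O l j * f (false, k) (false, l))) (win D))) by (intros; now rewrite Rsum_scal).
      rewrite Rsum_swap. apply Rsum_ext; intros l _. rewrite <- Rsum_scal. apply Rsum_ext; intros; ring. }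
    assert (S3 : S + S = - 2 * Rsum (fun k => O k j * O k j) (win D)).
    { rewrite S2 at 2. unfold S. rewrite <- Rsum_plus, <- Rsum_scal. apply Rsum_ext; intros k Hk.
      rewrite <- Rmult_plus_distr_l, <- Rsum_plus.
      rewrite (Rsum_ext _ (fun l => if Z.eq_dec l k then -2 * O l j else 0)).
      - rewrite (Rsum_delta Z.eq_dec (fun l => -2 * O l j)) by (auto using win_NoDup). ring.
      - intros l Hl. unfold f. rewrite (CAR (false, k) (false, l)) by auto. unfold eta; cbn [fst].
        destruct gen_eq_dec, (Z.eq_dec l k); try congruence; ring. }
    lra. }
  assert (OO := O_orth J h Hlam D Y HY j j Hj Hj). destruct (Z.eq_dec j j); [|congruence].
  rewrite ev_dv. 
  rewrite (Rsum_ext _ (fun k => - (O k j * O k j) - O k j * Rsum (fun l => O l j * f (false, k) (false, l)) (win D))).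
  - rewrite Rsum_minus, F4, Rsum_opp, OO. rewrite ev_dv. fold (f (true, j) (true, j)). rewrite F1.
    rewrite (Rsum_ext _ (fun k => - (O k j * O k j))).
    + rewrite Rsum_opp, OO. unfold eta; cbn [fst]. ring.
    + intros k Hk. fold (f (true, j) (false, k)). rewrite F3 by auto. unfold eta; cbn [fst]; ring.
  - intros k Hk. rewrite ev_dv. fold (f (false, k) (true, j)). rewrite F2 by auto. unfold eta; cbn [fst].
    rewrite (Rsum_ext _ (fun l => - (O l j * f (false, k) (false, l)))) by (intros l _; unfold f; ring).
    rewrite Rsum_opp. ring.
Qed.

(** Cauchy-Schwarz for the state conditioned at stage [n] bounds the square of the expectation of X
    times the annihilator by the norm in [Ph_quad]. This holds for both choices of [r], as [r] is a
    sign. *)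
Lemma Ph_right e r X j : signf e r -> overD X -> In j (win D) ->
  Ph r (X ++ [(true, j)]) = - Rsum (fun k => O k j * Ph r (X ++ [(false, k)])) (win D).
Proof.
  intros Hr HX Hj.
  assert (ov : forall g, In (snd g) (win D) -> overD (X ++ [g])).
  { intros g Hg. rewrite over_app, over_cons. split; auto. split; auto. intros x []. }
  assert (ov2 : forall g g' : gen, In (snd g) (win D) -> In (snd g') (win D) -> overD [g; g']).
  { intros g g' H H'. rewrite !over_cons. split; auto. split; auto. intros x []. }
  assert (dvS : forall x, In x (dv j) -> In (snd (snd x)) (win D)).
  { intros x [<-|Hx]; auto. apply in_map_iff in Hx. destruct Hx as [k [<- Hk]]. auto. }
  set (A := fun n => ev (fun g => Phn r n (X ++ [g])) (dv j)).
  set (B := fun n => ev (fun g => ev (fun g' => eta g * Phn (fun _ => 1) n [g; g']) (dv j)) (dv j)).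
  assert (LA : ulim A (ev (fun g => Ph r (X ++ [g])) (dv j))).
  { apply (ulim_Rsum (fun n x => fst x * Phn r n (X ++ [snd x])) (fun x => fst x * Ph r (X ++ [snd x]))).
    intros x Hx. apply ulim_scal. apply (Ph_lim e); auto. }
  assert (LB : ulim B 0).
  { rewrite <- (Ph_quad j Hj).
    apply (ulim_Rsum (fun n x => fst x * ev (fun g' => eta (snd x) * Phn (fun _ => 1) n [snd x; g']) (dv j))
      (fun x => fst x * ev (fun g' => eta (snd x) * Ph (fun _ => 1) [snd x; g']) (dv j))).
    intros x Hx. apply ulim_scal.
    apply (ulim_Rsum (fun n y => fst y * (eta (snd x) * Phn (fun _ => 1) n [snd x; snd y])) (fun y => fst y * (eta (snd x) * Ph (fun _ => 1) [snd x; snd y]))).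
    intros y Hy. do 2 apply ulim_scal. apply (Ph_lim 1); auto using one_signf. }
  assert (AB : forall n, Rsqr (A n) <= B n).
  { intros n. assert (P := pTpos n). set (q := plus (T n)). assert (Bq : bd1 q) by apply ind_bd.
    assert (CS := Om_CS_lin J h rho G X (dv j) (fun s => r s * q s) q (rp_bd e r n Hr) Bq). cbn beta in CS.
    assert (qq : (fun s => r s * q s * q s) = (fun s => r s * q s)).
    { extensionality s. rewrite Rmult_assoc. f_equal. apply (ind_sq (T n) (fun _ => true) s). }
    rewrite qq in CS.
    assert (q2 : (fun s => Rsqr (q s)) = q) by (extensionality s; apply ind_sq). rewrite q2 in CS.
    assert (EQ : E (fun s => Rsqr (r (flw X s) * q (flw X s))) = pT (T n)).
    { unfold prob_plus. f_equal. extensionality s. fold q. assert (Q := rp_sq e r n Hr).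
      apply (f_equal (fun F => F (flw X s))) in Q. cbn beta in Q. fold q in Q. rewrite Q.
      apply plus_flw. intros g Hg. now apply over_notT with X. }
    rewrite EQ in CS.
    assert (EA : ev (fun g => Om X (fun s => r s * q s) [g]) (dv j) = e * pT (T n) * A n).
    { unfold A, ev. rewrite <- Rsum_scal. apply Rsum_ext; intros x Hx.
      transitivity (fst x * (e * Om (X ++ [snd x]) (fun s => r s * q s) [])).
      - f_equal. apply (Om_move J h rho G X (snd x) (fun s => r s * q s) e); [now apply (rp_bd e)|apply Hr|].
        intros s. apply (rp_flip e); auto.
      - unfold Phn. fold q. field. lra. }
    assert (EBn : ev (fun g => ev (fun g' => eta g * Om [g] q [g']) (dv j)) (dv j) = pT (T n) * B n).
    { unfold B, ev. rewrite <- Rsum_scal. apply Rsum_ext; intros x Hx.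
      transitivity (fst x * (pT (T n) * Rsum (fun x0 => fst x0 * (eta (snd x) * Phn (fun _ => 1) n [snd x; snd x0])) (dv j))); [|ring].
      f_equal. rewrite <- Rsum_scal. apply Rsum_ext; intros y Hy.
      transitivity (fst y * (eta (snd x) * (1 * Om ([snd x] ++ [snd y]) q []))).
      - do 2 f_equal. apply (Om_move J h rho G [snd x] (snd y) q 1); auto; [ring|].
        intros s. assert (Q := rp_flip 1 (fun _ => 1) n (snd (snd y)) s one_signf (dvS y Hy)). unfold q. lra.
      - unfold Phn. replace (fun s => 1 * plus (T n) s) with q by (extensionality s; unfold q; ring). simpl app. field. lra. }
    rewrite EA, EBn in CS. unfold Rsqr in CS.
    destruct Hr as [He _].
    apply Rmult_le_reg_l with (pT (T n) * pT (T n)); [nra|]. unfold Rsqr.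
    replace (e * pT (T n) * A n * (e * pT (T n) * A n)) with ((e * e) * (pT (T n) * pT (T n) * (A n * A n))) in CS by ring.
    rewrite He in CS. lra. }
  assert (L0 : ulim A 0).
  { intros eps Hep. eapply ultra_mono; [|exact (LB (eps * eps) ltac:(nra))]. intros n Hn. cbn beta in *. specialize (AB n).
    rewrite Rminus_0_r in *. unfold Rsqr in AB.
    assert (B n < eps * eps) by (eapply Rle_lt_trans; [apply Rle_abs|exact Hn]). apply Rabs_def1; nra. }
  assert (Q := ulim_unique _ _ _ LA L0). rewrite ev_dv in Q.
  set (c := Ph r (X ++ [(true, j)])) in *.
  change (c + Rsum (fun k => O k j * Ph r (X ++ [(false, k)])) (win D) = 0) in Q. lra.
Qed.

(** Reversal of words exchanges the two ends; the opposite values of [eta] on the two types change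
    the sign in front of the sum. *)
Lemma Ph_left e r X j : signf e r -> overD X -> In j (win D) ->
  Ph r ((true, j) :: X) = Rsum (fun k => O k j * Ph r ((false, k) :: X)) (win D).
Proof.
  intros Hr HX Hj.
  assert (ov : forall g, In (snd g) (win D) -> overD (g :: X)) by (intros g Hg; rewrite over_cons; auto).
  assert (HXr : overD (rev X)) by (intros g Hg; apply HX; now apply in_rev).
  rewrite (Ph_rev e) by (auto; apply ov; auto). simpl rev. rewrite (Ph_right e) by auto.
  rewrite <- Ropp_mult_distr_r, Ropp_mult_distr_l, <- Rsum_scal. apply Rsum_ext; intros k Hk.
  assert (Q := Ph_rev e r ((false, k) :: X) Hr (ov (false, k) Hk)). simpl rev in Q. rewrite Q.
  simpl chi. unfold eta; cbn [fst]. match goal with |- _ * (_ * ?a) = _ * (_ * ?b) => change b with a end. ring.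
Qed.

(** The functionals with [r] the parity and with [r = 1] obey the same annihilation relations, so
    they are proportional with factor [sgm]. On the word representing the parity they take the
    values 1 and [sgm], whence sgm^2 = 1. *)
Theorem parity_deterministic : exists sg, sg * sg = 1 /\
  ulim (fun n => E (fun s => parity (win D) s * plus (T n) s) / pT (T n)) sg.
Proof.
  set (pi := parity (win D)).
  assert (Hpi : signf (-1) pi).
  { split; [ring|]. split; [intros; apply parity_sq|]. intros x s Hx. unfold pi. rewrite parity_in by (auto using win_NoDup). ring. }
  assert (H1 := one_signf). assert (on : overD []) by (intros x []).
  exists (Ph pi []). split; [|exact (Ph_lim (-1) pi [] Hpi on)].
  set (sgm := Ph pi []).
  (* At each site the product of the two generators is the spin, so the whole word acts as
     multiplication by the parity. *)
  set (w := flat_map (fun x => [(false, x); (true, x)]) (win D) : list gen).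
  assert (Hw : overD w).
  { intros g Hg. apply in_flat_map in Hg. destruct Hg as [x [Hx [<-|[<-|[]]]]]; auto. }
  assert (U := vacuum_unique (win D) O (fun w => Ph pi w - sgm * Ph (fun _ => 1) w)).
  assert (U1 : Ph pi w - sgm * Ph (fun _ => 1) w = 0).
  { apply U; auto using win_NoDup.
    - intros X j HX Hj. rewrite (Ph_right (-1) pi), (Ph_right 1 (fun _ => 1)) by auto.
      transitivity (- Rsum (fun k => O k j * Ph pi (X ++ [(false, k)])) (win D) + sgm * Rsum (fun k => O k j * Ph (fun _ => 1) (X ++ [(false, k)])) (win D)); [ring|].
      rewrite <- Rsum_scal, <- !Rsum_opp, <- Rsum_plus. apply Rsum_ext; intros; ring.
    - intros X j HX Hj. rewrite (Ph_left (-1) pi), (Ph_left 1 (fun _ => 1)) by auto.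
      rewrite <- Rsum_scal, <- Rsum_minus. apply Rsum_ext; intros; ring.
    - intros X g g' Yw HX. rewrite (Ph_car (-1) pi), (Ph_car 1 (fun _ => 1)) by auto. destruct gen_eq_dec; ring.
    - intros k l Hk Hl. now apply (O_orth' J h Hlam D Y HY).
    - rewrite Ph1_nil. unfold sgm. ring. }
  assert (WP : forall N psi s, inw N w -> wop N w psi s = pi s * psi s).
  { unfold pi, w. generalize (win D). intros V. induction V as [|x V IH]; intros N psi s HN; simpl; [ring|].
    assert (Hx : inN N (true, x)) by (apply (HN (true, x)); simpl; auto).
    rewrite gm_false by auto. 
    change (sg (s x) * gm N (true, x) (gm N (true, x) (wop N (flat_map (fun x => [(false, x); (true, x)]) V) psi)) s = sg (s x) * parity V s * psi s).
    rewrite gm_sq by auto. unfold eta; cbn [fst].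
    assert (E1 : wop N (flat_map (fun x => [(false, x); (true, x)]) V) psi s = parity V s * psi s).
    { apply IH. intros g Hg. apply HN. simpl. auto. }
    transitivity (sg (s x) * (1 * wop N (flat_map (fun x => [(false, x); (true, x)]) V) psi s)); [reflexivity|]. rewrite E1. ring. }
  assert (P1 : Ph pi w = 1).
  { apply LIM_eq. eapply ulim_ext with (x := fun _ => 1); [|apply ulim_const]. apply ultra_all; intros n. cbn beta.
    unfold Phn. assert (P := pTpos n).
    rewrite (Om_eq J h rho G w (fun s => pi s * plus (T n) s) [] [] (plus (T n)) [] 1).
    - unfold prob_plus, expect in *. field. lra.
    - now apply (rp_bd (-1)).
    - apply ind_bd.
    - intros N psi s HN. rewrite app_nil_r in HN. unfold tr. rewrite WP by auto. simpl.
      transitivity (pi s * pi s * (plus (T n) s * psi s)); [ring|]. unfold pi. rewrite parity_sq. ring. }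
  assert (P2 : Ph (fun _ => 1) w = sgm).
  { apply (ulim_unique (fun n => Phn (fun _ => 1) n w)); [now apply (Ph_lim 1)|].
    eapply ulim_ext; [|exact (Ph_lim (-1) pi [] Hpi on)]. apply ultra_all; intros n. cbn beta. unfold Phn. f_equal.
    rewrite (Om_eq J h rho G w (fun s => 1 * plus (T n) s) [] [] (fun s => pi s * plus (T n) s) [] 1); [ring| | |].
    - now apply (rp_bd 1).
    - now apply (rp_bd (-1)).
    - intros N psi s HN. rewrite app_nil_r in HN. unfold tr. rewrite WP by auto. simpl. ring. }
  rewrite P1, P2 in U1. lra.
Qed.
End Par2.

Lemma ind_parity V W t u : incl V W -> parity V u * ind W t u = parity V t * ind W t u.
Proof.
  induction V as [|x V IH]; intros H; simpl; [reflexivity|].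
  assert (Hx : In x W) by (apply H; simpl; auto). assert (HV : incl V W) by (intros y Hy; apply H; simpl; auto).
  transitivity (sg (u x) * (parity V u * ind W t u)); [ring|]. rewrite IH by auto.
  transitivity (parity V t * (ind W t u * sg (u x))); [ring|]. rewrite ind_sg by auto. ring.
Qed.

(** * Non-nullness and the bad configuration *)

Section Final.
Variables (J h : R) (rho : Z -> nat -> Op).
Hypothesis G : is_ground_state J h rho.
Hypothesis Hh : 0 < h.
Let lam := J / h.
Hypothesis Hlam : 0 < Rabs lam < 1 / 100.
Notation E := (expect rho).
Notation pT := (prob_plus rho).

Lemma ground_non_null : non_null (muz rho).
Proof.
  intros L x. rewrite (muz_E J h rho G).
  destruct (pattern_lower_bound J h rho G Hh Hlam (nodup Z.eq_dec L) x (NoDup_nodup _ _)) as (c & Hc & D & H).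
  assert (P1 : pT [] = 1).
  { unfold prob_plus. replace (plus []) with (fun _ : conf => 1) by reflexivity. apply (E_one J h rho G). }
  (* With the empty conditioning set the lower bound for patterns is plain positivity. *)
  specialize (H [] ltac:(constructor) ltac:(intros y []) ltac:(rewrite P1; lra)). rewrite P1, app_nil_r in H.
  rewrite (ind_perm L (nodup Z.eq_dec L)) by (intros; symmetry; apply nodup_In).
  replace (pat x []) with x in H by (extensionality k; reflexivity). lra.
Qed.

Lemma pT_pos T : 0 < pT T.
Proof. unfold prob_plus, plus. rewrite <- (muz_E J h rho G). apply ground_non_null. Qed.

Lemma E_add r r1 r2 : bd1 r -> bd1 r1 -> bd1 r2 -> (forall s, r s = r1 s + r2 s) -> E r = E r1 + E r2.
Proof. intros B B1 B2 H. rewrite (E_lin J h rho G r r1 r2 1 1); auto; [ring|]. intros s. rewrite H. ring. Qed.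

Section Wrong.
Variables (D : nat) (sgm : R) (T : list Z).
Hypothesis Hs : sgm * sgm = 1.
(** The indicator of the window parity opposite to the predicted [sgm]. *)
Definition wrong (u : conf) : R := (1 - sgm * parity (win D) u) / 2.

Lemma wrong_01 u : wrong u = 0 \/ wrong u = 1.
Proof.
  assert (P := parity_sq (win D) u). unfold wrong. set (p := parity (win D) u) in *.
  assert (S : sgm = 1 \/ sgm = -1).
  { destruct (Req_dec sgm 1); auto. right. assert ((sgm - 1) * (sgm + 1) = 0) by lra. apply Rmult_integral in H0. lra. }
  assert (Q : p = 1 \/ p = -1).
  { destruct (Req_dec p 1); auto. right. assert ((p - 1) * (p + 1) = 0) by lra. apply Rmult_integral in H0. lra. }
  destruct S as [->| ->], Q as [->| ->]; lra.
Qed.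
Lemma wrong_bd : bd1 wrong.
Proof. intros u. destruct (wrong_01 u) as [->| ->]; rewrite ?Rabs_R0, ?Rabs_R1; lra. Qed.
Lemma iw_bd A t : bd1 (fun u => ind A t u * wrong u).
Proof. apply bd1_mul; [apply ind_bd|apply wrong_bd]. Qed.

(** A certificate that can be summed over spins. If no pattern is twice as likely as its flip at 0,
    it is non-negative on full patterns: for the wrong parity it is zero, for the right one it is 2
    E (flip) - E. Summed over the free spins, it contradicts the rarity of the wrong parity. *)
Definition Gf (A : list Z) (t : conf) : R :=
  E (fun u => ind A t u * wrong u) + 2 * E (fun u => ind A (flip 0 t) u * wrong u) - E (ind A t).

Lemma Gf_split x A t : ~ In x A -> Gf A t = Gf (x :: A) t + Gf (x :: A) (flip x t).
Proof.
  intros Hx. unfold Gf.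
  rewrite (E_add (ind A t) (ind (x :: A) t) (ind (x :: A) (flip x t))) by (auto using ind_bd; intros; now apply ind_split).
  rewrite (E_add (fun u => ind A t u * wrong u) (fun u => ind (x :: A) t u * wrong u) (fun u => ind (x :: A) (flip x t) u * wrong u))
    by (auto using iw_bd; intros u; rewrite (ind_split x A t u Hx); ring).
  rewrite (E_add (fun u => ind A (flip 0 t) u * wrong u) (fun u => ind (x :: A) (flip 0 t) u * wrong u) (fun u => ind (x :: A) (flip 0 (flip x t)) u * wrong u))
    by (auto using iw_bd; intros u; rewrite (flip_comm 0 x), (ind_split x A (flip 0 t) u Hx); ring).
  ring.
Qed.

Lemma Gf_peel K A (ok : conf -> Prop) : NoDup (K ++ A) -> (forall x t, In x K -> ok t -> ok (flip x t)) ->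
  (forall t, ok t -> 0 <= Gf (K ++ A) t) -> forall t, ok t -> 0 <= Gf A t.
Proof.
  induction K as [|x K IH]; intros ND Hok H; [exact H|].
  simpl in ND. inversion ND; subst. apply IH; auto.
  - intros y t Hy Ht. apply Hok; simpl; auto.
  - intros t Ht. rewrite (Gf_split x) by auto. assert (Q3 := H t Ht). assert (Q4 := H (flip x t) (Hok x t ltac:(simpl; auto) Ht)). simpl app in *. lra.
Qed.

(** On a pattern fixing the whole window [wrong] is a constant, and the flip at 0 exchanges its two
    values. *)
Lemma Gf_top V t : incl (win D) V -> E (ind V t) <= 2 * E (ind V (flip 0 t)) -> 0 <= Gf V t.
Proof.
  intros HV H. unfold Gf.
  assert (W : forall t, E (fun u => ind V t u * wrong u) = wrong t * E (ind V t)).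
  { intros t'. rewrite (E_lin J h rho G _ (ind V t') (ind V t') (wrong t') 0); auto using iw_bd, ind_bd; [ring|].
    intros u. unfold wrong. assert (Q := ind_parity (win D) V t' u HV).
    transitivity ((ind V t' u - sgm * (parity (win D) u * ind V t' u)) / 2); [field|]. rewrite Q. field. }
  rewrite !W.
  assert (F : wrong (flip 0 t) = 1 - wrong t).
  { unfold wrong. rewrite parity_in by (auto using win_NoDup; apply win_In; lia). field. }
  rewrite F. destruct (wrong_01 t) as [->| ->]; lra.
Qed.

Lemma Gf_bound A t : incl T A -> (forall k, In k T -> t k = true) -> ~ In 0%Z T ->
  Gf A t <= 3 * E (fun u => wrong u * plus T u) - E (ind A t).
Proof.
  intros HA Ht H0. unfold Gf.
  assert (B : forall t', (forall k, In k T -> t' k = true) -> E (fun u => ind A t' u * wrong u) <= E (fun u => wrong u * plus T u)).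
  { intros t' Ht'. apply (E_le J h rho G); [apply iw_bd|apply bd1_mul; [apply wrong_bd|apply ind_bd]|].
    intros u. assert (M := ind_mono T A t' u HA). rewrite (ind_ext T t' (fun _ => true)) in M by auto.
    unfold plus. destruct (wrong_01 u) as [->| ->]; lra. }
  assert (B1 := B t Ht). assert (B2 := B (flip 0 t)).
  assert (forall k, In k T -> flip 0 t k = true) by (intros k Hk; rewrite flip_other; auto; intros ->; contradiction).
  specialize (B2 H). lra.
Qed.
End Wrong.

(** Given plus spins on the far annulus the parity of the inner window is almost deterministic, so
    some pattern with the right parity is much more likely than its flip at the origin. *)
Lemma lopsided l s c Dl n D sgm : (l <= D)%nat -> (Dl <= D)%nat -> (D <= n)%nat -> sgm * sgm = 1 -> 0 < c ->
  (forall T', NoDup T' -> (forall x, In x T' -> ~ In x (win l) /\ ~ In x (win Dl)) ->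
     0 < pT T' -> c * pT T' <= E (ind (win l ++ T') (pat s T'))) ->
  Rabs (E (fun u => parity (win D) u * plus (annulus D n) u) / pT (annulus D n) - sgm) < c / 2 ->
  exists t, (forall k, In k (win l) -> t k = s k) /\ 2 * E (ind (win n) (flip 0 t)) <= E (ind (win n) t).
Proof.
  intros HlD HDl HDn Hs Hc Hlow Hpar. set (T' := annulus D n) in *.
  assert (P := pT_pos T').
  assert (wl : forall x, In x T' -> ~ In x (win l) /\ ~ In x (win Dl)).
  { intros x Hx. apply annulus_In in Hx. rewrite !win_In in *. lia. }
  specialize (Hlow T' (annulus_NoDup D n) wl P).
  apply NNPP. intros N.
  set (K := filter (fun x => if in_dec Z.eq_dec x (win l) then false else true) (win D)).
  assert (KIn : forall x, In x K <-> In x (win D) /\ ~ In x (win l)).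
  { intros x. unfold K. rewrite filter_In. destruct in_dec; intuition congruence. }
  set (A := win l ++ T').
  assert (NDA : NoDup A). { apply NoDup_app; [apply win_NoDup|apply annulus_NoDup|]. intros x Hx Hy. destruct (wl x Hy); auto. }
  assert (NDK : NoDup (K ++ A)).
  { apply NoDup_app; auto; [apply NoDup_filter, win_NoDup|]. intros x Hx Hy. apply KIn in Hx. apply in_app_iff in Hy.
    destruct Hy as [|Hy]; [tauto|]. apply annulus_In in Hy. tauto. }
  assert (SetV : forall x, In x (K ++ A) <-> In x (win n)).
  { intros x. unfold A. rewrite !in_app_iff, KIn. unfold T'. rewrite annulus_In, !win_In. lia. }
  set (ok := fun t : conf => (forall k, In k (win l) -> t k = s k) /\ (forall k, In k T' -> t k = true)).
  (* Under the contradictory assumption [Gf] is non-negative on all full patterns extending [s] and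
     the plus annulus; the spins between [win l] and the annulus are summed out. *)
  assert (GA : 0 <= Gf D sgm A (pat s T')).
  { apply (Gf_peel D sgm Hs K A ok); auto.
    - intros x t Hx [H1 H2]. apply KIn in Hx. split; intros k Hk; rewrite flip_other; auto; intros ->; [tauto|].
      apply annulus_In in Hk. tauto.
    - intros t [H1 H2]. apply Gf_top; auto.
      + intros x Hx. apply SetV. rewrite win_In in *. lia.
      + apply Rnot_lt_le. intros Hlt. apply N. exists t. split; auto.
        rewrite <- !(ind_perm (K ++ A) (win n)) by auto. lra.
    - split; intros k Hk; unfold pat; destruct in_dec as [Hi|Hi]; try reflexivity; try contradiction. destruct (wl k Hi); contradiction. }
  assert (GB := Gf_bound D sgm T' Hs A (pat s T')).
  assert (GB' : Gf D sgm A (pat s T') <= 3 * E (fun u => wrong D sgm u * plus T' u) - E (ind A (pat s T'))).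
  { apply GB.
    - intros x Hx. apply in_app_iff; auto.
    - intros k Hk. unfold pat. destruct in_dec; auto; contradiction.
    - intros H0. apply annulus_In in H0. destruct H0 as [_ H0]. apply H0, win_In. lia. }
  assert (EW : E (fun u => wrong D sgm u * plus T' u) = / 2 * pT T' + - sgm / 2 * E (fun u => parity (win D) u * plus T' u)).
  { apply (E_lin J h rho G).
    - apply bd1_mul; [now apply wrong_bd|apply ind_bd].
    - apply ind_bd.
    - apply bd1_mul; [|apply ind_bd]. intros u. rewrite <- Rabs_R1. apply Rsqr_le_abs_0. unfold Rsqr. rewrite parity_sq. lra.
    - intros u. unfold wrong. field. }
  set (m := E (fun u => parity (win D) u * plus T' u)) in *.
  assert (Hm : 1 - sgm * (m / pT T') < c / 2).
  { replace (1 - sgm * (m / pT T')) with (- sgm * (m / pT T' - sgm)) by (rewrite <- Hs; ring).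
    set (X := m / pT T' - sgm) in *.
    assert (X < c / 2 /\ - X < c / 2) by (split; eapply Rle_lt_trans; try exact Hpar; [apply Rle_abs|rewrite <- Rabs_Ropp; apply Rle_abs]).
    assert (S : sgm = 1 \/ sgm = -1).
    { destruct (Req_dec sgm 1); auto. right. assert ((sgm - 1) * (sgm + 1) = 0) by lra. apply Rmult_integral in H1. lra. }
    destruct S as [->| ->]; lra. }
  apply Rmult_lt_compat_r with (r := pT T') in Hm; auto.
  replace ((1 - sgm * (m / pT T')) * pT T') with (pT T' - sgm * m) in Hm by (field; lra).
  (* The wrong parity has weight below c/4 times [pT T'], so three times it stays below the lower
     bound c [pT T'] of the pattern. *)
  fold A in Hlow. assert (0 < c * pT T') by (now apply Rmult_lt_0_compat). lra.
Qed.

Lemma cond_eq n z : cond (muz rho) 0 (win n) z = E (ind (win n) z) / (E (ind (win n) z) + E (ind (win n) (flip 0 z))).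
Proof.
  unfold cond. rewrite !(muz_E J h rho G). f_equal.
  assert (H0 : ~ In 0%Z (remove Z.eq_dec 0%Z (win n))) by apply remove_In.
  assert (PM : forall k, In k (0%Z :: remove Z.eq_dec 0%Z (win n)) <-> In k (win n)).
  { intros k. simpl. split.
    - intros [<-|H]; [apply win_In; lia|]. now apply in_remove in H.
    - intros H. destruct (Z.eq_dec k 0); [auto|right; now apply in_in_remove]. }
  apply E_add; try apply ind_bd. intros u. rewrite (ind_split 0 _ z u H0).
  now rewrite !(ind_perm _ (win n) _ PM).
Qed.

Lemma ground_bad : bad_config (muz rho) (fun _ => false).
Proof.
  (* The two conditional probabilities will be at least 2/3 and at most 1/3. *)
  exists (1 / 4). split; [lra|]. exists 0%Z. intros L H0.
  destruct (win_contains L) as [l Hl].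
  (* Two inner patterns differing only at the origin are needed: each has a lopsided continuation,
     and these favour opposite spins at 0 given the same minus spins around it. *)
  set (sm := (fun _ => false) : conf). set (sp := flip 0 sm).
  destruct (pattern_lower_bound J h rho G Hh Hlam (win l) sm (win_NoDup l)) as (c1 & Hc1 & D1 & Low1).
  destruct (pattern_lower_bound J h rho G Hh Hlam (win l) sp (win_NoDup l)) as (c2 & Hc2 & D2 & Low2).
  set (D := Nat.max l (Nat.max D1 D2)).
  destruct (Yex J h Hlam D) as [Y HY].
  destruct (parity_deterministic J h rho G Hh Hlam D (fun n => pT_pos (annulus D n)) Y HY) as (sgm & Hs & Lim).
  set (c := Rmin c1 c2). assert (Hc : 0 < c) by (unfold c; now apply Rmin_glb_lt).
  assert (Q := ultra_and _ _ (ultra_ge D) (Lim (c / 2) ltac:(lra))). apply ultra_ex in Q. destruct Q as [n [Hn HE]].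
  assert (HEc : forall c', c <= c' -> Rabs (E (fun u => parity (win D) u * plus (annulus D n) u) / pT (annulus D n) - sgm) < c' / 2) by (intros; lra).
  destruct (lopsided l sm c1 D1 n D sgm) as (t & Ht1 & Ht2); auto; try (unfold D; lia); [apply HEc, Rmin_l|].
  destruct (lopsided l sp c2 D2 n D sgm) as (t' & Ht1' & Ht2'); auto; try (unfold D; lia); [apply HEc, Rmin_r|].
  assert (In0 : In 0%Z (win l)) by (apply win_In; lia).
  exists (win n), t, t'.
  assert (g1 : glue L sm t = t).
  { extensionality k. unfold glue. destruct in_dec as [Hk|]; auto. symmetry. apply (Ht1 k (Hl k Hk)). }
  (* [t'] continues the pattern with plus at the origin; gluing restores minus there, so the
     unlikely spin is the one measured. *)
  assert (g2 : glue L sm t' = flip 0 t').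
  { extensionality k. unfold glue. destruct in_dec as [Hk|Hk].
    - destruct (Z.eq_dec k 0) as [->|Nk].
      + rewrite flip_same, Ht1' by auto. unfold sp. rewrite flip_same. reflexivity.
      + rewrite flip_other, Ht1' by auto. unfold sp. rewrite flip_other by auto. reflexivity.
    - rewrite flip_other; auto. intros ->. contradiction. }
  rewrite g1, g2.
  split; [intros x Hx; apply Hl, win_In in Hx; apply win_In; unfold D in Hn; lia|].
  split; [apply ground_non_null|]. split; [apply ground_non_null|].
  rewrite !cond_eq, flip_flip.
  assert (P1 : 0 < E (ind (win n) t)) by (rewrite <- (muz_E J h rho G); apply ground_non_null).
  assert (P2 : 0 < E (ind (win n) (flip 0 t))) by (rewrite <- (muz_E J h rho G); apply ground_non_null).
  assert (P3 : 0 < E (ind (win n) t')) by (rewrite <- (muz_E J h rho G); apply ground_non_null).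
  assert (P4 : 0 < E (ind (win n) (flip 0 t'))) by (rewrite <- (muz_E J h rho G); apply ground_non_null).
  set (a := E (ind (win n) t)) in *. set (b := E (ind (win n) (flip 0 t))) in *.
  set (a' := E (ind (win n) t')) in *. set (b' := E (ind (win n) (flip 0 t'))) in *.
  assert (R1 : 2 / 3 <= a / (a + b)).
  { apply Rmult_le_reg_r with (a + b); [lra|]. replace (a / (a + b) * (a + b)) with a by (field; lra). lra. }
  assert (R2 : b' / (b' + a') <= 1 / 3).
  { apply Rmult_le_reg_r with (b' + a'); [lra|]. replace (b' / (b' + a') * (b' + a')) with b' by (field; lra). lra. }
  rewrite Rabs_right; lra.
Qed.
End Final.

(** * Existence of a ground state *)

Section MinEigen.
Variables (A : Type) (S : list A) (K : A -> A -> R).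
Hypothesis Ksym : forall x y, In x S -> In y S -> K x y = K y x.
Hypothesis Sne : S <> [].
Definition nrm (v : A -> R) : R := Rsum (fun x => v x * v x) S.
Definition bil (v w : A -> R) : R := Rsum (fun x => Rsum (fun y => v x * (K x y * w y)) S) S.

Lemma nrm_nonneg v : 0 <= nrm v.
Proof. apply Rsum_nonneg; intros; apply Rle_0_sqr. Qed.
Lemma nrm_le1 v x : nrm v = 1 -> In x S -> Rabs (v x) <= 1.
Proof.
  intros H Hx. assert (Q := Rsum_mem_le (fun x => v x * v x) S x ltac:(intros; apply Rle_0_sqr) Hx). fold (nrm v) in Q. cbn beta in Q.
  rewrite H in Q. rewrite <- Rabs_R1. apply Rsqr_le_abs_0. unfold Rsqr. lra.
Qed.
Lemma nrm_scal c v : nrm (fun x => c * v x) = c * c * nrm v.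
Proof. unfold nrm. rewrite <- Rsum_scal. apply Rsum_ext; intros; ring. Qed.
Lemma bil_scal c v : bil (fun x => c * v x) (fun x => c * v x) = c * c * bil v v.
Proof. unfold bil. rewrite <- Rsum_scal. apply Rsum_ext; intros. rewrite <- Rsum_scal. apply Rsum_ext; intros; ring. Qed.

(** A limit of almost minimising unit vectors minimises the quadratic form, and the first variation
    around it vanishes, which is the eigenvalue equation tested against [w]. *)
Lemma min_eigen : exists v E, nrm v = 1 /\ (forall w, E * nrm w <= bil w w) /\ forall w, bil w v = E * Rsum (fun x => w x * v x) S.
Proof.
  set (P := fun r => exists v, nrm v = 1 /\ r = - bil v v).
  assert (Bd : bound P).
  { exists (Rsum (fun x => Rsum (fun y => Rabs (K x y)) S) S). intros r [v [Hv ->]].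
    eapply Rle_trans; [apply Rle_abs|]. rewrite Rabs_Ropp. unfold bil. eapply Rle_trans; [apply Rsum_abs|].
    apply Rsum_le; intros x Hx. eapply Rle_trans; [apply Rsum_abs|]. apply Rsum_le; intros y Hy. rewrite !Rabs_mult.
    assert (Q := nrm_le1 v x Hv Hx). assert (Q' := nrm_le1 v y Hv Hy).
    assert (0 <= Rabs (v x)) by apply Rabs_pos. assert (0 <= Rabs (v y)) by apply Rabs_pos. assert (0 <= Rabs (K x y)) by apply Rabs_pos.
    apply Rle_trans with (1 * (Rabs (K x y) * 1)); [|lra].
    apply Rmult_le_compat; auto; [apply Rmult_le_pos; auto|]. apply Rmult_le_compat_l; auto. }
  assert (Ne : exists r, P r).
  { set (v := fun _ : A => / sqrt (INR (length S))). exists (- bil v v), v. split; auto.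
    assert (L : 0 < INR (length S)) by (apply lt_0_INR; destruct S; [congruence|simpl; lia]).
    unfold nrm, v. rewrite Rsum_const. rewrite <- Rinv_mult, sqrt_sqrt by lra. field. lra. }
  destruct (completeness P Bd Ne) as [e [He1 He2]]. set (E := - e).
  assert (HE : forall v, nrm v = 1 -> E <= bil v v).
  { intros v Hv. assert (Q := He1 (- bil v v) (ex_intro _ v (conj Hv eq_refl))). unfold E. lra. }
  assert (Seq : forall k : nat, exists v, nrm v = 1 /\ bil v v < E + / (INR k + 1)).
  { intros k. apply NNPP. intros N. assert (Pk : 0 < / (INR k + 1)) by (apply Rinv_0_lt_compat; assert (Q := pos_INR k); lra).
    assert (Q : is_upper_bound P (e - / (INR k + 1))).
    { intros r [v [Hv ->]]. apply Rnot_lt_le. intros Hl. apply N. exists v. split; auto. unfold E. lra. }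
    apply He2 in Q. lra. }
  destruct (ClassicalEpsilon.choice _ Seq) as [vs Hvs].
  set (v := fun x => LIM (fun k => vs k x)).
  assert (Lv : forall x, In x S -> ulim (fun k => vs k x) (v x)).
  { intros x Hx. apply ulim_LIM. exists 1. apply ultra_all; intros k. apply nrm_le1; auto. apply Hvs. }
  assert (Nv : nrm v = 1).
  { apply (ulim_unique (fun k => nrm (vs k))).
    - apply (ulim_Rsum (fun k x => vs k x * vs k x) (fun x => v x * v x)). intros x Hx. now apply ulim_mult; apply Lv.
    - eapply ulim_ext with (x := fun _ => 1); [|apply ulim_const]. apply ultra_all; intros k. symmetry. apply Hvs. }
  assert (Bv : bil v v <= E).
  { apply Rnot_lt_le. intros Hl.
    assert (LB : ulim (fun k => bil (vs k) (vs k)) (bil v v)).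
    { apply (ulim_Rsum (fun k x => Rsum (fun y => vs k x * (K x y * vs k y)) S) (fun x => Rsum (fun y => v x * (K x y * v y)) S)).
      intros x Hx. apply (ulim_Rsum (fun k y => vs k x * (K x y * vs k y)) (fun y => v x * (K x y * v y))).
      intros y Hy. apply ulim_mult; [now apply Lv|]. apply ulim_scal; now apply Lv. }
    set (dlt := (bil v v - E) / 2). assert (Hd : 0 < dlt) by (unfold dlt; lra).
    destruct (archimed_cor1 dlt Hd) as [n0 [Hn0 Hp]].
    assert (U := ultra_and _ _ (ultra_ge n0) (LB dlt Hd)). apply ultra_ex in U. destruct U as [k [Hk Hb]].
    destruct (Hvs k) as [_ Hv2]. assert (0 < INR n0) by (apply lt_0_INR; lia).
    assert (/ (INR k + 1) <= / INR n0). { apply Rinv_le_contravar; auto. apply le_INR in Hk. lra. }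
    apply Rabs_def2 in Hb. unfold dlt in *. lra. }
  assert (HW : forall w, E * nrm w <= bil w w).
  { intros w. assert (N0 := nrm_nonneg w). destruct (Req_dec (nrm w) 0) as [Z|NZ].
    - assert (W0 : forall x, In x S -> w x = 0).
      { intros x Hx. assert (Q := Rsum_mem_le (fun x => w x * w x) S x ltac:(intros; apply Rle_0_sqr) Hx). fold (nrm w) in Q. cbn beta in Q.
        assert (0 <= w x * w x) by apply Rle_0_sqr. apply Rsqr_0_uniq. unfold Rsqr. lra. }
      rewrite Z, Rmult_0_r. right. symmetry. apply Rsum_zero; intros x Hx. apply Rsum_zero; intros y Hy. rewrite W0 by auto. ring.
    - set (c := / sqrt (nrm w)). assert (C2 : c * c = / nrm w).
      { unfold c. rewrite <- Rinv_mult, sqrt_sqrt by lra. reflexivity. }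
      assert (Q := HE (fun x => c * w x)). rewrite nrm_scal, bil_scal, C2 in Q. rewrite Rinv_l in Q by auto. specialize (Q eq_refl).
      apply Rmult_le_compat_r with (r := nrm w) in Q; auto. replace (/ nrm w * bil w w * nrm w) with (bil w w) in Q by (field; lra). lra. }
  exists v, E. split; auto. split; auto.
  intros w. set (ip := Rsum (fun x => w x * v x) S).
  assert (Bsym : bil v w = bil w v).
  { unfold bil. rewrite Rsum_swap. apply Rsum_ext; intros x Hx. apply Rsum_ext; intros y Hy. rewrite (Ksym x y) by auto. ring. }
  assert (Q : forall t, 0 <= 2 * t * (bil w v - E * ip) + t * t * (bil w w - E * nrm w)).
  { intros t. assert (H := HW (fun x => v x + t * w x)).
    assert (E1 : nrm (fun x => v x + t * w x) = nrm v + 2 * t * ip + t * t * nrm w).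
    { unfold nrm, ip. rewrite <- !Rsum_scal, <- !Rsum_plus. apply Rsum_ext; intros; ring. }
    assert (E2 : bil (fun x => v x + t * w x) (fun x => v x + t * w x) = bil v v + t * bil v w + t * bil w v + t * t * bil w w).
    { unfold bil. rewrite <- !Rsum_scal, <- !Rsum_plus. apply Rsum_ext; intros. rewrite <- !Rsum_scal, <- !Rsum_plus. apply Rsum_ext; intros; ring. }
    rewrite E1, E2, Nv, Bsym in H. assert (E <= bil v v) by (now apply HE). lra. }
  set (b := bil w v - E * ip) in *. set (c := bil w w - E * nrm w) in *.
  assert (C0 : 0 <= c) by (unfold c; specialize (HW w); lra).
  destruct (Req_dec b 0) as [Z|NZ]; [unfold b in Z; lra|]. exfalso.
  (* A quadratic 2 t b + t^2 c with b different from 0 is negative at this [t]; the denominator c +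
     1 also covers c = 0. *)
  specialize (Q (- b / (c + 1))).
  assert (QQ : 2 * (- b / (c + 1)) * b + - b / (c + 1) * (- b / (c + 1)) * c = - (b * b) * (c + 2) / ((c + 1) * (c + 1))) by (field; lra).
  rewrite QQ in Q. assert (0 < b * b) by nra.
  assert (0 < b * b * (c + 2) / ((c + 1) * (c + 1))) by (apply Rdiv_lt_0_compat; nra).
  replace (- (b * b) * (c + 2) / ((c + 1) * (c + 1))) with (- (b * b * (c + 2) / ((c + 1) * (c + 1)))) in Q by (field; lra). lra.
Qed.
End MinEigen.

(** * Block operators inside a longer chain *)

Definition mrg (a : Z) (n : nat) (s v : conf) : conf :=
  fun j => if (a <=? j)%Z && (j <? a + Z.of_nat n)%Z then v j else s j.

Lemma mrg_in a n s v j : inb a n j -> mrg a n s v j = v j.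
Proof. unfold inb, mrg; intros H. destruct (Z.leb_spec a j), (Z.ltb_spec j (a + Z.of_nat n)); try lia. reflexivity. Qed.
Lemma mrg_out a n s v j : ~ inb a n j -> mrg a n s v j = s j.
Proof. unfold inb, mrg; intros H. destruct (Z.leb_spec a j), (Z.ltb_spec j (a + Z.of_nat n)); try lia; reflexivity. Qed.

Lemma inb_dec a n j : {inb a n j} + {~ inb a n j}.
Proof. unfold inb. destruct (Z_le_dec a j), (Z_lt_dec j (a + Z.of_nat n)); [left|right|right|right]; lia. Qed.

(** [F] acts on the block only; spins outside it are parameters. *)
Definition LocM (a : Z) (n : nat) (F : op) : Prop := forall psi s s1,
  (forall j, inb a n j -> s1 j = s j) -> F psi s = F (fun v => psi (mrg a n s v)) s1.

Lemma LocM_comp a n F F' : LocM a n F -> LocM a n F' -> LocM a n (fun psi => F (F' psi)).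
Proof.
  intros H H' psi s s1 Hs. rewrite (H _ s s1 Hs). f_equal. extensionality v.
  rewrite (H' psi (mrg a n s v) v) by (intros j Hj; now rewrite mrg_in).
  f_equal. extensionality v'. f_equal. extensionality j. destruct (inb_dec a n j); [now rewrite !mrg_in|now rewrite !mrg_out].
Qed.
Lemma LocM_lin a n F F' c : LocM a n F -> LocM a n F' -> LocM a n (fun psi s => F psi s + c * F' psi s).
Proof. intros H H' psi s s1 Hs. now rewrite (H _ s s1 Hs), (H' _ s s1 Hs). Qed.

Lemma LocM_mono a n b m F : (b <= a)%Z -> (a + Z.of_nat n <= b + Z.of_nat m)%Z -> LocM a n F -> LocM b m F.
Proof.
  intros H1 H2 H psi s s1 Hs. rewrite (H psi s s1) by (intros j Hj; apply Hs; unfold inb in *; lia).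
  rewrite (H (fun v => psi (mrg b m s v)) s1 s1) by auto. f_equal. extensionality v. f_equal. extensionality j.
  destruct (inb_dec a n j) as [Hj|Hj].
  - rewrite mrg_in by auto. rewrite mrg_in by (unfold inb in *; lia). now rewrite mrg_in.
  - rewrite mrg_out by auto. destruct (inb_dec b m j) as [Hj'|Hj'].
    + rewrite mrg_in by auto. rewrite mrg_out by auto. symmetry. now apply Hs.
    + now rewrite mrg_out.
Qed.

Lemma LocM_Hop J h a m : LocM a m (Hop J h a m).
Proof.
  intros psi s s1 Hs. unfold Hop.
  assert (Eqf : forall k, (k < m - 1)%nat -> flip (a + Z.of_nat (S k)) (flip (a + Z.of_nat k) s) = mrg a m s (flip (a + Z.of_nat (S k)) (flip (a + Z.of_nat k) s1))).
  { intros k Hk. extensionality j. destruct (inb_dec a m j) as [Hj|Hj].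
    - rewrite mrg_in by auto. unfold flip. rewrite Hs by auto. reflexivity.
    - rewrite mrg_out by auto. unfold inb in Hj. rewrite !flip_other by lia. reflexivity. }
  assert (Eqs : s = mrg a m s s1).
  { extensionality j. destruct (inb_dec a m j) as [Hj|Hj]; [rewrite mrg_in by auto; symmetry; now apply Hs|now rewrite mrg_out]. }
  f_equal; f_equal; apply Rsum_ext; intros k Hk; apply in_seq in Hk.
  - cbn beta. rewrite Eqf by lia. reflexivity.
  - rewrite <- Eqs. rewrite Hs by (unfold inb; lia). reflexivity.
Qed.

(** The matrix [A] on the spins of the block, the identity on all others. *)
Definition kop (a : Z) (n : nat) (A : list bool -> list bool -> R) : op := fun psi s =>
  Rsum (fun t => A (res a n s) t * psi (mrg a n s (emb a t))) (all_cfg n).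

Lemma mrg_emb a n l t : length l = n -> length t = n -> mrg a n (emb a l) (emb a t) = emb a t.
Proof.
  intros Hl Ht. extensionality j. destruct (inb_dec a n j) as [Hj|Hj]; [now rewrite mrg_in|].
  rewrite mrg_out, !emb_out by congruence. reflexivity.
Qed.

Lemma kop_LocM a n A : LocM a n (kop a n A).
Proof.
  intros psi s s1 Hs. unfold kop. apply Rsum_ext; intros t _. rewrite (res_ext a n s1 s) by auto. f_equal. f_equal.
  extensionality j. destruct (inb_dec a n j); [now rewrite !mrg_in|now rewrite !mrg_out].
Qed.
Lemma kop_adj a n A : adj a n (kop a n A) (kop a n (fun s t => A t s)).
Proof.
  intros psi phi. unfold ip, Bsum, kop.
  rewrite (Rsum_ext _ (fun l => Rsum (fun t => A l t * psi (emb a t) * phi (emb a l)) (all_cfg n))).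
  - rewrite Rsum_swap. apply Rsum_ext; intros t Ht. apply all_cfg_In in Ht. rewrite <- Rsum_scal. apply Rsum_ext; intros l Hl. apply all_cfg_In in Hl.
    rewrite res_emb, mrg_emb by auto. ring.
  - intros l Hl. apply all_cfg_In in Hl. rewrite <- Rsum_scal_r. apply Rsum_ext; intros t Ht. apply all_cfg_In in Ht. now rewrite res_emb, mrg_emb.
Qed.
Lemma kop_ker a n A s t : length s = n -> length t = n -> ker a n (kop a n A) s t = A s t.
Proof.
  intros Hs Ht. unfold ker, kop.
  rewrite (Rsum_ext _ (fun u => if list_eq_dec bool_dec u t then A s u else 0)).
  - rewrite (Rsum_delta (list_eq_dec bool_dec) (fun u => A s u)); auto using all_cfg_NoDup. now apply all_cfg_In.
  - intros u Hu. apply all_cfg_In in Hu. rewrite res_emb, mrg_emb by auto. unfold dl. rewrite res_emb by auto. destruct list_eq_dec; ring.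
Qed.
Lemma chi_mrg a n (chi : wf) : (forall j u, inb a n j -> chi (flip j u) = chi u) -> forall s v, chi (mrg a n s v) = chi s.
Proof.
  intros H s v. induction n as [|n IH].
  - f_equal. extensionality j. apply mrg_out. unfold inb; lia.
  - rewrite <- IH by (intros j u Hj; apply H; unfold inb in *; lia).
    set (x := (a + Z.of_nat n)%Z).
    destruct (bool_dec (v x) (s x)) as [e|ne].
    + f_equal. extensionality j. destruct (Z.eq_dec j x) as [->|Hj].
      * rewrite mrg_in, mrg_out by (unfold inb, x in *; lia). auto.
      * destruct (inb_dec a n j); [rewrite !mrg_in by (unfold inb, x in *; lia)|rewrite !mrg_out by (unfold inb, x in *; lia)]; reflexivity.
    + rewrite <- (H x (mrg a n s v)) by (unfold inb, x; lia). f_equal. extensionality j. destruct (Z.eq_dec j x) as [->|Hj].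
      * rewrite flip_same, mrg_in, mrg_out by (unfold inb, x in *; lia). destruct (v x), (s x); simpl; congruence.
      * rewrite flip_other by auto.
        destruct (inb_dec a n j); [rewrite !mrg_in by (unfold inb, x in *; lia)|rewrite !mrg_out by (unfold inb, x in *; lia)]; reflexivity.
Qed.
Lemma kop_loc a n A : loc a n (kop a n A).
Proof.
  split.
  - intros chi psi s Hc. unfold kop. rewrite <- Rsum_scal. apply Rsum_ext; intros t _. rewrite chi_mrg by auto. ring.
  - intros psi Hp s s' Hs. unfold kop. rewrite (res_ext a n s s') by auto. apply Rsum_ext; intros t _. f_equal. apply Hp.
    intros j Hj. now rewrite !mrg_in.
Qed.

Lemma split_sum p m q (f : list bool -> R) : Rsum f (all_cfg (p + (m + q))) =
  Rsum (fun l1 => Rsum (fun l2 => Rsum (fun s => f (l1 ++ s ++ l2)) (all_cfg m)) (all_cfg q)) (all_cfg p).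
Proof.
  rewrite all_cfg_sum_app. apply Rsum_ext; intros l1 _. rewrite (all_cfg_sum_app m q (fun l => f (l1 ++ l))). apply Rsum_swap.
Qed.

(** * Reduced density matrices of a chain vector *)

Section Reduced.
Variable v : list bool -> R.
(** The partial trace of the projection onto [v] over the first [p] and the last [q] sites. *)
Definition rd (p m q : nat) (s t : list bool) : R :=
  Rsum (fun l1 => Rsum (fun l2 => v (l1 ++ s ++ l2) * v (l1 ++ t ++ l2)) (all_cfg q)) (all_cfg p).

Lemma rd_sym p m q s t : rd p m q s t = rd p m q t s.
Proof. unfold rd. apply Rsum_ext; intros; apply Rsum_ext; intros; ring. Qed.

Lemma rd_quad p m q (x : list bool -> R) :
  Rsum (fun s => Rsum (fun t => x s * rd p m q s t * x t) (all_cfg m)) (all_cfg m) =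
  Rsum (fun l1 => Rsum (fun l2 => Rsqr (Rsum (fun s => x s * v (l1 ++ s ++ l2)) (all_cfg m))) (all_cfg q)) (all_cfg p).
Proof.
  unfold rd. symmetry.
  rewrite (Rsum_ext _ (fun l1 => Rsum (fun l2 => Rsum (fun s => Rsum (fun t => x s * (v (l1 ++ s ++ l2) * v (l1 ++ t ++ l2)) * x t) (all_cfg m)) (all_cfg m)) (all_cfg q))).
  2:{ intros l1 _. apply Rsum_ext; intros l2 _. unfold Rsqr. rewrite <- Rsum_scal_r. apply Rsum_ext; intros s _. rewrite <- Rsum_scal. apply Rsum_ext; intros; ring. }
  rewrite (Rsum_ext _ (fun l1 => Rsum (fun s => Rsum (fun t => Rsum (fun l2 => x s * (v (l1 ++ s ++ l2) * v (l1 ++ t ++ l2)) * x t) (all_cfg q)) (all_cfg m)) (all_cfg m))).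
  2:{ intros l1 _. rewrite Rsum_swap. apply Rsum_ext; intros s _. apply Rsum_swap. }
  rewrite Rsum_swap. apply Rsum_ext; intros s _. rewrite Rsum_swap. apply Rsum_ext; intros t _.
  rewrite <- Rsum_scal, <- Rsum_scal_r. apply Rsum_ext; intros l1 _. rewrite <- Rsum_scal, <- Rsum_scal_r. apply Rsum_ext; intros; ring.
Qed.

Lemma rd_psd p m q x : 0 <= Rsum (fun s => Rsum (fun t => x s * rd p m q s t * x t) (all_cfg m)) (all_cfg m).
Proof. rewrite rd_quad. apply Rsum_nonneg; intros; apply Rsum_nonneg; intros; apply Rle_0_sqr. Qed.

Lemma rd_tr p m q : Rsum (fun s => rd p m q s s) (all_cfg m) = nrm _ (all_cfg (p + (m + q))) v.
Proof.
  unfold nrm. rewrite split_sum. unfold rd. rewrite Rsum_swap. apply Rsum_ext; intros l1 _. apply Rsum_swap.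
Qed.

Lemma rd_right p m q s t : rd p m (S q) s t = rd p (S m) q (s ++ [true]) (t ++ [true]) + rd p (S m) q (s ++ [false]) (t ++ [false]).
Proof.
  unfold rd. rewrite <- Rsum_plus. apply Rsum_ext; intros l1 _. rewrite all_cfg_sum_S.
  f_equal; apply Rsum_ext; intros l2 _; rewrite <- !app_assoc; reflexivity.
Qed.
Lemma rd_left p m q s t : rd (S p) m q s t = rd p (S m) q (true :: s) (true :: t) + rd p (S m) q (false :: s) (false :: t).
Proof.
  unfold rd. rewrite all_cfg_sum_snoc, <- Rsum_plus. apply Rsum_ext; intros l1 _.
  f_equal; apply Rsum_ext; intros l2 _; rewrite <- !app_assoc; reflexivity.
Qed.
Lemma rd_bd p m q s t : length s = m -> length t = m -> nrm _ (all_cfg (p + (m + q))) v = 1 -> Rabs (rd p m q s t) <= 1.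
Proof.
  intros Hs Ht H.
  assert (B : forall s, length s = m -> rd p m q s s <= 1).
  { intros u Hu. rewrite <- H, <- (rd_tr p m q).
    apply (Rsum_mem_le (fun s => rd p m q s s)); [|now apply all_cfg_In].
    intros y _. apply Rsum_nonneg; intros; apply Rsum_nonneg; intros; apply Rle_0_sqr. }
  assert (B1 := B s Hs). assert (B2 := B t Ht).
  apply Rle_trans with (/ 2 * rd p m q s s + / 2 * rd p m q t t); [|lra].
  unfold rd. rewrite <- !Rsum_scal, <- Rsum_plus. eapply Rle_trans; [apply Rsum_abs|]. apply Rsum_le; intros l1 _.
  rewrite <- !Rsum_scal, <- Rsum_plus. eapply Rle_trans; [apply Rsum_abs|]. apply Rsum_le; intros l2 _.
  set (x := v (l1 ++ s ++ l2)). set (y := v (l1 ++ t ++ l2)).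
  assert (0 <= Rsqr (x - y)) by apply Rle_0_sqr. assert (0 <= Rsqr (x + y)) by apply Rle_0_sqr. unfold Rsqr in *.
  apply Rabs_le. lra.
Qed.
End Reduced.

Section ChainBlock.
Variables (a0 : Z) (p m q : nat).
Let b := (a0 + Z.of_nat p)%Z.
Let M := (p + (m + q))%nat.

(** The slice of [psi] with the spins left and right of the block frozen; block operators act on
    each slice separately. *)
Definition sub (psi : wf) (l1 l2 : list bool) : wf := fun u => psi (emb a0 (l1 ++ res b m u ++ l2)).

Lemma mrg_chain l1 l l2 u : length l1 = p -> length l = m -> length l2 = q ->
  mrg b m (emb a0 (l1 ++ l ++ l2)) u = emb a0 (l1 ++ res b m u ++ l2).
Proof.
  intros H1 H H2. extensionality j. assert (R := res_length b m u).
  destruct (inb_dec b m j) as [Hj|Hj].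
  - rewrite mrg_in by auto. unfold inb, b in Hj. unfold emb. destruct (Z.leb_spec a0 j); [|lia].
    rewrite app_nth2 by lia. rewrite app_nth1 by lia. rewrite res_nth by lia. f_equal. unfold b. lia.
  - rewrite mrg_out by auto. unfold inb, b in Hj. unfold emb. destruct (Z.leb_spec a0 j); auto.
    destruct (Nat.lt_ge_cases (Z.to_nat (j - a0)) p).
    + rewrite !app_nth1 by lia. reflexivity.
    + rewrite !(app_nth2 l1) by lia. rewrite !app_nth2 by lia. f_equal. lia.
Qed.
Lemma res_chain l1 l l2 : length l1 = p -> length l = m -> length l2 = q -> res b m (emb a0 (l1 ++ l ++ l2)) = l.
Proof.
  intros H1 H H2. apply nth_ext with false false; rewrite res_length; auto. intros i Hi. rewrite res_nth by auto.
  unfold emb, b. destruct (Z.leb_spec a0 (a0 + Z.of_nat p + Z.of_nat i)); [|lia].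
  rewrite app_nth2 by lia. rewrite app_nth1 by lia. f_equal. lia.
Qed.
Lemma sub_eval psi l1 l l2 : length l = m -> sub psi l1 l2 (emb b l) = psi (emb a0 (l1 ++ l ++ l2)).
Proof. intros H. unfold sub. now rewrite res_emb. Qed.

Lemma LocM_sub F psi l1 l l2 : LocM b m F -> length l1 = p -> length l = m -> length l2 = q ->
  F psi (emb a0 (l1 ++ l ++ l2)) = F (sub psi l1 l2) (emb b l).
Proof.
  intros HF H1 H H2. rewrite (HF psi _ (emb b l)).
  - f_equal. extensionality u. unfold sub. f_equal. now apply mrg_chain.
  - intros j Hj. assert (Q := res_chain l1 l l2 H1 H H2). rewrite <- Q at 1. now rewrite emb_res.
Qed.

Lemma ip_chain_op F psi phi : LocM b m F ->
  ip a0 M (F psi) phi = Rsum (fun l1 => Rsum (fun l2 => ip b m (F (sub psi l1 l2)) (sub phi l1 l2)) (all_cfg q)) (all_cfg p).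
Proof.
  intros HF. unfold ip at 1, Bsum, M. rewrite split_sum. apply Rsum_ext; intros l1 Hl1. apply Rsum_ext; intros l2 Hl2.
  unfold ip, Bsum. apply Rsum_ext; intros l Hl. apply all_cfg_In in Hl, Hl1, Hl2. now rewrite LocM_sub, sub_eval.
Qed.

Lemma adj_chain F F' : LocM b m F -> LocM b m F' -> adj b m F F' -> adj a0 M F F'.
Proof.
  intros H H' A psi phi. rewrite ip_chain_op by auto. rewrite (ip_sym a0 M psi), ip_chain_op by auto.
  apply Rsum_ext; intros l1 _. apply Rsum_ext; intros l2 _. rewrite A. apply ip_sym.
Qed.

Lemma rd_om v F F' : LocM b m F -> adj b m F F' ->
  om b m (rd v p m q) F = ip a0 M (F (fun s => v (res a0 M s))) (fun s => v (res a0 M s)).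
Proof.
  intros HF A. rewrite ip_chain_op by auto. rewrite (om_kernel _ _ _ F F') by auto. unfold rd.
  set (psi := fun s => v (res a0 M s)).
  assert (Ev : forall l1 l l2, length l1 = p -> length l = m -> length l2 = q -> sub psi l1 l2 (emb b l) = v (l1 ++ l ++ l2)).
  { intros l1 l l2 H1 H H2. rewrite sub_eval by auto. unfold psi. rewrite res_emb; [reflexivity|].
    rewrite !length_app. unfold M. lia. }
  symmetry.
  rewrite (Rsum_ext _ (fun l1 => Rsum (fun l2 => Rsum (fun l => Rsum (fun l' => ker b m F l l' * (v (l1 ++ l' ++ l2) * v (l1 ++ l ++ l2))) (all_cfg m)) (all_cfg m)) (all_cfg q))).
  2:{ intros l1 Hl1. apply Rsum_ext; intros l2 Hl2. unfold ip, Bsum. apply Rsum_ext; intros l Hl. apply all_cfg_In in Hl, Hl1, Hl2.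
      rewrite (ker_expand b m F F') by auto. rewrite Ev by auto. rewrite <- Rsum_scal_r. apply Rsum_ext; intros l' Hl'. apply all_cfg_In in Hl'.
      rewrite Ev by auto. ring. }
  rewrite (Rsum_ext _ (fun l1 => Rsum (fun l => Rsum (fun l' => Rsum (fun l2 => ker b m F l l' * (v (l1 ++ l' ++ l2) * v (l1 ++ l ++ l2))) (all_cfg q)) (all_cfg m)) (all_cfg m))).
  2:{ intros l1 _. rewrite Rsum_swap. apply Rsum_ext; intros s _. apply Rsum_swap. }
  rewrite Rsum_swap. apply Rsum_ext; intros s _. rewrite Rsum_swap. apply Rsum_ext; intros t _.
  rewrite <- Rsum_scal. apply Rsum_ext; intros l1 _. now rewrite <- Rsum_scal.
Qed.
End ChainBlock.

Lemma Rsum_seq_add (f : nat -> R) p m : Rsum f (seq p m) = Rsum (fun k => f (p + k)%nat) (seq 0 m).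
Proof.
  revert f p. induction m as [|m IH]; intros f p; [reflexivity|]. simpl seq.
  rewrite !Rsum_cons, Nat.add_0_r, (IH f), (IH (fun k => f (p + k)%nat) 1%nat). f_equal. apply Rsum_ext; intros k _. f_equal. lia.
Qed.

Lemma Rsum_window (g : Z -> R) a0 p m q :
  (forall i, (i < a0 + Z.of_nat p)%Z \/ (a0 + Z.of_nat p + Z.of_nat m <= i)%Z -> g i = 0) ->
  Rsum (fun k => g (a0 + Z.of_nat k)%Z) (seq 0 (p + (m + q))) = Rsum (fun k => g (a0 + Z.of_nat p + Z.of_nat k)%Z) (seq 0 m).
Proof.
  intros H. rewrite seq_app, Rsum_app, seq_app, Rsum_app.
  rewrite Rsum_zero by (intros k Hk; apply in_seq in Hk; apply H; lia).
  rewrite (Rsum_zero _ (seq _ q)) by (intros k Hk; apply in_seq in Hk; apply H; lia).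
  simpl Nat.add. rewrite Rsum_seq_add. rewrite Rplus_0_l, Rplus_0_r. apply Rsum_ext; intros k _. f_equal. lia.
Qed.

(** * Commutators with a block operator see only neighbouring terms *)

Section Commutator.
Variables (J h : R) (a : Z) (n : nat) (A : list bool -> list bool -> R).
Notation F := (kop a n A).

Definition ff (i : Z) (s : conf) : conf := flip (i + 1) (flip i s).
Definition Xc (psi : wf) (s : conf) (i : Z) : R := F psi (ff i s) - F (fun u => psi (ff i u)) s.
Definition Dc (psi : wf) (s : conf) (i : Z) : R := sg (s i) * F psi s - F (fun u => sg (u i) * psi u) s.

Lemma cm_terms b M psi s : cm (Hop J h b M) F psi s =
  - J * Rsum (fun k => Xc psi s (b + Z.of_nat k)) (seq 0 (M - 1)) - h * Rsum (fun k => Dc psi s (b + Z.of_nat k)) (seq 0 M).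
Proof.
  unfold cm.
  assert (E : F (Hop J h b M psi) s = - J * Rsum (fun k => F (fun u => psi (ff (b + Z.of_nat k) u)) s) (seq 0 (M - 1))
     - h * Rsum (fun k => F (fun u => sg (u (b + Z.of_nat k)%Z) * psi u) s) (seq 0 M)).
  { unfold kop, Hop. rewrite (Rsum_swap (fun k t => A (res a n s) t * psi (ff (b + Z.of_nat k) (mrg a n s (emb a t))))).
    rewrite (Rsum_swap (fun k t => A (res a n s) t * (sg (mrg a n s (emb a t) (b + Z.of_nat k)%Z) * psi (mrg a n s (emb a t))))).
    rewrite <- !Rsum_scal, <- Rsum_minus. apply Rsum_ext; intros t _.
    rewrite !Rsum_scal. 
    rewrite (Rsum_ext (fun k => psi (ff (b + Z.of_nat k) (mrg a n s (emb a t)))) (fun k => psi (flip (b + Z.of_nat (S k)) (flip (b + Z.of_nat k) (mrg a n s (emb a t)))))).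
    - ring.
    - intros k _. unfold ff. do 2 f_equal. lia. }
  rewrite E. unfold Hop, Xc, Dc. rewrite !Rsum_minus.
  rewrite (Rsum_ext (fun k => F psi (ff (b + Z.of_nat k) s)) (fun k => F psi (flip (b + Z.of_nat (S k)) (flip (b + Z.of_nat k) s)))).
  - ring.
  - intros k _. unfold ff. do 2 f_equal. lia.
Qed.

(** The bond from [i] to [i + 1] meets the block only for a - 1 <= i < a + n, that is for n + 1
    values of [i]. *)
Lemma Xc_zero psi s i : (i < a - 1)%Z \/ (a - 1 + Z.of_nat (n + 1) <= i)%Z -> Xc psi s i = 0.
Proof.
  intros H. unfold Xc, kop. rewrite (res_ext a n (ff i s) s).
  - rewrite <- Rsum_minus. apply Rsum_zero. intros t _.
    replace (mrg a n (ff i s) (emb a t)) with (ff i (mrg a n s (emb a t))); [ring|].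
    extensionality j. unfold ff, flip. destruct (inb_dec a n j) as [Hj|Hj].
    + rewrite !mrg_in by auto. unfold inb in Hj. destruct (Z.eqb_spec j (i + 1)), (Z.eqb_spec j i); try lia; reflexivity.
    + rewrite !mrg_out by auto. reflexivity.
  - intros j Hj. unfold inb in Hj. unfold ff. rewrite !flip_other by lia. reflexivity.
Qed.
Lemma Dc_zero psi s i : (i < a - 1)%Z \/ (a - 1 + Z.of_nat (n + 2) <= i)%Z -> Dc psi s i = 0.
Proof.
  intros H. unfold Dc, kop. rewrite <- Rsum_scal, <- Rsum_minus. apply Rsum_zero. intros t _.
  rewrite mrg_out by (unfold inb; lia). ring.
Qed.

Lemma cm_local a0 p q psi s : (a0 + Z.of_nat p = a - 1)%Z ->
  cm (Hop J h a0 (p + ((n + 2) + q))) F psi s = cm (Hop J h (a - 1) (n + 2)) F psi s.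
Proof.
  intros Ha. rewrite !cm_terms.
  replace (p + (n + 2 + q) - 1)%nat with (p + ((n + 1) + q))%nat by lia. replace (n + 2 - 1)%nat with (n + 1)%nat by lia.
  rewrite (Rsum_window (Xc psi s)), (Rsum_window (Dc psi s)); rewrite ?Ha; auto.
  - intros i Hi. apply Dc_zero. lia.
  - intros i Hi. apply Xc_zero. lia.
Qed.
End Commutator.

Section Existence.
Variables J h : R.
Definition cs (N : nat) : Z := (- Z.of_nat N)%Z.
Definition cl (N : nat) : nat := (2 * N + 1)%nat.
Notation HH N := (Hop J h (cs N) (cl N)).

(** A normalised vector of lowest energy on the free chain [-N, N], with the eigenvalue equation in
    weak form. *)
Definition eigen (N : nat) (v : list bool -> R) (E : R) : Prop :=
  nrm _ (all_cfg (cl N)) v = 1 /\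
  (forall phi, E * ip (cs N) (cl N) phi phi <= ip (cs N) (cl N) phi (HH N phi)) /\
  forall phi, ip (cs N) (cl N) phi (HH N (fun s => v (res (cs N) (cl N) s))) = E * ip (cs N) (cl N) phi (fun s => v (res (cs N) (cl N) s)).

Lemma eigen_exists N : exists v E, eigen N v E.
Proof.
  set (K := ker (cs N) (cl N) (HH N)).
  destruct (min_eigen _ (all_cfg (cl N)) K) as (v & E & H1 & H2 & H3).
  - intros x y Hx Hy. apply all_cfg_In in Hx, Hy. apply (ker_adj _ _ (HH N) (HH N)); auto using adj_Hop.
  - intros H. assert (Q := proj2 (all_cfg_In (cl N) (repeat true (cl N))) (repeat_length _ _)). rewrite H in Q. destruct Q.
  - exists v, E. split; auto.
    assert (B : forall phi psi : wf, ip (cs N) (cl N) phi (HH N psi) = bil _ (all_cfg (cl N)) K (fun l => phi (emb (cs N) l)) (fun l => psi (emb (cs N) l))).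
    { intros phi psi. unfold ip, Bsum, bil. apply Rsum_ext; intros l Hl. apply all_cfg_In in Hl.
      rewrite (ker_expand _ _ (HH N) (HH N)) by auto using adj_Hop. rewrite Rsum_scal. reflexivity. }
    split.
    + intros phi. rewrite B. apply H2.
    + intros phi. rewrite B.
      transitivity (bil _ (all_cfg (cl N)) K (fun l => phi (emb (cs N) l)) v).
      * unfold bil. apply Rsum_ext; intros l Hl. apply Rsum_ext; intros l' Hl'. apply all_cfg_In in Hl'. now rewrite res_emb.
      * rewrite H3. f_equal. unfold ip, Bsum. apply Rsum_ext; intros l Hl. apply all_cfg_In in Hl. now rewrite res_emb.
Qed.

Lemma seq_exists : exists (v : nat -> list bool -> R) (E : nat -> R), forall N, eigen N (v N) (E N).
Proof.
  destruct (ClassicalEpsilon.choice _ eigen_exists) as [v Hv].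
  destruct (ClassicalEpsilon.choice _ Hv) as [E HE]. eauto.
Qed.

Section Limit.
Variables (v : nat -> list bool -> R) (E : nat -> R).
Hypothesis HE : forall N, eigen N (v N) (E N).
(** The numbers of chain sites left and right of the block; because of truncation they are
    meaningful only when the block [fits]. *)
Definition pN (N : nat) (a : Z) : nat := Z.to_nat (a + Z.of_nat N).
Definition qN (N : nat) (a : Z) (n : nat) : nat := (cl N - pN N a - n)%nat.
Definition rN (N : nat) (a : Z) (n : nat) (s t : list bool) : R := rd (v N) (pN N a) n (qN N a n) s t.
Definition rr (a : Z) (n : nat) (s t : list bool) : R := LIM (fun N => rN N a n s t).
Definition fits (N : nat) (a : Z) (n : nat) : Prop := (- Z.of_nat N <= a)%Z /\ (a + Z.of_nat n <= Z.of_nat N + 1)%Z.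

Lemma eventually_fits a n : ultra (fun N => fits N a n).
Proof. eapply ultra_mono; [|exact (ultra_ge (Z.abs_nat a + n + 1))]. intros N HN. unfold fits; cbn beta in HN; lia. Qed.
Lemma fits_len N a n : fits N a n -> (pN N a + (n + qN N a n) = cl N)%nat /\ (cs N + Z.of_nat (pN N a) = a)%Z.
Proof. unfold fits, qN, pN, cl, cs. lia. Qed.

Lemma rr_lim a n s t : length s = n -> length t = n -> ulim (fun N => rN N a n s t) (rr a n s t).
Proof.
  intros Hs Ht. apply ulim_LIM. exists 1. eapply ultra_mono; [|exact (eventually_fits a n)]. intros N HN.
  apply rd_bd; auto. rewrite (proj1 (fits_len N a n HN)). apply HE.
Qed.

Lemma rr_sym a n s t : rr a n s t = rr a n t s.
Proof. unfold rr. f_equal. extensionality N. apply rd_sym. Qed.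

Lemma rr_psd a n x : 0 <= Rsum (fun s => Rsum (fun t => x s * rr a n s t * x t) (all_cfg n)) (all_cfg n).
Proof.
  apply (ulim_le (fun _ => 0) (fun N => Rsum (fun s => Rsum (fun t => x s * rN N a n s t * x t) (all_cfg n)) (all_cfg n))); [apply ulim_const| |].
  - apply (ulim_Rsum (fun N s => Rsum (fun t => x s * rN N a n s t * x t) (all_cfg n)) (fun s => Rsum (fun t => x s * rr a n s t * x t) (all_cfg n))).
    intros s Hs. apply (ulim_Rsum (fun N t => x s * rN N a n s t * x t) (fun t => x s * rr a n s t * x t)). intros t Ht.
    apply all_cfg_In in Hs, Ht. apply ulim_mult; [|apply ulim_const]. apply ulim_scal. now apply rr_lim.
  - apply ultra_all; intros N. apply rd_psd.
Qed.

Lemma rr_tr a n : Rsum (fun s => rr a n s s) (all_cfg n) = 1.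
Proof.
  apply (ulim_unique (fun N => Rsum (fun s => rN N a n s s) (all_cfg n))).
  - apply (ulim_Rsum (fun N s => rN N a n s s) (fun s => rr a n s s)). intros s Hs. apply all_cfg_In in Hs. now apply rr_lim.
  - eapply ulim_ext with (x := fun _ => 1); [|apply ulim_const]. eapply ultra_mono; [|exact (eventually_fits a n)]. intros N HN. cbn beta.
    unfold rN. rewrite rd_tr, (proj1 (fits_len N a n HN)). symmetry. apply HE.
Qed.

Lemma rr_right a n s t : length s = n -> length t = n ->
  rr a n s t = rr a (S n) (s ++ [true]) (t ++ [true]) + rr a (S n) (s ++ [false]) (t ++ [false]).
Proof.
  intros Hs Ht. apply LIM_eq.
  eapply ulim_ext with (x := fun N => rN N a (S n) (s ++ [true]) (t ++ [true]) + rN N a (S n) (s ++ [false]) (t ++ [false])).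
  - eapply ultra_mono; [|exact (eventually_fits a (S n))]. intros N HN. cbn beta. unfold rN.
    replace (qN N a n) with (S (qN N a (S n))) by (unfold fits, qN, pN, cl in *; lia). now rewrite rd_right.
  - apply ulim_plus; apply rr_lim; rewrite length_app; simpl; lia.
Qed.
Lemma rr_left a n s t : length s = n -> length t = n ->
  rr (a + 1) n s t = rr a (S n) (true :: s) (true :: t) + rr a (S n) (false :: s) (false :: t).
Proof.
  intros Hs Ht. apply LIM_eq.
  eapply ulim_ext with (x := fun N => rN N a (S n) (true :: s) (true :: t) + rN N a (S n) (false :: s) (false :: t)).
  - eapply ultra_mono; [|exact (eventually_fits a (S n))]. intros N HN. cbn beta. unfold rN.
    replace (qN N (a + 1) n) with (qN N a (S n)) by (unfold fits, qN, pN, cl in *; lia).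
    replace (pN N (a + 1)) with (S (pN N a)) by (unfold fits, qN, pN, cl in *; lia). now rewrite rd_left.
  - apply ulim_plus; apply rr_lim; simpl; lia.
Qed.

Definition rhoL (a : Z) (n : nat) : Op := fun s t => RtoC (rr a n s t).

Lemma rhoL_state : is_state rhoL.
Proof.
  split; [|split; [|split]].
  - intros a n w q. split.
    + unfold q, Csum, Cre. rewrite Cre_sum.
      (* The limiting matrix is real and symmetric, so a complex vector splits into its real and
         imaginary parts and the cross terms cancel. *)
      apply Rle_trans with (Rsum (fun s => Rsum (fun t => fst (w s) * rr a n s t * fst (w t)) (all_cfg n)) (all_cfg n)
        + Rsum (fun s => Rsum (fun t => snd (w s) * rr a n s t * snd (w t)) (all_cfg n)) (all_cfg n)).
      * assert (P1 := rr_psd a n (fun s => fst (w s))). assert (P2 := rr_psd a n (fun s => snd (w s))). cbn beta in *. lra.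
      * right. rewrite <- Rsum_plus. apply Rsum_ext; intros s _. rewrite Cre_sum, <- Rsum_plus. apply Rsum_ext; intros t _.
        unfold rhoL, RtoC, Cmul, Cconj; cbn [fst snd]. ring.
    + unfold q, Csum, Cim. rewrite Cim_sum.
      set (X := Rsum (fun s => Rsum (fun t => fst (w s) * rr a n s t * snd (w t)) (all_cfg n)) (all_cfg n)).
      set (Y := Rsum (fun s => Rsum (fun t => snd (w s) * rr a n s t * fst (w t)) (all_cfg n)) (all_cfg n)).
      assert (XY : X = Y).
      { unfold X. rewrite Rsum_swap. apply Rsum_ext; intros s _. apply Rsum_ext; intros t _. rewrite (rr_sym a n t s). ring. }
      transitivity (X - Y); [|lra]. unfold X, Y. rewrite <- Rsum_minus. apply Rsum_ext; intros s _. rewrite Cim_sum, <- Rsum_minus. apply Rsum_ext; intros t _.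
      unfold rhoL, RtoC, Cmul, Cconj; cbn [fst snd]. ring.
  - intros a n. unfold Csum. rewrite (surjective_pairing (Csum_list _ _)), Cre_sum, Cim_sum. unfold C1, rhoL, RtoC; cbn [fst snd].
    f_equal; [apply rr_tr|apply Rsum_zero; auto].
  - intros a n s t Hs Ht. unfold rhoL, Csum_list, RtoC, Cadd, C0; simpl. rewrite (rr_right a n s t Hs Ht). f_equal; ring.
  - intros a n s t Hs Ht. unfold rhoL, Csum_list, RtoC, Cadd, C0; simpl. rewrite (rr_left a n s t Hs Ht). f_equal; ring.
Qed.

Lemma om_rr_lim a n F F' : adj a n F F' -> ulim (fun N => om a n (rN N a n) F) (om a n (rr a n) F).
Proof.
  intros A. rewrite (om_kernel a n _ F F') by auto.
  eapply ulim_ext with (x := fun N => Rsum (fun l => Rsum (fun l' => ker a n F l l' * rN N a n l' l) (all_cfg n)) (all_cfg n)).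
  - apply ultra_all; intros N. cbn beta. now rewrite (om_kernel a n _ F F').
  - apply (ulim_Rsum (fun N l => Rsum (fun l' => ker a n F l l' * rN N a n l' l) (all_cfg n)) (fun l => Rsum (fun l' => ker a n F l l' * rr a n l' l) (all_cfg n))).
    intros l Hl. apply (ulim_Rsum (fun N l' => ker a n F l l' * rN N a n l' l) (fun l' => ker a n F l l' * rr a n l' l)).
    intros l' Hl'. apply all_cfg_In in Hl, Hl'. apply ulim_scal. now apply rr_lim.
Qed.

Lemma omega_rhoL a n K F1 F1' F2 F2' : adj a n F1 F1' -> adj a n F2 F2' ->
  (forall s t, length s = n -> length t = n -> K s t = (ker a n F1 s t, ker a n F2 s t)) ->
  omega rhoL a n K = (om a n (rr a n) F1, om a n (rr a n) F2).
Proof.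
  intros A1 A2 HK. unfold omega, Csum. rewrite (surjective_pairing (Csum_list _ _)), Cre_sum, Cim_sum.
  rewrite (om_kernel a n _ F1 F1'), (om_kernel a n _ F2 F2') by auto.
  f_equal; rewrite Rsum_swap; rewrite Rsum_swap; [rewrite (Rsum_ext _ (fun s => Rsum (fun t => rr a n s t * ker a n F1 t s) (all_cfg n)))
    | rewrite (Rsum_ext _ (fun s => Rsum (fun t => rr a n s t * ker a n F2 t s) (all_cfg n)))].
  - rewrite Rsum_swap. apply Rsum_ext; intros s _. apply Rsum_ext; intros; ring.
  - intros s Hs. rewrite Cre_sum. apply Rsum_ext; intros t Ht. apply all_cfg_In in Hs, Ht. rewrite HK by auto. unfold rhoL, RtoC, Cmul; cbn [fst snd]. ring.
  - rewrite Rsum_swap. apply Rsum_ext; intros s _. apply Rsum_ext; intros; ring.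
  - intros s Hs. rewrite Cim_sum. apply Rsum_ext; intros t Ht. apply all_cfg_In in Hs, Ht. rewrite HK by auto. unfold rhoL, RtoC, Cmul; cbn [fst snd]. ring.
Qed.

Section GroundCond.
Variables (a : Z) (n : nat) (A : Op).
Notation F1 := (kop a n (fun s t => fst (A s t))).
Notation F2 := (kop a n (fun s t => snd (A s t))).
Notation F1' := (kop a n (fun s t => fst (A t s))).
Notation F2' := (kop a n (fun s t => snd (A t s))).
Notation Hb := (Hop J h (a - 1) (n + 2)).
Notation adjb := (adj (a - 1) (n + 2)).

Lemma block_adj B : adjb (kop a n B) (kop a n (fun s t => B t s)).
Proof.
  assert (Q := adj_chain (a - 1) 1 n 1 (kop a n B) (kop a n (fun s t => B t s))).
  replace (a - 1 + Z.of_nat 1)%Z with a in Q by lia. replace (1 + (n + 1))%nat with (n + 2)%nat in Q by lia.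
  apply Q; auto using kop_LocM, kop_adj.
Qed.
Lemma block_loc B : LocM (a - 1) (n + 2) (kop a n B).
Proof. apply (LocM_mono a n); [lia|lia|apply kop_LocM]. Qed.

Lemma cm_adj B : adjb (cm Hb (kop a n B)) (fun psi s => kop a n (fun s t => B t s) (Hb psi) s - Hb (kop a n (fun s t => B t s) psi) s).
Proof. apply adj_cm; [apply block_adj|apply adj_Hop]. Qed.
Lemma cm_loc B : LocM (a - 1) (n + 2) (cm Hb (kop a n B)).
Proof.
  assert (Q := LocM_lin _ _ _ _ (-1) (LocM_comp _ _ _ _ (LocM_Hop J h (a - 1) (n + 2)) (block_loc B)) (LocM_comp _ _ _ _ (block_loc B) (LocM_Hop J h (a - 1) (n + 2)))).
  intros psi s s1 Hs. unfold cm. specialize (Q psi s s1 Hs). cbn beta in Q. lra.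
Qed.

(** The chain Hamiltonian differs from that of the block by terms commuting with operators on the
    inner block. *)
Lemma chain_value N B B2 : fits N (a - 1) (n + 2) ->
  om (a - 1) (n + 2) (rN N (a - 1) (n + 2)) (fun psi => kop a n (fun s t => B t s) (cm Hb (kop a n B2) psi)) =
  let psi := fun s => v N (res (cs N) (cl N) s) in
  ip (cs N) (cl N) (kop a n B psi) (HH N (kop a n B2 psi)) - E N * ip (cs N) (cl N) (kop a n B psi) (kop a n B2 psi).
Proof.
  intros HN. cbn zeta. set (psi := fun s => v N (res (cs N) (cl N) s)). destruct (fits_len N _ _ HN) as [HL HA].
  set (p := pN N (a - 1)) in *. set (q := qN N (a - 1) (n + 2)) in *.
  set (F := fun psi => kop a n (fun s t => B t s) (cm Hb (kop a n B2) psi)).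
  assert (LF : LocM (cs N + Z.of_nat p) (n + 2) F) by (rewrite HA; exact (LocM_comp _ _ _ _ (block_loc (fun s t => B t s)) (cm_loc B2))).
  assert (AF := adj_comp _ _ _ _ _ _ (block_adj (fun s t => B t s)) (cm_adj B2)).
  assert (Q := rd_om (cs N) p (n + 2) q (v N) F). rewrite HA in Q, LF. specialize (Q _ LF AF). rewrite HL in Q. fold psi in Q.
  etransitivity; [exact Q|]. unfold F.
  assert (CA : forall B0, adj (cs N) (cl N) (kop a n B0) (kop a n (fun s t => B0 t s))).
  { intros B0. rewrite <- HL. apply adj_chain; rewrite HA; [apply block_loc|apply block_loc|apply block_adj]. }
  assert (CB := CA (fun s t => B t s)). change (adj (cs N) (cl N) (kop a n (fun s t => B t s)) (kop a n B)) in CB.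
  rewrite CB, ip_sym.
  assert (EC : cm Hb (kop a n B2) psi = fun s => HH N (kop a n B2 psi) s - kop a n B2 (HH N psi) s).
  { extensionality s. rewrite <- (cm_local J h a n B2 (cs N) p q psi s HA). rewrite HL. reflexivity. }
  rewrite EC.
  transitivity (ip (cs N) (cl N) (kop a n B psi) (HH N (kop a n B2 psi)) - ip (cs N) (cl N) (kop a n B psi) (kop a n B2 (HH N psi))).
  { unfold ip, Bsum. rewrite <- Rsum_minus. apply Rsum_ext; intros; ring. }
  f_equal. rewrite <- (adj_sym _ _ _ _ (CA B2)). destruct (HE N) as (_ & _ & H3). fold psi in H3. rewrite H3.
  f_equal. apply (adj_sym _ _ _ _ (CA B2)).
Qed.

(** For the chain vector psi the real part is the sum over F1 and F2 of <F psi, (H - E) F psi>,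
    non-negative as E is the lowest energy. The imaginary part is the difference of the two mixed
    terms, which agree because H is symmetric. Both facts pass to the limit. *)
Lemma ground_cond : let B := embOp A in
  let w := omega rhoL (a - 1)%Z (n + 2) (mulOp (n + 2) (adjOp B) (commOp (n + 2) (Ham J h (n + 2)) B)) in
  0 <= Cre w /\ Cim w = 0.
Proof.
  intros B w.
  set (X1 := fun psi u => F1' (cm Hb F1 psi) u + 1 * F2' (cm Hb F2 psi) u).
  set (X2 := fun psi u => F1' (cm Hb F2 psi) u + (- 1) * F2' (cm Hb F1 psi) u).
  assert (AA : forall B1 B2, adjb (fun psi => kop a n (fun s t => B1 t s) (cm Hb (kop a n B2) psi)) _)
    by (intros B1 B2; exact (adj_comp _ _ _ _ _ _ (block_adj (fun s t => B1 t s)) (cm_adj B2))).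
  assert (AX1 := adj_lin _ _ _ _ _ _ 1 (AA (fun s t => fst (A s t)) (fun s t => fst (A s t))) (AA (fun s t => snd (A s t)) (fun s t => snd (A s t)))).
  assert (AX2 := adj_lin _ _ _ _ _ _ (-1) (AA (fun s t => fst (A s t)) (fun s t => snd (A s t))) (AA (fun s t => snd (A s t)) (fun s t => fst (A s t)))).
  assert (W : w = (om (a - 1) (n + 2) (rr (a - 1) (n + 2)) X1, om (a - 1) (n + 2) (rr (a - 1) (n + 2)) X2)).
  { unfold w. apply (omega_rhoL (a - 1) (n + 2) _ X1 _ X2 _ AX1 AX2). intros s t Hs Ht.
    assert (CK := comm_kernel J h a n F1 F2 F1' F2' (kop_loc _ _ _) (kop_loc _ _ _) (block_adj (fun s t => fst (A s t))) (block_adj (fun s t => snd (A s t)))). cbn zeta in CK.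
    specialize (CK s t Hs Ht). etransitivity; [|exact CK].
    set (B' := embOp (fun s t => (ker a n F1 s t, ker a n F2 s t))).
    assert (BB : forall u x, length u = (n + 2)%nat -> length x = (n + 2)%nat -> B u x = B' u x).
    { intros u x Hu Hx. destruct (list_outer n u Hu) as (_ & mu & _ & _ & Hmu & Eu & _ & _). destruct (list_outer n x Hx) as (_ & mx & _ & _ & Hmx & Ex & _ & _).
      unfold B, B', embOp. rewrite Eu, Ex. destruct (_ && _); [|reflexivity]. rewrite !kop_ker by auto. apply surjective_pairing. }
    assert (CE : forall (f g : list bool -> C) l, (forall u, In u l -> f u = g u) -> Csum_list f l = Csum_list g l).
    { intros f g l. induction l as [|u l IH]; intros H; simpl; [reflexivity|]. rewrite (H u) by (simpl; auto). rewrite IH by (intros; apply H; simpl; auto). reflexivity. }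
    unfold mulOp at 1 2, Csum. apply CE. intros u Hu. apply all_cfg_In in Hu. unfold adjOp. rewrite BB by auto. f_equal.
    unfold commOp, subOp, mulOp, Csum. f_equal; apply CE; intros x Hx; apply all_cfg_In in Hx; rewrite BB by auto; reflexivity. }
  rewrite W. unfold Cre, Cim; cbn [fst snd]. split.
  - apply (ulim_le (fun _ => 0) (fun N => om (a - 1) (n + 2) (rN N (a - 1) (n + 2)) X1)); [apply ulim_const|exact (om_rr_lim _ _ _ _ AX1)|].
    eapply ultra_mono; [|exact (eventually_fits (a - 1) (n + 2))]. intros N HN. cbn beta. unfold X1. rewrite om_lin.
    assert (V1 := chain_value N (fun s t => fst (A s t)) (fun s t => fst (A s t)) HN).
    assert (V2 := chain_value N (fun s t => snd (A s t)) (fun s t => snd (A s t)) HN). cbn beta zeta in V1, V2. 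
    match type of V1 with ?x = _ => change (0 <= x + 1 * om (a - 1) (n + 2) (rN N (a - 1) (n + 2)) (fun psi => F2' (cm Hb F2 psi))) end. rewrite V1, V2. destruct (HE N) as (_ & H2 & _).
    assert (Q1 := H2 (F1 (fun s => v N (res (cs N) (cl N) s)))). assert (Q2 := H2 (F2 (fun s => v N (res (cs N) (cl N) s)))). lra.
  - apply (ulim_unique (fun N => om (a - 1) (n + 2) (rN N (a - 1) (n + 2)) X2)); [exact (om_rr_lim _ _ _ _ AX2)|].
    eapply ulim_ext with (x := fun _ => 0); [|apply ulim_const].
    eapply ultra_mono; [|exact (eventually_fits (a - 1) (n + 2))]. intros N HN. cbn beta. unfold X2. rewrite om_lin.
    assert (V1 := chain_value N (fun s t => fst (A s t)) (fun s t => snd (A s t)) HN).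
    assert (V2 := chain_value N (fun s t => snd (A s t)) (fun s t => fst (A s t)) HN). cbn beta zeta in V1, V2.
    match type of V1 with ?x = _ => change (0 = x + -1 * om (a - 1) (n + 2) (rN N (a - 1) (n + 2)) (fun psi => F2' (cm Hb F1 psi))) end. rewrite V1, V2. set (psi := fun s => v N (res (cs N) (cl N) s)).
    rewrite <- (adj_Hop J h (cs N) (cl N) (F1 psi) (F2 psi)). rewrite (ip_sym _ _ (HH N (F1 psi))), (ip_sym _ _ (F1 psi) (F2 psi)). ring.
Qed.
End GroundCond.
End Limit.

Theorem ground_state_exists : exists rho, is_ground_state J h rho.
Proof.
  destruct seq_exists as (v & E & HE). exists (rhoL v). split; [now apply (rhoL_state v E)|].
  intros a n A. now apply (ground_cond v E).
Qed.
End Existence.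

Theorem theorem3 :
  exists delta : R, 0 < delta /\
  forall J h : R, 0 < h -> 0 < Rabs (J / h) < delta ->
    (exists rho, is_ground_state J h rho) /\
    (forall rho, is_ground_state J h rho ->
       non_null (muz rho) /\ bad_config (muz rho) (fun _ => false)).
Proof.
  exists (1 / 100). split; [lra|]. intros J h Hh Hlam. split; [apply ground_state_exists|].
  intros rho G. split; [now apply (ground_non_null J h)|now apply (ground_bad J h)].
Qed.
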